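(* Let $(X,J)$ be a compact almost-complex manifold of real dimension $4$ and let $\omega$ be a Hermitian metric on $(X,J)$. If $\omega$ is globally conformally Kähler (in particular, if $\omega$ is almost-Kähler), then $$h^{1,1}_{\overline\partial}=b_-+1.$$ If $\omega$ is (strictly) locally conformally Kähler, then $$h^{1,1}_{\overline\partial}=b_-.$$ Here $h^{1,1}_{\overline\partial}$ is computed with respect to $\omega$.
   Context: Manifolds are smooth and connected; the almost-complex structure $J$ is not assumed integrable. $X$ carries the orientation induced by $J$. A Hermitian metric on $(X,J)$ is a $J$-invariant Riemannian metric $g$, identified with its fundamental $(1,1)$-form $\omega(\cdot,\cdot)=g(J\cdot,\cdot)$. $A^{p,q}(X)$ denotes the space of smooth complex-valued $(p,q)$-forms with respect to $J$. On $A^{p,q}(X)$ the operator $\overline\partial: A^{p,q}(X)\to A^{p,q+1}(X)$ is the $(p,q+1)$-component of the exterior derivative $d$ (in general $\overline\partial^2\neq 0$), and $\overline\partial^*$ is its formal $L^2$-adjoint with respect to $g$. The $\overline\partial$-Laplacian is $\Delta_{\overline\partial}=\overline\partial\,\overline\partial^*+\overline\partial^*\overline\partial$, a second order elliptic operator. Put $\mathcal H^{p,q}_{\overline\partial}=\ker(\Delta_{\overline\partial}|_{A^{p,q}(X)})$ and $h^{p,q}_{\overline\partial}=\dim_{\mathbb C}\mathcal H^{p,q}_{\overline\partial}$, which is finite since $X$ is compact. $b_-$ denotes the dimension of the space of anti-self-dual $d$-harmonic $2$-forms on $X$ (forms $\gamma$ with $*\gamma=-\gamma$, $d\gamma=0$),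 a topological invariant of $X$. In real dimension $4$: $\omega$ is almost-Kähler if $d\omega=0$; $\omega$ is globally conformally Kähler if $d\omega=\alpha\wedge\omega$ for a $d$-exact $1$-form $\alpha$ (if $\alpha=df$, then $e^{-f}\omega$ is almost-Kähler; $J$ need not be integrable); $\omega$ is (strictly) locally conformally Kähler if $d\omega=\alpha\wedge\omega$ for a $1$-form $\alpha$ that is $d$-closed but not $d$-exact. *)

(* Defs.v *)
From HB Require Import structures.
From mathcomp Require Import all_boot all_order all_algebra.
From mathcomp Require Import all_classical all_reals all_analysis.
From mathcomp Require Import complex.

Set Implicit Arguments.
Unset Strict Implicit.
Unset Printing Implicit Defensive.

Import Order.TTheory GRing.Theory Num.Theory.
Import numFieldNormedType.Exports.

Local Open Scope classical_set_scope.
Local Open Scope ring_scope.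

Local Notation e_ := (delta_mx 0) (only parsing).

Section Dimension.
Variables (K : fieldType) (V : lmodType K).

Definition is_basis_of (S : set V) (d : nat) (b : 'I_d -> V) : Prop :=
  [/\ forall i, S (b i),
      forall c : 'I_d -> K, \sum_i c i *: b i = 0 -> forall i, c i = 0 &
      forall v, S v -> exists c : 'I_d -> K, v = \sum_i c i *: b i].

(* The value is 0 when S has no finite basis. *)
Definition dimension (S : set V) : nat :=
  xget 0%N [set d | exists b : 'I_d -> V, is_basis_of S b].

End Dimension.

Section Smooth.
Variables (R : realType) (n : nat).

(* iter_deriv [:: v1; ...; vr] f is D_v1 (... (D_vr f)). *)
Definition iter_deriv (s : seq 'rV[R]_n) (f : 'rV[R]_n -> R) : 'rV[R]_n -> R :=
  foldr (fun v h y => 'D_v h y) f s.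

Definition smooth_on (U : set 'rV[R]_n) (f : 'rV[R]_n -> R) : Prop :=
  forall (s : seq 'rV[R]_n) (y : 'rV[R]_n), U y ->
    {for y, continuous (iter_deriv s f)} /\
    forall v, derivable (iter_deriv s f) y v.

End Smooth.

(* Nonempty, connected, Hausdorff, second countable smooth manifolds. The      *)
(* atlas is indexed by the points, chart x being a chart around x, defined on  *)
(* chart_dom x, with image chart_im x and inverse chart_inv x. The values of   *)
(* chart x outside chart_dom x and of chart_inv x outside chart_im x are junk. *)
Record manifold (R : realType) (n : nat) := Manifold {
  mcarrier :> topologicalType;
  chart_dom : mcarrier -> set mcarrier;
  chart_im : mcarrier -> set 'rV[R]_n;
  chart : mcarrier -> mcarrier -> 'rV[R]_n;
  chart_inv : mcarrier -> 'rV[R]_n -> mcarrier;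
  _ : [set: mcarrier] !=set0;
  _ : connected [set: mcarrier];
  _ : hausdorff_space mcarrier;
  _ : @second_countable mcarrier;
  _ : forall x, open (chart_dom x) /\ chart_dom x x;
  _ : forall x, open (chart_im x);
  _ : forall x p, chart_dom x p ->
        [/\ chart_im x (chart x p), chart_inv x (chart x p) = p &
            {for p, continuous (chart x)}];
  _ : forall x y, chart_im x y ->
        [/\ chart_dom x (chart_inv x y), chart x (chart_inv x y) = y &
            {for y, continuous (chart_inv x)}];
  _ : forall x x' (i : 'I_n),
        smooth_on (chart_im x `&` chart_inv x @^-1` chart_dom x')
          (fun y => chart x' (chart_inv x y) 0 i)
}.

Section Forms.
Variables (R : realType) (n : nat) (X : manifold R n).
Implicit Types (x c p : X) (y : 'rV[R]_n).

(* The tangent space at p is 'rV[R]_n, through the differential of chart p.    *)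
(* tangent_change c c' p takes the coordinates in chart c of a tangent vector  *)
(* at p to its coordinates in chart c'.                                        *)
Definition tangent_change c c' p (v : 'rV[R]_n) : 'rV[R]_n :=
  'D_v (chart c' \o chart_inv c) (chart c p).

(* The vector at chart_inv c y whose coordinates in chart c are v. *)
Definition from_chart c y (v : 'rV[R]_n) : 'rV[R]_n :=
  let p := chart_inv c y in tangent_change c p p v.

Definition rform k := X -> ('I_k -> 'rV[R]_n) -> R.
Definition cform k := X -> ('I_k -> 'rV[R]_n) -> R[i].

Definition local_form k (a : rform k) c y (v : 'I_k -> 'rV[R]_n) : R :=
  a (chart_inv c y) (fun i => from_chart c y (v i)).

Definition alternating k (f : ('I_k -> 'rV[R]_n) -> R) : Prop :=
  (forall (v : 'I_k -> 'rV[R]_n) i (t : R) (u w : 'rV[R]_n),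
     f (dfwith v i (t *: u + w)) = t * f (dfwith v i u) + f (dfwith v i w)) /\
  (forall (v : 'I_k -> 'rV[R]_n) i j, i != j -> v i = v j -> f v = 0).

Definition smooth_form k (a : rform k) : Prop :=
  (forall x, alternating (a x)) /\
  (forall c (u : 'I_k -> 'rV[R]_n), smooth_on (chart_im c)
     (fun y => local_form a c y u)).

(* Computed at x in the coordinates of chart x; there is no factor 1/(k+1). *)
Definition ext_d k (a : rform k) : rform k.+1 := fun x v =>
  \sum_(i < k.+1) (-1) ^+ i *
    'D_(v i) (fun y => local_form a x y (fun j => v (lift i j))) (chart x x).

Definition closed_form k (a : rform k) : Prop := ext_d a = (fun _ _ => 0).

Definition exact_form k (a : rform k.+1) : Prop :=
  exists2 f : rform k, smooth_form f & a = ext_d f.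

Definition wedge1 k (a : rform 1) (b : rform k) : rform k.+1 := fun x v =>
  \sum_(i < k.+1) (-1) ^+ i * a x (fun _ => v i) * b x (fun j => v (lift i j)).

Definition re_form k (a : cform k) : rform k := fun x v => complex.Re (a x v).
Definition im_form k (a : cform k) : rform k := fun x v => complex.Im (a x v).

Definition smooth_cform k (a : cform k) : Prop :=
  smooth_form (re_form a) /\ smooth_form (im_form a).

Definition ext_dC k (a : cform k) : cform k.+1 := fun x v =>
  Complex (ext_d (re_form a) x v) (ext_d (im_form a) x v).

(* Complex-multilinear extension of a real-multilinear f to complexified *)
(* tangent vectors.                                                      *)
Definition extC k (f : ('I_k -> 'rV[R]_n) -> R[i]) (w : 'I_k -> 'rV[R[i]]_n) :
    R[i] :=
  \sum_(T : {set 'I_k}) (Complex 0 1) ^+ #|T| *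
    f (fun j => if j \in T then map_mx (@complex.Im R) (w j)
                else map_mx (@complex.Re R) (w j)).

(* J x acts on tangent vectors (rows) by v |-> v *m J x. *)
Definition almost_complex (J : X -> 'M[R]_n) : Prop :=
  (forall x, J x *m J x = - 1%:M) /\
  (forall c v i, smooth_on (chart_im c) (fun y =>
     let p := chart_inv c y in
     tangent_change p c p (from_chart c y v *m J p) 0 i)).

Definition metric (g : X -> 'M[R]_n) x (v w : 'rV[R]_n) : R := (v *m g x *m w^T) 0 0.

Definition riemannian (g : X -> 'M[R]_n) : Prop :=
  [/\ forall x, (g x)^T = g x,
      forall x v, v != 0 -> 0 < metric g x v v &
      forall c v w, smooth_on (chart_im c) (fun y =>
        metric g (chart_inv c y) (from_chart c y v) (from_chart c y w))].

Definition hermitian_metric (J g : X -> 'M[R]_n) : Prop :=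
  riemannian g /\
  forall x v w, metric g x (v *m J x) (w *m J x) = metric g x v w.

Definition fundamental_form (J g : X -> 'M[R]_n) : rform 2 := fun x v =>
  metric g x (v ord0 *m J x) (v ord_max).

(* Projections of the complexified tangent space onto T^{1,0} and T^{0,1}, *)
(* the eigenspaces of J for 'i and - 'i.                                    *)
Definition proj10 (J : X -> 'M[R]_n) x (w : 'rV[R[i]]_n) : 'rV[R[i]]_n :=
  2^-1 *: (w - Complex 0 1 *: (w *m map_mx (real_complex R) (J x))).
Definition proj01 (J : X -> 'M[R]_n) x (w : 'rV[R[i]]_n) : 'rV[R[i]]_n :=
  2^-1 *: (w + Complex 0 1 *: (w *m map_mx (real_complex R) (J x))).

(* The component of bidegree (p, k - p) of a k-form. *)
Definition component (J : X -> 'M[R]_n) (p k : nat) (a : cform k) : cform k :=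
  fun x v => \sum_(S : {set 'I_k} | #|S| == p)
    extC (a x) (fun j => let w := map_mx (real_complex R) (v j) in
                         if j \in S then proj10 J x w else proj01 J x w).

(* The degree is written q + p so that (q.+1 + p) is convertible to (q + p).+1 *)
Definition Apq (J : X -> 'M[R]_n) (p q : nat) : set (cform (q + p)) :=
  [set a | smooth_cform a /\ component J p a = a].
Arguments Apq : clear implicits.

Definition dbar (J : X -> 'M[R]_n) (p q : nat) (a : cform (q + p)) :
    cform (q.+1 + p) :=
  component J p (ext_dC a).
Arguments dbar : clear implicits.

(* \int_{R^m} h, as an iterated integral *)
Fixpoint iter_integral (m : nat) : ('rV[R]_m -> R) -> R :=
  match m with
  | 0 => fun h => h 0
  | m'.+1 => fun h => \int[@lebesgue_measure R]_t
      iter_integral (fun y : 'rV[R]_m' => h (row_mx (t%:M : 'rV[R]_1) y))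
  end.

Definition partition_of_unity (m : nat) (c : 'I_m -> X) (r : 'I_m -> X -> R) :
    Prop :=
  [/\ forall i, continuous (r i),
      forall i x, 0 <= r i x,
      forall i, closure [set x | r i x != 0] `<=` chart_dom (c i) &
      forall x, \sum_i r i x = 1].

Definition density (g : X -> 'M[R]_n) c y : R :=
  Num.sqrt (\det (\matrix_(i, j) metric g (chart_inv c y)
    (from_chart c y (e_ i)) (from_chart c y (e_ j)))).

(* Integral of a continuous function on X (assumed compact) against the       *)
(* Riemannian volume; it does not depend on the partition of unity.           *)
Definition integral_vol (g : X -> 'M[R]_n) (f : X -> R) : R :=
  xget 0 [set s | exists m (c : 'I_m -> X) (r : 'I_m -> X -> R),
    partition_of_unity c r /\
    s = \sum_i iter_integral (fun y =>
          if y \in chart_im (c i)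
          then r i (chart_inv (c i) y) * f (chart_inv (c i) y)
               * density g (c i) y
          else 0)].

(* Pointwise Hermitian product of k-forms, in terms of the inverse metric. *)
Definition inner (g : X -> 'M[R]_n) k (a b : cform k) x : R[i] :=
  (k`!%:R)^-1 * \sum_(s : {ffun 'I_k -> 'I_n}) \sum_(t : {ffun 'I_k -> 'I_n})
    real_complex R (\prod_i invmx (g x) (s i) (t i)) *
    a x (fun i => e_ (s i)) * conjc (b x (fun i => e_ (t i))).

Definition L2 (g : X -> 'M[R]_n) k (a b : cform k) : R[i] :=
  Complex (integral_vol g (fun x => complex.Re (inner g a b x)))
          (integral_vol g (fun x => complex.Im (inner g a b x))).

(* The value at b of the formal adjoint of dbar : A^{p,q} -> A^{p,q+1}. *)
Definition dbar_star (J g : X -> 'M[R]_n) (p q : nat) (b : cform (q.+1 + p)) :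
    cform (q + p) :=
  xget (fun _ _ => 0) [set a | Apq J p q a /\
    forall z, Apq J p q z -> L2 g (dbar J p q z) b = L2 g z a].
Arguments dbar_star : clear implicits.

Definition laplacian_dbar (J g : X -> 'M[R]_n) (p q : nat) :
    cform (q + p) -> cform (q + p) :=
  match q with
  | 0 => fun a => dbar_star J g p 0 (dbar J p 0 a)
  | q'.+1 => fun a x v =>
      dbar J p q' (dbar_star J g p q' a) x v
      + dbar_star J g p q'.+1 (dbar J p q'.+1 a) x v
  end.
Arguments laplacian_dbar : clear implicits.

Definition harmonic_dbar (J g : X -> 'M[R]_n) (p q : nat) :
    set (X -> ('I_(q + p) -> 'rV[R]_n) -> R[i]) :=
  [set a | Apq J p q a /\ laplacian_dbar J g p q a = (fun _ _ => 0)].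
Arguments harmonic_dbar : clear implicits.

Definition h_dbar (J g : X -> 'M[R]_n) (p q : nat) : nat :=
  @dimension R[i] _ (harmonic_dbar J g p q).

Definition almost_Kahler (J g : X -> 'M[R]_n) : Prop :=
  closed_form (fundamental_form J g).

Definition globally_conformally_Kahler (J g : X -> 'M[R]_n) : Prop :=
  exists a : rform 1, [/\ smooth_form a, exact_form a &
    ext_d (fundamental_form J g) = wedge1 a (fundamental_form J g)].

Definition strictly_locally_conformally_Kahler (J g : X -> 'M[R]_n) : Prop :=
  exists a : rform 1, [/\ smooth_form a, closed_form a, ~ exact_form a &
    ext_d (fundamental_form J g) = wedge1 a (fundamental_form J g)].

End Forms.

Section Dimension4.
Variables (R : realType) (X : manifold R 4).
Implicit Types (x : X) (J g : X -> 'M[R]_4).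

(* The orientation induced by J: bases (u, Ju, w, Jw) are positive. *)
Definition positive_basis J x (v : 'I_4 -> 'rV[R]_4) : Prop :=
  exists u w : 'rV[R]_4,
    0 < \det (\matrix_(i < 4) v i) *
        \det (\matrix_(i < 4) nth 0 [:: u; u *m J x; w; w *m J x] i).

Definition vol_form J g : rform X 4 := fun x v =>
  (if `[< positive_basis J x v >] then 1 else -1) *
  Num.sqrt (\det (\matrix_(i < 4, j < 4) metric g x (v i) (v j))).

Definition hodge_star2 J g (a : rform X 2) : rform X 2 := fun x v =>
  2^-1 * \sum_(i < 4) \sum_(j < 4) \sum_(k < 4) \sum_(l < 4)
    invmx (g x) i k * invmx (g x) j l * a x (tnth [tuple e_ i; e_ j]) *
    vol_form J g x (tnth [tuple e_ k; e_ l; v ord0; v ord_max]).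

Definition asd_harmonic J g : set (X -> ('I_2 -> 'rV[R]_4) -> R) :=
  [set a : rform X 2 | [/\ smooth_form a,
     hodge_star2 J g a = (fun x v => - a x v) & closed_form a]].

(* Real dimension, of the real-valued forms. *)
Definition b_minus J g : nat := @dimension R _ (asd_harmonic J g).

End Dimension4.

(* Main.v *)
(**
A real (1,1)-form is f w + b with b anti-self-dual. If f w + b is harmonic, then for
d w = alpha /\ w both the 1-form theta = d f + f alpha and d b are determined by each other
through J and star. Pairing theta with logarithmic weights A(f) such that |t A'(t)| <= 2 while
A(t) / t is arbitrarily large gives theta = 0, hence d b = 0. So h^{1,1} is b_- plus the dimension of the
solutions of d f + f alpha = 0; a nonzero solution vanishes nowhere, is unique up to a factor,
and exists (f = e^(-h)) exactly when alpha = d h.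
Only the finiteness of b_- needs analysis. Lie derivatives of a closed anti-self-dual form
along cut-off coordinate fields are exact up to lower order, and an exact form has equal self-dual
and anti-self-dual energy; this bounds the H^1 norm by the L^2 norm, and a Rellich argument with
finitely many averages bounds the dimension. That the integral does not depend on charts is
proved by Lax's approach to the change of variables formula.
*)
From HB Require Import structures.
From mathcomp Require Import all_boot all_order all_algebra.
From mathcomp Require Import all_classical all_reals all_analysis.
From mathcomp Require Import complex perm.
From mathcomp Require Import ring lra.
Require Import Defs.

Set Implicit Arguments.
Unset Strict Implicit.
Unset Printing Implicit Defensive.

Import Order.TTheory GRing.Theory Num.Theory.
Import numFieldNormedType.Exports.

Local Open Scope classical_set_scope.
Local Open Scope ring_scope.
Local Notation "''e_' j" := (delta_mx 0 j) (format "''e_' j", at level 8, j at level 2).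
Local Notation iint := iter_integral.

(** No elliptic theory is used: identities are checked in a unitary frame and integrated by parts.
    In particular the adjoint of dbar is exhibited by Stokes' formula, so [dbar_star] never falls
    back on its default value on the forms that occur. The vanishing of theta is not formal: that
    its divergence is 0 is a second order equation for f whose zero order term has no sign, and
    testing with f itself only bounds theta. The test forms k(f) df are closed and cost nothing,
    whereas A(f) alpha with A(t) = t k(t) costs A'(f) df /\ alpha. Since |df|^2 <= 2 <df, theta> +
    f^2 |alpha|^2 and A'(f)^2 df is again closed, a bound on t A'(t) makes the cost independent of
    the weight, while the gain is the integral of k |theta|^2; a logarithm allows k to grow under
    this constraint. Finiteness of b_- cannot be skipped: [dimension] is 0 when no finite basis
    exists, and the equality with b_- + 1 would then fail. *)

Lemma funext2 (A B C: Type) (f g: A -> B -> C): (forall x y, f x y = g x y) -> f = g.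
by move=> h; apply/funext=> x; apply/funext=> y; exact: h. Qed.

(** * Bases and dimension of subsets of a vector space *)

Section FiniteDimension.
Variables (K: fieldType) (V: lmodType K).
Implicit Types (S: set V).

Definition indep d (b: 'I_d -> V) := forall c: 'I_d -> K, \sum_i c i *: b i = 0 -> forall i, c i = 0.

(** The rows of [1 - M *m pinvmx M] are killed by [M], so the hypothesis makes this matrix zero and
    [M] row free. *)
Lemma rows_le d t (M: 'M[K]_(d, t)): (forall w: 'rV_d, w *m M = 0 -> w = 0) -> (d <= t)%N.
move=> h; suff /eqP <- : row_free M by exact: rank_leq_col.
apply/row_freeP; exists (pinvmx M); apply/eqP; rewrite -subr_eq0; apply/eqP/row_matrixP=> i; rewrite row0.
by apply: h; rewrite -row_mul mulmxBl mul1mx mulmxKpV ?subrr ?row0.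
Qed.

(** The coordinates of [b] in [b'] form a matrix with trivial left kernel. *)
Lemma basis_bd S d (b: 'I_d -> V) d' (b': 'I_d' -> V): is_basis_of S b -> is_basis_of S b' -> (d <= d')%N.
move=> [Sb ib _] [_ ib' gen'].
have /choice[M ME] : forall i, exists c: 'I_d' -> K, b i = \sum_j c j *: b' j by move=> i; exact: gen'.
apply: (@rows_le _ _ (\matrix_(i, j) M i j))=> w wA.
apply/rowP=> j; rewrite [RHS]mxE; apply: (ib (fun j=> w 0 j)).
under eq_bigr do rewrite ME scaler_sumr; rewrite exchange_big big1// => k _.
have := congr1 (fun m: 'rV_d'=> m 0 k) wA; rewrite !mxE=> E.
rewrite -[RHS](scale0r (b' k)) -E scaler_suml; by apply: eq_bigr=> m _; rewrite mxE scalerA.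
Qed.

Lemma dimensionE S d (b: 'I_d -> V): is_basis_of S b -> dimension S = d.
move=> bb; apply: xget_unique; first by exists b.
by move=> d' [b' bb']; apply/eqP; rewrite eqn_leq (basis_bd bb' bb) (basis_bd bb bb').
Qed.

Section Bounded.
Variables (S: set V) (T: finType) (l: T -> V -> K).
Hypotheses (Scomb: forall d (c: 'I_d -> K) (b: 'I_d -> V), (forall i, S (b i)) -> S (\sum_i c i *: b i))
 (llin: forall t d (c: 'I_d -> K) (b: 'I_d -> V), (forall i, S (b i)) ->
   l t (\sum_i c i *: b i) = \sum_i c i * l t (b i))
 (lker: forall v, S v -> (forall t, l t v = 0) -> v = 0).

(** The values of the functionals on an independent family form a matrix with trivial left kernel.
    The functionals are asked to be linear only on combinations of elements of [S], because those
    used later are integrals, additive only for tame integrands. *)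
Lemma indep_bd d (b: 'I_d -> V): (forall i, S (b i)) -> indep b -> (d <= #|T|)%N.
move=> Sb ib; apply: (@rows_le _ _ (\matrix_(i, j) l (enum_val j) (b i)))=> w wM.
apply/rowP=> j; rewrite [RHS]mxE; apply: (ib (fun j=> w 0 j)).
apply: lker=> [|t]; first exact: Scomb.
rewrite llin//; have := congr1 (fun m: 'rV_#|T| => m 0 (enum_rank t)) wM; rewrite !mxE=> E; rewrite -[RHS]E.
by apply: eq_bigr=> k _; rewrite mxE enum_rankK.
Qed.

(** An independent family of maximal length spans, and a maximal length exists because lengths are
    bounded by the number of separating functionals. *)
Lemma basis_ex: exists d (b: 'I_d -> V), is_basis_of S b.
pose P d := `[< exists b: 'I_d -> V, (forall i, S (b i)) /\ indep b >].
have P0: exists d, P d by exists 0%N; apply/asboolP; exists (fun=> 0); split=> [[]|c _ []].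
have Pm d: P d -> (d <= #|T|)%N by move=> /asboolP[b [Sb ib]]; exact: indep_bd Sb ib.
have [d /asboolP[b [Sb ib]] dmax] := ex_maxnP P0 Pm; exists d, b; split=>// v Sv.
apply: contrapT=> nv.
suff: P d.+1 by move/dmax; rewrite ltnn.
apply/asboolP; exists (fun i=> if unlift ord0 i is Some j then b j else v); split=> [i|a].
 by case: unliftP=> [j|] _.
rewrite big_ord_recl unlift_none; under eq_bigr do rewrite liftK.
move=> E; have a0: a ord0 = 0.
 (* If the new vector had a nonzero coefficient, the relation would express it through [b]. *)
 apply: contrapT=> /eqP a0; apply: nv; exists (fun j=> - (a ord0)^-1 * a (lift ord0 j)).
 move/eqP: E; rewrite addr_eq0=> /eqP E; apply: (scalerI a0); rewrite E scaler_sumr -sumrN.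
 by apply: eq_bigr=> j _; rewrite scalerA mulrA mulrN mulfV// mulN1r scaleNr.
move: E; rewrite a0 scale0r add0r=> /ib h i; case: (unliftP ord0 i)=> [j ->|->//]; exact: h.
Qed.

End Bounded.
End FiniteDimension.

(** * Filters and continuity at a point *)

Lemma near_and (T: Type) (F: set_system T) (P Q: T -> Prop): Filter F ->
 (\forall z \near F, P z) -> (\forall z \near F, Q z) -> \forall z \near F, P z /\ Q z.
by move=> FF HP HQ; exact: (@filterI _ _ FF _ _ HP HQ). Qed.

Lemma der_line0 (R: realType) n (W: normedModType R) (g: 'rV[R]_n -> W) y v:
 'D_v g y = derive1 (fun h: R=> g (h *: v + y)) 0.
rewrite /derive1 /derive /=.
have -> : (fun h: R=> h^-1 *: (g (h *: v + y) - g y)) =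
  (fun h: R=> h^-1 *: (g ((h + 0) *: v + y) - g (0 *: v + y)))=>//.
by apply/funext=> h; rewrite addr0 scale0r add0r.
Qed.

Section ContinuousAt.
Variables (R: realType) (T: topologicalType).
Implicit Types (f g: T -> R) (x: T).

Lemma cont_atD f g x: {for x, continuous f} -> {for x, continuous g} ->
 {for x, continuous (fun y=> f y + g y)}.
by move=> cf cg; exact: cvgD. Qed.

Lemma cont_atM f g x: {for x, continuous f} -> {for x, continuous g} ->
 {for x, continuous (fun y=> f y * g y)}.
by move=> cf cg; exact: cvgM. Qed.

Lemma cont_atN f x: {for x, continuous f} -> {for x, continuous (fun y=> - f y)}.
by move=> cf; exact: cvgN. Qed.

Lemma cont_atV f x: f x != 0 -> {for x, continuous f} ->
 {for x, continuous (fun y=> (f y)^-1)}.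
by move=> f0 cf; exact: cvgV. Qed.

Lemma cont_cst (c: R) x: {for x, continuous (fun _: T=> c)}.
exact: cst_continuous. Qed.

End ContinuousAt.

Lemma cont_sum (R: realType) (T: topologicalType) (I: Type) (r: seq I)
  (P: pred I) (F: I -> T -> R) (x: T):
 (forall i, P i -> {for x, continuous (F i)}) ->
 {for x, continuous (fun y=> \sum_(i <- r | P i) F i y)}.
move=> cF; elim: r=> [|i r IH].
 rewrite (_: (fun y=> _) = cst 0); first exact: cst_continuous.
 by apply/funext=> y; rewrite big_nil.
case: (boolP (P i))=> Pi.
 rewrite (_: (fun y=> _) = F i \+ (fun y=> \sum_(i <- r | P i) F i y)).
  by apply: cvgD; [exact: cF|exact: IH].
 by apply/funext=> y; rewrite big_cons Pi.
rewrite (_: (fun y=> _) = (fun y=> \sum_(i <- r | P i) F i y)) //.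
by apply/funext=> y; rewrite big_cons (negbTE Pi).
Qed.

(** * Mean values, differentiability, and functions of class C^k on open sets *)

Section Calculus.
Variables (R: realType) (n: nat).
Local Notation V := 'rV[R]_n.
Implicit Types (f g: V -> R) (U: set V) (x y v w: V).

Lemma dvb_line f x v (t: R): derivable f (t *: v + x) v ->
 is_derive t 1 (fun s: R=> f (s *: v + x)) ('D_v f (t *: v + x)).
move=> df.
have E: (fun h: R=> h^-1 *: (f ((h *: 1 + t) *: v + x) - f (t *: v + x)))
  = (fun h: R=> h^-1 *: (f (h *: v + (t *: v + x)) - f (t *: v + x))).
 by apply/funext=> h; rewrite [h *: 1]mulr1 scalerDl addrA.
apply: DeriveDef; first by rewrite /derivable /= E.
by rewrite /derive /= E.
Qed.

(** The bound by [|t|] covers both signs of [t]; each is the one-variable theorem on the segment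
    between 0 and [t]. *)
Lemma MVT_line f x v (t: R):
 (forall s: R, `|s| <= `|t| -> derivable f (s *: v + x) v) ->
 exists2 s: R, `|s| <= `|t| & f (t *: v + x) - f x = t * 'D_v f (s *: v + x).
move=> df.
have dg (s: R): `|s| <= `|t| ->
  is_derive s 1 (fun s: R=> f (s *: v + x)) ('D_v f (s *: v + x)).
 by move=> /df/dvb_line.
have [t0|t0] := leP 0 t.
- have [|//|s] := @MVT_segment R (fun s: R=> f (s *: v + x))
  (fun s=> 'D_v f (s *: v + x)) 0 t t0.
 + by move=> s; rewrite in_itv/= => /andP[/ltW s0 /ltW st]; apply: dg; rewrite !ger0_norm.
 + apply: derivable_within_continuous=> s; rewrite in_itv/= => /andP[s0 st].
  by have [|] := dg s; first by rewrite !ger0_norm.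
 rewrite in_itv/= => /andP[s0 st]; rewrite subr0 scale0r add0r mulrC=> ->; exists s=>//.
 by rewrite !ger0_norm.
- have [|//|s] := @MVT_segment R (fun s: R=> f (s *: v + x))
  (fun s=> 'D_v f (s *: v + x)) t 0 (ltW t0).
 + move=> s; rewrite in_itv/= => /andP[/ltW s0 /ltW st]; apply: dg.
  by rewrite !ler0_norm ?lerN2 ?(ltW t0).
 + apply: derivable_within_continuous=> s; rewrite in_itv/= => /andP[s0 st].
  by have [|] := dg s; first by rewrite !ler0_norm ?lerN2 ?(ltW t0).
 rewrite in_itv/= => /andP[s0 st]; rewrite sub0r scale0r add0r=> E; exists s.
  by rewrite !ler0_norm ?lerN2 ?(ltW t0).
 by rewrite -opprB E mulrN opprK mulrC.
Qed.

(** Differentiability is stated with a little-o and the differential picked by choice; this is the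
    bridge from an explicit epsilon estimate. *)
Lemma diff_eps f x (L: {linear V -> R}): continuous L ->
 (forall e: R, 0 < e -> \forall y \near x, `|f y - f x - L (y - x)| <= e * `|y - x|) ->
 differentiable f x /\ 'd f x = L :> (V -> R).
move=> cL H.
have E: f \o shift x = cst (f x) + L +o_ (0: V) id.
 apply/eqaddoP=> e /= e0.
 have := H e e0=> /nbhs_ballP[d /= d0 Hd].
 apply/nbhs_ballP; exists d=>//= y yd.
 have := Hd (y + x); rewrite /= addrK -!ball_normE/= in yd *.
 rewrite opprD addrA [x - y]addrC addrK=> Hy.
 have -> : (f \o shift x - (cst (f x) + L)) y = f (y + x) - f x - L y.
  by rewrite !fctE /= opprD addrA.
 by apply: Hy; move: yd; rewrite sub0r.
split; last exact: diff_unique.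
have hdf h: (f \o shift x = cst (f x) + h +o_ (0: V) id) ->
  h = f \o shift x - cst (f x) +o_ (0: V) id.
 move=> hdf; apply: eqaddoE.
 rewrite hdf addrAC -!addrA addrC !addrA subrK.
 rewrite -[LHS]addr0 -addrA; congr (_ + _).
 by apply/eqP; rewrite eq_sym addrC addr_eq0 oppo.
apply/diffP=> /=.
apply: (@getPex _ (fun (df: {linear V -> R})=> continuous df /\
 forall y, f y = f (lim (nbhs x)) + df (y - lim (nbhs x))
         +o_(y \near x) (y - lim (nbhs x)))).
exists L; split=>//; apply: eqaddoEx=> z.
rewrite (hdf _ E) !addrA lim_id // /(_ \o _) /= subrK [f _ + _]addrC addrK.
rewrite -addrA -[LHS]addr0; congr (_ + _).
apply/eqP; rewrite eq_sym addrC addr_eq0 oppox; apply/eqP.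
rewrite [in LHS]littleo_center0 (comp_centerK x id).
by rewrite -[- _ in RHS](comp_centerK x).
Qed.

Lemma coord_cont (i: 'I_n): continuous (fun y: V=> y 0 i).
exact: (@coord_continuous R 1 n 0 i). Qed.

Lemma coord_le y (j: 'I_n): `|y 0 j| <= `|y|.
rewrite [leRHS]/Num.norm /= mx_normrE.
by apply: (le_bigmax _ (fun ij: 'I_1 * 'I_n=> `|y ij.1 ij.2|) (0, j)).
Qed.

Lemma norm_leP y (e: R): 0 <= e -> (`|y| <= e) <-> (forall j, `|y 0 j| <= e).
move=> e0; split=> [ye j|H]; first exact: le_trans (coord_le y j) ye.
by rewrite [leLHS]/Num.norm /= mx_normrE; apply: bigmax_le=>// -[i j] _; rewrite ord1.
Qed.

Lemma norm_ltP y (e: R): 0 < e -> (`|y| < e) <-> (forall j, `|y 0 j| < e).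
move=> e0; split=> [ye j|H]; first exact: le_lt_trans (coord_le y j) ye.
by rewrite [ltLHS]/Num.norm /= mx_normrE; apply: bigmax_lt=>// -[i j] _; rewrite ord1.
Qed.

Lemma near_forall (I: finType) (P: I -> V -> Prop) x:
 (forall i, \forall z \near x, P i z) -> \forall z \near x, forall i, P i z.
by move=> H; exact: (@filter_forall V I P (nbhs x) _ H). Qed.

(** From [x] to [y] one moves along the coordinate axes and applies the mean value theorem to each
    leg; the partial derivatives met there are close to those at [x]. *)
Lemma C1_diff f x:
 (forall i, \forall y \near x, derivable f y 'e_i) ->
 (forall i, {for x, continuous ('D_'e_i f)}) ->
 differentiable f x.
move=> df cf.
pose L0 (h: V): R := \sum_i h 0 i * 'D_'e_i f x.
have lL: linear L0.
 move=> a u w; rewrite /L0 scaler_sumr -big_split /=; apply: eq_bigr=> i _.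
 by rewrite !mxE mulrDl -mulrA.
pose L1: {linear V -> R} := HB.pack L0 (GRing.isLinear.Build _ _ _ _ _ lL).
have cL: continuous L1.
 move=> z; rewrite -[L1: V -> R]/(fun h: V=> \sum_i h 0 i * _); apply: cont_sum=> i _.
 by apply: cont_atM; [exact: coord_cont|exact: cont_cst].
suff: differentiable f x /\ 'd f x = L1 :> (V -> R) by case.
apply: diff_eps=>// e e0.
(* There are [n] legs; dividing by [n.+1] also covers [n = 0]. *)
have e1: 0 < e / n.+1%:R by rewrite divr_gt0.
have dcf: \forall z \near x, forall i: 'I_n, derivable f z 'e_i /\
   `|'D_'e_i f z - 'D_'e_i f x| <= e / n.+1%:R.
 have dcfi (i: 'I_n): \forall z \near x, derivable f z 'e_i /\
   `|'D_'e_i f z - 'D_'e_i f x| <= e / n.+1%:R.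
  apply: filterI; first exact: df.
  by have /cvgrPdist_le/(_ _ e1) := cf i; apply: filterS=> z; rewrite distrC.
 exact: near_forall dcfi.
have /nbhs_ballP[d /= d0 Hd] := dcf.
apply/nbhs_ballP; exists d=>//= y; rewrite -ball_normE/= => xy.
have [h hE] : exists h: V, h = y - x by exists (y - x).
have hd: `|h| < d by rewrite hE distrC.
(* [P k] keeps the first [k] coordinates of [h], so leg [k] joins [P k + x] to [P k.+1 + x]. *)
pose P (k: nat): V := \row_j (if (j < k)%N then h 0 j else 0).
have P0: P 0%N = 0 by apply/rowP=> j; rewrite !mxE.
have Pn: P n = h by apply/rowP=> j; rewrite !mxE ltn_ord.
have PS (k: 'I_n): P k.+1 = h 0 k *: delta_mx 0 k + P k.
 apply/rowP=> j; rewrite !mxE eqxx/= ltnS leq_eqVlt -val_eqE /=.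
 by case: eqP=> [/val_inj ->|_]; rewrite ?ltnn /= ?mulr1 ?addr0 ?mulr0 ?add0r.
have key (k: 'I_n): `|f (P k.+1 + x) - f (P k + x) - h 0 k * 'D_'e_k f x|
  <= e / n.+1%:R * `|h|.
 have inb (s: R): `|s| <= `|h 0 k| -> ball x d (s *: delta_mx 0 k + (P k + x)).
  move=> sh; rewrite -ball_normE/= distrC addrA addrK; apply/norm_ltP=>// j.
  rewrite !mxE eqxx /=; case: eqP=> [->|_]; rewrite ?ltnn /= ?mulr1 ?addr0.
   by apply: le_lt_trans sh _; apply: le_lt_trans (coord_le _ _) hd.
  rewrite mulr0 add0r; case: ifP=> _; rewrite ?normr0//.
  by apply: le_lt_trans (coord_le _ _) hd.
 have [|s sh E] := @MVT_line f (P k + x) 'e_k (h 0 k).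
  by move=> s /inb/Hd/(_ k)[].
 move: E; rewrite addrA -PS=> ->; rewrite -mulrBr normrM mulrC ler_pM//.
 - by have /inb/Hd/(_ k)[] := sh.
 - exact: coord_le.
have -> : f y - f x - L1 (y - x) =
  \sum_(k < n) (f (P k.+1 + x) - f (P k + x) - h 0 k * 'D_'e_k f x).
 rewrite sumrB; congr (_ - _); last by rewrite -hE.
 rewrite -(big_mkord xpredT (fun k=> f (P k.+1 + x) - f (P k + x))).
 by rewrite telescope_sumr// Pn P0 add0r hE subrK.
rewrite -hE.
apply: le_trans (ler_norm_sum _ _ _) _.
apply: (@le_trans _ _ (\sum_(k < n) e / n.+1%:R * `|h|)); first exact: ler_sum.
rewrite -mulr_suml ler_wpM2r// sumr_const card_ord -[X in X <= _]mulr_natr -mulrA ler_piMr ?(ltW e0)//.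
by rewrite mulrC ler_pdivrMr// mul1r ler_nat.
Qed.

Lemma der_coord f x v: differentiable f x ->
 'D_v f x = \sum_(i < n) v 0 i * 'D_'e_i f x.
move=> df; rewrite [v in LHS]row_sum_delta deriveE// linear_sum /=.
by apply: eq_bigr=> i _; rewrite linearZ /= deriveE.
Qed.

(** Recursion on the order, with derivatives in all directions: closure properties then follow by
    induction on [k], where [smooth_on] would call for inductions over lists of directions. *)
Fixpoint Ck (k: nat) U f: Prop :=
 (forall y, U y -> {for y, continuous f}) /\
 if k is k'.+1 then
  (forall y v, U y -> derivable f y v) /\ (forall v, Ck k' U ('D_v f))
 else True.

Lemma Ck_cont k U f: Ck k U f -> forall y, U y -> {for y, continuous f}.
by case: k=> [|k] []. Qed.

Lemma Ck_dvb k U f: Ck k.+1 U f -> forall y v, U y -> derivable f y v.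
by case=> _ []. Qed.

Lemma Ck_der k U f v: Ck k.+1 U f -> Ck k U ('D_v f).
by case=> _ [_ H]; exact: H. Qed.

Lemma Ck_S k U f: Ck k.+1 U f -> Ck k U f.
elim: k f=> [|k IH] f; first by case.
by case=> cf [df Df]; split=>//; split=>// v; apply: IH.
Qed.

Lemma sm_on_der U f v: smooth_on U f -> smooth_on U ('D_v f).
move=> sf s y Uy.
have -> : iter_deriv s ('D_v f) = iter_deriv (rcons s v) f.
 by rewrite /iter_deriv foldr_rcons.
exact: sf.
Qed.

Lemma sm_onP U f: smooth_on U f <-> forall k, Ck k U f.
split=> [sf k|cf s].
 elim: k f sf=> [|k IH] f sf; first by split=>// y /(sf [::])[].
 split; first by move=> y /(sf [::])[].
 split; first by move=> y v /(sf [::])[].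
 by move=> v; apply/IH/sm_on_der.
elim/last_ind: s f cf=> [|s v IH] f cf.
 by move=> y Uy; split; [exact: (Ck_cont (cf 0%N))|move=> v; exact: (Ck_dvb (cf 1%N))].
rewrite (_: iter_deriv (rcons s v) f = iter_deriv s ('D_v f)).
 by apply: IH=> k; exact: Ck_der (cf k.+1).
by rewrite /iter_deriv foldr_rcons.
Qed.

Lemma nearO U (P: V -> Prop) y: open U -> U y -> (forall z, U z -> P z) ->
 \forall z \near y, P z.
by move=> oU Uy UP; apply: filterS UP _; exact: open_nbhs_nbhs. Qed.

Lemma cont_near f g y: (\forall z \near y, f z = g z) ->
 {for y, continuous f} -> {for y, continuous g}.
move=> fg cf; rewrite /prop_for /continuous_at -(nbhs_singleton fg).
exact: cvg_trans (near_eq_cvg fg) cf.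
Qed.

Lemma Ck_ext k U f g: open U -> (forall y, U y -> f y = g y) -> Ck k U f -> Ck k U g.
move=> oU; elim: k f g=> [|k IH] f g fg cf.
 split=>// y Uy; apply: (cont_near _ (Ck_cont cf Uy)).
 exact: nearO Uy fg.
split.
 by move=> y Uy; apply: (cont_near _ (Ck_cont cf Uy)); exact: nearO Uy fg.
split=> [y v Uy|v].
 by apply: (@near_eq_derivable _ _ _ f g y v _ (Ck_dvb cf Uy)); exact: nearO Uy fg.
apply: (IH _ _ _ (Ck_der v cf))=> y Uy.
by apply: near_eq_derive; exact: nearO Uy fg.
Qed.

Lemma Ck_sub k (U W: set V) f: U `<=` W -> Ck k W f -> Ck k U f.
move=> UW; elim: k f=> [|k IH] f cf; first by split=>// y /UW; exact: (Ck_cont cf).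
split; first by move=> y /UW; exact: (Ck_cont cf).
split; first by move=> y v /UW; exact: (Ck_dvb cf).
by move=> v; apply: IH; exact: Ck_der cf.
Qed.

Lemma Ck_diff k U f y: open U -> Ck k.+1 U f -> U y -> differentiable f y.
move=> oU cf Uy; apply: C1_diff=> i.
 by apply: (nearO oU Uy)=> z; exact: (Ck_dvb cf).
exact: (Ck_cont (Ck_der _ cf)) Uy.
Qed.

Lemma Ck_cst k U (c: R): Ck k U (fun _=> c).
elim: k c=> [|k IH] c; split; try by move=> y _; exact: cst_continuous.
- by [].
- split=> [y v _|v]; first exact: derivable_cst.
 rewrite (_: 'D_v (fun=> c) = fun=> 0)//.
 by apply/funext=> y; exact: derive_cst.
Qed.

Lemma der_rV (i: 'I_n) y v: derivable (fun y: V=> y 0 i) y v /\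
 'D_v (fun y: V=> y 0 i) y = v 0 i.
have E: (fun h: R=> h^-1 *: ((h *: v + y) 0 i - y 0 i)) @ 0^' --> v 0 i.
 have E: \forall h \near (0: R)^', v 0 i = h^-1 *: ((h *: v + y) 0 i - y 0 i).
  apply: filterS (nbhs_dnbhs_neq _)=> h h0.
  by rewrite !mxE addrK [RHS]mulrA mulVf ?mul1r.
 exact: cvg_trans (near_eq_cvg E) (cvg_cst _).
by split; [apply/cvg_ex; exists (v 0 i)|apply/cvg_lim].
Qed.

Lemma Ck_coord k U (i: 'I_n): Ck k U (fun y=> y 0 i).
case: k=> [|k]; split; try by move=> y _; exact: coord_cont.
- by [].
- split=> [y v _|v]; first by have [] := der_rV i y v.
 rewrite (_: 'D_v _ = fun=> v 0 i); first exact: Ck_cst.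
 by apply/funext=> y; have [] := der_rV i y v.
Qed.

Lemma Ck_D k U f g: open U -> Ck k U f -> Ck k U g -> Ck k U (fun y=> f y + g y).
move=> oU; elim: k f g=> [|k IH] f g cf cg; split; try by
 move=> y Uy; apply: cont_atD; [exact: (Ck_cont cf)|exact: (Ck_cont cg)].
- by [].
split=> [y v Uy|v].
 by apply: derivableD; [exact: (Ck_dvb cf)|exact: (Ck_dvb cg)].
apply: Ck_ext (IH _ _ (Ck_der v cf) (Ck_der v cg))=>// y Uy.
by rewrite -deriveD//; [exact: (Ck_dvb cf)|exact: (Ck_dvb cg)].
Qed.

Lemma Ck_M k U f g: open U -> Ck k U f -> Ck k U g -> Ck k U (fun y=> f y * g y).
move=> oU; elim: k f g=> [|k IH] f g cf cg; split; try by
 move=> y Uy; apply: cont_atM; [exact: (Ck_cont cf)|exact: (Ck_cont cg)].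
- by [].
split=> [y v Uy|v].
 by apply: derivableM; [exact: (Ck_dvb cf)|exact: (Ck_dvb cg)].
apply: (@Ck_ext _ _ (fun y=> f y * 'D_v g y + g y * 'D_v f y))=>// [y Uy|].
 by rewrite (@deriveM _ _ f g)//; [exact: (Ck_dvb cf)|exact: (Ck_dvb cg)].
by apply: Ck_D=>//; apply: IH; [exact: Ck_S cf|exact: Ck_der cg|
 exact: Ck_S cg|exact: Ck_der cf].
Qed.

Lemma Ck_N k U f: open U -> Ck k U f -> Ck k U (fun y=> - f y).
move=> oU cf; apply: (@Ck_ext _ _ (fun y=> -1 * f y))=>// [y _|].
 by rewrite mulN1r.
by apply: Ck_M=>//; exact: Ck_cst.
Qed.

Lemma Ck_sum k U (I: Type) (r: seq I) (P: pred I) (F: I -> V -> R): open U ->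
 (forall i, P i -> Ck k U (F i)) -> Ck k U (fun y=> \sum_(i <- r | P i) F i y).
move=> oU cF; elim: r=> [|i r IH].
 by under eq_fun do rewrite big_nil; exact: Ck_cst.
rewrite (_: (fun y=> _) = if P i then fun y=> F i y + \sum_(j <- r | P j) F j y
 else fun y=> \sum_(j <- r | P j) F j y).
 by case: ifPn=>// Pi; apply: Ck_D=>//; exact: cF.
by apply/funext=> y; rewrite big_cons; case: ifP.
Qed.

Lemma Ck_prod k U (I: Type) (r: seq I) (P: pred I) (F: I -> V -> R): open U ->
 (forall i, P i -> Ck k U (F i)) -> Ck k U (fun y=> \prod_(i <- r | P i) F i y).
move=> oU cF; elim: r=> [|i r IH].
 by under eq_fun do rewrite big_nil; exact: Ck_cst.
rewrite (_: (fun y=> _) = if P i then fun y=> F i y * \prod_(j <- r | P j) F j y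
 else fun y=> \prod_(j <- r | P j) F j y).
 by case: ifPn=>// Pi; apply: Ck_M=>//; exact: cF.
by apply/funext=> y; rewrite big_cons; case: ifP.
Qed.

Lemma der_cmp1 (G: R -> R) f y v: derivable f y v -> derivable G (f y) 1 ->
 derivable (fun y=> G (f y)) y v /\
 'D_v (fun y=> G (f y)) y = derive1 G (f y) * 'D_v f y.
move=> df dG; pose c (h: R) := f (h *: v + y).
have dc: derivable c 0 1 by exact: (derivable1P f y v).1.
have c0: c 0 = f y by rewrite /c scale0r add0r.
have dGc: derivable (G \o c) 0 1.
 apply/derivable1_diffP; apply: differentiable_comp; first exact/derivable1_diffP.
 by apply/derivable1_diffP; rewrite c0.
split; first exact: (derivable1P (fun y=> G (f y)) y v).2.
have -> : 'D_v (fun y=> G (f y)) y = derive1 (G \o c) 0 by rewrite der_line0.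
have dGc0: derivable G (c 0) 1 by rewrite c0.
by rewrite (derive1_comp dc dGc0) c0 (der_line0 f).
Qed.

(** The derivative of the inverse is again a product of inverses and of a derivative of [f], so the
    induction hypothesis of lower order applies to it. The square root and the exponential follow
    the same pattern. *)
Lemma Ck_V k U f: open U -> (forall y, U y -> f y != 0) -> Ck k U f ->
 Ck k U (fun y=> (f y)^-1).
move=> oU f0; elim: k=> [|k IH] cf; split; try by
 move=> y Uy; apply: cont_atV; [exact: f0|exact: (Ck_cont cf)].
- by [].
split=> [y v Uy|v].
 by apply: derivableV; [exact: f0|exact: (Ck_dvb cf)].
apply: (@Ck_ext _ _ (fun y=> - ((f y)^-1 * (f y)^-1 * 'D_v f y)))=>// [y Uy|].
 rewrite (@deriveV _ _ f)//; [|exact: f0|exact: (Ck_dvb cf)].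
 by rewrite scaleNr -expr2 exprVn.
apply: Ck_N=>//; apply: Ck_M=>//; last exact: Ck_der cf.
by apply: Ck_M=>//; apply/IH/Ck_S.
Qed.

Lemma Ck_sqrt k U f: open U -> (forall y, U y -> 0 < f y) -> Ck k U f ->
 Ck k U (fun y=> Num.sqrt (f y)).
move=> oU f0; elim: k=> [|k IH] cf; split; try by
 move=> y Uy; apply: (@continuous_comp _ _ _ f Num.sqrt);
  [exact: (Ck_cont cf)|exact: sqrt_continuous].
- by [].
have ds y: U y -> is_derive (f y) 1 Num.sqrt (2 * Num.sqrt (f y))^-1.
 by move=> Uy; exact: is_derive1_sqrt (f0 y Uy).
split=> [y v Uy|v].
 by have [] := @der_cmp1 Num.sqrt f y v (Ck_dvb cf Uy) (@ex_derive _ _ _ _ _ _ _ (ds _ Uy)).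
apply: (@Ck_ext _ _ (fun y=> (2 * Num.sqrt (f y))^-1 * 'D_v f y))=>// [y Uy|].
 have [_ ->] := @der_cmp1 Num.sqrt f y v (Ck_dvb cf Uy) (@ex_derive _ _ _ _ _ _ _ (ds _ Uy)).
 by rewrite derive1E (@derive_val _ _ _ _ _ _ _ (ds _ Uy)).
apply: Ck_M=>//; last exact: Ck_der cf.
apply: Ck_V=>// [y Uy|]; first by rewrite mulf_neq0// sqrtr_eq0 -ltNge f0.
by apply: Ck_M=>//; [exact: Ck_cst|exact/IH/Ck_S].
Qed.

Lemma Ck_ln k U f: open U -> (forall y, U y -> 0 < f y) -> Ck k U f ->
 Ck k U (fun y=> ln (f y)).
move=> oU f0 cf.
have ds y: U y -> is_derive (f y) 1 (@ln R) (f y)^-1.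
 by move=> Uy; exact: is_derive1_ln (f0 y Uy).
have cln y: U y -> {for y, continuous (fun y=> ln (f y))}.
 move=> Uy; apply: (@continuous_comp _ _ _ f (@ln R)); first exact: (Ck_cont cf).
 exact: continuous_ln (f0 y Uy).
case: k cf=> [|k] cf; split=>//.
split=> [y v Uy|v].
 by have [] := @der_cmp1 (@ln R) f y v (Ck_dvb cf Uy) (@ex_derive _ _ _ _ _ _ _ (ds _ Uy)).
apply: (@Ck_ext _ _ (fun y=> (f y)^-1 * 'D_v f y))=>// [y Uy|].
 have [_ ->] := @der_cmp1 (@ln R) f y v (Ck_dvb cf Uy) (@ex_derive _ _ _ _ _ _ _ (ds _ Uy)).
 by rewrite derive1E (@derive_val _ _ _ _ _ _ _ (ds _ Uy)).
apply: Ck_M=>//; last exact: Ck_der cf.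
by apply: Ck_V (Ck_S cf)=>// y /f0; rewrite lt0r=> /andP[].
Qed.

Lemma Ck_exp k U f: open U -> Ck k U f -> Ck k U (fun y=> expR (f y)).
move=> oU; elim: k=> [|k IH] cf; split; try by
 move=> y Uy; apply: (@continuous_comp _ _ _ f (@expR R));
  [exact: (Ck_cont cf)|exact: continuous_expR].
- by [].
have ds y: is_derive (f y) 1 (@expR R) (expR (f y)) by exact: is_derive_expR.
split=> [y v Uy|v].
 by have [] := @der_cmp1 (@expR R) f y v (Ck_dvb cf Uy) (@ex_derive _ _ _ _ _ _ _ (ds _)).
apply: (@Ck_ext _ _ (fun y=> expR (f y) * 'D_v f y))=>// [y Uy|].
 have [_ ->] := @der_cmp1 (@expR R) f y v (Ck_dvb cf Uy) (@ex_derive _ _ _ _ _ _ _ (ds _)).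
 by rewrite derive1E (@derive_val _ _ _ _ _ _ _ (ds _)).
by apply: Ck_M=>//; [exact/IH/Ck_S|exact: Ck_der cf].
Qed.

(** The second difference of [f] with steps [s *: u] and [s *: v] equals [s ^ 2] times either mixed
    derivative at a nearby point, by two uses of the mean value theorem taken in either order.
    Continuity of the mixed derivatives then compares their values at [y]. *)
Lemma Schwarz U f y u v: open U -> Ck 2 U f -> U y ->
 'D_u ('D_v f) y = 'D_v ('D_u f) y.
move=> oU cf Uy; apply/eqP; rewrite -subr_eq0 -normr_le0; apply/ler_addgt0Pl=> e e0.
rewrite addr0.
have e2: 0 < e / 2 by rewrite divr_gt0.
pose Q (a b: V): V -> R := 'D_a ('D_b f).
rewrite -/(Q u v y) -/(Q v u y).
have cQ a b: {for y, continuous (Q a b)}.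
 exact: (Ck_cont (Ck_der _ (Ck_der _ cf))).
have: \forall z \near y, [/\ U z, `|Q u v y - Q u v z| <= e / 2 & `|Q v u y - Q v u z| <= e / 2].
 have H1: \forall z \near y, `|Q u v y - Q u v z| <= e / 2.
  by have /cvgrPdist_le/(_ _ e2) := cQ u v.
 have H2: \forall z \near y, `|Q v u y - Q v u z| <= e / 2.
  by have /cvgrPdist_le/(_ _ e2) := cQ v u.
 have H3: \forall z \near y, U z by exact: open_nbhs_nbhs.
 have H := near_and (nbhs_filter y) H3 (near_and (nbhs_filter y) H1 H2).
 by apply: (filterS _ H)=> z [h3 [h1 h2]]; split.
move=> /nbhs_ballP[d /= d0 Hd].
pose s := d / 2 / (`|u| + `|v| + 1).
have uv0: 0 < `|u| + `|v| + 1 by rewrite ltr_wpDl// addr_ge0.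
have s0: 0 < s by rewrite !divr_gt0.
have inb (a b: R): `|a| <= `|s| -> `|b| <= `|s| -> ball y d (a *: u + (b *: v + y)).
 move=> sa sb; rewrite -ball_normE /= distrC addrA addrK.
 apply: (@le_lt_trans _ _ (s * (`|u| + `|v| + 1))).
  rewrite (le_trans (ler_normD _ _))// !normrZ.
  rewrite (gtr0_norm s0) in sa sb.
  apply: le_trans (lerD (ler_wpM2r (normr_ge0 u) sa) (ler_wpM2r (normr_ge0 v) sb)) _.
  by rewrite !mulrDr mulr1 lerDl ltW.
 by rewrite /s divfK ?gt_eqF// ltr_pdivrMr// ltr_pMr// ltr1n.
have inU (a b: R): `|a| <= `|s| -> `|b| <= `|s| -> U (a *: u + (b *: v + y)).
 by move=> /inb/[apply]/Hd[].
have key (p q: V): (forall a b: R, `|a| <= `|s| -> `|b| <= `|s| -> U (a *: p + (b *: q + y))) ->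
 exists a b: R, [/\ `|a| <= `|s|, `|b| <= `|s| &
  f (s *: p + (s *: q + y)) - f (s *: q + y) - (f (s *: p + y) - f y)
  = s * (s * Q q p (a *: p + (b *: q + y)))].
 move=> inUpq.
 pose phi z := f (s *: q + z) - f z.
 have dsh z: derivable f (s *: q + z) p -> derivable (fun z=> f (s *: q + z)) z p /\
   'D_p (fun z=> f (s *: q + z)) z = 'D_p f (s *: q + z).
  have E: (fun h: R=> h^-1 *: (f (s *: q + (h *: p + z)) - f (s *: q + z))) =
       (fun h: R=> h^-1 *: (f (h *: p + (s *: q + z)) - f (s *: q + z))).
   by apply/funext=> h; rewrite addrCA.
  by move=> H; split; rewrite /derivable /derive /= E.
 have n0: `|0: R| <= `|s| by rewrite normr0.
 have sU (a: R): `|a| <= `|s| -> U (s *: q + (a *: p + y)).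
  by move=> sa; rewrite addrCA; exact: inUpq.
 have aU (a: R): `|a| <= `|s| -> U (a *: p + y).
  by move=> /inUpq/(_ n0); rewrite scale0r add0r.
 have [a sa|a sa E1] := @MVT_line phi y p s.
  apply: derivableB; last exact: (Ck_dvb cf (aU _ sa)).
  by apply: (dsh _ _).1; exact: (Ck_dvb cf (sU _ sa)).
 have [b sb|b sb E2] := @MVT_line ('D_p f) (a *: p + y) q s.
  apply: (Ck_dvb (Ck_der _ cf)).
  by rewrite addrCA; exact: inUpq.
 exists a, b; split=>//.
 rewrite [a *: p + _]addrCA /Q -E2.
 have <- : 'D_p phi (a *: p + y) = 'D_p f (s *: q + (a *: p + y)) - 'D_p f (a *: p + y).
  rewrite /phi deriveB.
  - by rewrite (dsh _ (Ck_dvb cf (sU _ sa))).2.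
  - exact: (dsh _ (Ck_dvb cf (sU _ sa))).1.
  - exact: (Ck_dvb cf (aU _ sa)).
 rewrite -E1 /phi [s *: p + (_ + _)]addrCA.
 by rewrite !opprB addrACA addrA [RHS]addrC !addrA; ring.
clearbody Q s.
have [a [b [sa sb E1]]] := key u v inU.
have [|a' [b' [sa' sb' E2]]] := key v u.
 by move=> a1 b1 H1 H2; rewrite addrCA; exact: inU.
have E: Q v u (a *: u + (b *: v + y)) = Q u v (a' *: v + (b' *: u + y)).
 have: s * (s * Q v u (a *: u + (b *: v + y))) = s * (s * Q u v (a' *: v + (b' *: u + y))).
  have rg (p q r t: R): p - q - (r - t) = p - r - (q - t) by ring.
  have Ec: s *: u + (s *: v + y) = s *: v + (s *: u + y) by exact: addrCA.
  apply: etrans (esym E1) _; apply: etrans _ E2; rewrite Ec; exact: rg.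
 have s1: s != 0 by rewrite gt_eqF.
 by move=> H; exact: (mulfI s1 (mulfI s1 H)).
have [_ _ H1] := Hd _ (inb _ _ sa sb).
have [_ H2 _] := Hd _ (inb _ _ sb' sa').
rewrite (splitr e); rewrite E in H1; rewrite [b' *: u + _]addrCA in H2.
rewrite distrC in H1.
apply: le_trans (lerD H2 H1).
exact: ler_distD.
Qed.

End Calculus.

Lemma cont_rV (R: realType) (T: topologicalType) n (phi: T -> 'rV[R]_n) (y: T):
 (forall i, {for y, continuous (fun z=> phi z 0 i)}) -> {for y, continuous phi}.
move=> cphi; apply/cvgrPdist_lt=> e e0.
have H (i: 'I_n): \forall z \near y, `|(phi y - phi z) 0 i| < e.
 have /cvgrPdist_lt/(_ _ e0) := cphi i.
 by apply: filterS=> z; rewrite !mxE.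
have: \forall z \near y, forall i, `|(phi y - phi z) 0 i| < e.
 exact: (@filter_forall _ _ (fun i z=> `|(phi y - phi z) 0 i| < e) (nbhs y) _ H).
by apply: filterS=> z Hz; apply/norm_ltP.
Qed.

Local Notation Ckv k U Phi := (forall i, Ck k U (fun y=> Phi y 0 i)).

(** * Chain rule and composition of C^k maps *)

Section Composition.
Variables (R: realType) (m n: nat).
Implicit Types (phi: 'rV[R]_m -> 'rV[R]_n) (F: 'rV[R]_n -> R).

(** Restriction to the line through [y] in direction [v] reduces the chain rule to a curve followed
    by [F]. *)
Lemma der_comp phi F y v: (forall i, derivable (fun y=> phi y 0 i) y v) ->
 differentiable F (phi y) ->
 derivable (fun y=> F (phi y)) y v /\
 'D_v (fun y=> F (phi y)) y = 'D_(\row_i 'D_v (fun y=> phi y 0 i) y) F (phi y).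
move=> dphi dF; pose c (h: R) := phi (h *: v + y).
have dphiy: derivable phi y v by apply/derivable_mxP=> i j; rewrite ord1.
have dc: derivable c 0 1 by exact: (derivable1P phi y v).1.
have c0: c 0 = phi y by rewrite /c scale0r add0r.
have dFc: differentiable (F \o c) 0.
 by apply: differentiable_comp; [exact/derivable1_diffP|rewrite c0].
split; first by apply: (derivable1P (fun y=> F (phi y)) y v).2; exact/derivable1_diffP.
rewrite der_line0 -[X in derive1 X 0]/(F \o c) derive1E deriveE// diff_comp//=; last 2 first.
- exact/derivable1_diffP.
- by rewrite c0.
rewrite c0 -deriveE// -deriveE; last exact/derivable1_diffP.
congr ('D_ _ F _); rewrite (derive_mx dc); apply/rowP=> j; rewrite !mxE -derive1E.
by rewrite (der_line0 (fun y=> phi y 0 j)).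
Qed.

Lemma Ck_comp k U W phi F: open U -> open W -> (forall y, U y -> W (phi y)) ->
 Ckv k U phi -> Ck k W F -> Ck k U (fun y=> F (phi y)).
move=> oU oW UW; elim: k F=> [|k IH] F cphi cF.
- split=>// y Uy; apply: (@continuous_comp _ _ _ phi F); last exact: (Ck_cont cF (UW _ Uy)).
 by apply: cont_rV=> i; exact: (Ck_cont (cphi i)).
- have cF1 := Ck_diff oW cF.
 have dphi y v (Uy: U y) i := Ck_dvb (cphi i) (v:=v) Uy.
 split=> [y Uy|].
  apply: (@continuous_comp _ _ _ phi F); last exact: (Ck_cont cF (UW _ Uy)).
  by apply: cont_rV=> i; exact: (Ck_cont (cphi i)).
 split=> [y v Uy|v].
  by have [] := der_comp (dphi y v Uy) (cF1 _ (UW _ Uy)).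
 apply: (@Ck_ext _ _ _ _ (fun y=> \sum_i 'D_v (fun y=> phi y 0 i) y * 'D_'e_i F (phi y)))=>//.
  move=> y Uy; have [_ ->] := der_comp (dphi y v Uy) (cF1 _ (UW _ Uy)).
  rewrite der_coord; last exact: cF1 (UW _ Uy).
  by apply: eq_bigr=> i _; rewrite mxE.
 apply: Ck_sum=>// i _; apply: Ck_M=>//; first exact: Ck_der.
 by apply: (IH ('D_'e_i F))=> [j|]; [exact: Ck_S|exact: Ck_der].
Qed.
End Composition.

(** * Integrals of continuous functions of one variable with compact support *)

Section Integral1.
Variable R: realType.
Implicit Types (f g: R -> R) (L M: R).
Local Notation mu := (@lebesgue_measure R).

Definition supp1 L f := forall t, L < `|t| -> f t = 0.

Lemma supp1_patch L f: supp1 L f -> f \_ `[- L, L] = f.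
move=> sf; apply/funext=> t; rewrite patchE; case: ifPn=>// tI.
have [|Lt] := leP `|t| L; last by rewrite sf.
by rewrite ler_norml=> tL; move: tI; rewrite notin_setE /= in_itv /= tL.
Qed.

(** Over a segment continuity gives integrability, and the fundamental theorem of calculus
    applies. *)
Lemma Rsupp L f: supp1 L f ->
 \int[mu]_t f t = \int[mu]_(t in `[- L, L]) f t.
by move=> sf; rewrite [RHS]Rintegral_mkcond supp1_patch. Qed.

Lemma int_itv f (a b: R): continuous f -> mu.-integrable `[a, b] (EFin \o f).
move=> cf; apply: continuous_compact_integrable; first exact: segment_compact.
exact: continuous_subspaceT.
Qed.

Lemma intble_sp L f: continuous f -> supp1 L f -> mu.-integrable setT (EFin \o f).
move=> cf sf; have := int_itv (- L) L cf.
rewrite integrable_mkcond//; congr (_.-integrable _ _).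
by rewrite restrict_EFin supp1_patch.
Qed.

Lemma RsuppD L f g: continuous f -> continuous g -> supp1 L f -> supp1 L g ->
 \int[mu]_t (f t + g t) = \int[mu]_t f t + \int[mu]_t g t.
by move=> cf cg sf sg; apply: RintegralD=>//; exact: (@intble_sp L). Qed.

Lemma RsuppZ L f (c: R): continuous f -> supp1 L f ->
 \int[mu]_t (c * f t) = c * \int[mu]_t f t.
by move=> cf sf; apply: RintegralZl=>//; exact: (@intble_sp L). Qed.

Lemma le_Rsupp L f g: continuous f -> continuous g -> supp1 L f -> supp1 L g ->
 (forall t, f t <= g t) -> \int[mu]_t f t <= \int[mu]_t g t.
by move=> cf cg sf sg fg; apply: le_Rintegral=>//; exact: (@intble_sp L). Qed.

Lemma Rint_cst (a b c: R): a <= b -> \int[mu]_(t in `[a, b]) c = c * (b - a).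
move=> ab; rewrite Rintegral_cst//= lebesgue_measure_itv /= lte_fin.
move: ab; rewrite le_eqVlt=> /predU1P[->|->//]; last by rewrite ltxx subrr.
Qed.

Lemma norm_Rsupp L M f: 0 <= L -> continuous f -> supp1 L f ->
 (forall t, `|f t| <= M) -> `|\int[mu]_t f t| <= M * (2 * L).
move=> L0 cf sf fM; rewrite (Rsupp sf).
apply: le_trans (le_normr_Rintegral _ (int_itv _ _ cf)) _=>//.
rewrite (_: 2 * L = L - - L); last by rewrite opprK mulr_natl mulr2n.
rewrite -Rint_cst; last by rewrite ge0_cp.
apply: le_Rintegral=>//.
 by apply: (@int_itv (fun t=> `|f t|))=> t; apply: cvg_norm; exact: cf.
by apply: int_itv=> t; exact: cvg_cst.
Qed.

Lemma Rint_der L F f: continuous f -> supp1 L F -> (forall t: R, is_derive t 1 F (f t)) ->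
 \int[mu]_t f t = 0.
move=> cf sF dF.
(* [K] exceeds [|L|] strictly, so that [F] vanishes at both endpoints and its derivative [f] beyond
   them. *)
pose K := `|L| + 1.
have LK: L < K by rewrite /K (le_lt_trans (ler_norm L))// ltrDl.
have K0: 0 < K by rewrite /K ltr_wpDl.
have sf: supp1 K f.
 move=> t tK; have [_ <-] := dF t.
 rewrite -(derive_cst (0: R) t 1); apply: near_eq_derive.
 have: \forall z \near t, K < `|z|.
  have /cvgr_gt := @norm_continuous _ R t; exact.
 by apply: filterS=> z Kz; rewrite sF// (lt_trans LK).
rewrite (Rsupp sf) /Rintegral.
have cF t: {for t, continuous F}.
 by apply: differentiable_continuous; apply/derivable1_diffP; have [] := dF t.
rewrite (@continuous_FTC2 _ f F) //.
- have n1: L < `|K| by rewrite gtr0_norm.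
 have n2: L < `|- K| by rewrite normrN gtr0_norm.
 by rewrite (sF _ n1) (sF _ n2) /= subrr.
- by rewrite gtrN.
- exact: continuous_subspaceT.
- split.
 + by move=> t _; have [] := dF t.
 + exact: cvg_at_right_filter (cF _).
 + exact: cvg_at_left_filter (cF _).
- by move=> t _; rewrite derive1E; have [_ ->] := dF t.
Qed.

(** By continuity [f] stays above [f t0 / 2] on a segment around [t0]. *)
Lemma Rint_gt0 L f t0: continuous f -> supp1 L f -> (forall t, 0 <= f t) ->
 0 < f t0 -> 0 < \int[mu]_t f t.
move=> cf sf f0 ft0.
have f2: f t0 / 2 < f t0 by rewrite ltr_pdivrMr// ltr_pMr// ltr1n.
have /nbhs_ballP[d /= d0 Hd] : \forall t \near t0, f t0 / 2 < f t.
 have /cvgr_gt := cf t0; exact.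
pose e := d / 2.
have e0: 0 < e by rewrite divr_gt0.
pose A := `[t0 - e, t0 + e]%classic.
have eA: t0 - e <= t0 + e by rewrite lerD2l (le_trans _ (ltW e0))// oppr_le0 ltW.
have c0: 0 < f t0 / 2 by rewrite divr_gt0.
apply: (@lt_le_trans _ _ (\int[mu]_(t in A) (f t0 / 2))).
 rewrite Rint_cst// mulr_gt0// opprD addrACA subrr add0r opprK.
 by rewrite addr_gt0.
rewrite Rintegral_mkcond; apply: le_Rintegral=>//.
- have H: mu.-integrable `[t0 - e, t0 + e] (EFin \o (fun=> f t0 / 2)).
  by apply: int_itv=> t; exact: cvg_cst.
 rewrite integrable_mkcond// restrict_EFin in H.
 exact: H.
- exact: (@intble_sp L).
move=> t _; rewrite patchE; case: ifPn=>// /set_mem.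
rewrite /A /= in_itv /= => /andP[h1 h2]; apply/ltW/Hd.
rewrite -ball_normE /= ltr_norml; rewrite /e in h1 h2.
by apply/andP; split; lra.
Qed.

Lemma RintN L f: continuous f -> supp1 L f -> \int[mu]_t f (- t) = \int[mu]_t f t.
move=> cf sf.
have L0: - `|L| <= `|L| by rewrite ge0_cp.
have sf': supp1 `|L| f by move=> t /(le_lt_trans (ler_norm L)); exact: sf.
have sfN: supp1 `|L| (fun t=> f (- t)) by move=> t tL; rewrite sf'// normrN.
rewrite (Rsupp sfN) (Rsupp sf') /Rintegral.
have := @integration_by_substitution_oppr R f (- `|L|) `|L| L0.
rewrite opprK=> ->//; exact: continuous_subspaceT.
Qed.

End Integral1.

(** * Iterated integrals of continuous functions with compact support *)

Section IterInt.
Variable R: realType.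
Local Notation mu := (@lebesgue_measure R).

Definition supp n L (h: 'rV[R]_n -> R) := forall y, L < `|y| -> h y = 0.
(** The class on which the iterated integral is well behaved: it is stable under slicing, and the
    integrals of slices are continuous with compact support in the slicing variable. *)
Definition cc n (h: 'rV[R]_n -> R) := continuous h /\ exists L, supp L h.

Lemma cc_sp n (h: 'rV[R]_n -> R): cc h -> exists2 L, 0 < L & supp L h.
move=> [_ [L sL]]; exists (`|L| + 1); first by rewrite ltr_wpDl.
by move=> y Ly; apply: sL; apply: le_lt_trans Ly; rewrite (le_trans (ler_norm L))// lerDl.
Qed.

Lemma cc_common n (f g: 'rV[R]_n -> R): cc f -> cc g ->
 exists2 L, 0 < L & supp L f /\ supp L g.
move=> /cc_sp[L1 L10 s1] /cc_sp[L2 L20 s2]; exists (Num.max L1 L2); first by rewrite lt_max L10.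
by split=> y; rewrite gt_max=> /andP[? ?]; [exact: s1|exact: s2].
Qed.

Lemma cc_D n (f g: 'rV[R]_n -> R): cc f -> cc g -> cc (fun y=> f y + g y).
move=> cf cg; have [L _ [sf sg]] := cc_common cf cg; case: cf cg=> cf _ [cg _].
split; first by move=> y; exact: (cont_atD (cf y) (cg y)).
by exists L=> y Ly; rewrite sf// sg// addr0.
Qed.

Lemma cc_Mr n (f g: 'rV[R]_n -> R): continuous f -> cc g -> cc (fun y=> f y * g y).
move=> cf [cg [L sg]]; split; first by move=> y; exact: (cont_atM (cf y) (cg y)).
by exists L=> y Ly; rewrite sg// mulr0.
Qed.

Lemma cc_Z n (c: R) (g: 'rV[R]_n -> R): cc g -> cc (fun y=> c * g y).
by move=> cg; apply: (@cc_Mr _ (fun=> c))=>// y; exact: cst_continuous. Qed.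

Lemma cc_N n (g: 'rV[R]_n -> R): cc g -> cc (fun y=> - g y).
by move=> /(cc_Z (-1)); congr cc; apply/funext=> y; rewrite mulN1r.
Qed.

Lemma cc_0 n: cc (fun _: 'rV[R]_n=> 0).
by split; [move=> y; exact: cst_continuous|exists 0]. Qed.

Lemma cc_sum n (I: Type) (r: seq I) (P: pred I) (F: I -> 'rV[R]_n -> R):
 (forall i, P i -> cc (F i)) -> cc (fun y=> \sum_(i <- r | P i) F i y).
move=> cF; elim: r=> [|i r IH].
 by under eq_fun do rewrite big_nil; exact: cc_0.
rewrite (_: (fun y=> _) = if P i then fun y=> F i y + \sum_(j <- r | P j) F j y
 else fun y=> \sum_(j <- r | P j) F j y).
 by case: ifPn=>// Pi; apply: cc_D=>//; exact: cF.
by apply/funext=> y; rewrite big_cons; case: ifP.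
Qed.

Lemma supp_le n (L L': R) (h: 'rV[R]_n -> R): L <= L' -> supp L h -> supp L' h.
by move=> LL sL y /(le_lt_trans LL); exact: sL. Qed.

Lemma closed_ball_cpt n (L: R): compact [set y: 'rV[R]_n | `|y| <= L].
apply: bounded_closed_compact.
 by exists L; split; [exact: num_real|move=> M LM y /= /le_trans; apply; exact: ltW].
rewrite (_: [set y | _] = (fun y: 'rV[R]_n=> `|y|) @^-1` [set x | x <= L])//.
apply: closed_comp; last exact: closed_le.
by move=> y _; exact: norm_continuous.
Qed.

(** Turns a local positive threshold into a uniform one. The local hypothesis covers all smaller
    thresholds [d'] as well, so that it speaks of the filter of right neighbourhoods of 0, to which
    compactness in its near-covering form applies. *)
Lemma cpt_unif (X: topologicalType) (K: set X) (P: R -> X -> Prop):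
 compact K ->
 (forall x, K x -> exists2 U, nbhs x U &
   exists2 d: R, 0 < d & forall x' d', U x' -> 0 < d' -> d' <= d -> P d' x') ->
 exists2 d: R, 0 < d & forall x, K x -> P d x.
move=> /compact_near_coveringP cK H.
have [|d [d0 Hd]] := @filter_ex _ ((0: R)^'+) _ (fun d=> 0 < d /\ forall x, K x -> P d x).
 have H1: \forall d \near (0: R)^'+, 0 < d by exact: nbhs_right_gt.
 have H2: \forall d \near (0: R)^'+, K `<=` P d.
  apply: cK=> x /H[U xU [d d0 Ud]].
  exists (U, [set d' | 0 < d' /\ d' <= d]); last by move=> [x' d'] /= [Ux' [? ?]]; exact: Ud.
  have H2: \forall d' \near (0: R)^'+, d' <= d by exact: nbhs_right_le.
  by split=>//=; exact: near_and H1 H2.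
 exact: near_and H1 H2.
by exists d.
Qed.

(** Compactness is used on the ball of radius [L + 1]; outside it both values vanish because [d] is
    at most 1. *)
Lemma cc_unif n (h: 'rV[R]_n -> R) (e: R): cc h -> 0 < e ->
 exists2 d: R, 0 < d & forall x z, `|z| < d -> `|h (x + z) - h x| < e.
move=> ch e0; have [L L0 sL] := cc_sp ch; have [cth _] := ch.
have e2: 0 < e / 2 by rewrite divr_gt0.
have [|d d0 Hd] := @cpt_unif _ _ (fun (d: R) x =>
  d <= 1 /\ forall z, `|z| < d -> `|h (x + z) - h x| < e) (@closed_ball_cpt n (L + 1)).
 move=> x _; have /cvgrPdist_lt/(_ _ e2)/nbhs_ballP[d /= d0 Hd] := cth x.
 have d20: 0 < d / 2 by rewrite divr_gt0.
 exists (ball x (d / 2)); first exact: nbhsx_ballx.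
 exists (Num.min (d / 2) 1); first by rewrite lt_min d20 /=.
 move=> x' d' xx' d'0; rewrite le_min=> /andP[dd' d'1]; split=>// z zd'.
 have H1: ball x d x' by apply: le_ball xx'; rewrite ler_pdivrMr// ler_peMr ?ler1n// ltW.
 have H2: ball x d (x' + z).
  rewrite (splitr d); apply: ball_triangle xx' _.
  by rewrite -ball_normE /= opprD addrA subrr sub0r normrN (lt_le_trans zd').
 have := ltrD (Hd _ H2) (Hd _ H1); rewrite -splitr; apply: le_lt_trans.
 by rewrite [X in _ <= X + _]distrC; exact: ler_distD.
exists d=>// x z zd.
have [xL|xL] := leP `|x| (L + 1); first by apply: (Hd x xL).2.
have d1: d <= 1 by have [] := Hd 0 _; rewrite /= ?normr0 ?addr_ge0// ltW.
have -> : h x = 0 by apply: sL; rewrite (lt_trans _ xL)// ltrDl.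
rewrite sL ?subrr ?normr0//; rewrite -ltrBrDr in xL; apply: (lt_le_trans xL).
have := ler_normB (x + z) z; rewrite addrK -lerBlDr=> /(le_trans _); apply.
by rewrite lerD2l lerN2 (le_trans (ltW zd)).
Qed.

Lemma norm_row n (t: R) (y: 'rV[R]_n):
 `|row_mx (t%:M: 'rV[R]_1) y: 'rV[R]_(1 + n)| = Num.max `|t| `|y|.
apply/eqP; rewrite eq_le; apply/andP; split.
 apply/norm_leP; first by rewrite le_max normr_ge0.
 move=> j; rewrite mxE; case: splitP=> k _.
  by rewrite ord1 mxE eqxx mulr1n le_max lexx.
 by rewrite le_max coord_le orbT.
rewrite ge_max; apply/andP; split.
 by have := coord_le (row_mx (t%:M: 'rV[R]_1) y) (lshift n 0); rewrite row_mxEl mxE mulr1n.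
apply/norm_leP=>// j.
by have := coord_le (row_mx (t%:M: 'rV[R]_1) y) (rshift 1 j); rewrite row_mxEr.
Qed.

Local Notation slice h t := (fun y=> h (row_mx (t%:M: 'rV[R]_1) y)).

Lemma slc_supp n L (h: 'rV[R]_n.+1 -> R) t: supp L h -> supp L (slice h t).
by move=> sL y Ly; apply: sL; rewrite norm_row lt_max Ly orbT. Qed.

Lemma slc_sp0 n L (h: 'rV[R]_n.+1 -> R) t: supp L h -> L < `|t| -> slice h t = fun=> 0.
by move=> sL tL; apply/funext=> y; apply: sL; rewrite norm_row lt_max tL. Qed.

Lemma slc_cc n (h: 'rV[R]_n.+1 -> R) t: cc h -> cc (slice h t).
move=> [ch [L sL]]; split; last by exists L; exact: slc_supp.
move=> y; apply: (@continuous_comp _ _ _ (fun y=> row_mx (t%:M: 'rV[R]_1) y) h); last exact: ch.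
apply: cont_rV=> j.
rewrite (_: (fun z=> _) = match fintype.split j with inl k=> fun=> (t%:M: 'rV[R]_1) 0 k
 | inr k=> fun z: 'rV[R]_n=> z 0 k end).
 by case: fintype.split=> k; [exact: cst_continuous|exact: coord_cont].
by apply/funext=> z; rewrite mxE; case: fintype.split.
Qed.

Lemma iintS n (h: 'rV[R]_n.+1 -> R):
 iint h = \int[mu]_t iint (slice h t).
by []. Qed.

Lemma slc_shift n (s t: R) (y: 'rV[R]_n):
 row_mx (s%:M: 'rV[R]_1) y + row_mx ((t - s)%:M: 'rV[R]_1) 0 = row_mx (t%:M: 'rV[R]_1) y.
by rewrite add_row_mx addr0 -raddfD addrC subrK. Qed.

(** The three facts are proved together: linearity in dimension [n.+1] needs the integrals of slices
    to be continuous, and this continuity rests on linearity and on the bound in dimension [n]. *)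
Lemma iint_facts n:
 [/\ forall f g: 'rV[R]_n -> R, cc f -> cc g ->
    iint (fun y=> f y + g y) = iint f + iint g,
   forall (c: R) (f: 'rV[R]_n -> R), cc f ->
    iint (fun y=> c * f y) = c * iint f &
   forall (f: 'rV[R]_n -> R) L M, 0 <= L -> cc f -> supp L f -> (forall y, `|f y| <= M) ->
    `|iint f| <= M * (2 * L) ^+ n].
elim: n=> [|n [IHD IHZ IHb]]; first by split=>//= f L M _ _ _; rewrite mulr1.
have cst0: iint (fun _: 'rV[R]_n=> 0) = 0 :> R.
 have c0: cc (fun _: 'rV[R]_n=> 0: R) by split; [exact: cst_continuous|exists 0].
 apply: etrans (etrans (IHZ 0 _ c0) (mul0r _)).
 by congr iint; apply/funext=> y; rewrite mulr0.
have ssupp L (h: 'rV[R]_n.+1 -> R): supp L h -> supp1 L (fun t=> iint (slice h t)).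
 by move=> sL t tL; rewrite (slc_sp0 sL tL).
have scont (h: 'rV[R]_n.+1 -> R): cc h -> continuous (fun t=> iint (slice h t)).
 move=> ch t; have [L L0 sL] := cc_sp ch.
 apply/cvgrPdist_le=> e e0.
 have e1: 0 < e / ((2 * L) ^+ n + 1) by rewrite divr_gt0// ltr_wpDl// exprn_ge0// mulr_ge0 // ltW.
 have [d d0 Hd] := cc_unif ch e1.
 exists d=>//= s /= ts.
 have cN: cc (fun y=> -1 * slice h s y) by exact/cc_Z/slc_cc.
 rewrite -mulN1r -IHZ -?IHD; try exact: slc_cc; last by [].
 have H y: `|slice h t y + -1 * slice h s y| <= e / ((2 * L) ^+ n + 1).
  rewrite mulN1r; have := Hd (row_mx (s%:M: 'rV[R]_1) y) (row_mx ((t - s)%:M: 'rV[R]_1) 0).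
  by rewrite norm_row normr0 max_l// [X in h X - _]slc_shift=> /(_ ts)/ltW.
 have cD: cc (fun y=> slice h t y + -1 * slice h s y) by apply: cc_D=>//; exact: slc_cc.
 have sD: supp L (fun y=> slice h t y + -1 * slice h s y).
  by move=> y Ly; rewrite (slc_supp t sL)// (slc_supp s sL)// mulr0 addr0.
 apply: le_trans (IHb _ _ _ (ltW L0) cD sD H) _.
 have n0: 0 <= (2 * L) ^+ n by rewrite exprn_ge0// mulr_ge0 // ltW.
 rewrite mulrAC ler_pdivrMr ?ltr_wpDl// ler_wpM2l ?(ltW e0)// lerDl.
 by [].
split=> [f g cf cg|c f cf|f L M L0 cf sf fM].
- have [L1 L10 s1] := cc_sp cf; have [L2 L20 s2] := cc_sp cg.
 have s1': supp (Num.max L1 L2) f by apply: supp_le s1; rewrite le_max lexx.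
 have s2': supp (Num.max L1 L2) g by apply: supp_le s2; rewrite le_max lexx orbT.
 rewrite !iintS -(RsuppD (scont _ cf) (scont _ cg) (ssupp _ _ s1') (ssupp _ _ s2')).
 by congr Rintegral; apply/funext=> t; rewrite IHD//; exact: slc_cc.
- have [L1 L10 s1] := cc_sp cf.
 rewrite !iintS -(RsuppZ _ (scont _ cf) (ssupp _ _ s1)).
 by congr Rintegral; apply/funext=> t; rewrite IHZ//; exact: slc_cc.
- rewrite iintS exprSr mulrA.
 apply: (norm_Rsupp L0 (scont _ cf) (ssupp _ _ sf))=> t.
 by apply: IHb=>//; [exact: slc_cc|exact: slc_supp].
Qed.

Lemma iintD n (f g: 'rV[R]_n -> R): cc f -> cc g ->
 iint (fun y=> f y + g y) = iint f + iint g.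
by have [H _ _] := iint_facts n; exact: H. Qed.

Lemma iintZ n (c: R) (f: 'rV[R]_n -> R): cc f ->
 iint (fun y=> c * f y) = c * iint f.
by have [_ H _] := iint_facts n; exact: H. Qed.

Lemma iint_bd n (f: 'rV[R]_n -> R) L M: 0 <= L -> cc f -> supp L f ->
 (forall y, `|f y| <= M) -> `|iint f| <= M * (2 * L) ^+ n.
by have [_ _ H] := iint_facts n; exact: H. Qed.

Lemma iint0 n: iint (fun _: 'rV[R]_n=> 0) = 0.
apply: etrans (etrans (iintZ 0 (@cc_0 n)) (mul0r _)).
by congr iint; apply/funext=> y; rewrite mulr0.
Qed.

Lemma iintN n (f: 'rV[R]_n -> R): cc f ->
 iint (fun y=> - f y) = - iint f.
move=> cf; rewrite -mulN1r -iintZ//.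
by congr iint; apply/funext=> y; rewrite mulN1r.
Qed.

Lemma iintB n (f g: 'rV[R]_n -> R): cc f -> cc g ->
 iint (fun y=> f y - g y) = iint f - iint g.
by move=> cf cg; rewrite iintD ?iintN//; exact: cc_N. Qed.

Lemma iint_sum n (I: Type) (r: seq I) (P: pred I) (F: I -> 'rV[R]_n -> R):
 (forall i, P i -> cc (F i)) ->
 iint (fun y=> \sum_(i <- r | P i) F i y) = \sum_(i <- r | P i) iint (F i).
move=> cF; elim: r=> [|i r IH].
 rewrite big_nil -[RHS](@iint0 n).
 by congr iint; apply/funext=> y; rewrite big_nil.
rewrite big_cons -IH; case: ifPn=> Pi.
 rewrite -iintD; [|exact: cF|exact: cc_sum].
 by congr iint; apply/funext=> y; rewrite big_cons Pi.
by congr iint; apply/funext=> y; rewrite big_cons (negbTE Pi).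
Qed.

Lemma slc_cont n (h: 'rV[R]_n.+1 -> R): cc h ->
 continuous (fun t=> iint (slice h t)).
move=> ch t; have [L L0 sL] := cc_sp ch.
apply/cvgrPdist_le=> e e0.
have n0: 0 <= (2 * L) ^+ n by rewrite exprn_ge0// mulr_ge0 // ltW.
have e1: 0 < e / ((2 * L) ^+ n + 1) by rewrite divr_gt0// ltr_wpDl.
have [d d0 Hd] := cc_unif ch e1.
exists d=>//= s /= ts.
rewrite -iintB; try exact: slc_cc.
have H y: `|slice h t y - slice h s y| <= e / ((2 * L) ^+ n + 1).
 have := Hd (row_mx (s%:M: 'rV[R]_1) y) (row_mx ((t - s)%:M: 'rV[R]_1) 0).
 by rewrite norm_row normr0 max_l// [X in h X - _]slc_shift=> /(_ ts)/ltW.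
have cD: cc (fun y=> slice h t y - slice h s y).
 by apply: cc_D; [|apply: cc_N]; exact: slc_cc.
have sD: supp L (fun y=> slice h t y - slice h s y).
 by move=> y Ly; rewrite (slc_supp t sL)// (slc_supp s sL)// subr0.
apply: le_trans (iint_bd (ltW L0) cD sD H) _.
by rewrite mulrAC ler_pdivrMr ?ltr_wpDl// ler_wpM2l ?(ltW e0)// lerDl.
Qed.

Lemma slc_sp n L (h: 'rV[R]_n.+1 -> R): supp L h ->
 supp1 L (fun t=> iint (slice h t)).
by move=> sL t tL; rewrite (slc_sp0 sL tL) iint0. Qed.

Lemma le_iint n (f g: 'rV[R]_n -> R): cc f -> cc g -> (forall y, f y <= g y) ->
 iint f <= iint g.
elim: n f g=> [|n IH] f g cf cg fg; first exact: fg.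
have [L _ [sf sg]] := cc_common cf cg.
apply: (le_Rsupp (slc_cont cf) (slc_cont cg)
 (slc_sp sf) (slc_sp sg))=> t.
by apply: IH=>//; exact: slc_cc.
Qed.

Lemma iint_ge0 n (f: 'rV[R]_n -> R): cc f -> (forall y, 0 <= f y) ->
 0 <= iint f.
by move=> cf f0; rewrite -(@iint0 n); apply: le_iint=>//; exact: cc_0. Qed.

Lemma row_mx_head n (y: 'rV[R]_(1 + n)): row_mx ((y 0 0)%:M: 'rV[R]_1) (rsubmx y) = y.
rewrite -[RHS](hsubmxK y); congr row_mx; apply/rowP=> j; rewrite ord1 !mxE eqxx mulr1n.
by congr (y _ _); apply/val_inj.
Qed.

Lemma iint_gt0 n (f: 'rV[R]_n -> R) y0: cc f -> (forall y, 0 <= f y) ->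
 0 < f y0 -> 0 < iint f.
elim: n f y0=> [|n IH] f y0 cf f0 fy0; first by move: fy0; rewrite (thinmx0 y0).
have [L _ sf] := cc_sp cf.
pose y1: 'rV[R]_(1 + n) := y0.
apply: (Rint_gt0 (t0:=y1 0 0) (slc_cont cf) (slc_sp sf)).
 by move=> t; apply: iint_ge0=>//; exact: slc_cc.
apply: (IH _ (rsubmx y1))=>//; first exact: slc_cc.
by rewrite (row_mx_head y1).
Qed.

Lemma slc_derive n (h: 'rV[R]_n.+1 -> R) t v y:
 derivable h (row_mx (t%:M: 'rV[R]_1) y) (row_mx (0: 'rV[R]_1) v) ->
 derivable (slice h t) y v /\
 'D_v (slice h t) y = 'D_(row_mx (0: 'rV[R]_1) v) h (row_mx (t%:M: 'rV[R]_1) y).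
have E: (fun s: R=> s^-1 *: (h (row_mx (t%:M: 'rV[R]_1) (s *: v + y)) - h (row_mx (t%:M: 'rV[R]_1) y))) =
 (fun s: R=> s^-1 *: (h (s *: row_mx (0: 'rV[R]_1) v + row_mx (t%:M: 'rV[R]_1) y) - h (row_mx (t%:M: 'rV[R]_1) y))).
 by apply/funext=> s; rewrite scale_row_mx scaler0 add_row_mx add0r.
by move=> dh; split; rewrite /derivable /derive /= E.
Qed.

(** Differentiation under the integral sign: by the mean value theorem the difference quotient is a
    value of [h'] at a point at distance at most [|s|], and [h'] is uniformly continuous. *)
Lemma slc_der n (h h': 'rV[R]_n.+1 -> R): cc h -> cc h' ->
 (forall y, is_derive y (row_mx (1%:M: 'rV[R]_1) (0: 'rV[R]_n)) h (h' y)) ->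
 forall t: R, is_derive t 1 (fun t=> iint (slice h t)) (iint (slice h' t)).
move=> ch ch' dh t; have [L L0 [sL sL']] := cc_common ch ch'.
set v := row_mx _ _ in dh.
suff H: (fun s: R=> s^-1 *: (iint (slice h (s *: 1 + t)) - iint (slice h t)))
  @ 0^' --> iint (slice h' t).
 by apply: DeriveDef; [apply/cvg_ex; eexists; exact: H|exact/cvg_lim].
apply/cvgrPdist_le=> e e0.
have n0: 0 <= (2 * L) ^+ n by rewrite exprn_ge0// mulr_ge0 // ltW.
have e1: 0 < e / ((2 * L) ^+ n + 1) by rewrite divr_gt0// ltr_wpDl.
have [d d0 Hd] := cc_unif ch' e1.
exists d=>//= s /=; rewrite sub0r normrN=> sd s0.
rewrite [s *: 1]mulr1.
have vE (r: R) y: r *: v + row_mx (t%:M: 'rV[R]_1) y = row_mx ((r + t)%:M: 'rV[R]_1) y.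
 by rewrite /v scale_row_mx scaler0 add_row_mx add0r scale_scalar_mx mulr1 raddfD.
have -> : s^-1 *: (iint (slice h (s + t)) - iint (slice h t)) =
  iint (fun y=> s^-1 * (slice h (s + t) y - slice h t y)).
 rewrite iintZ; last by apply: cc_D; [|apply: cc_N]; exact: slc_cc.
 by rewrite iintB//; exact: slc_cc.
have cQ: cc (fun y=> s^-1 * (slice h (s + t) y - slice h t y)).
 by apply: cc_Z; apply: cc_D; [|apply: cc_N]; exact: slc_cc.
rewrite -iintB//; last exact: slc_cc.
have H y: `|slice h' t y - s^-1 * (slice h (s + t) y - slice h t y)| <= e / ((2 * L) ^+ n + 1).
 have [|r rs E] := @MVT_line R n.+1 h (row_mx (t%:M: 'rV[R]_1) y) v s.
  by move=> r _; have [] := dh (r *: v + row_mx (t%:M: 'rV[R]_1) y).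
 have [_ D] := dh (r *: v + row_mx (t%:M: 'rV[R]_1) y).
 have -> : slice h (s + t) y - slice h t y = s * h' (r *: v + row_mx (t%:M: 'rV[R]_1) y).
  by rewrite -D -E -vE.
 rewrite mulKf// distrC.
 have rd: `|r *: v| < d.
  rewrite (le_lt_trans _ sd)// normrZ /v norm_row normr0 normr1 max_l// mulr1.
  exact: rs.
 by have /ltW := Hd (row_mx (t%:M: 'rV[R]_1) y) (r *: v) rd; rewrite [X in h' X - _]addrC.
have cD: cc (fun y=> slice h' t y - s^-1 * (slice h (s + t) y - slice h t y)).
 by apply: cc_D; [exact: slc_cc|exact: cc_N].
have sD: supp L (fun y=> slice h' t y - s^-1 * (slice h (s + t) y - slice h t y)).
 by move=> y Ly; rewrite (slc_supp t sL')// (slc_supp t sL)// (slc_supp (s + t) sL)// subr0 mulr0 subr0.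
apply: le_trans (iint_bd (ltW L0) cD sD H) _.
by rewrite mulrAC ler_pdivrMr ?ltr_wpDl// ler_wpM2l ?(ltW e0)// lerDl.
Qed.

Lemma delta_row0 n: delta_mx 0 0 = row_mx (1%:M: 'rV[R]_1) (0: 'rV[R]_n).
apply/rowP=> j; rewrite !mxE; case: splitP=> k jk; rewrite !mxE.
 have -> : j = 0 by apply/val_inj; rewrite /= jk ord1.
 by rewrite ord1 !eqxx.
by rewrite (_: (j == 0) = false) ?andbF//; apply/negbTE; rewrite -val_eqE /= jk.
Qed.

Lemma delta_rowS n (i: 'I_n): delta_mx 0 (lift 0 i) = row_mx (0: 'rV[R]_1) 'e_i.
apply/rowP=> j; rewrite !mxE; case: splitP=> k jk; rewrite !mxE -!val_eqE /= jk.
 by rewrite ord1.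
by rewrite /bump /= add1n eqSS.
Qed.

(** Induction on the dimension: a derivative along a later coordinate is integrated slice by slice,
    one along the first coordinate after passing to the integrals of slices. *)
Lemma iint_der n (h h': 'rV[R]_n -> R) (i: 'I_n): cc h -> cc h' ->
 (forall y, is_derive y 'e_i h (h' y)) -> iint h' = 0.
elim: n h h' i=> [|n IH] h h' i ch ch' dh; first by case: i {dh}.
have [L L0 sL] := cc_sp ch.
case: (unliftP 0 i) dh=> [j ->|->] dh.
 rewrite iintS (_: (fun t=> _) = fun=> 0).
  by apply: (@Rint_der R 0 (fun=> 0))=>// t; exact: cst_continuous.
 apply/funext=> t; apply: (IH _ _ j (slc_cc t ch) (slc_cc t ch'))=> y.
 have [d D] := dh (row_mx (t%:M: 'rV[R]_1) y); rewrite delta_rowS in d D.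
 by have [d' D'] := slc_derive d; apply: DeriveDef=>//; rewrite D' D.
rewrite iintS; apply: (Rint_der (slc_cont ch') (slc_sp sL)).
by apply: slc_der=>// y; rewrite -delta_row0.
Qed.

Definition refl n (i: 'I_n) (y: 'rV[R]_n): 'rV[R]_n :=
 \row_j (if j == i then - y 0 j else y 0 j).

Lemma reflK n (i: 'I_n): involutive (refl i).
by move=> y; apply/rowP=> j; rewrite !mxE; case: eqP=>// _; rewrite opprK. Qed.

Lemma norm_refl n (i: 'I_n) y: `|refl i y| = `|y|.
have H z: `|refl i z| <= `|z|.
 apply/norm_leP=>// j; rewrite mxE; case: eqP=> _; rewrite ?normrN; exact: coord_le.
by apply/eqP; rewrite eq_le H /= -{1}(reflK i y) H.
Qed.

Lemma iint_reflect n (h: 'rV[R]_n -> R) i: cc h ->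
 iint (h \o refl i) = iint h.
elim: n h i=> [|n IH] h i ch; first by case: i.
have [L L0 sL] := cc_sp ch.
case: (unliftP 0 i)=> [j ->|->].
 rewrite !iintS; congr Rintegral; apply/funext=> t.
 rewrite -(IH _ j (slc_cc t ch)); congr iint; apply/funext=> y /=.
 congr h; apply/rowP=> k; rewrite !mxE -val_eqE /=; case: splitP=> l kl; rewrite kl.
  by rewrite ord1.
 by rewrite mxE /bump /= add1n eqSS val_eqE.
rewrite !iintS -(RintN (slc_cont ch) (slc_sp sL)).
congr Rintegral; apply/funext=> t; congr iint; apply/funext=> y /=.
congr h; apply/rowP=> k; rewrite !mxE -val_eqE /=; case: splitP=> l kl; rewrite kl.
 by rewrite ord1 !mxE /= !mulr1n.
by [].
Qed.

End IterInt.

(** * Smooth bump functions *)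

Section Bump.
Variable R: realType.
Implicit Types t: R.

(** The classical flat function times powers of [1 / t]: the family over [m] is closed under
    differentiation, which gives smoothness by induction. *)
Definition flat (m: nat) t: R := if 0 < t then t^-1 ^+ m * expR (- t^-1) else 0.

Lemma flat_ge0 m t: 0 <= flat m t.
by rewrite /flat; case: ifP=>// t0; rewrite mulr_ge0 ?expR_ge0 ?exprn_ge0 ?invr_ge0 ?ltW.
Qed.

(** From [expR u >= u ^ (m + 2) / (m + 2)!] at [u = 1 / t]. The factor [t ^ 2] makes the difference
    quotient at 0 tend to 0. *)
Lemma flat_bd m t: `|flat m t| <= (m.+2)`!%:R * t ^+ 2.
rewrite ger0_norm ?flat_ge0// /flat; case: ifP=> [t0|_]; last first.
 by rewrite mulr_ge0 ?ler0n// sqr_ge0.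
have u0: 0 < t^-1 by rewrite invr_gt0.
rewrite expRN -[X in _ * X ^+ 2]invrK; move: (t^-1) u0=> u u0.
rewrite exprVn ler_pdivlMr ?exprn_gt0// mulrAC -exprD addn2.
rewrite ler_pdivrMr ?expR_gt0//.
have f0: 0 < (m.+2)`!%:R :> R by rewrite ltr0n fact_gt0.
rewrite mulrC -ler_pdivrMr//.
by apply: le_trans (expR_ge1Dxn m.+1 (ltW u0)); rewrite lerDr.
Qed.

Lemma flat_der m t: is_derive t 1 (flat m) (- m%:R * flat m.+1 t + flat m.+2 t).
have [t0|t0|t0] := ltgtP 0 t.
- have E: \forall s \near t, s^-1 ^+ m * expR (- s^-1) = flat m s.
  have: \forall s \near t, 0 < s by have /cvgr_gt := @cvg_id _ (nbhs t); exact.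
  by apply: filterS=> s s0; rewrite /flat s0.
 apply: (near_eq_is_derive E).
 have tn0: t != 0 by rewrite gt_eqF.
 have dV: is_derive t 1 (fun s: R=> s^-1) (- t^-1 ^+ 2).
  apply: DeriveDef; first by apply: (@derivableV _ _ id)=>//; exact: derivable_id.
  rewrite (@deriveV _ _ id t 1 tn0 (@derivable_id _ _ t 1)) derive_id.
  by rewrite [LHS]mulr1 exprVn.
 rewrite /flat t0 /=.
 have dE: is_derive t 1 (fun s: R=> expR (- s^-1)) (expR (- t^-1) * (t^-1 ^+ 2)).
  have dN: is_derive t 1 (fun s: R=> - s^-1) (t^-1 ^+ 2).
   by rewrite -[X in is_derive _ _ _ X]opprK; apply: is_deriveN.
  have dE := @is_derive_expR R (- t^-1).
  have := @is_derive1_comp R (@expR R) (fun s=> - s^-1) t _ _ dE dN.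
  by rewrite mulrC.
 have dX: is_derive t 1 (fun s: R=> s^-1 ^+ m) (- m%:R * t^-1 ^+ m.+1).
  elim: m {E} => [|m IHm]; first by rewrite oppr0 mul0r; exact: is_derive_cst.
  have := is_deriveM dV IHm.
  rewrite (_: (fun s: R=> s^-1) * (fun s: R=> s^-1 ^+ m) = fun s=> s^-1 ^+ m.+1); last first.
   by apply/funext=> s; rewrite [RHS]exprS.
  congr is_derive; rewrite /GRing.scale /= -natr1 !exprS; ring.
 have := is_deriveM dX dE.
 congr is_derive; rewrite /GRing.scale /= !exprS; ring.
- have E: \forall s \near t, 0 = flat m s.
  have: \forall s \near t, s < 0 by have /cvgr_lt := @cvg_id _ (nbhs t); exact.
  by apply: filterS=> s s0; rewrite /flat ltNge ltW.
 apply: (near_eq_is_derive E).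
 by rewrite /flat [0 < t]ltNge ltW//= mulr0 addr0; exact: is_derive_cst.
- rewrite -t0 {2 3}/flat ltxx mulr0 addr0.
 have H: (fun h: R=> h^-1 *: (flat m (h *: 1 + 0) - flat m 0)) @ 0^' --> 0.
  apply/cvgrPdist_le=> e e0.
  have f0: 0 < (m.+2)`!%:R :> R by rewrite ltr0n fact_gt0.
  exists (e / (m.+2)`!%:R)=> /=; first by rewrite divr_gt0.
  move=> h /=; rewrite sub0r normrN=> he h0.
  rewrite sub0r normrN {2}/flat ltxx subr0 addr0 [h *: 1]mulr1 normrM normfV.
  rewrite mulrC ler_pdivrMr ?normr_gt0//; apply: le_trans (flat_bd m h) _.
  have -> : h ^+ 2 = `|h| * `|h| by rewrite -expr2 real_normK// num_real.
  by rewrite mulrA ler_wpM2r// mulrC -ler_pdivlMr// ltW.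
 by apply: DeriveDef; [apply/cvg_ex; exists 0|exact/cvg_lim].
Qed.

Lemma Ck_flat n k (U: set 'rV[R]_n) (f: 'rV[R]_n -> R) m: open U -> Ck k U f ->
 Ck k U (fun y=> flat m (f y)).
move=> oU; elim: k m=> [|k IH] m cf; split; try by
 move=> y Uy; apply: (@continuous_comp _ _ _ f (flat m)); [exact: (Ck_cont cf)|
 apply: differentiable_continuous; apply/derivable1_diffP; have [] := flat_der m (f y)].
- by [].
split=> [y v Uy|v].
 by have [] := @der_cmp1 _ _ (flat m) f y v (Ck_dvb cf Uy) (@ex_derive _ _ _ _ _ _ _ (flat_der m _)).
apply: (@Ck_ext _ _ _ _ (fun y=> (- m%:R * flat m.+1 (f y) + flat m.+2 (f y)) * 'D_v f y))=>// [y Uy|].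
 have [_ ->] := @der_cmp1 _ _ (flat m) f y v (Ck_dvb cf Uy) (@ex_derive _ _ _ _ _ _ _ (flat_der m _)).
 by rewrite derive1E (@derive_val _ _ _ _ _ _ _ (flat_der m _)).
apply: Ck_M=>//; last exact: Ck_der cf.
apply: Ck_D=>//; last exact/IH/Ck_S.
by apply: Ck_M=>//; [exact: Ck_cst|exact/IH/Ck_S].
Qed.

Variable n: nat.
Implicit Types (p y: 'rV[R]_n) (r: R).

(** A product of one-variable bumps, since balls of the sup norm on rows are cubes. *)
Definition bumpq p r y := \prod_(i < n) flat 0 (r ^+ 2 - (y 0 i - p 0 i) ^+ 2).

Lemma bumpq_sm p r (U: set 'rV[R]_n): open U -> smooth_on U (bumpq p r).
move=> oU; apply/sm_onP=> k; apply: Ck_prod=>// i _; apply: Ck_flat=>//.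
apply: Ck_D=>//; first exact: Ck_cst.
apply: Ck_N=>//; under eq_fun do rewrite expr2.
by apply: Ck_M=>//; apply: Ck_D=>//; try exact: Ck_cst; exact: Ck_coord.
Qed.

Lemma bumpq_ge0 p r y: 0 <= bumpq p r y.
by apply: prodr_ge0=> i _; exact: flat_ge0. Qed.

Lemma bump_gt0 p r y: `|y - p| < r -> 0 < bumpq p r y.
move=> yr; apply: prodr_gt0=> i _; rewrite /flat.
have r0: 0 < r by apply: le_lt_trans yr.
have: `|y 0 i - p 0 i| < r by have := coord_le (y - p) i; rewrite !mxE=> /le_lt_trans; exact.
rewrite -ltr_sqr ?nnegrE// ?(ltW r0)// real_normK ?num_real// => h.
by rewrite subr_gt0 h expr0 mul1r expR_gt0.
Qed.

(** In dimension 0 the product is empty and equals 1, hence the condition on [n]. *)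
Lemma bump_eq0 p r y: 0 <= r -> r <= `|y - p| -> n != 0%N -> bumpq p r y = 0.
move=> r0 ry n0; apply/eqP/negPn/negP=> b0.
suff: `|y - p| < r by rewrite ltNge ry.
have b1 i: 0 < r ^+ 2 - (y 0 i - p 0 i) ^+ 2.
 rewrite ltNge; apply: contra b0=> h; rewrite /bumpq (bigD1 i)//=.
 by rewrite {1}/flat ltNge h mul0r.
have rp: 0 < r.
 rewrite lt0r r0 andbT; apply/eqP=> re.
 rewrite -lt0n in n0; have := b1 (Ordinal n0).
 by rewrite re expr0n /= sub0r ltNge oppr_le0 sqr_ge0.
apply/norm_ltP=>// i; rewrite !mxE.
have := b1 i; rewrite subr_gt0 -[X in X < _]real_normK ?num_real// ltr_sqr// nnegrE.
Qed.

End Bump.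

(** * Deformation invariance of signed integrals of pullbacks *)

Section Lax.
Variable R: realType.
Local Notation mu := (@lebesgue_measure R).

Lemma Ck_setU n k (U W: set 'rV[R]_n) f: Ck k U f -> Ck k W f -> Ck k (U `|` W) f.
elim: k f=> [|k IH] f cU cW.
 by split=>// y [] ?; [exact: (Ck_cont cU)|exact: (Ck_cont cW)].
split; first by move=> y [] ?; [exact: (Ck_cont cU)|exact: (Ck_cont cW)].
split; first by move=> y v [] ?; [exact: (Ck_dvb cU)|exact: (Ck_dvb cW)].
by move=> v; apply: IH; exact: Ck_der.
Qed.

Lemma Ck_zero_ext n k (U W: set 'rV[R]_n) f g: open U -> open W -> U `|` W = setT ->
 (forall y, U y -> f y = g y) -> (forall y, W y -> f y = 0) -> Ck k U g -> Ck k setT f.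
move=> oU oW UW fg f0 cg; rewrite -UW; apply: Ck_setU.
 by apply: (@Ck_ext _ _ _ _ g)=>// y Uy; rewrite fg.
by apply: (@Ck_ext _ _ _ _ (fun=> 0))=>// [y /f0 ->//|]; exact: Ck_cst.
Qed.

(** The product is regular on [U] and zero off the closed set [C], and these two open sets cover the
    space; the values of [G] outside [U] do no harm. *)
Lemma Ck_Mext n k (U C: set 'rV[R]_n) w G: open U -> closed C -> C `<=` U ->
 (forall y, ~ C y -> w y = 0) -> Ck k setT w -> Ck k U G ->
 Ck k setT (fun y=> w y * G y).
move=> oU cC CU w0 cw cG.
apply: (@Ck_zero_ext _ _ U (~` C) _ (fun y=> w y * G y))=>//.
- exact: closed_openC.
- apply/seteqP; split=>// y _; have [Cy|nC] := pselect (C y); last by right.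
 by left; exact: CU.
- by move=> y /w0 ->; rewrite mul0r.
by apply: Ck_M=>//; apply: Ck_sub cw.
Qed.

Lemma Ck_det n m k (U: set 'rV[R]_n) (M: 'rV[R]_n -> 'M[R]_m): open U ->
 (forall i j, Ck k U (fun y=> M y i j)) -> Ck k U (fun y=> \det (M y)).
move=> oU cM; apply: Ck_sum=>// s _; apply: Ck_M=>//; first exact: Ck_cst.
by apply: Ck_prod.
Qed.

Lemma Ck_cofactor n m k (U: set 'rV[R]_n) (M: 'rV[R]_n -> 'M[R]_m) i j: open U ->
 (forall i j, Ck k U (fun y=> M y i j)) -> Ck k U (fun y=> cofactor (M y) i j).
move=> oU cM; apply: Ck_M=>//; first exact: Ck_cst.
apply: Ck_det=>// a b; rewrite (_: (fun y=> _) = fun y=> M y (lift i a) (lift j b))//.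
by apply/funext=> y; rewrite !mxE.
Qed.

Lemma supp_der n L (h: 'rV[R]_n -> R) v: supp L h -> supp L ('D_v h).
move=> sL y Ly; rewrite -(derive_cst (0: R) y v); apply: near_eq_derive.
have: \forall z \near y, L < `|z| by have /cvgr_gt := @norm_continuous _ _ y; exact.
by apply: filterS=> z Lz; exact: sL.
Qed.

Lemma Ck_cc n k (h: 'rV[R]_n -> R) L: Ck k setT h -> supp L h -> cc h.
by move=> ch sL; split; [move=> y; exact: (Ck_cont ch)|exists L]. Qed.

Lemma Ck_cc_der n k (h: 'rV[R]_n -> R) L v: Ck k.+1 setT h -> supp L h -> cc ('D_v h).
by move=> ch sL; apply: (@Ck_cc _ k _ L); [exact: Ck_der|exact: supp_der]. Qed.

Lemma int_der0 n k (h: 'rV[R]_n -> R) L i: Ck k.+1 setT h -> supp L h ->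
 iint ('D_'e_i h) = 0.
move=> ch sL; apply: (@iint_der _ _ h _ i).
- exact: Ck_cc ch sL.
- exact: Ck_cc_der ch sL.
- by move=> y; apply: DeriveDef=>//; exact: (Ck_dvb ch).
Qed.

Lemma der_sums n (I: Type) (r: seq I) (P: pred I) (f: I -> 'rV[R]_n -> R) y v:
 (forall i, P i -> derivable (f i) y v) ->
 derivable (fun y=> \sum_(i <- r | P i) f i y) y v /\
 'D_v (fun y=> \sum_(i <- r | P i) f i y) y = \sum_(i <- r | P i) 'D_v (f i) y.
move=> df; elim: r=> [|a r [dr Dr]].
 rewrite big_nil (_: (fun y=> _) = fun=> 0); last by apply/funext=> z; rewrite big_nil.
 by split; [exact: derivable_cst|exact: derive_cst].
rewrite big_cons (_: (fun y=> _) =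
  if P a then fun y=> f a y + \sum_(i <- r | P i) f i y else fun y=> \sum_(i <- r | P i) f i y).
 case: ifPn=>// Pa; have da := df a Pa; split; first exact: (derivableD da dr).
 by rewrite (@deriveD _ _ _ (f a) (fun y=> \sum_(i <- r | P i) f i y) y v da dr) Dr.
by apply/funext=> z; rewrite big_cons; case: ifP.
Qed.

Lemma deriveMc n (c: R) (f: 'rV[R]_n -> R) y v: derivable f y v ->
 derivable (fun y=> c * f y) y v /\ 'D_v (fun y=> c * f y) y = c * 'D_v f y.
by move=> df; split; [exact: derivableZ|exact: deriveZ]. Qed.

Lemma der_prod n (I: eqType) (r: seq I) (P: pred I) (f: I -> 'rV[R]_n -> R) y v:
 uniq r -> (forall i, P i -> derivable (f i) y v) ->
 derivable (fun y=> \prod_(i <- r | P i) f i y) y v /\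
 'D_v (fun y=> \prod_(i <- r | P i) f i y) y =
 \sum_(m <- r | P m) 'D_v (f m) y * \prod_(i <- r | P i && (i != m)) f i y.
move=> + df; elim: r=> [_|a r IH /andP[ar ur]].
 rewrite big_nil (_: (fun y=> _) = fun=> 1); last by apply/funext=> z; rewrite big_nil.
 by split; [exact: derivable_cst|exact: derive_cst].
have [dr Dr] := IH ur; rewrite big_cons.
have E: (fun y=> \prod_(i <- a :: r | P i) f i y) =
  if P a then fun y=> f a y * \prod_(i <- r | P i) f i y else fun y=> \prod_(i <- r | P i) f i y.
 by apply/funext=> z; rewrite big_cons; case: ifP.
have S: \sum_(m <- r | P m) 'D_v (f m) y * \prod_(i <- a :: r | P i && (i != m)) f i y =
  (if P a then f a y else 1) * \sum_(m <- r | P m) 'D_v (f m) y * \prod_(i <- r | P i && (i != m)) f i y.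
 rewrite mulr_sumr big_seq_cond [RHS]big_seq_cond; apply: eq_bigr=> m /andP[mr _].
 rewrite big_cons.
 have -> : a != m by apply: contraNneq ar=> ->.
 by rewrite andbT; case: ifP=> _; rewrite ?mul1r// mulrCA.
rewrite E S; case: ifPn=> Pa; last by rewrite mul1r.
have da := df a Pa; split; first exact: (derivableM da dr).
rewrite (@deriveM _ _ (f a) (fun y=> \prod_(i <- r | P i) f i y) y v da dr) Dr addrC.
congr (_ + _); rewrite [LHS]mulrC; congr (_ * _).
rewrite big_cons eqxx andbF big_seq_cond [RHS]big_seq_cond; apply: eq_bigl=> i.
by case ir: (i \in r); rewrite //= andbC; case: eqP ir=>// ->; rewrite (negbTE ar).
Qed.

Lemma tpermM_out n (k m i: 'I_n) (s: {perm 'I_n}): k != i -> i != m ->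
 (tperm k m * s)%g i = s i.
by move=> ki im; rewrite permM tpermD// eq_sym. Qed.

Definition jac n (Phi: 'rV[R]_n -> 'rV[R]_n) y: 'M[R]_n :=
 \matrix_(i, j) 'D_'e_j (fun y=> Phi y 0 i) y.

(* The rows of the cofactor matrix of a Jacobian are divergence free: for fixed m the sum *)
(* over permutations s is antisymmetric under s |-> tperm k m * s, by Schwarz.            *)
Lemma piola n (U: set 'rV[R]_n) (Phi: 'rV[R]_n -> 'rV[R]_n) (k: 'I_n) y: open U -> U y ->
 Ckv 2 U Phi ->
 \sum_j 'D_'e_j (fun y=> cofactor (jac Phi y) k j) y = 0.
move=> oU Uy cPhi.
pose f (s: {perm 'I_n}) i y := 'D_(delta_mx 0 (s i)) (fun y=> Phi y 0 i) y.
have cf s i: Ck 1 U (f s i) by exact: Ck_der.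
have E j: (fun y=> cofactor (jac Phi y) k j) =
  fun y=> \sum_(s: {perm 'I_n} | s k == j) (-1) ^+ s * \prod_(i | k != i) f s i y.
 apply/funext=> z; rewrite expand_cofactor; apply: eq_bigr=> s _; congr (_ * _).
 by apply: eq_bigr=> i _; rewrite mxE.
have dprod (s: {perm 'I_n}) v := @der_prod n _ (index_enum 'I_n) (fun i=> k != i) (f s) y v
 (index_enum_uniq _) (fun i _=> Ck_dvb (cf s i) (v:=v) Uy).
have D j: 'D_'e_j (fun y=> cofactor (jac Phi y) k j) y =
  \sum_(s: {perm 'I_n} | s k == j) \sum_(m | k != m) (-1) ^+ s *
   ('D_(delta_mx 0 (s k)) (f s m) y * \prod_(i | (k != i) && (i != m)) f s i y).
 have dterm (s: {perm 'I_n}) := @deriveMc n ((-1) ^+ s) _ y 'e_j (dprod s 'e_j).1.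
 rewrite E (der_sums _ (fun s _=> (dterm s).1)).2.
 apply: eq_bigr=> s /eqP sk; rewrite (dterm s).2 (dprod s _).2 mulr_sumr.
 by apply: eq_bigr=> m _; rewrite sk.
under eq_bigr do rewrite D.
transitivity (\sum_(s: {perm 'I_n}) \sum_(m | k != m) (-1) ^+ s *
   ('D_(delta_mx 0 (s k)) (f s m) y * \prod_(i | (k != i) && (i != m)) f s i y)).
 by symmetry; rewrite (partition_big (fun s: {perm 'I_n} => s k) xpredT).
rewrite exchange_big /=; apply: big1=> m km.
set S := \sum_i _; suff: S = - S by move/eqP; rewrite -addr_eq0 -mulr2n mulrn_eq0=> /eqP.
rewrite {1}/S (reindex_inj (mulgI (tperm k m))) /= /S -sumrN; apply: eq_bigr=> s _.
have e1: 'D_(delta_mx 0 ((tperm k m * s)%g k)) (f (tperm k m * s)%g m) y =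
  'D_(delta_mx 0 (s k)) (f s m) y.
 by rewrite /f !permM tpermL tpermR; exact: (Schwarz _ _ oU).
have e2 i: (k != i) && (i != m) -> f (tperm k m * s)%g i y = f s i y.
 by move=> /andP[ki im]; rewrite /f (tpermM_out s ki im).
rewrite e1 (eq_bigr _ e2) odd_permM odd_tperm km signr_addb expr1 mulN1r mulNr.
by [].
Qed.

Lemma contfB (T: topologicalType) (F G: T -> R): continuous F -> continuous G ->
 continuous (fun s=> F s - G s).
by move=> cF cG s; exact: (cvgB (cF s) (cG s)). Qed.

Lemma contfZ (T: topologicalType) (c: R) (F: T -> R): continuous F ->
 continuous (fun s=> c * F s).
by move=> cF s; exact: (cvgM (cvg_cst c) (cF s)). Qed.

Lemma cont_eps (W: normedModType R) (F: W -> R) y: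
 (forall e: R, 0 < e -> exists2 d: R, 0 < d & forall z, `|z - y| < d -> `|F y - F z| <= e) ->
 {for y, continuous F}.
move=> H; apply/cvgrPdist_le=> e /H[d d0 Hd].
apply/nbhs_ballP; exists d=>//= z; rewrite -ball_normE /= distrC.
exact: Hd.
Qed.

Section Antiderivative.
Variables (n: nat) (u: 'rV[R]_n) (c: R).
Hypothesis cp: 0 < c.
Let c0: 0 <= c := ltW cp.

(** The window has fixed length [c] instead of being a half line: the support stays compact, and the
    derivative along [u] is [h y - h (y - c *: u)]. This serves for translation invariance and, with
    large [c], as an antiderivative on a ball. *)
Definition line_int (h: 'rV[R]_n -> R) y := \int[mu]_(s in `[0, c]) h (y - s *: u).

Lemma line_cont (h: 'rV[R]_n -> R) y: continuous h ->
 continuous (fun s: R=> h (y - s *: u)).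
move=> ch s; apply: (@continuous_comp _ _ _ (fun s: R=> y - s *: u) h); last exact: ch.
apply: cont_rV=> j.
rewrite (_: (fun z=> _) = fun s: R=> y 0 j - s * u 0 j).
 by apply: cvgB; [exact: cvg_cst|apply: cvgM; [exact: cvg_id|exact: cvg_cst]].
by apply/funext=> r; rewrite !mxE.
Qed.

Lemma line_contB (f g: 'rV[R]_n -> R) y z: continuous f -> continuous g ->
 continuous (fun s: R=> f (y - s *: u) - g (z - s *: u)).
by move=> cf cg; exact: (contfB (line_cont (y:=y) cf) (line_cont (y:=z) cg)).
Qed.

Lemma itv_int_bd (F: R -> R) M: continuous F -> (forall s, `|F s| <= M) ->
 `|\int[mu]_(s in `[0, c]) F s| <= M * c.
move=> cF FM; apply: le_trans (le_normr_Rintegral _ (int_itv _ _ cF)) _=>//.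
rewrite -[X in _ <= M * X]subr0 -Rint_cst//; apply: le_Rintegral=>//.
 by apply: (@int_itv _ (fun t=> `|F t|))=> t; apply: cvg_norm; exact: cF.
by apply: int_itv=> t; exact: cvg_cst.
Qed.

Lemma line_intB (f g: 'rV[R]_n -> R) y z: continuous f -> continuous g ->
 line_int f y - line_int g z = \int[mu]_(s in `[0, c]) (f (y - s *: u) - g (z - s *: u)).
by move=> cf cg; rewrite RintegralB//; apply: int_itv; exact: line_cont.
Qed.

Lemma line_int_cont h y: cc h -> {for y, continuous (line_int h)}.
move=> ch; apply: cont_eps=> e e0.
have e1: 0 < e / (c + 1) by rewrite divr_gt0// ltr_wpDl.
have [d d0 Hd] := cc_unif ch e1.
exists d=>// z yz.
rewrite line_intB; try exact: ch.1.
apply: (@le_trans _ _ (e / (c + 1) * c)).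
 apply: itv_int_bd=> [|s]; first exact: (line_contB (y:=y) (z:=z) ch.1 ch.1).
 have := Hd (y - s *: u) (z - y) yz; rewrite distrC=> /ltW.
 by rewrite [y - _ + _]addrC addrA subrK.
by rewrite mulrAC ler_pdivrMr ?ltr_wpDl// ler_wpM2l ?(ltW e0)// lerDl.
Qed.

Lemma line_int_der h v y: cc h -> cc ('D_v h) -> (forall y, derivable h y v) ->
 is_derive y v (line_int h) (line_int ('D_v h) y).
move=> ch cDh dh.
suff H: (fun t: R=> t^-1 *: (line_int h (t *: v + y) - line_int h y)) @ 0^' -->
  line_int ('D_v h) y.
 by apply: DeriveDef; [apply/cvg_ex; eexists; exact: H|exact/cvg_lim].
apply/cvgrPdist_le=> e e0.
have e1: 0 < e / (c + 1) by rewrite divr_gt0// ltr_wpDl.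
have [d d0 Hd] := cc_unif cDh e1.
have v1: 0 < `|v| + 1 by rewrite ltr_wpDl.
exists (d / (`|v| + 1))=> /=; first by rewrite divr_gt0.
move=> t /=; rewrite sub0r normrN=> td t0.
have tvd: `|t| * `|v| < d.
 apply: (@le_lt_trans _ _ (`|t| * (`|v| + 1))); first by rewrite ler_wpM2l// lerDl.
 by rewrite -ltr_pdivlMr.
pose Q s := t^-1 * (h (t *: v + y - s *: u) - h (y - s *: u)).
have cQ: continuous Q.
 exact: (contfZ (c:=t^-1) (line_contB (y:=t *: v + y) (z:=y) ch.1 ch.1)).
have -> : t^-1 *: (line_int h (t *: v + y) - line_int h y) = \int[mu]_(s in `[0, c]) Q s.
 rewrite line_intB; try exact: ch.1.
 rewrite [LHS]/GRing.scale /= -RintegralZl//; apply: int_itv.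
 exact: (line_contB ch.1 ch.1).
rewrite -RintegralB//; [|by apply: int_itv; exact: (line_cont cDh.1)|exact: int_itv].
apply: (@le_trans _ _ (e / (c + 1) * c)).
 apply: itv_int_bd=> [|s].
  by have cB := contfB (line_cont (y:=y) cDh.1) cQ; exact: cB.
 have [|r rt E] := @MVT_line R n h (y - s *: u) v t; first by move=> r _; exact: dh.
 rewrite /Q -[t *: v + y - _]addrA E mulKf// distrC.
 have rvd: `|r *: v| < d by rewrite normrZ (le_lt_trans _ tvd)// ler_wpM2r.
 by have /ltW := Hd (y - s *: u) (r *: v) rvd; rewrite [r *: v + _]addrC.
by rewrite mulrAC ler_pdivrMr ?ltr_wpDl// ler_wpM2l ?(ltW e0)// lerDl.
Qed.

Lemma line_int_Ck1 h L: Ck 1 setT h -> supp L h -> Ck 1 setT (line_int h).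
move=> ch sL.
have cch := Ck_cc ch sL; have ccDh v := Ck_cc_der v ch sL.
have D y v := line_int_der y cch (ccDh v) (fun y=> Ck_dvb ch (y:=y) (v:=v) I).
split; first by move=> y _; exact: line_int_cont.
split; first by move=> y v _; have [] := D y v.
move=> v; split=>// y _.
rewrite (_: 'D_v (line_int h) = line_int ('D_v h)); first exact: line_int_cont.
by apply/funext=> z; have [] := D z v.
Qed.

Lemma line_int_der_u h L y: Ck 1 setT h -> supp L h ->
 'D_u (line_int h) y = h y - h (y - c *: u).
move=> ch sL.
have cch := Ck_cc ch sL; have ccDh v := Ck_cc_der v ch sL.
have [_ ->] := line_int_der y cch (ccDh u) (fun y=> Ck_dvb ch (y:=y) (v:=u) I).
pose F s := - h (y - s *: u).
have dF (s: R): is_derive s 1 F ('D_u h (y - s *: u)).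
 have := @dvb_line R n h y (- u) s.
 have dN: derivable h (s *: - u + y) (- u) by exact: (Ck_dvb ch).
 move=> /(_ dN) H; rewrite -[X in is_derive _ _ _ X]opprK; apply: is_deriveN.
 rewrite (_: (fun s=> _) = (fun s=> h (s *: - u + y))); last first.
  by apply/funext=> r; rewrite scalerN addrC.
 rewrite (_: - 'D_u h (y - s *: u) = 'D_(- u) h (s *: - u + y)); first exact: H.
 have df: differentiable h (y - s *: u) by apply: (Ck_diff openT ch).
 rewrite [s *: - u]scalerN [- _ + y]addrC !deriveE//.
 by rewrite linearN.
rewrite /line_int /Rintegral (@continuous_FTC2 _ _ F) //.
- by rewrite /F scale0r subr0 /= opprK addrC.
- by have cD := line_cont (y:=y) (ccDh u).1; exact: continuous_subspaceT cD.
- have cF s: {for s, continuous F}.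
  by apply: differentiable_continuous; apply/derivable1_diffP; have [] := dF s.
 by split; [move=> s _; have [] := dF s|exact: cvg_at_right_filter (cF _)|exact: cvg_at_left_filter (cF _)].
- by move=> s _; rewrite derive1E; have [_ ->] := dF s.
Qed.

Lemma line_int_sp h L: supp L h -> supp (L + c * `|u|) (line_int h).
move=> sL y Ly; rewrite /line_int.
have -> : \int[mu]_(s in `[0, c]) h (y - s *: u) = \int[mu]_(s in `[0, c]) 0; last first.
 by rewrite Rint_cst// mul0r.
apply: eq_Rintegral=> s; rewrite inE /= in_itv /= => /andP[s0 sc]; apply: sL.
rewrite -(ltrD2r (c * `|u|)); apply: (lt_le_trans Ly).
have := ler_normD (y - s *: u) (s *: u); rewrite subrK=> /le_trans; apply.
by rewrite lerD2l normrZ ger0_norm// ler_wpM2r.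
Qed.

End Antiderivative.

(** The difference of [h] and its translate along [u] is the derivative of [line_int u c h], which
    has compact support, so its integral is 0. Coordinate directions are treated in turn, and
    negative steps by reversing the roles of the two functions. *)
Lemma iint_shift n (h: 'rV[R]_n -> R) L (v: 'rV[R]_n): Ck 1 setT h -> supp L h ->
 iint (fun y=> h (y - v)) = iint h.
have Ck_shift (g: 'rV[R]_n -> R) w: Ck 1 setT g -> Ck 1 setT (fun y=> g (y - w)).
 move=> cg; apply: (@Ck_comp _ _ _ _ _ setT (fun y=> y - w)) cg=>//; try exact: openT.
 move=> i; rewrite (_: (fun y: 'rV[R]_n=> _) = fun y: 'rV[R]_n=> y 0 i + - w 0 i).
  by apply: Ck_D; [exact: openT|exact: Ck_coord|exact: Ck_cst].
 by apply/funext=> y; rewrite !mxE.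
have supp_shift (g: 'rV[R]_n -> R) K w: supp K g -> supp (K + `|w|) (fun y=> g (y - w)).
 move=> sg y Ky; apply: sg; rewrite -(ltrD2r `|w|); apply: (lt_le_trans Ky).
 by have := ler_normD (y - w) w; rewrite subrK.
have pos (g: 'rV[R]_n -> R) K i (c: R): 0 <= c -> Ck 1 setT g -> supp K g ->
  iint (fun y=> g (y - c *: delta_mx 0 i)) = iint g.
 rewrite le_eqVlt=> /predU1P[<- _ _|c0 cg sg].
  by congr iint; apply/funext=> y; rewrite scale0r subr0.
 pose u: 'rV[R]_n := delta_mx 0 i.
 have H := int_der0 i (@line_int_Ck1 n u c c0 g K cg sg) (@line_int_sp n u c c0 g K sg).
 apply/esym/eqP; rewrite -subr_eq0 -iintB.
 - rewrite -[X in _ == X]H; apply/eqP; congr iint; apply/funext=> y.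
  by rewrite (@line_int_der_u n u c c0 g K y cg sg).
 - exact: Ck_cc cg sg.
 - exact: Ck_cc (Ck_shift _ _ cg) (supp_shift _ _ _ sg).
have dir (g: 'rV[R]_n -> R) K i (c: R): Ck 1 setT g -> supp K g ->
  iint (fun y=> g (y - c *: delta_mx 0 i)) = iint g.
 move=> cg sg; have [c0|c0] := leP 0 c; first exact: (pos _ K).
 have c1: 0 <= - c by rewrite oppr_ge0 ltW.
 rewrite -(pos _ _ i _ c1 (Ck_shift _ (c *: delta_mx 0 i) cg) (supp_shift _ _ (c *: delta_mx 0 i) sg)).
 by congr iint; apply/funext=> y; rewrite scaleNr opprK addrK.
move=> ch sL; rewrite [v]row_sum_delta.
elim: (index_enum 'I_n)=> [|i r IH].
 by congr iint; apply/funext=> y; rewrite big_nil subr0.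
rewrite -IH; set w := \sum_(j <- r) _.
rewrite -(dir _ _ i (v 0 i) (Ck_shift _ w ch) (supp_shift _ _ w sL)).
by congr iint; apply/funext=> y; rewrite big_cons -/w opprD addrA.
Qed.

Lemma MVT_unit n (h: 'rV[R]_n -> R) x v:
 (forall s: R, 0 <= s <= 1 -> derivable h (s *: v + x) v) ->
 exists2 s: R, 0 <= s <= 1 & h (v + x) - h x = 'D_v h (s *: v + x).
move=> dh.
have dg (s: R): 0 <= s <= 1 ->
  is_derive s 1 (fun s: R=> h (s *: v + x)) ('D_v h (s *: v + x)).
 by move=> /dh/dvb_line.
have [|//|s] := @MVT_segment R (fun s: R=> h (s *: v + x))
  (fun s=> 'D_v h (s *: v + x)) 0 1 ler01.
- by move=> s; rewrite in_itv/= => /andP[/ltW s0 /ltW st]; apply: dg; rewrite s0.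
- apply: derivable_within_continuous=> s; rewrite in_itv/= => st.
 by have [] := dg s st.
by rewrite in_itv/= => sI; rewrite subr0 mulr1 scale0r add0r scale1r=> E; exists s.
Qed.

Lemma cpt_bd (T: topologicalType) (K: set T) (F: T -> R): compact K ->
 (forall x, K x -> {for x, continuous F}) -> exists2 M: R, 0 < M & forall x, K x -> `|F x| <= M.
move=> cK cF.
have [|d d0 Hd] := @cpt_unif R T K (fun d x=> `|F x| <= d^-1) cK.
 move=> x Kx; have /cvgrPdist_lt/(_ _ ltr01) near1 := cF x Kx.
 exists [set z | `|F x - F z| < 1]=>//.
 have f1: 0 < `|F x| + 1 by rewrite ltr_wpDl.
 exists (`|F x| + 1)^-1; first by rewrite invr_gt0.
 move=> z d' /= Fz d'0 d'd; apply: (@le_trans _ _ (`|F x| + 1)).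
  have := ler_normB (F x) (F x - F z); rewrite opprB addrC subrK=> /le_trans; apply.
  by rewrite lerD2l ltW.
 by rewrite -[leLHS]invrK lef_pV2// posrE invr_gt0.
by exists d^-1; rewrite ?invr_gt0.
Qed.

Lemma cube_cpt n (p: 'rV[R]_n) r: compact [set y | `|y - p| <= r].
apply: bounded_closed_compact.
 exists (r + `|p|); split; [exact: num_real|move=> M LM y /= yr].
 rewrite (le_trans _ (ltW LM))//.
 by have := ler_normD (y - p) p; rewrite subrK=> /le_trans; apply; rewrite lerD2r.
rewrite (_: [set y | _] = (fun y: 'rV[R]_n=> `|y - p|) @^-1` [set x | x <= r])//.
apply: closed_comp; last exact: closed_le.
move=> y _; apply: cont_eps=> e e0; exists e=>// z zy.
rewrite (le_trans (ler_dist_dist _ _))// opprB addrA subrK distrC.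
exact: ltW.
Qed.

Lemma cubeC n (p: 'rV[R]_n) r: closed [set y | `|y - p| <= r].
by apply: compact_closed; [exact: norm_hausdorff|exact: cube_cpt]. Qed.

Lemma cubeO n (p: 'rV[R]_n) r: open [set y: 'rV[R]_n | `|y - p| < r].
rewrite (_: mkset _ = ball p r); first exact: ball_open.
by rewrite -ball_normE /=; apply/seteqP; split=> y /=; rewrite distrC.
Qed.

(** The chain rule, followed by the product of a matrix with its adjugate. *)
Lemma jac_comp n (U: set 'rV[R]_n) (Phi: 'rV[R]_n -> 'rV[R]_n) (H: 'rV[R]_n -> R) k y:
 open U -> U y -> Ckv 1 U Phi -> Ck 1 setT H ->
 \sum_j 'D_'e_j (fun y=> H (Phi y)) y * cofactor (jac Phi y) k j =
 'D_'e_k H (Phi y) * \det (jac Phi y).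
move=> oU Uy cPhi cH.
have dH: differentiable H (Phi y) by exact: (Ck_diff openT cH).
have E j: 'D_'e_j (fun y=> H (Phi y)) y =
  \sum_i 'D_'e_i H (Phi y) * jac Phi y i j.
 rewrite (der_comp (fun i=> Ck_dvb (cPhi i) Uy) dH).2 der_coord//.
 by apply: eq_bigr=> i _; rewrite !mxE mulrC.
under eq_bigr do rewrite E mulr_suml.
rewrite exchange_big /= (bigD1 k)//= [X in _ + X]big1=> [|i ik].
 rewrite addr0 (expand_det_row _ k) mulr_sumr.
 by apply: eq_bigr=> j _; exact/esym/mulrA.
under eq_bigr do rewrite -mulrA.
rewrite -mulr_sumr; have := congr1 (fun A: 'M[R]_n=> A i k) (mul_mx_adj (jac Phi y)).
rewrite !mxE (negbTE ik) mulr0n=> H0; rewrite (_: \sum_(j < n) _ = 0) ?mulr0//.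
apply: etrans H0; apply: eq_bigr=> j _; congr (_ * _).
by rewrite mxE.
Qed.

(** By [piola] the integrand is the divergence of [w] times a row of the cofactor matrix, a field
    with compact support in [U]. *)
Lemma int_cofactor n (U C: set 'rV[R]_n) (Phi: 'rV[R]_n -> 'rV[R]_n) w L k:
 open U -> closed C -> C `<=` U -> Ckv 2 U Phi ->
 Ck 1 setT w -> (forall y, ~ C y -> w y = 0) -> supp L w ->
 iint (fun y=> \sum_j 'D_'e_j w y * cofactor (jac Phi y) k j) = 0.
move=> oU cC CU cPhi cw w0 sw.
have cj i j: Ck 1 U (fun y=> jac Phi y i j).
 rewrite (_: (fun y=> _) = 'D_'e_j (fun y=> Phi y 0 i)); first exact: Ck_der.
 by apply/funext=> y; rewrite mxE.
have ccof j: Ck 1 U (fun y=> cofactor (jac Phi y) k j) by exact: Ck_cofactor.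
have ch j: Ck 1 setT (fun y=> w y * cofactor (jac Phi y) k j) by exact: (Ck_Mext oU cC CU w0 cw).
have sh j: supp L (fun y=> w y * cofactor (jac Phi y) k j) by move=> y /sw ->; rewrite mul0r.
transitivity (iint (fun y=> \sum_j 'D_'e_j (fun y=> w y * cofactor (jac Phi y) k j) y)).
 congr iint; apply/funext=> y.
 have [Cy|nCy] := pselect (C y).
  have Uy := CU _ Cy.
  have D j: 'D_'e_j (fun y=> w y * cofactor (jac Phi y) k j) y =
    w y * 'D_'e_j (fun y=> cofactor (jac Phi y) k j) y +
    'D_'e_j w y * cofactor (jac Phi y) k j.
   have d1 := Ck_dvb cw (y:=y) (v:=delta_mx 0 j) I.
   have d2 := Ck_dvb (ccof j) (v:=delta_mx 0 j) Uy.
   have := deriveM d1 d2; rewrite [X in _ = _ + X]mulrC; exact.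
  under [in RHS]eq_bigr do rewrite D.
  by rewrite big_split /= -mulr_sumr (piola k oU Uy cPhi) mulr0 add0r.
 rewrite !big1// => j _.
  rewrite -(derive_cst (0: R) y 'e_j); apply: near_eq_derive.
  by apply: (nearO (closed_openC cC) nCy)=> z nCz; rewrite w0// mul0r.
 rewrite (_: 'D_'e_j w y = 0) ?mul0r//.
 rewrite -(derive_cst (0: R) y 'e_j); apply: near_eq_derive.
 by apply: (nearO (closed_openC cC) nCy)=> z nCz; rewrite w0.
rewrite iint_sum=> [|j _]; last exact: Ck_cc_der (ch j) (sh j).
by apply: big1=> j _; exact: int_der0 (ch j) (sh j).
Qed.

(** The factor is the signed determinant, not its absolute value: only signed integrals are
    invariant under deformation. *)
Definition lint n (Phi: 'rV[R]_n -> 'rV[R]_n) p r h :=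
 iint (fun y=> if `|y - p| < r then h (Phi y) * \det (jac Phi y) else 0).

Lemma half_cover n (p: 'rV[R]_n) r: 0 < r ->
 [set y: 'rV[R]_n | `|y - p| < r] `|` ~` [set y | `|y - p| <= r / 2] = setT.
move=> r0; apply/seteqP; split=>// y _.
have [yr|yr] := leP `|y - p| (r / 2); [left|right].
 by rewrite /= (le_lt_trans yr)// ltr_pdivrMr// ltr_pMr// ltr1n.
by rewrite /= => /le_lt_trans/(_ yr); rewrite ltxx.
Qed.

(** Vanishing on the outer half of the cube leaves an open overlap between the region where [f] is
    used and the region of zeros. *)
Lemma ext_ball_Ck n k (p: 'rV[R]_n) r (f: 'rV[R]_n -> R): 0 < r ->
 Ck k [set y | `|y - p| < r] f -> (forall y, r / 2 <= `|y - p| < r -> f y = 0) ->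
 Ck k setT (fun y=> if `|y - p| < r then f y else 0) /\
 supp (r + `|p|) (fun y=> if `|y - p| < r then f y else 0).
move=> r0 cf f0; split.
 apply: (@Ck_zero_ext _ _ [set y | `|y - p| < r] (~` [set y | `|y - p| <= r / 2]) _ f)=>//.
 - exact: cubeO.
 - exact: closed_openC (@cubeC _ _ _).
 - exact: half_cover.
 - by move=> y /= ->.
 - move=> y /= /negP; rewrite -ltNge=> yr; case: ifP=>// yr'.
  by apply: f0; rewrite (ltW yr).
move=> y; rewrite -ltrBrDr=> yr; case: ifPn=>// yr'.
by have := lt_le_trans (lt_trans yr' yr) (lerB_dist y p); rewrite ltxx.
Qed.

(** The window is so long that the subtracted translate falls outside the support of [h] whenever
    [|z| <= K]. *)
Lemma antider n (k: 'I_n) (h: 'rV[R]_n -> R) L K: 0 < K -> Ck 1 setT h -> supp L h ->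
 exists2 H, Ck 1 setT H & forall z, `|z| <= K -> 'D_'e_k H z = h z.
move=> K0 ch sL; set c := K + `|L| + 1.
have c0: 0 < c by rewrite /c ltr_wpDl// !addr_ge0// ltW.
exists (line_int 'e_k c h)=> [|z zK]; first exact: (line_int_Ck1 _ c0 ch sL).
rewrite (line_int_der_u _ c0 _ ch sL) [X in _ - X]sL ?subr0//.
have := ler_normB z (z - c *: delta_mx 0 k); rewrite opprB addrC subrK.
have n1: c <= `|c *: delta_mx 0 k: 'rV[R]_n|.
 have := coord_le (c *: delta_mx 0 k: 'rV[R]_n) k.
 by rewrite !mxE !eqxx mulr1 (gtr0_norm c0).
have := ler_norm L; rewrite /c in n1 *; move: (`|_ *: _|) n1=> N n1.
lra.
Qed.

Lemma norm_convex n (a b: 'rV[R]_n) (s K: R): `|a| <= K -> `|b| <= K -> 0 <= s <= 1 ->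
 `|s *: (a - b) + b| <= K.
move=> aK bK /andP[s0 s1].
rewrite (_: s *: (a - b) + b = s *: a + (1 - s) *: b); last first.
 by rewrite scalerBr scalerBl scale1r addrA addrAC.
rewrite (le_trans (ler_normD _ _))// !normrZ ger0_norm// ger0_norm ?subr_ge0//.
have -> : K = s * K + (1 - s) * K by rewrite -mulrDl addrC subrK mul1r.
by rewrite lerD// ler_wpM2l// subr_ge0.
Qed.

Lemma Ck_map_bd n (U: set 'rV[R]_n) (F: 'rV[R]_n -> 'rV[R]_n) p r:
 [set y | `|y - p| <= r] `<=` U -> Ckv 2 U F ->
 exists2 K, 0 < K & forall y, `|y - p| < r -> `|F y| <= K.
move=> BU cF; have [K K0 HK] : exists2 K, 0 < K &
  forall y, `|y - p| <= r -> `| `|F y| | <= K.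
 apply: (cpt_bd (@cube_cpt _ p r))=> y By.
 apply: (@continuous_comp _ _ _ F Num.norm); last exact: norm_continuous.
 by apply: cont_rV=> i; apply: (Ck_cont (cF i)); exact: BU.
by exists K=>// y /ltW/HK; rewrite normr_id.
Qed.

Lemma cofactor_jac_eq n (Phi Psi: 'rV[R]_n -> 'rV[R]_n) k y j:
 (forall i y, i != k -> Phi y 0 i = Psi y 0 i) ->
 cofactor (jac Phi y) k j = cofactor (jac Psi y) k j.
move=> PhiPsi.
have E a: (fun y0=> Phi y0 0 (lift k a)) = (fun y0=> Psi y0 0 (lift k a)).
 by apply/funext=> z; apply: PhiPsi; rewrite eq_sym neq_lift.
congr (_ * \det _); apply/matrixP=> a b; rewrite !mxE.
by rewrite E.
Qed.

Lemma lax_step_diff n (U: set 'rV[R]_n) (Phi Psi: 'rV[R]_n -> 'rV[R]_n) k H y: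
 open U -> U y -> Ckv 1 U Phi -> Ckv 1 U Psi ->
 (forall i y, i != k -> Phi y 0 i = Psi y 0 i) -> Ck 1 setT H ->
 \sum_j ('D_'e_j (fun y=> H (Phi y)) y - 'D_'e_j (fun y=> H (Psi y)) y)
  * cofactor (jac Phi y) k j =
 'D_'e_k H (Phi y) * \det (jac Phi y) - 'D_'e_k H (Psi y) * \det (jac Psi y).
move=> oU Uy cPhi cPsi PhiPsi cH.
under eq_bigr do rewrite mulrBl.
rewrite sumrB (jac_comp k oU Uy cPhi cH) -(jac_comp k oU Uy cPsi cH).
by congr (_ - _); apply: eq_bigr=> j _; rewrite (cofactor_jac_eq _ _ PhiPsi).
Qed.

Lemma Ck_ball_pull n (U: set 'rV[R]_n) (F: 'rV[R]_n -> 'rV[R]_n) h: open U ->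
 Ckv 2 U F -> Ck 1 setT h -> Ck 1 U (fun y=> h (F y)).
move=> oU cF ch; apply: (@Ck_comp _ _ _ _ _ setT F _ oU openT _ _ ch)=>// i.
exact: Ck_S (cF i).
Qed.

Lemma Ck_det_jac n (U: set 'rV[R]_n) (F: 'rV[R]_n -> 'rV[R]_n): open U ->
 Ckv 2 U F -> Ck 1 U (fun y=> \det (jac F y)).
move=> oU cF; apply: Ck_det=>// i j.
rewrite (_: (fun y=> _) = 'D_'e_j (fun y=> F y 0 i)).
 exact: Ck_der.
by apply/funext=> y; rewrite mxE.
Qed.

Lemma cc_lint n (U: set 'rV[R]_n) (F: 'rV[R]_n -> 'rV[R]_n) p r h:
 [set y | `|y - p| < r] `<=` U -> 0 < r -> Ckv 2 U F ->
 Ck 1 setT h -> (forall y, r / 2 <= `|y - p| < r -> h (F y) = 0) ->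
 cc (fun y=> if `|y - p| < r then h (F y) * \det (jac F y) else 0).
move=> BU r0 cF ch hF0; have oB := @cubeO n p r.
have cF' i := Ck_sub BU (cF i).
have cG: Ck 1 [set y | `|y - p| < r] (fun y=> h (F y) * \det (jac F y)).
 exact: (Ck_M oB (Ck_ball_pull oB cF' ch) (Ck_det_jac oB cF')).
have G0 y: r / 2 <= `|y - p| < r -> h (F y) * \det (jac F y) = 0.
 by move=> yr; rewrite hF0// mul0r.
by have [c1 s1] := ext_ball_Ck r0 cG G0; exact: Ck_cc c1 s1.
Qed.

(** On the segment from [Psi y] to [Phi y] only coordinate [k] varies, so the increment of [H] sees
    only [h], which vanishes there. *)
Lemma antider_diff0 n (U: set 'rV[R]_n) (Phi Psi: 'rV[R]_n -> 'rV[R]_n) k h H K y: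
 (forall i y, i != k -> Phi y 0 i = Psi y 0 i) ->
 Ck 1 setT H -> (forall z, `|z| <= K -> 'D_'e_k H z = h z) ->
 `|Phi y| <= K -> `|Psi y| <= K ->
 (forall t, 0 <= t <= 1 -> h (t *: (Phi y - Psi y) + Psi y) = 0) -> H (Phi y) - H (Psi y) = 0.
move=> PhiPsi cH DH bPhi bPsi hseg.
have [s s01 E] := @MVT_unit n H (Psi y) (Phi y - Psi y)
  (fun s _=> Ck_dvb cH (y:=s *: (Phi y - Psi y) + Psi y) (v:=Phi y - Psi y) I).
rewrite subrK in E; rewrite E.
have dH: differentiable H (s *: (Phi y - Psi y) + Psi y) by exact: (Ck_diff openT cH).
rewrite der_coord// (bigD1 k)//= DH ?hseg// ?mulr0 ?add0r; last exact: norm_convex.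
by apply: big1=> i ik; rewrite !mxE PhiPsi// subrr mul0r.
Qed.

(** Row [k] of the cofactor matrix does not involve component [k], hence is common to [Phi] and
    [Psi]. With [H] an antiderivative of [h] along coordinate [k], the difference of the two
    integrands is the divergence of [H (Phi y) - H (Psi y)] times that row. The last hypothesis
    makes this field vanish near the boundary of the cube. *)
Lemma lax_step n (U: set 'rV[R]_n) (Phi Psi: 'rV[R]_n -> 'rV[R]_n) k p r h L:
 open U -> 0 < r -> [set y | `|y - p| <= r] `<=` U ->
 Ckv 2 U Phi -> Ckv 2 U Psi ->
 (forall i y, i != k -> Phi y 0 i = Psi y 0 i) ->
 Ck 1 setT h -> supp L h ->
 (forall y (t: R), r / 2 <= `|y - p| < r -> 0 <= t <= 1 -> h (t *: (Phi y - Psi y) + Psi y) = 0) ->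
 lint Phi p r h = lint Psi p r h.
move=> oU r0 BU cPhi cPsi PhiPsi ch sL hseg.
have BU': [set y | `|y - p| < r] `<=` U by move=> y /= /ltW yr; exact: BU.
have oB := @cubeO n p r.
have [K1 K10 HK1] := Ck_map_bd BU cPhi.
have [K2 K20 HK2] := Ck_map_bd BU cPsi.
have [K [K0 bPhi bPsi]] : exists K, [/\ 0 < K, forall y, `|y - p| < r -> `|Phi y| <= K &
  forall y, `|y - p| < r -> `|Psi y| <= K].
 exists (K1 + K2); split; [exact: addr_gt0|move=> y /HK1/le_trans|move=> y /HK2/le_trans].
  by apply; rewrite lerDl ltW.
 by apply; rewrite lerDr ltW.
clear K1 K10 HK1 K2 K20 HK2.
have [H cH DH] := antider k K0 ch sL.
have cPhi' i := Ck_sub BU' (cPhi i); have cPsi' i := Ck_sub BU' (cPsi i).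
have cHPhi := Ck_ball_pull oB cPhi' cH.
have cHPsi := Ck_ball_pull oB cPsi' cH.
have w00 y: r / 2 <= `|y - p| < r -> H (Phi y) - H (Psi y) = 0.
 move=> yr; have yr': `|y - p| < r by case/andP: yr.
 apply: (antider_diff0 U PhiPsi cH DH (bPhi _ yr') (bPsi _ yr'))=> t.
 exact: hseg.
have cw0: Ck 1 [set y | `|y - p| < r] (fun y=> H (Phi y) - H (Psi y)).
 exact: (Ck_D oB cHPhi (Ck_N oB cHPsi)).
have [cw sw] := ext_ball_Ck r0 cw0 w00.
have [w Ew] : exists w: 'rV[R]_n -> R, w = (fun y=> if `|y - p| < r then H (Phi y) - H (Psi y) else 0).
 by eexists.
rewrite -Ew in cw sw.
have wC y: ~ [set y | `|y - p| <= r / 2] y -> w y = 0.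
 move=> /= /negP; rewrite -ltNge=> yr; rewrite Ew; case: ifP=>// yr'.
 by apply: w00; rewrite (ltW yr).
have CU: [set y | `|y - p| <= r / 2] `<=` [set y | `|y - p| < r].
 by move=> y /= /le_lt_trans; apply; rewrite ltr_pdivrMr// ltr_pMr// ltr1n.
have I0 := int_cofactor k oB (@cubeC _ _ _) CU cPhi' cw wC sw.
have ccPhi: cc (fun y=> if `|y - p| < r then h (Phi y) * \det (jac Phi y) else 0).
 apply: (cc_lint BU' r0 cPhi ch)=> y yr; have := hseg y 1 yr; rewrite scale1r subrK; apply.
 by rewrite ler01 lexx.
have ccPsi: cc (fun y=> if `|y - p| < r then h (Psi y) * \det (jac Psi y) else 0).
 apply: (cc_lint BU' r0 cPsi ch)=> y yr; have := hseg y 0 yr; rewrite scale0r add0r; apply.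
 by rewrite ler01 lexx.
apply/eqP; rewrite -subr_eq0 /lint -(iintB ccPhi ccPsi); apply/eqP.
apply: etrans I0; congr iint; apply/funext=> y.
have [yr|yr] := ltP `|y - p| r; last first.
 rewrite subr0 big1// => j _.
 rewrite (_: 'D_'e_j w y = 0) ?mul0r//.
 rewrite -(derive_cst (0: R) y 'e_j); apply: near_eq_derive.
 have oC := closed_openC (@cubeC n p (r / 2)).
 apply: (nearO oC)=> [|z /wC //] /=.
 by apply/negP; rewrite -ltNge (lt_le_trans _ yr)// ltr_pdivrMr// ltr_pMr// ltr1n.
have Dw j: 'D_'e_j w y =
  'D_'e_j (fun y=> H (Phi y)) y - 'D_'e_j (fun y=> H (Psi y)) y.
 rewrite -(deriveB (Ck_dvb cHPhi yr) (Ck_dvb cHPsi yr)); apply: near_eq_derive.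
 by apply: (nearO oB yr)=> z zr; rewrite Ew zr.
under eq_bigr do rewrite Dw.
rewrite (lax_step_diff oB yr (fun i=> Ck_S (cPhi' i)) (fun i=> Ck_S (cPsi' i)) PhiPsi cH).
by rewrite (DH _ (bPhi _ yr)) (DH _ (bPsi _ yr)).
Qed.

End Lax.

(** * Local degree and the local change of variables formula *)

Section LocalChange.
Variables (R: realType) (n: nat).
Local Notation V := 'rV[R]_n.
Implicit Types (Phi Psi: V -> V) (p q y: V) (M: 'M[R]_n) (u: 'cV[R]_n).

(** [e] is the local degree of [Phi] at [p], tested on functions supported near [Phi p]; the size
    [d] of the support may depend on the radius [r] of the cube. *)
Definition ldeg Phi p (e: R) := exists2 r0, 0 < r0 & forall r, 0 < r <= r0 ->
 exists2 d, 0 < d & forall h, Ck 1 setT h -> (forall z, d <= `|z - Phi p| -> h z = 0) ->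
  lint Phi p r h = e * iint h.

Lemma ballcO (U: set V) p: open U -> U p -> exists2 r, 0 < r & [set y | `|y - p| <= r] `<=` U.
move=> oU Up; have /nbhs_ballP[e /= e0 He] := open_nbhs_nbhs (conj oU Up).
exists (e / 2); first exact: divr_gt0.
move=> y /= ye; apply: He; rewrite -ball_normE /= distrC (le_lt_trans ye)//.
by rewrite ltr_pdivrMr// ltr_pMr// ltr1n.
Qed.

Lemma sp_ball (h: V -> R) q d: (forall z, d <= `|z - q| -> h z = 0) -> supp (d + `|q|) h.
move=> H z dz; apply: H; have := lerB_dist z q.
by rewrite lerBlDr=> /(lt_le_trans dz); rewrite ltrD2r=> /ltW.
Qed.

(** The lower bound keeps the segments from [Psi y] to [Phi y] away from [Phi p] when [y] is in the
    outer half of the cube, so an [h] with small enough support vanishes on them, as [lax_step]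
    requires. *)
Lemma ldeg_step (U: set V) Phi Psi k p m r1 e: open U -> U p ->
 Ckv 2 U Phi -> Ckv 2 U Psi ->
 (forall i y, i != k -> Phi y 0 i = Psi y 0 i) -> Phi p = Psi p -> 0 < m -> 0 < r1 ->
 (forall y (t: R), `|y - p| < r1 -> 0 <= t <= 1 ->
   m * `|y - p| <= `|t *: (Phi y - Psi y) + Psi y - Phi p|) ->
 ldeg Psi p e -> ldeg Phi p e.
move=> oU Up cPhi cPsi PhiPsi Ep m0 r10 low [r0 r00 HPsi].
have [r2 r20 Br2] := ballcO oU Up.
exists (Num.min r0 (Num.min r1 r2)); first by rewrite !lt_min r00 r10.
move=> r /andP[r0' ]; rewrite !le_min=> /and3P[rr0 rr1 rr2].
have [|d d0 Hd] := HPsi r; first by rewrite r0'.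
exists (Num.min d (m * (r / 2))); first by rewrite lt_min d0 mulr_gt0// divr_gt0.
move=> h ch h0; rewrite -Hd//; last first.
 by move=> z dz; apply: h0; rewrite Ep ge_min dz.
apply: (lax_step (U:=U) (k:=k) (L:=Num.min d (m * (r / 2)) + `|Phi p|) oU r0' _ cPhi cPsi PhiPsi ch).
- by move=> y /= yr; apply: Br2; rewrite /= (le_trans yr).
- exact: sp_ball.
- move=> y t /andP[yr yr'] t01; apply: h0; rewrite ge_min; apply/orP; right.
 apply: le_trans (low y t _ t01); first by rewrite ler_pM2l.
 exact: lt_le_trans yr' rr1.
Qed.

Lemma mulmx_norm M: exists2 C: R, 0 < C & forall v: V, `|v *m M| <= C * `|v|.
exists (1 + \sum_i \sum_j `|M i j|).
 by rewrite ltr_wpDr// sumr_ge0// => i _; rewrite sumr_ge0.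
move=> v; apply/norm_leP.
 by rewrite mulr_ge0// addr_ge0// sumr_ge0// => i _; rewrite sumr_ge0.
move=> j; rewrite mxE (le_trans (ler_norm_sum _ _ _))// mulrDl mul1r ler_wpDl// mulr_suml.
apply: ler_sum=> i _; rewrite normrM mulrC ler_pM ?coord_le//.
by rewrite (bigD1 j)//= lerDl sumr_ge0.
Qed.

Definition aff q p M y := q + (y - p) *m M.

Lemma Ck_aff k U q p M i: open U -> Ck k U (fun y=> aff q p M y 0 i).
move=> oU; rewrite (_: (fun y=> _) = (fun y=> q 0 i + \sum_j (y 0 j + - p 0 j) * M j i)); last first.
 by apply/funext=> y; rewrite !mxE; congr (_ + _); apply: eq_bigr=> j _; rewrite !mxE.
apply: Ck_D=>//; first exact: Ck_cst.
apply: Ck_sum=>// j _; apply: Ck_M=>//; last exact: Ck_cst.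
by apply: Ck_D=>//; [exact: Ck_coord|exact: Ck_cst].
Qed.

Lemma aff_diff q p M y z: aff q p M y - aff q p M z = (y - z) *m M.
by rewrite /aff opprD addrACA subrr add0r -mulmxBl opprB addrA subrK. Qed.

Lemma der_aff q p M i y v: is_derive y v (fun y=> aff q p M y 0 i) ((v *m M) 0 i).
have Ec: (fun t: R=> t^-1 *: (((fun y=> aff q p M y 0 i) \o shift y) (t *: v) - aff q p M y 0 i)) @ 0^' -->
  (v *m M) 0 i.
 apply: (@cvg_trans _ ((fun=> (v *m M) 0 i) @ (0: R)^')); last exact: cvg_cst.
 apply: near_eq_cvg; exists 1=>//= t _ t0.
 have -> : aff q p M (t *: v + y) 0 i - aff q p M y 0 i = (t *: v *m M) 0 i.
  by rewrite -[t *: v in RHS](addrK y) -(aff_diff q p) !mxE.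
 by rewrite -scalemxAl [X in _ *: X]mxE; rewrite /GRing.scale /= mulrA mulVf// mul1r.
by split; [apply/cvg_ex; exists ((v *m M) 0 i)|apply: cvg_lim=>//; exact: Rhausdorff].
Qed.

Lemma jac_aff q p M y: jac (aff q p M) y = M^T.
apply/matrixP=> i j; rewrite !mxE; have [_ ->] := der_aff q p M i y 'e_j.
by rewrite -rowE mxE.
Qed.

Lemma unitmx_low M: M \in unitmx -> exists2 m: R, 0 < m & forall v: V, m * `|v| <= `|v *m M|.
move=> uM; have [C C0 HC] := mulmx_norm (invmx M).
exists C^-1; rewrite ?invr_gt0// => v; rewrite mulrC ler_pdivrMr// mulrC.
by have := HC (v *m M); rewrite -mulmxA mulmxV// mulmx1.
Qed.

(** This is [M] times the identity with column [k] replaced by [u]. As vectors are rows, it alters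
    only component [k] of [y |-> y *m M]. *)
Definition colrep M (k: 'I_n) u: 'M[R]_n := \matrix_(i, j) (if j == k then (M *m u) i 0 else M i j).

Lemma crep1E k u i j: colrep 1%:M k u i j = if j == k then u i 0 else (i == j)%:R.
by rewrite mxE mul1mx mxE. Qed.

Lemma crepE M k u: colrep M k u = M *m colrep 1%:M k u.
apply/matrixP=> i j; rewrite !mxE; have [->|jk] := eqVneq j k.
 by apply: eq_bigr=> l _; rewrite crep1E eqxx.
rewrite -[M in LHS](mulmx1 M) mxE; apply: eq_bigr=> l _.
by rewrite crep1E (negbTE jk) mxE.
Qed.

Lemma det_cr M k u: \det (colrep M k u) = \det M * u k 0.
rewrite crepE det_mulmx; congr (_ * _).
rewrite (expand_det_col _ k).
transitivity (\sum_i u i 0 * (\adj (1%:M: 'M[R]_n)) k i); last first.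
 rewrite adj1 (bigD1 k)//= big1 ?addr0=> [|i ik]; rewrite !mxE ?eqxx ?mulr1//.
 by rewrite eq_sym (negbTE ik) mulr0.
apply: eq_bigr=> i _; rewrite [in RHS]mxE; congr (_ * _); first by rewrite mxE eqxx mul1mx.
congr (_ * \det _); apply/matrixP=> a b; rewrite !mxE.
by rewrite eq_sym (negbTE (neq_lift _ _)).
Qed.

(** For a positive [u k 0] the straight path between the two matrices stays invertible, with a
    uniform lower bound: the components other than [k] do not move, and component [k] of [w] is
    recovered from [z] on division by [t + (1 - t) * u k 0]. *)
Lemma ldeg_cr q p M k u e: M \in unitmx -> 0 < u k 0 ->
 ldeg (aff q p (colrep M k u)) p e -> ldeg (aff q p M) p e.
move=> uM uk.
have E0 N: aff q p N p = q by rewrite /aff subrr mul0mx addr0.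
have [m m0 low] := unitmx_low uM.
set S := \sum_j `|u j 0|.
have S0: 0 <= S by exact: sumr_ge0.
set mu := Num.min 1 (u k 0); have mu0: 0 < mu by rewrite lt_min ltr01.
(* The second term bounds the recovered component [k], the first one the unchanged components. *)
set K := 1 + (1 + S) / mu.
have K0: 0 < K by rewrite ltr_wpDr// divr_ge0 ?(ltW mu0)// addr_ge0.
apply: (ldeg_step (U:=setT) (k:=k) (m:=m / K) (r1:=1))=>//.
- exact: openT.
- by move=> i; apply: Ck_aff; exact: openT.
- by move=> i; apply: Ck_aff; exact: openT.
- move=> i y ik; rewrite /aff !mxE; congr (_ + _); apply: eq_bigr=> j _.
 by congr (_ * _); rewrite mxE (negbTE ik).
- by rewrite !E0.
- exact: divr_gt0.
move=> y t _ t01; rewrite E0.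
set w := (y - p) *m M.
have -> : t *: (aff q p M y - aff q p (colrep M k u) y) + aff q p (colrep M k u) y - q =
  t *: w + (1 - t) *: (w *m colrep 1%:M k u).
 rewrite /aff crepE mulmxA -/w; apply/rowP=> j; rewrite !mxE.
 by ring.
rewrite mulrAC ler_pdivrMr// (le_trans (low _))// -/w.
set z := t *: w + _.
have wj j: j != k -> z 0 j = w 0 j.
 move=> jk; have -> : z 0 j = t * w 0 j + (1 - t) * (w *m colrep 1%:M k u) 0 j.
  by rewrite /z mxE [X in X + _]mxE [X in _ + X]mxE.
 rewrite (_: (w *m _) 0 j = w 0 j); first by rewrite -mulrDl addrC subrK mul1r.
 rewrite -[w in RHS]mulmx1 !mxE; apply: eq_bigr=> l _; congr (_ * _).
 by rewrite crep1E (negbTE jk) mxE.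
have zk: z 0 k = t * w 0 k + (1 - t) * \sum_j w 0 j * u j 0.
 rewrite !mxE; congr (_ + _ * _); apply: eq_bigr=> l _; congr (_ * _).
 by rewrite crep1E eqxx.
case/andP: t01=> t0 t1.
have bk: `|w 0 k| <= (1 + S) / mu * `|z|.
 rewrite mulrAC ler_pdivlMr//.
 have E: (t + (1 - t) * u k 0) * w 0 k = z 0 k - (1 - t) * \sum_(j | j != k) z 0 j * u j 0.
  have ES: \sum_(j | j != k) z 0 j * u j 0 = \sum_(j | j != k) w 0 j * u j 0.
   by apply: eq_bigr=> j /wj ->.
  rewrite ES zk (bigD1 k)//=.
  by ring.
 have mut: mu <= t + (1 - t) * u k 0.
  have: mu <= 1 by rewrite ge_min lexx.
  have: mu <= u k 0 by rewrite ge_min lexx orbT.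
  move=> mu_le_u mu_le1; apply: (@le_trans _ _ (t * mu + (1 - t) * mu)); first by rewrite -mulrDl addrC subrK mul1r.
  apply: lerD; first by rewrite ler_piMr.
  by rewrite ler_wpM2l// subr_ge0.
 apply: (@le_trans _ _ (`|(t + (1 - t) * u k 0) * w 0 k|)).
  by rewrite normrM mulrC ler_wpM2r// (le_trans mut)// ler_norm.
 rewrite E (le_trans (ler_normB _ _))// [leRHS]mulrDl mul1r lerD ?coord_le//.
 rewrite normrM (@le_trans _ _ (1 * `|\sum_(j | j != k) z 0 j * u j 0|))//.
  by rewrite ler_wpM2r// ger0_norm ?subr_ge0// gerBl.
 rewrite mul1r (le_trans (ler_norm_sum _ _ _))// /S mulr_suml [leRHS](bigD1 k)//= ler_wpDl ?mulr_ge0//.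
 by apply: ler_sum=> j _; rewrite normrM mulrC ler_wpM2l// coord_le.
apply/norm_leP; first by rewrite mulr_ge0// ltW.
move=> j; have [->|jk] := eqVneq j k.
 by rewrite mulrC mulrDl mul1r ler_wpDl.
rewrite -wj// mulrC (le_trans (coord_le _ _))// mulrDl mul1r lerDl mulr_ge0// divr_ge0 ?(ltW mu0)//.
by rewrite addr_ge0.
Qed.

(** [rho] is the reflection of coordinate [k] about the point [q]; it is a reflection about 0
    followed by a translation, and both preserve the integral. *)
Lemma iint_flip (h: V -> R) q d k: Ck 1 setT h -> (forall z, d <= `|z - q| -> h z = 0) ->
 let rho z := q + (z - q) *m colrep 1%:M k (- delta_mx k 0) in
 [/\ Ck 1 setT (h \o rho), forall z, d <= `|z - q| -> h (rho z) = 0 &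
   iint (h \o rho) = iint h].
move=> ch h0 rho; have rhoE z: rho z = refl k z - (- (2 * q 0 k) *: delta_mx 0 k).
 apply/rowP=> j; rewrite !mxE (bigD1 j)//= big1 ?addr0=> [|i ij]; last first.
  rewrite crep1E; case: eqP=> [jk|_]; last by rewrite (negbTE ij) mulr0.
  by rewrite !mxE -jk (negbTE ij) oppr0 mulr0.
 rewrite crep1E !mxE; case: (eqVneq j k)=> [->|jk]; rewrite ?eqxx /=; ring.
have N z: `|rho z - q| = `|z - q|.
 rewrite -[RHS](norm_refl k); congr (`|_|); rewrite rhoE; apply/rowP=> j; rewrite !mxE.
 by have [->|_] := eqVneq j k; rewrite ?eqxx /=; ring.
have h0' z: d <= `|z - q| -> h (rho z) = 0 by rewrite -N=> /h0.
have cs (g: V -> V): Ckv 1 setT g -> Ck 1 setT (fun y=> h (g y)).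
 by move=> cg; apply: (@Ck_comp _ _ _ _ _ setT g _ openT openT).
split=>//; first by apply: cs=> i; exact: (@Ck_aff 1 setT q q _ i openT).
pose h1 z := h (z - (- (2 * q 0 k) *: delta_mx 0 k)).
rewrite (_: h \o rho = h1 \o refl k); last by apply/funext=> z; rewrite /= rhoE.
have s1 := sp_ball h0.
rewrite iint_reflect ?(iint_shift _ ch s1)//.
apply: (@Ck_cc _ _ 1 _ (d + `|q| + `| - (2 * q 0 k) *: delta_mx 0 k: V|)).
 apply: cs=> i; apply: (eq_rect _ (fun F=> Ck 1 setT F) (@Ck_aff 1 setT 0 (- (2 * q 0 k) *: delta_mx 0 k) 1%:M i openT)).
 by apply/funext=> y; rewrite /aff mulmx1 add0r.
move=> z Hz; apply: s1; have := lerB_dist z (- (2 * q 0 k) *: delta_mx 0 k).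
by rewrite lerBlDr=> /(lt_le_trans Hz); rewrite ltrD2r.
Qed.

Lemma crep_flipK M k: colrep (colrep M k (- delta_mx k 0)) k (- delta_mx k 0) = M.
apply/matrixP=> i j; rewrite mxE; case: (eqVneq j k)=> [->|jk]; last by rewrite mxE (negbTE jk).
by rewrite mulmxN mxE -colE mxE mxE eqxx mulmxN -colE !mxE opprK.
Qed.

(** Changing the sign of column [k] changes the sign of the determinant, and composing the test
    function with the reflection [rho] compensates the change of the map. *)
Lemma ldeg_flip q p M k e:
 ldeg (aff q p (colrep M k (- delta_mx k 0))) p (- e) -> ldeg (aff q p M) p e.
have E0 N: aff q p N p = q by rewrite /aff subrr mul0mx addr0.
move=> [r0 r00 H]; exists r0=>// r rr0; have [d d0 Hd] := H r rr0; exists d=>// h ch h0.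
rewrite E0 in h0.
have [ch1 h10 Ih1] := iint_flip k ch h0.
pose h2 z := - h (q + (z - q) *m colrep 1%:M k (- delta_mx k 0)).
have ch2: Ck 1 setT h2 by exact: (Ck_N openT ch1).
have h20 z: d <= `|z - aff q p (colrep M k (- delta_mx k 0)) p| -> h2 z = 0.
 by rewrite E0 /h2=> /h10 ->; rewrite oppr0.
have := Hd _ ch2 h20; rewrite (iintN (Ck_cc ch1 (sp_ball h10))) Ih1 mulrNN=> <-.
congr iint; apply/funext=> y; rewrite !jac_aff !det_tr det_cr !mxE !eqxx mulrN1 /h2 mulrNN.
have -> : q + (aff q p (colrep M k (- delta_mx k 0)) y - q) *m colrep 1%:M k (- delta_mx k 0) = aff q p M y.
 by rewrite {1}/aff [q + _ - q]addrC addKr -mulmxA -crepE crep_flipK.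
by [].
Qed.

Lemma ldeg_translation q p: ldeg (aff q p 1%:M) p 1.
have E y: aff q p 1%:M y = y - (p - q) by rewrite /aff mulmx1 opprB addrC addrAC -addrA.
exists 1=>// r /andP[r0 _]; exists r=>// h ch; 
have -> : aff q p 1%:M p = q by rewrite /aff subrr mul0mx addr0.
move=> h0; rewrite mul1r -(iint_shift (p - q) ch (sp_ball h0)) /lint.
congr iint; apply/funext=> y; rewrite jac_aff trmx1 det1 mulr1 E.
case: ltP=>// yr; rewrite h0//.
by rewrite (_: y - (p - q) - q = y - p)// opprB (addrC q) addrA addrK.
Qed.

(** Gauss elimination by column replacements that respect the degree; [m] counts the columns that
    are not yet those of the identity. *)
Lemma ldeg_lin p M q: M \in unitmx -> ldeg (aff q p M) p (Num.sg (\det M)).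
suff H m: (m <= n)%N -> forall M, M \in unitmx ->
  (forall i j: 'I_n, (j < n - m)%N -> M i j = (i == j)%:R) ->
  ldeg (aff q p M) p (Num.sg (\det M)).
 by move=> uM; apply: (H n)=>// i j; rewrite subnn.
elim: m=> [|m IH] mn {}M uM M1.
 have -> : M = 1%:M by apply/matrixP=> i j; rewrite mxE M1// subn0.
 by rewrite det1 sgr1; exact: ldeg_translation.
have kn: (n - m.+1 < n)%N by rewrite ltn_subrL (leq_ltn_trans _ mn).
pose k := Ordinal kn.
have jk (j: 'I_n): (j < n - m)%N -> j != k -> (j < n - m.+1)%N.
 by rewrite -[(n - m)%N](@subnSK m n)// ltnS leq_eqVlt=> /orP[/eqP E|//]; rewrite -val_eqE /= E eqxx.
have colk (N: 'M[R]_n) (u: 'cV[R]_n) (i j: 'I_n): (forall i j: 'I_n, (j < n - m.+1)%N -> N i j = (i == j)%:R) ->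
  (N *m u) = delta_mx k 0 -> (j < n - m)%N -> colrep N k u i j = (i == j)%:R.
 move=> N1 Nu jm; rewrite mxE Nu; case: eqVneq=> [->|jk']; first by rewrite mxE eqxx andbT.
 by apply: N1; exact: jk.
suff step (N: 'M[R]_n) (u: 'cV[R]_n): N \in unitmx -> (forall i j: 'I_n, (j < n - m.+1)%N -> N i j = (i == j)%:R) ->
  N *m u = delta_mx k 0 -> u k 0 != 0 -> ldeg (aff q p N) p (Num.sg (\det N)).
 (* With this [u] the new column [M *m u] is the [k]-th unit column. *)
 pose u := invmx M *m delta_mx k (0: 'I_1).
 have Mu: M *m u = delta_mx k 0 by rewrite mulmxA mulmxV// mul1mx.
 clearbody u.
 have [uk|uk] := eqVneq (u k 0) 0; last exact: (step M u).
 (* If [u k 0 = 0] the replacement would be singular. Adding column [k] to a later column [i] with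
    [u i 0 != 0] turns this entry into [- u i 0] and leaves the finished columns alone. *)
 have [i ik ui] : exists2 i: 'I_n, (k < i)%N & u i 0 != 0.
  apply/not_exists2P=> H; have := congr1 (fun A: 'cV[R]_n=> A k 0) Mu; rewrite !mxE !eqxx.
  rewrite big1=> [/eqP|i _]; first by rewrite eq_sym oner_eq0.
  have [ik|ik|ik] := ltngtP i k.
  - by rewrite M1// -val_eqE eq_sym (ltn_eqF ik) mul0r.
  - by have [//|/negP] := H i; rewrite negbK=> /eqP ->; rewrite mulr0.
  - by rewrite (val_inj ik) uk mulr0.
 have ik': i != k by rewrite -val_eqE eq_sym (ltn_eqF ik).
 have c1: (delta_mx i 0 + delta_mx k 0: 'cV[R]_n) i 0 = 1 by rewrite !mxE eqxx (negbTE ik') addr0.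
 apply: (@ldeg_cr q p M i (delta_mx i 0 + delta_mx k 0))=>//; first by rewrite c1.
 have dN := det_cr M i (delta_mx i 0 + delta_mx k 0).
 rewrite c1 mulr1 in dN; rewrite -dN.
 apply: (step _ (u - u i 0 *: delta_mx k 0)).
 - by rewrite unitmxE dN -unitmxE.
 - move=> a b bm; rewrite mxE M1//; case: eqP=>// bi.
  by move: bm; rewrite bi ltnNge (ltnW ik).
 - rewrite crepE -mulmxA -[RHS]Mu; congr (_ *m _).
  have -> : colrep 1%:M i (delta_mx i 0 + delta_mx k 0) = 1%:M + delta_mx k i.
   apply/matrixP=> a b; rewrite crep1E !mxE; case: (eqVneq b i)=> [->|bi].
    by rewrite !andbT.
   by rewrite andbF addr0.
  have D (x: 'cV[R]_n): delta_mx k i *m x = x i 0 *: delta_mx k 0.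
   apply/colP=> a; rewrite !mxE (bigD1 i)//= big1=> [|b bi]; rewrite !mxE ?eqxx.
    by rewrite addr0 !andbT mulrC.
   by rewrite (negbTE bi) andbF mul0r.
  rewrite mulmxDl mul1mx D !mxE eqxx (negbTE ik') mulr0 subr0.
  by rewrite subrK.
 - by rewrite !mxE !eqxx uk mulr1 sub0r oppr_eq0.
move=> uN N1 Nu uk.
have [uk0|uk0] := ltP 0 (u k 0).
 apply: (@ldeg_cr q p N k u)=>//.
 have -> : Num.sg (\det N) = Num.sg (\det (colrep N k u)).
  by rewrite det_cr sgrM (gtr0_sg uk0) mulr1.
 apply: IH; [exact: ltnW| |by move=> i j; exact: colk].
 by rewrite unitmxE det_cr unitrM -unitmxE uN unitfE.
(* For a negative entry the replacement uses [- u], and a flip of column [k] corrects the sign. *)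
have uk1: u k 0 < 0 by rewrite lt_neqAle uk.
apply: (@ldeg_cr q p N k (- u))=>//; first by rewrite mxE oppr_gt0.
apply: (@ldeg_flip q p _ k).
have E: colrep (colrep N k (- u)) k (- delta_mx k 0) = colrep N k u.
 apply/matrixP=> i j; rewrite mxE [in RHS]mxE; case: eqVneq=> jk'; last by rewrite mxE (negbTE jk').
 by rewrite mulmxN mxE -colE 2!mxE eqxx mulmxN mxE opprK.
rewrite E; have -> : - Num.sg (\det N) = Num.sg (\det (colrep N k u)).
 by rewrite det_cr sgrM (ltr0_sg uk1) mulrN1.
apply: IH; [exact: ltnW| |by move=> i j; exact: colk].
by rewrite unitmxE det_cr unitrM -unitmxE uN unitfE.
Qed.

Lemma jac_lin_eps (U: set V) Phi p (e: R): open U -> U p -> Ckv 1 U Phi -> 0 < e ->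
 \forall y \near p, forall i, `|Phi y 0 i - aff (Phi p) p (jac Phi p)^T y 0 i| <= e * `|y - p|.
move=> oU Up cPhi e0; apply: near_forall=> i.
have dP := Ck_diff oU (cPhi i) Up.
move/diff_locallyP: (dP)=> [_ /eqaddoP/(_ e e0)].
move=> /nbhs_ballP[d /= d0 Hd]; apply/nbhs_ballP; exists d=>//= y yd.
have /Hd: ball (0: V) d (y - p) by rewrite -ball_normE /= sub0r opprB; move: yd; rewrite -ball_normE.
rewrite !fctE /= subrK; apply: le_trans.
have -> // : Phi y 0 i - aff (Phi p) p (jac Phi p)^T y 0 i = Phi y 0 i - (Phi p 0 i + 'd (fun y0=> Phi y0 0 i) p (y - p)).
rewrite -deriveE// der_coord// /aff !mxE; congr (_ - (_ + _)); apply: eq_bigr=> j _.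
by rewrite !mxE.
Qed.

(** The components of [Phi] are exchanged one at a time for those of its affine approximation [A] at
    [p]. Near [p] all intermediate maps differ from [A] by at most [m / 2 * |y - p|], while [A y] is
    at distance at least [m * |y - p|] from [Phi p]. *)
Lemma ldeg_C2 (U: set V) Phi p: open U -> U p -> Ckv 2 U Phi ->
 \det (jac Phi p) != 0 -> ldeg Phi p (Num.sg (\det (jac Phi p))).
move=> oU Up cPhi dP; set M := (jac Phi p)^T; set A := aff (Phi p) p M.
have uM: M \in unitmx by rewrite unitmxE det_tr unitfE.
have Ap: A p = Phi p by rewrite /A /aff subrr mul0mx addr0.
have cA i: Ck 2 U (fun y=> A y 0 i) by exact: Ck_aff.
pose mix (j: nat) y: V := \row_(i < n) if (i < j)%N then A y 0 i else Phi y 0 i.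
have cmix j i: Ck 2 U (fun y=> mix j y 0 i).
 have [ij|ij] := boolP (i < j)%N.
  by rewrite (_: (fun y=> _) = (fun y=> A y 0 i))//; apply/funext=> y; rewrite mxE ij.
 by rewrite (_: (fun y=> _) = (fun y=> Phi y 0 i))//; apply/funext=> y; rewrite mxE (negbTE ij).
have mixp j: mix j p = Phi p by apply/rowP=> i; rewrite mxE Ap if_same.
have [m m0 low] := unitmx_low uM.
have [r1 r10 near1] : exists2 r1, 0 < r1 & forall y, `|y - p| < r1 -> forall i, `|Phi y 0 i - A y 0 i| <= m / 2 * `|y - p|.
 have /nbhs_ballP[d /= d0 Hd] := jac_lin_eps oU Up (fun i=> Ck_S (cPhi i)) (divr_gt0 m0 (ltr0Sn R 1)).
 by exists d=>// y yd; apply: Hd; rewrite -ball_normE /= distrC.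
have -> : Phi = mix 0%N by apply/funext=> y; apply/rowP=> i; rewrite mxE.
have -> : \det (jac (mix 0%N) p) = \det M.
 rewrite det_tr; congr (\det (jac _ p)); by apply/funext=> y; apply/rowP=> i; rewrite mxE.
have mixn: mix n = A by apply/funext=> y; apply/rowP=> i; rewrite mxE ltn_ord.
suff H j: (j <= n)%N -> ldeg (mix (n - j)%N) p (Num.sg (\det M)).
 by have := H n (leqnn n); rewrite subnn.
elim: j=> [_|j IH jn]; first by rewrite subn0 mixn; exact: ldeg_lin.
have kn: (n - j.+1 < n)%N by rewrite ltn_subrL (leq_ltn_trans _ jn).
have Ej: (n - j)%N = (n - j.+1).+1 by rewrite subnSK.
have mixE l y i: mix l y 0 i = if (i < l)%N then A y 0 i else Phi y 0 i by rewrite mxE.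
have Hl := IH (ltnW jn).
have EA z: (z - p) *m M = A z - Phi p by rewrite -Ap aff_diff.
clear IH mixn; clearbody mix; clearbody A M.
apply: (ldeg_step (k:=Ordinal kn) oU Up (cmix _) (cmix (n - j)%N) _ _ _ r10 _ Hl
 (m:=m / 2)).
- move=> i y; rewrite -val_eqE /= => ik; rewrite !mixE.
 by rewrite (_: (i < n - j)%N = (i < n - j.+1)%N)// Ej ltnS [RHS]ltn_neqAle ik.
- by rewrite !mixp.
- exact: divr_gt0.
- move=> y t yr /andP[t0 t1]; rewrite mixp.
 have lowy := low (y - p).
 rewrite EA in lowy.
 set z := _ - Phi p; have zA: `|A y - Phi p - z| <= m / 2 * `|y - p|.
  apply/norm_leP; first by rewrite mulr_ge0// divr_ge0// ltW.
  move=> i; rewrite !mxE !mixE; have := near1 y yr i.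
  set a := A y 0 i; set b := Phi y 0 i=> Hab.
  set c := if _ then _ else _; set c' := if _ then _ else _.
  suff [s /andP[s0 s1] ->] : exists2 s, 0 <= s <= 1 & a - Phi p 0 i - (t * (c - c') + c' - Phi p 0 i) = s * (a - b).
   by rewrite normrM ger0_norm// distrC (le_trans _ Hab)// ler_piMl.
  rewrite /c /c'; case: ifP=> _; case: ifP=> _.
  - by exists 0; rewrite ?lexx ?ler01//; ring.
  - by exists (1 - t); rewrite ?subr_ge0 ?t1 ?gerBl//; ring.
  - by exists t; rewrite ?t0//; ring.
  - by exists 1; rewrite ?lexx ?ler01//; ring.
 have := ler_normD (A y - Phi p - z) z; rewrite subrK.
 move: zA lowy; move: (`|A y - Phi p|) (`|_ - z|) (`|z|) (`|y - p|)=> a b c d.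
 by move=> ? ? ?; lra.
Qed.

(** Near [p] the determinant keeps its sign, which cancels the degree. *)
Lemma change_var_local (U: set V) Phi p: open U -> U p -> Ckv 2 U Phi ->
 \det (jac Phi p) != 0 -> exists2 r0, 0 < r0 & forall r, 0 < r <= r0 ->
 exists2 d, 0 < d & forall h, Ck 1 setT h -> (forall z, d <= `|z - Phi p| -> h z = 0) ->
  iint (fun y=> if `|y - p| < r then h (Phi y) * `|\det (jac Phi y)| else 0) = iint h.
move=> oU Up cPhi dP.
have cdet := Ck_cont (Ck_det_jac oU cPhi) Up.
have [r1 r10 H1] : exists2 r1, 0 < r1 & forall y, `|y - p| < r1 -> Num.sg (\det (jac Phi y)) = Num.sg (\det (jac Phi p)).
 have e0: 0 < `|\det (jac Phi p)| by rewrite normr_gt0.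
 have := cdet _ (@nbhsx_ballx _ _ _ (`|\det (jac Phi p)|) e0).
 move=> /nbhs_ballP[d /= d0 Hd]; exists d=>// y yd.
 have := Hd y; rewrite -!ball_normE /= distrC=> /(_ yd).
 move: (\det (jac Phi p)) (\det (jac Phi y)) dP=> a b a0; rewrite ltr_norml=> /andP[].
 case: (ltrgtP a 0) a0=>// a0 _.
  rewrite (ltr0_norm a0) opprK=> h1 h2; rewrite (ltr0_sg a0) ltr0_sg//; lra.
 rewrite (gtr0_norm a0)=> h1 h2; rewrite (gtr0_sg a0) gtr0_sg//; lra.
have [r0 r00 H0] := ldeg_C2 oU Up cPhi dP.
exists (Num.min r0 r1); first by rewrite lt_min r00.
move=> r; rewrite le_min=> /and3P[r0' rr0 rr1]; have [|d d0 Hd] := H0 r; first by rewrite r0'.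
exists d=>// h ch h0; pose s := Num.sg (\det (jac Phi p)).
have ss: s * s = 1 by rewrite /s -expr2 sqr_sg dP.
have ch': Ck 1 setT (fun z=> s * h z) by apply: (Ck_M openT _ ch); exact: Ck_cst.
have h0' z: d <= `|z - Phi p| -> s * h z = 0 by move=> /h0 ->; rewrite mulr0.
have := Hd _ ch' h0'; rewrite (iintZ _ (Ck_cc ch (sp_ball h0))) mulrA -/s ss mul1r=> <-.
congr iint; apply/funext=> y; case: ifP=>// yr.
rewrite normrEsg (H1 y (lt_le_trans yr rr1)) -/s; ring.
Qed.

End LocalChange.

(** * Finite covers, approximation, and change of variables for continuous functions *)

Section Covers.
Variables (R: realType) (n: nat).
Local Notation V := 'rV[R]_n.

(** Finite sequences, filtered by inclusion of their elements, are fed to the near-covering form of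
    compactness. *)
Lemma finite_cover (T: topologicalType) (K: set T) (N: T -> set T): compact K ->
 (forall x, K x -> open (N x)) -> (forall x, K x -> N x x) ->
 exists2 s: seq T, {in s, forall x, K x} & forall x, K x -> exists2 y, y \in s & N y x.
move=> cK oN Nx.
pose F (S: set (seq T)) := exists s0: seq T, forall s: seq T, {subset s0 <= s} -> S s.
have FF: Filter F.
 split.
 - by exists [::].
 - move=> P Q [s0 Hs0] [s1 Hs1]; exists (s0 ++ s1)=> s ss; split.
   by apply: Hs0=> x xs; apply: ss; rewrite mem_cat xs.
  by apply: Hs1=> x xs; apply: ss; rewrite mem_cat xs orbT.
 - by move=> P Q PQ [s0 Hs0]; exists s0=> s /Hs0/PQ.
have [|s0 Hs0] := iffLR (compact_near_coveringP K) cK _ F (fun s x=> exists2 y, y \in s & K y /\ N y x) FF.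
 move=> x Kx; exists (N x, [set s: seq T | x \in s]).
  split; first exact: open_nbhs_nbhs (conj (oN x Kx) (Nx x Kx)).
  by exists [:: x]=> s; apply; rewrite inE.
 by move=> [x' s] [/= Nx' xs]; exists x.
exists [seq x <- s0 | `[< K x >]]=> [x|x Kx]; first by rewrite mem_filter=> /andP[/asboolP].
have [y ys [Ky Nyx]] := Hs0 s0 (fun _=> id) x Kx; exists y=>//.
by rewrite mem_filter ys andbT; exact/asboolP.
Qed.

(** [u] is averaged against bumps centred at a fine net. The constant [et] keeps the denominator
    positive everywhere, at the price of an error [et * u / (P + et)], which its choice makes at
    most [e / 2]; the oscillation of [u] accounts for the other half. *)
Lemma approx_C1 (u: V -> R) (p: V) (d e: R): n != 0%N -> cc u -> 0 < d -> 0 < e ->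
 (forall y, d <= `|y - p| -> u y = 0) ->
 exists v, [/\ Ck 1 setT v, forall y, 2 * d <= `|y - p| -> v y = 0 & forall y, `|u y - v y| <= e].
move=> n0 cu d0 e0 u0.
have [d1 d10 Hd1] := cc_unif cu (divr_gt0 e0 (ltr0Sn R 1)).
pose r := Num.min d1 d; have r0: 0 < r by rewrite lt_min d10.
pose K := [set y: V | `|y - p| <= d].
have [s sK Ks] : exists2 s: seq V, {in s, forall x, K x} & forall x, K x -> exists2 y, y \in s & [set z: V | `|z - y| < r] x.
 apply: finite_cover; first exact: cube_cpt.
  by move=> x _; exact: cubeO.
 by move=> x _; rewrite /= subrr normr0.
pose P y := \sum_(q <- s) bumpq q r y.
have cb q: Ck 1 setT (bumpq q r) by have /sm_onP/(_ 1%N) := bumpq_sm q r openT.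
have cP: Ck 1 setT P by apply: Ck_sum; [exact: openT|move=> q _; exact: cb].
have P0 y: 0 <= P y by apply: sumr_ge0=> q _; exact: bumpq_ge0.
have PK y: K y -> 0 < P y.
 move=> Ky; have [q qs yq] := Ks y Ky; rewrite /P (big_rem q)//= ltr_pwDl ?bump_gt0//.
 by apply: sumr_ge0=> i _; exact: bumpq_ge0.
have [M M0 HM] : exists2 M, 0 < M & forall y, K y -> `|(P y)^-1 * u y| <= M.
 apply: cpt_bd; first exact: cube_cpt.
 move=> y Ky; apply: cont_atM; last exact: cu.1.
 apply: cont_atV; first by rewrite gt_eqF// PK.
 exact: (Ck_cont cP (y:=y)).
pose et := e / 2 / M; have et0: 0 < et by rewrite !divr_gt0.
have Pe0 y: 0 < P y + et by rewrite ltr_wpDl.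
exists (fun y=> (\sum_(q <- s) u q * bumpq q r y) * (P y + et)^-1); split.
- apply: Ck_M; first exact: openT.
  apply: Ck_sum; first exact: openT.
  move=> q _; apply: Ck_M; [exact: openT|exact: Ck_cst|exact: cb].
 apply: Ck_V; first exact: openT.
  by move=> y _; rewrite gt_eqF.
 apply: Ck_D; [exact: openT|exact: cP|exact: Ck_cst].
- move=> y yd; rewrite big_seq big1 ?mul0r// => q qs.
 rewrite bump_eq0 ?mulr0// ?(ltW r0)//.
 have: r <= d by rewrite ge_min lexx orbT.
 move=> /le_trans; apply; have := ler_normD (y - q) (q - p); rewrite addrA subrK=> yqp.
 have: `|q - p| <= d := sK q qs.
 move: yd yqp; move: (`|y - p|) (`|y - q|) (`|q - p|)=> a b c; lra.
- move=> y.
 have -> : u y - (\sum_(q <- s) u q * bumpq q r y) * (P y + et)^-1 =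
   (\sum_(q <- s) (u y - u q) * bumpq q r y) / (P y + et) + et * u y / (P y + et).
  under [in RHS]eq_bigr do rewrite mulrBl.
  rewrite sumrB -mulr_sumr -/(P y).
  by move: (Pe0 y)=> /lt0r_neq0 Pe; field.
 rewrite (splitr e) (le_trans (ler_normD _ _))// lerD//.
  rewrite normrM normfV (gtr0_norm (Pe0 y)) ler_pdivrMr//.
  apply: (@le_trans _ _ (e / 2 * P y)); last by rewrite ler_wpM2l// ?divr_ge0 ?ltW// ltrDl.
  rewrite /P mulr_sumr (le_trans (ler_norm_sum _ _ _))//; apply: ler_sum=> q _.
  rewrite normrM (ger0_norm (bumpq_ge0 _ _ _)).
  have [rq|rq] := leP r `|y - q|.
   by rewrite bump_eq0// ?(ltW r0)// !mulr0.
  rewrite ler_wpM2r ?bumpq_ge0//; apply: ltW.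
  have := Hd1 q (y - q); rewrite (addrC q) subrK; apply.
  by rewrite (lt_le_trans rq)// ge_min lexx.
 have [dy|yd] := leP d `|y - p|; first by rewrite u0// mulr0 mul0r normr0 divr_ge0// ltW.
 have Ky: K y by exact: ltW.
 have HM': `|u y| <= M * P y.
  by have := HM y Ky; rewrite normrM normfV (gtr0_norm (PK y Ky)) mulrC ler_pdivrMr ?PK.
 rewrite normrM normfV normrM (gtr0_norm et0) (gtr0_norm (Pe0 y)) ler_pdivrMr//.
 apply: (@le_trans _ _ (et * (M * P y))); first by rewrite ler_wpM2l// ltW.
 rewrite mulrA /et divfK ?gt_eqF// ler_wpM2l// ?divr_ge0// ?(ltW e0)//.
 by rewrite lerDl ltW.
Qed.

(** Integrands on the manifold are only continuous, whereas the deformation argument differentiates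
    [h]; both integrals are stable under uniform approximation with controlled support. *)
Lemma change_var_cont (U: set V) (Phi: V -> V) p: n != 0%N -> open U -> U p ->
 Ckv 2 U Phi ->
 \det (jac Phi p) != 0 -> exists2 r0, 0 < r0 & forall r, 0 < r <= r0 ->
 exists2 d, 0 < d & forall h, cc h -> (forall z, d <= `|z - Phi p| -> h z = 0) ->
  iint (fun y=> if `|y - p| < r then h (Phi y) * `|\det (jac Phi y)| else 0) = iint h.
move=> n0 oU Up cPhi dP.
have [r1 r10 Hr1] := change_var_local oU Up cPhi dP.
have [r2 r20 Hr2] := ballcO oU Up.
(* [Phi] stretches distances from [p] by at least half the factor of its linear part, so [h]
   composed with [Phi] vanishes near the boundary of the cube. *)
have [m m0 [r3 r30 low]] : exists2 m, 0 < m & exists2 r3, 0 < r3 &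
  forall y, `|y - p| < r3 -> m * `|y - p| <= `|Phi y - Phi p|.
 pose M := (jac Phi p)^T.
 have uM: M \in unitmx by rewrite unitmxE det_tr unitfE.
 have [m m0 low] := unitmx_low uM.
 exists (m / 2); first exact: divr_gt0.
 have /nbhs_ballP[d /= d0 Hd] := jac_lin_eps oU Up (fun i=> Ck_S (cPhi i)) (divr_gt0 m0 (ltr0Sn R 1)).
 exists d=>// y yd; have Hy: forall i, `|Phi y 0 i - aff (Phi p) p M y 0 i| <= m / 2 * `|y - p|.
  by apply: Hd; rewrite -ball_normE /= distrC.
 have Hy': `|Phi y - aff (Phi p) p M y| <= m / 2 * `|y - p|.
  apply/norm_leP; first by rewrite mulr_ge0// divr_ge0// ltW.
  by move=> i; rewrite 2!mxE; exact: Hy.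
 have := low (y - p); rewrite -(aff_diff (Phi p) p).
 have -> : aff (Phi p) p M p = Phi p by rewrite /aff subrr mul0mx addr0.
 have := ler_normD (Phi y - Phi p) (aff (Phi p) p M y - Phi y).
 rewrite [X in `|X| <= _](_: _ = aff (Phi p) p M y - Phi p); last by rewrite addrC addrA subrK.
 move: Hy'; rewrite -[`|aff _ _ _ _ - Phi y|]distrC.
 move: (`|y - p|) (`|Phi y - Phi p|) (`|Phi y - aff _ _ _ _|) (`|aff _ _ _ _ - Phi p|)=> a b c d'.
 lra.
pose r0 := Num.min r1 (Num.min r2 r3).
exists r0; first by rewrite !lt_min r10 r20.
move=> r /andP[r00]; rewrite !le_min=> /and3P[rr1 rr2 rr3].
have [|d d0 Hd] := Hr1 r; first by rewrite r00.
(* Half of the available radius, because the approximation doubles the support. *)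
pose d1 := Num.min d (m * (r / 2)) / 2.
have d10: 0 < d1 by rewrite divr_gt0// lt_min d0 mulr_gt0// divr_gt0.
exists d1=>// h ch h0.
have BU: [set y | `|y - p| < r] `<=` U by move=> y /= yr; apply: Hr2; rewrite /= (le_trans _ rr2)// ltW.
have oB := @cubeO R n p r.
have cdet := Ck_det_jac oU cPhi.
have cF (g: V -> R): cc g -> (forall z, 2 * d1 <= `|z - Phi p| -> g z = 0) ->
  cc (fun y=> if `|y - p| < r then g (Phi y) * `|\det (jac Phi y)| else 0).
 move=> cg g0; split; last first.
  exists (r + `|p|)=> y ry; case: ifPn=>// yr; have := lerB_dist y p.
  by move: ry yr; move: (`|y|) (`|y - p|) (`|p|)=> a b c ? ? ?; lra.
 move=> y; have [yr|yr] := ltP `|y - p| (r * (3 / 4)).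
  have yr': `|y - p| < r by lra.
  have cc1: {for y, continuous (fun y=> g (Phi y) * `|\det (jac Phi y)|)}; last first.
   apply: cont_near cc1.
   by apply: (nearO oB yr')=> z /= ->.
  apply: cont_atM.
   apply: (@continuous_comp _ _ _ Phi g); last exact: cg.1.
   by apply: cont_rV=> i; apply: (Ck_cont (cPhi i)); exact: BU.
  apply: (@continuous_comp _ _ _ (fun y=> \det (jac Phi y)) Num.norm); last exact: norm_continuous.
  by apply: (Ck_cont cdet); exact: BU.
 apply: (@cont_near _ _ (fun=> 0)); last exact: cont_cst.
 have oC := closed_openC (@cubeC R n p (r / 2)).
 apply: (nearO oC)=> [|z zr]; first by apply/negP; rewrite -ltNge; lra.
 case: ifP=>// zr'; rewrite g0 ?mul0r//.
 apply: le_trans (low _ (lt_le_trans zr' rr3)).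
 rewrite /d1 mulrC divfK// ge_min; apply/orP; right; rewrite ler_pM2l// ltW// ltNge; exact/negP.
set F := fun y: V=> _; suff H (e: R): 0 < e -> `|iint F - iint h| <= e.
 by apply/eqP; rewrite -subr_eq0 -normr_le0; apply/ler_addgt0Pr=> e /H; rewrite add0r.
move=> e0.
have [C C0 HC] : exists2 C, 0 < C & forall y, `|y - p| <= r -> `| `|\det (jac Phi y)| | <= C.
 apply: cpt_bd=> [|y yr]; first exact: cube_cpt.
 apply: (@continuous_comp _ _ _ (fun y=> \det (jac Phi y)) Num.norm); last exact: norm_continuous.
 by apply: (Ck_cont cdet); apply: Hr2; rewrite /= (le_trans yr).
set L1 := (r + `|p|); set L2 := 2 * d1 + `|Phi p|.
(* The first two terms measure the effect of a uniform error on the two integrals; the 1 keeps [B]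
   positive. *)
pose B := C * (2 * L1) ^+ n + (2 * L2) ^+ n + 1.
have L10: 0 <= L1 by rewrite addr_ge0// ltW.
have L20: 0 <= L2 by rewrite addr_ge0// mulr_ge0// ltW.
have B0: 0 < B by rewrite /B ltr_wpDl// addr_ge0 ?mulr_ge0 ?exprn_ge0 ?mulr_ge0// ltW.
have [v [cv v0 uv]] := approx_C1 n0 ch d10 (divr_gt0 e0 B0) h0.
have ccv: cc v := Ck_cc cv (sp_ball v0).
have h0' z: 2 * d1 <= `|z - Phi p| -> h z = 0.
 by move=> zd; apply: h0; apply: le_trans zd; rewrite ler_peMl ?ltW// ltr1n.
have Hv: iint (fun y=> if `|y - p| < r then v (Phi y) * `|\det (jac Phi y)| else 0) = iint v.
 apply: Hd=>// z dz; apply: v0; apply: le_trans dz.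
 by rewrite /d1 mulrC divfK// ge_min lexx.
have -> : iint F - iint h = (iint F - iint (fun y=> if `|y - p| < r then v (Phi y) * `|\det (jac Phi y)| else 0)) + (iint v - iint h).
 by rewrite Hv addrA subrK.
have eB := divr_gt0 e0 B0.
have e1: e = e / B * (C * (2 * L1) ^+ n) + e / B * (2 * L2) ^+ n + e / B.
 by rewrite -mulrDr -[X in _ + X]mulr1 -mulrDr -/B divfK// gt_eqF.
rewrite -(iintB (cF _ ch h0') (cF _ ccv v0)) -(iintB ccv ch).
rewrite (le_trans (ler_normD _ _))// [leRHS]e1 ler_wpDr ?(ltW eB)// lerD// ?mulrA.
 apply: iint_bd=>//.
 - exact: cc_D (cF _ ch h0') (cc_N (cF _ ccv v0)).
 - move=> y; rewrite /L1=> ry; case: ifPn=> yr; last by rewrite subrr.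
  have := lerB_dist y p.
  by move: ry yr; move: (`|y|) (`|y - p|) (`|p|)=> a b c ? ? ?; lra.
 - move=> y; case: ifPn=> yr; last by rewrite subrr normr0 mulr_ge0// ltW.
  by rewrite -mulrBl normrM ler_pM//; exact: HC (ltW yr).
apply: iint_bd=>//.
- exact: cc_D ccv (cc_N ch).
- by move=> y Ly; rewrite (sp_ball v0 Ly) (sp_ball h0' Ly) subrr.
- by move=> y; rewrite distrC.
Qed.

End Covers.

(** * Charts, partitions of unity, and integration on a compact manifold *)

Section Charts.
Variables (R: realType) (n: nat) (X: manifold R n).
Local Notation V := 'rV[R]_n.
Implicit Types (c x p: X) (y: V).

Lemma dom_open c: open (chart_dom c). Proof. by case: X c=> T D I ch inv ? ? ? ? H ? ? ? ? c; have [] := H c. Qed.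
Lemma dom_self c: chart_dom c c. Proof. by case: X c=> T D I ch inv ? ? ? ? H ? ? ? ? c; have [] := H c. Qed.
Lemma im_open c: open (chart_im c). Proof. by case: X c=> T D I ch inv ? ? ? ? ? H ? ? ? c. Qed.
Lemma chimP c p: chart_dom c p -> chart_im c (chart c p).
by case: X c p=> T D I ch inv ? ? ? ? ? ? H ? ? c p /H []. Qed.
Lemma chartK c p: chart_dom c p -> chart_inv c (chart c p) = p.
by case: X c p=> T D I ch inv ? ? ? ? ? ? H ? ? c p /H []. Qed.
Lemma chart_cont c p: chart_dom c p -> {for p, continuous (chart c)}.
by case: X c p=> T D I ch inv ? ? ? ? ? ? H ? ? c p /H []. Qed.
Lemma chdomP c y: chart_im c y -> chart_dom c (chart_inv c y).
by case: X c y=> T D I ch inv ? ? ? ? ? ? ? H ? c y /H []. Qed.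
Lemma cinvK c y: chart_im c y -> chart c (chart_inv c y) = y.
by case: X c y=> T D I ch inv ? ? ? ? ? ? ? H ? c y /H []. Qed.
Lemma cinv_cont c y: chart_im c y -> {for y, continuous (chart_inv c)}.
by case: X c y=> T D I ch inv ? ? ? ? ? ? ? H ? c y /H []. Qed.
Lemma hausdorff: hausdorff_space X.
by case: X. Qed.
Lemma Mconnected: connected [set: X].
by case: X. Qed.
Lemma nonempty: [set: X] !=set0.
by case: X. Qed.

Definition olap c c' := chart_im c `&` chart_inv c @^-1` chart_dom c'.
Definition trans c c' y := chart c' (chart_inv c y).

Lemma trans_sm c c' i k: Ck k (olap c c') (fun y=> trans c c' y 0 i).
suff /sm_onP: smooth_on (olap c c') (fun y=> trans c c' y 0 i) by [].
by rewrite /olap /trans; case: X c c'=> T D I ch inv ? ? ? ? ? ? ? ? H c c'; exact: H.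
Qed.

Lemma cinv_open c (W: set X): open W -> open (chart_im c `&` chart_inv c @^-1` W).
move=> oW; rewrite openE=> y [cy Wy]; apply: filterI.
 exact: open_nbhs_nbhs (conj (@im_open c) cy).
by apply: (cinv_cont cy); exact: open_nbhs_nbhs (conj oW Wy).
Qed.

Lemma chart_open c (W: set V): open W -> open (chart_dom c `&` chart c @^-1` W).
move=> oW; rewrite openE=> y [cy Wy]; apply: filterI.
 exact: open_nbhs_nbhs (conj (@dom_open c) cy).
by apply: (chart_cont cy); exact: open_nbhs_nbhs (conj oW Wy).
Qed.

Lemma olapO c c': open (olap c c').
exact/cinv_open/dom_open. Qed.

Lemma olapP c c' p: chart_dom c p -> chart_dom c' p -> olap c c' (chart c p).
by move=> cp c'p; split; [exact: chimP|rewrite /preimage /= chartK]. Qed.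

(** Transposed because tangent vectors are rows. *)
Definition tmat c c' p: 'M[R]_n := (jac (trans c c') (chart c p))^T.

Lemma trans_dvb c c' y i v: olap c c' y -> derivable (fun y=> trans c c' y 0 i) y v.
 exact/Ck_dvb/(@trans_sm _ _ _ 1). Qed.

Lemma tmatE c c' p i v: chart_dom c p -> chart_dom c' p ->
 'D_v (fun y=> trans c c' y 0 i) (chart c p) = (v *m tmat c c' p) 0 i.
move=> cp c'p; have ov := olapP cp c'p.
rewrite der_coord; last exact: (Ck_diff (@olapO c c') (trans_sm c c' i 1) ov).
by rewrite mxE; apply: eq_bigr=> j _; rewrite !mxE.
Qed.

Lemma tchgE c c' p v: chart_dom c p -> chart_dom c' p ->
 tangent_change c c' p v = v *m tmat c c' p.
move=> cp c'p; apply/rowP=> i; rewrite -tmatE//.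
have ov := olapP cp c'p.
rewrite /tangent_change.
have dm: derivable (chart c' \o chart_inv c) (chart c p) v.
 apply/derivable_mxP=> a b; rewrite ord1.
 exact: trans_dvb ov.
by rewrite (derive_mx dm) mxE.
Qed.

Lemma tmat_comp c c' c'' p: chart_dom c p -> chart_dom c' p -> chart_dom c'' p ->
 tmat c c' p *m tmat c' c'' p = tmat c c'' p.
move=> cp c'p c''p; apply/row_matrixP=> i; rewrite !rowE mulmxA; apply/rowP=> j.
have ov := olapP cp c'p.
rewrite -tmatE// -[in RHS]tmatE//.
pose W := olap c c' `&` olap c c''.
have oW: open W by apply: openI; exact: olapO.
have Wp: W (chart c p) by split; exact: olapP.
have E: \forall y \near chart c p, trans c c'' y 0 j = trans c' c'' (trans c c' y) 0 j.
 by apply: (nearO oW Wp)=> y [[cy c'y] _]; rewrite /trans chartK.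
rewrite (near_eq_derive _ E).
have ov' := olapP c'p c''p.
have tp: trans c c' (chart c p) = chart c' p by rewrite /trans chartK.
rewrite (der_comp (phi:=trans c c') (F:=fun y=> trans c' c'' y 0 j)
 (fun i=> trans_dvb ov) _).2 ?tp; last first.
 exact: (Ck_diff (@olapO c' c'') (trans_sm c' c'' j 1) ov').
congr ('D_ _ _ _); apply/rowP=> k; by rewrite [in RHS]mxE tmatE.
Qed.

Lemma tmat_id c p: chart_dom c p -> tmat c c p = 1%:M.
move=> cp; apply/row_matrixP=> i; rewrite !rowE; apply/rowP=> j; rewrite -tmatE// mulmx1.
rewrite -(der_rV j (chart c p) 'e_i).2; apply: near_eq_derive.
apply: (nearO (im_open (c:=c)) (chimP cp))=> y cy.
by rewrite /trans cinvK.
Qed.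

Lemma tmat_unit c c' p: chart_dom c p -> chart_dom c' p -> tmat c c' p \in unitmx.
move=> cp c'p; have := tmat_comp cp c'p cp; rewrite tmat_id// => E.
by case/mulmx1_unit: E.
Qed.

Lemma fchE c y v: chart_im c y -> from_chart c y v = v *m tmat c (chart_inv c y) (chart_inv c y).
by move=> cy; rewrite /from_chart tchgE//; [exact: chdomP|exact: dom_self]. Qed.

(** The Gram matrix of the coordinate vectors is [A *m g *m A^T]. *)
Lemma densE g c y: chart_im c y -> density g c y =
 `|\det (tmat c (chart_inv c y) (chart_inv c y))| * Num.sqrt (\det (g (chart_inv c y))).
move=> cy; set A := tmat _ _ _; rewrite /density.
have -> : \matrix_(i, j) metric g (chart_inv c y) (from_chart c y 'e_i) (from_chart c y 'e_j)
  = A *m g (chart_inv c y) *m A^T.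
 apply/matrixP=> i j; rewrite mxE /metric !fchE// -/A trmx_mul trmx_delta !mulmxA.
 by rewrite -colE mxE -!mulmxA -rowE mxE.
have -> : \det (A *m g (chart_inv c y) *m A^T) = \det A ^+ 2 * \det (g (chart_inv c y)).
 clearbody A; rewrite !det_mulmx det_tr expr2; exact: mulrAC.
by rewrite sqrtrM ?sqr_ge0// sqrtr_sqr.
Qed.

Lemma dens_trans g c c' p: chart_dom c p -> chart_dom c' p ->
 density g c (chart c p) = `|\det (jac (trans c c') (chart c p))| * density g c' (chart c' p).
move=> cp c'p; have pp := dom_self p.
rewrite !densE ?chartK//; [|exact: chimP..].
by rewrite -(tmat_comp cp c'p pp) det_mulmx normrM /tmat !det_tr mulrA.
Qed.

Definition cintd (g: X -> 'M[R]_n) c (f: X -> R) y :=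
 if y \in chart_im c then f (chart_inv c y) * density g c y else 0.
Definition cint g c f := iint (cintd g c f).

Definition sptd (K: set X) (f: X -> R) := forall x, ~ K x -> f x = 0.
Definition cont_dens g := forall c y, chart_im c y -> {for y, continuous (density g c)}.

Lemma cimg_cpt c (K: set X): compact K -> K `<=` chart_dom c -> compact (chart c @` K).
move=> cK Kc; apply: continuous_compact=>//; apply: continuous_in_subspaceT=> x.
by rewrite inE=> /Kc; exact: chart_cont.
Qed.

Lemma cinv_image_cpt c (K: set V): compact K -> K `<=` chart_im c -> compact (chart_inv c @` K).
move=> cK Kc; apply: continuous_compact=>//; apply: continuous_in_subspaceT=> x.
by rewrite inE=> /Kc; exact: cinv_cont.
Qed.

Lemma cpt_closed (K: set X): compact K -> closed K.
exact: compact_closed hausdorff. Qed.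

Lemma cintd_in g c f y: chart_im c y ->
 cintd g c f y = f (chart_inv c y) * density g c y.
by move=> cy; rewrite /cintd mem_set. Qed.

Lemma cintd0 g c f y: ~ chart_im c y -> cintd g c f y = 0.
by move=> cy; rewrite /cintd memNset. Qed.

Lemma cintd_cc g c f (K: set X): cont_dens g -> continuous f ->
 compact K -> K `<=` chart_dom c -> sptd K f -> cc (cintd g c f).
move=> cg cf cK Kc Kf; have cI := cimg_cpt cK Kc.
have out y: ~ (chart c @` K) y -> cintd g c f y = 0.
 move=> nK; have [cy|ny] := pselect (chart_im c y); last exact: cintd0.
 rewrite cintd_in// Kf ?mul0r// => Ky; apply: nK; exists (chart_inv c y)=>//.
 exact: cinvK.
split=> [y|].
 have [cy|ny] := pselect (chart_im c y).
  have c1: {for y, continuous (fun y=> f (chart_inv c y) * density g c y)}.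
   apply: cont_atM; last exact: cg.
   by apply: (@continuous_comp _ _ _ (chart_inv c) f); [exact: cinv_cont|exact: cf].
  apply: cont_near c1; apply: (nearO (im_open (c:=c)) cy)=> z cz.
  by rewrite cintd_in.
 apply: (@cont_near _ _ (fun=> 0)); last exact: cont_cst.
 have oC := closed_openC (compact_closed (@norm_hausdorff _ _) cI).
 apply: (nearO oC)=> [|z /out//]; move=> [x Kx xy]; apply: ny; rewrite -xy.
 by apply: chimP; exact: Kc.
have [M [_ HM]] := compact_bounded cI; exists (M + 1)=> y My; apply: out=> Ky.
have := HM (M + 1); rewrite ltrDl ltr01=> /(_ isT y Ky) /(lt_le_trans My).
by rewrite ltxx.
Qed.

(** [W] is small in both charts: inside the cube where the local formula holds, and inside the ball
    where its test functions must be supported. *)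
Lemma cint_change_local g c c' p: n != 0%N -> cont_dens g ->
 chart_dom c p -> chart_dom c' p -> exists2 W: set X, open W /\ W p &
 forall f K, continuous f -> compact K -> K `<=` W -> sptd K f ->
  cint g c f = cint g c' f.
move=> n0 cg cp c'p; have ov := olapP cp c'p.
have dP: \det (jac (trans c c') (chart c p)) != 0.
 by have := tmat_unit cp c'p; rewrite unitmxE det_tr unitfE.
have Pp: trans c c' (chart c p) = chart c' p by rewrite /trans chartK.
have [r0 r00 Hr0] := change_var_cont n0 (@olapO c c') ov (fun i=> trans_sm c c' i 2) dP.
have [r1 r10 Hr1] := ballcO (@olapO c c') ov.
pose r := Num.min r0 r1; have [|d d0 Hd] := Hr0 r.
 by rewrite lt_min r00 r10 ge_min lexx.
have rr1: r <= r1 by rewrite ge_min lexx orbT.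
have rpos: 0 < r by rewrite lt_min r00.
exists ((chart_dom c `&` chart c @^-1` [set y | `|y - chart c p| < r]) `&`
    (chart_dom c' `&` chart c' @^-1` [set y | `|y - chart c' p| < d])).
 split; first by apply: openI; apply: chart_open; exact: cubeO.
 by split; split=>//; rewrite /preimage /= subrr normr0.
move=> f K cf cK KW Kf.
have c2 := cintd_cc cg cf cK (fun x Kx=> (KW x Kx).2.1) Kf.
have h0 z: d <= `|z - trans c c' (chart c p)| -> cintd g c' f z = 0.
 rewrite Pp=> dz; have [c'z|] := pselect (chart_im c' z); last exact: cintd0.
 rewrite cintd_in// Kf ?mul0r// => /KW[_ [_]]; rewrite /preimage /= cinvK//.
 by move/(le_lt_trans dz); rewrite ltxx.
apply: etrans (Hd _ c2 h0).
congr iint; apply/funext=> y; have [yr|yr] := ltP `|y - chart c p| r.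
 have [cy c'y] : olap c c' y by apply: Hr1; rewrite /= (le_trans _ rr1)// ltW.
 have dy := chdomP cy.
 rewrite cintd_in// cintd_in; last exact: chimP.
 rewrite /trans chartK// -mulrA; congr (_ * _).
 by have := dens_trans g dy c'y; rewrite cinvK// mulrC.
have [cy|] := pselect (chart_im c y); last exact: cintd0.
rewrite cintd_in// Kf ?mul0r// => /KW[[_]]; rewrite /preimage /= cinvK//.
by move=> /(le_lt_trans yr); rewrite ltxx.
Qed.

Definition sfun (f: X -> R) := forall c k, Ck k (chart_im c) (fun y=> f (chart_inv c y)).

Lemma sf_cont f: sfun f -> continuous f.
move=> sf x; have cx := dom_self x.
have c1: {for x, continuous (fun x'=> f (chart_inv x (chart x x')))}.
 apply: (@continuous_comp _ _ _ (chart x) (fun y=> f (chart_inv x y))); first exact: chart_cont.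
 exact: (Ck_cont (sf x 0%N) (chimP cx)).
have E: \forall x' \near x, f (chart_inv x (chart x x')) = f x'.
 apply: filterS (open_nbhs_nbhs (conj (@dom_open x) cx))=> x' /= /chartK.
 by move=> ->.
rewrite /continuous_at -(nbhs_singleton E).
exact: cvg_trans (near_eq_cvg E) c1.
Qed.

Definition bump p r x := if `[< chart_dom p x >] then bumpq (chart p p) r (chart p x) else 0.

Lemma bump_ge0 p r x: 0 <= bump p r x.
by rewrite /bump; case: ifP=>// _; exact: bumpq_ge0. Qed.

Lemma bump_sptd p r: n != 0%N -> 0 <= r ->
 sptd (chart_inv p @` [set y | `|y - chart p p| <= r]) (bump p r).
move=> n0 r0 x nx; rewrite /bump; case: asboolP=>// px.
rewrite bump_eq0// leNgt; apply/negP=> /ltW h.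
by apply: nx; exists (chart p x)=>//; exact: chartK.
Qed.

Lemma bump_sm p r: n != 0%N -> 0 < r -> [set y | `|y - chart p p| <= r] `<=` chart_im p ->
 sfun (bump p r).
move=> n0 r0 rp c k; set K := chart_inv p @` [set y | `|y - chart p p| <= r].
have cK: compact K by apply: cinv_image_cpt=>//; exact: cube_cpt.
have oK := closed_openC (cpt_closed cK).
have Kp: K `<=` chart_dom p by move=> _ [y /rp py <-]; exact: chdomP.
have oW := @cinv_open c _ oK.
apply: (@Ck_sub _ _ _ _ (olap c p `|` (chart_im c `&` chart_inv c @^-1` (~` K)))).
 move=> y cy; have [Ky|nK] := pselect (K (chart_inv c y)); [left|right]; split=>//.
 exact: Kp.
apply: Ck_setU.
 apply: (@Ck_ext _ _ _ _ (fun y=> bumpq (chart p p) r (trans c p y))).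
 - exact: olapO.
 - by move=> y [cy py]; rewrite /bump asboolT.
 - apply: (@Ck_comp _ _ _ _ _ setT (trans c p))=>//.
  + exact: olapO.
  + exact: openT.
  + by move=> i; exact: trans_sm.
  + exact: (iffLR (@sm_onP _ _ _ _) (bumpq_sm _ _ openT)).
apply: (@Ck_ext _ _ _ _ (fun=> 0))=>//; last exact: Ck_cst.
by move=> y [cy nK]; rewrite bump_sptd// ltW.
Qed.

Hypothesis cptX: compact [set: X].
Hypothesis n0: n != 0%N.

(** Bumps on coordinate cubes contained in [N p], finitely many by compactness, divided by their
    sum. *)
Lemma sm_part (N: X -> set X): (forall p, open (N p)) -> (forall p, N p p) ->
 exists m (c: 'I_m -> X) (r: 'I_m -> X -> R),
 [/\ forall i, sfun (r i), forall i x, 0 <= r i x,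
   forall i, exists K, [/\ compact K, K `<=` N (c i), K `<=` chart_dom (c i) & sptd K (r i)] &
   forall x, \sum_i r i x = 1].
move=> oN Np.
have H p: {e: R | 0 < e & [set y | `|y - chart p p| <= e] `<=` chart_im p `&` chart_inv p @^-1` N p}.
 apply: cid2; apply: ballcO; first exact: cinv_open.
 split; first exact/chimP/dom_self.
 by rewrite /preimage /= chartK//; exact: dom_self.
pose e p := s2val (H p).
have e0 p: 0 < e p by rewrite /e; case: (H p).
have eim p: [set y | `|y - chart p p| <= e p] `<=` chart_im p.
 by rewrite /e; case: (H p)=> d /= _ Hd y /Hd[].
have eN p: chart_inv p @` [set y | `|y - chart p p| <= e p] `<=` N p.
 by rewrite /e; case: (H p)=> d /= _ Hd _ [y /Hd[_ Ny] <-].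
clearbody e; clear H.
have oB p (_: [set: X] p): open (chart_dom p `&` chart p @^-1` [set y | `|y - chart p p| < e p]).
 by apply: chart_open; exact: cubeO.
have pB p (_: [set: X] p): (chart_dom p `&` chart p @^-1` [set y | `|y - chart p p| < e p]) p.
 by split; [exact: dom_self|rewrite /preimage /= subrr normr0].
have [s _ Hs] := finite_cover cptX oB pB.
pose c (i: 'I_(size s)) := tnth (in_tuple s) i.
pose b i := bump (c i) (e (c i)).
have sb i: sfun (b i) by apply: bump_sm=>//; exact: eim.
have P0 x: 0 < \sum_i b i x.
 have [p ps [px xe]] := Hs x I; have [i Ei] := tnthP (in_tuple s) p ps.
 rewrite (bigD1 i)//= ltr_pwDl ?sumr_ge0// => [|j _]; last exact: bump_ge0.
 by rewrite /b /bump /c -Ei asboolT// bump_gt0.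
exists (size s), c, (fun i x=> b i x * (\sum_i b i x)^-1); split.
- move=> i c0 k; have oI := @im_open c0.
 apply: (Ck_M oI (sb i c0 k)); apply: Ck_V=>//; first by move=> y _; rewrite gt_eqF.
 by apply: Ck_sum=>// j _; exact: sb.
- by move=> i x; rewrite mulr_ge0 ?bump_ge0// invr_ge0 ltW.
- move=> i; exists (chart_inv (c i) @` [set y | `|y - chart (c i) (c i)| <= e (c i)]); split.
 + by apply: cinv_image_cpt=>//; exact: cube_cpt.
 + exact: eN.
 + by move=> _ [y /eim cy <-]; exact: chdomP.
 + by move=> x nK; rewrite /b bump_sptd ?mul0r// ltW.
- by move=> x; rewrite -mulr_suml divff// gt_eqF.
Qed.

Variable g: X -> 'M[R]_n.
Hypothesis g_dens: cont_dens g.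

Lemma contfM (f h: X -> R): continuous f -> continuous h -> continuous (fun x=> f x * h x).
by move=> cf ch x; exact: (cont_atM (cf x) (ch x)). Qed.

Lemma cint_sum m c (r: 'I_m -> X -> R) f (K: set X): (forall i, continuous (r i)) ->
 (forall x, \sum_i r i x = 1) -> continuous f -> compact K -> K `<=` chart_dom c -> sptd K f ->
 cint g c f = \sum_i cint g c (fun x=> r i x * f x).
move=> cr r1 cf cK Kc Kf; rewrite /cint -iint_sum=> [|i _]; last first.
 apply: (cintd_cc g_dens _ cK Kc); first exact: contfM.
 by move=> x /Kf ->; rewrite mulr0.
congr iint; apply/funext=> y; have [cy|ny] := pselect (chart_im c y).
 rewrite cintd_in//; under eq_bigr do rewrite cintd_in//.
 by rewrite -mulr_suml -mulr_suml r1 mul1r.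
by rewrite cintd0// big1// => i _; exact: cintd0.
Qed.

Lemma cint0 c f: (forall x, chart_dom c x -> f x = 0) -> cint g c f = 0.
move=> f0; rewrite /cint (_: cintd _ _ _ = fun=> 0) ?iint0//.
apply/funext=> y; have [cy|] := pselect (chart_im c y); last exact: cintd0.
by rewrite cintd_in// f0 ?mul0r//; exact: chdomP.
Qed.

(** A partition of unity subordinate to neighbourhoods that either miss [K] or carry the local
    formula reduces the claim to [cint_change_local]. *)
Lemma cint_change c c' f (K: set X): continuous f -> compact K -> K `<=` chart_dom c ->
 K `<=` chart_dom c' -> sptd K f -> cint g c f = cint g c' f.
move=> cf cK Kc Kc' Kf.
have oK := closed_openC (cpt_closed cK).
have H p: exists W: set X, [/\ open W, W p & (forall x, W x -> ~ K x) \/ forall f K, continuous f -> compact K -> K `<=` W -> sptd K f ->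
  cint g c f = cint g c' f].
 have [Kp|nK] := pselect (K p).
  have [W [oW Wp] HW] := cint_change_local n0 g_dens (Kc p Kp) (Kc' p Kp).
  by exists W; split=>//; right.
 by exists (~` K); split=>//; left.
have [N HN] := choice H.
have [m [d [r [sr _ Hr r1]]]] := sm_part (fun p=> let: And3 h _ _ := HN p in h)
 (fun p=> let: And3 _ h _ := HN p in h).
have cr i := sf_cont (sr i).
rewrite (cint_sum cr r1 cf cK Kc Kf) (cint_sum cr r1 cf cK Kc' Kf).
apply: eq_bigr=> i _; have [Ki [cKi KN Kd Kr]] := Hr i.
have cri := contfM (cr i) cf.
have [_ _ [nK|same]] := HN (d i).
 rewrite !cint0// => x _.
  have [/KN/nK/Kf ->|/Kr ->] := pselect (Ki x); [exact: mulr0|exact: mul0r].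
 have [/KN/nK/Kf ->|/Kr ->] := pselect (Ki x); [exact: mulr0|exact: mul0r].
by apply: (same _ Ki)=>// x /Kr ->; rewrite mul0r.
Qed.

Lemma part_cpt m (c: 'I_m -> X) r: partition_of_unity c r ->
 forall i, exists K, [/\ compact K, K `<=` chart_dom (c i) & sptd K (r i)].
move=> [_ _ rc _] i; exists (closure [set x | r i x != 0]); split.
- by apply: (subclosed_compact _ cptX)=>//; exact: closed_closure.
- exact: rc.
- move=> x nx; apply/eqP/negPn/negP=> rx; apply: nx; exact: subset_closure.
Qed.

(** Both sides equal the double sum over the products of the two partitions, each term of which is
    supported in two charts at once. *)
Lemma part_indep m (c: 'I_m -> X) r m' (c': 'I_m' -> X) r' f:
 partition_of_unity c r -> partition_of_unity c' r' -> continuous f ->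
 \sum_i cint g (c i) (fun x=> r i x * f x) =
 \sum_i cint g (c' i) (fun x=> r' i x * f x).
move=> pr pr' cf; have Hr := part_cpt pr; have Hr' := part_cpt pr'.
case: (pr) (pr')=> [cr _ _ r1] [cr' _ _ r1'].
transitivity (\sum_i \sum_j cint g (c i) (fun x=> r' j x * (r i x * f x))).
 apply: eq_bigr=> i _; have [K [cK Kc Kr]] := Hr i.
 apply: (@cint_sum _ _ _ _ K)=>//; first exact: contfM.
 by move=> x /Kr ->; rewrite mul0r.
rewrite exchange_big; apply: eq_bigr=> j _; have [K' [cK' Kc' Kr']] := Hr' j.
transitivity (\sum_i cint g (c' j) (fun x=> r i x * (r' j x * f x))); last first.
 apply/esym/(@cint_sum _ _ _ _ K')=>//; first exact: contfM.
 by move=> x /Kr' ->; rewrite mul0r.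
apply: eq_bigr=> i _; have [K [cK Kc Kr]] := Hr i.
have -> : (fun x=> r' j x * (r i x * f x)) = (fun x=> r i x * (r' j x * f x)).
 by apply/funext=> x; ring.
apply: (@cint_change _ _ _ (K `&` K')).
- by apply: contfM=>//; exact: contfM.
- apply: (subclosed_compact _ cptX)=>//.
 by apply: closedI; exact: cpt_closed.
- by move=> x [/Kc].
- by move=> x [_ /Kc'].
- move=> x nK; have [Kx|/Kr ->] := pselect (K x); last by rewrite mul0r.
 have [K'x|/Kr' ->] := pselect (K' x); last by rewrite mul0r mulr0.
 by exfalso; apply: nK.
Qed.

Lemma part_ex: exists m (c: 'I_m -> X) (r: 'I_m -> X -> R), partition_of_unity c r.
have [m [c [r [sr r0 Hr r1]]]] := sm_part (N:=fun=> setT) (fun=> openT) (fun=> I).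
exists m, c, r; split=>// i; first exact: sf_cont.
have [K [cK _ Kc Kr]] := Hr i.
have KE := (closure_id K).1 (cpt_closed cK).
apply: subset_trans Kc; rewrite [X in _ `<=` X]KE.
by apply: closure_subset=> x /= rx; apply: contrapT=> /Kr /eqP; apply/negP.
Qed.

(** By [part_indep] there is only one candidate for the value chosen by [xget]. *)
Lemma ivolE m (c: 'I_m -> X) r f: partition_of_unity c r -> continuous f ->
 integral_vol g f = \sum_i cint g (c i) (fun x=> r i x * f x).
move=> pr cf; apply: xget_unique; first by exists m, c, r.
by move=> _ [m' [c' [r' [pr' ->]]]]; exact: part_indep pr' pr cf.
Qed.

Lemma ivol_chart c f (K: set X): continuous f -> compact K -> K `<=` chart_dom c ->
 sptd K f -> integral_vol g f = cint g c f.
move=> cf cK Kc Kf; have [m [d [r pr]]] := part_ex.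
rewrite (ivolE pr cf); have Hr := part_cpt pr; case: pr=> [cr _ _ r1].
rewrite (cint_sum cr r1 cf cK Kc Kf); apply: eq_bigr=> i _.
have [K' [cK' Kc' Kr']] := Hr i.
apply: (@cint_change _ _ _ (K `&` K')).
- exact: contfM.
- apply: (subclosed_compact _ cptX)=>//.
 by apply: closedI; exact: cpt_closed.
- by move=> x [_ /Kc'].
- by move=> x [/Kc].
- move=> x nK; have [Kx|/Kf ->] := pselect (K x); last by rewrite mulr0.
 have [K'x|/Kr' ->] := pselect (K' x); last by rewrite mul0r.
 by exfalso; apply: nK.
Qed.

Lemma part_cc m (c: 'I_m -> X) r f i: partition_of_unity c r -> continuous f ->
 cc (cintd g (c i) (fun x=> r i x * f x)).
move=> pr cf; have [K [cK Kc Kr]] := part_cpt pr i; case: pr=> [cr _ _ r1].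
apply: (cintd_cc g_dens _ cK Kc); first exact: contfM.
by move=> x /Kr ->; rewrite mul0r.
Qed.

Lemma ivolD f h: continuous f -> continuous h ->
 integral_vol g (fun x=> f x + h x) = integral_vol g f + integral_vol g h.
move=> cf ch; have [m [c [r pr]]] := part_ex.
have cfh: continuous (fun x=> f x + h x) by move=> x; exact: cont_atD (cf x) (ch x).
rewrite !(ivolE pr)// -big_split /=; apply: eq_bigr=> i _.
rewrite /cint -iintD; [|exact: part_cc..].
congr iint; apply/funext=> y; rewrite /cintd; case: ifP=> _; last by rewrite addr0.
ring.
Qed.

Lemma ivolZ (a: R) f: continuous f ->
 integral_vol g (fun x=> a * f x) = a * integral_vol g f.
move=> cf; have [m [c [r pr]]] := part_ex.
have caf: continuous (fun x=> a * f x) by move=> x; apply: cont_atM (cf x); exact: cont_cst.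
rewrite !(ivolE pr)// mulr_sumr; apply: eq_bigr=> i _.
rewrite /cint -iintZ; last exact: part_cc.
congr iint; apply/funext=> y; rewrite /cintd; case: ifP=> _; last by rewrite mulr0.
ring.
Qed.

Lemma dens_ge0 c y: 0 <= density g c y. Proof. exact: sqrtr_ge0. Qed.

Lemma ivol_ge0 (f: X -> R): continuous f -> (forall x, 0 <= f x) -> 0 <= integral_vol g f.
move=> cf f0; have [m [c [r pr]]] := part_ex.
rewrite (ivolE pr cf); apply: sumr_ge0=> i _; apply: iint_ge0.
 exact: part_cc.
move=> y; rewrite /cintd; case: ifP=>// _; rewrite !mulr_ge0 ?dens_ge0//.
by case: pr.
Qed.

Lemma ivol_eq0 (f: X -> R): (forall c y, chart_im c y -> 0 < density g c y) ->
 continuous f -> (forall x, 0 <= f x) -> integral_vol g f = 0 -> forall x, f x = 0.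
move=> d0 cf f0 I0 x; have [m [c [r pr]]] := part_ex.
apply/eqP/negPn/negP=> fx; move: I0; rewrite (ivolE pr cf)=> I0.
have pos i y: 0 <= cintd g (c i) (fun x=> r i x * f x) y.
 rewrite /cintd; case: ifP=>// _; rewrite !mulr_ge0 ?dens_ge0//.
 by case: pr.
have [i ri] : exists i, r i x != 0.
 apply: contrapT=> H; case: (pr)=> _ _ _ /(_ x)/eqP; rewrite big1 ?(eq_sym 0) ?oner_eq0// => i _.
 by apply/eqP/negPn/negP=> rx; apply: H; exists i.
have [K [_ Kc Kr]] := part_cpt pr i.
have cx: chart_dom (c i) x by apply: contrapT=> nx; move/eqP: ri; apply; apply: Kr=> /Kc.
have := iint_gt0 (y0:=chart (c i) x) (part_cc i pr cf) (pos i).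
rewrite cintd_in ?chartK//; last exact: chimP.
have rx: 0 < r i x by rewrite lt_neqAle eq_sym ri /=; case: (pr)=> _ ->.
have fx0: 0 < f x by rewrite lt_neqAle eq_sym fx f0.
rewrite !mulr_gt0 ?d0//; [|exact: chimP..]=> /(_ isT).
move/eqP: I0; rewrite psumr_eq0=> [/allP/(_ i)|j _].
 by rewrite mem_index_enum /= => /(_ isT)/eqP; rewrite /cint=> ->; rewrite ltxx.
by apply: iint_ge0=>//; exact: part_cc.
Qed.

End Charts.

(** * Rellich estimate in one variable *)

Section Rellich1.
Variable R: realType.
Implicit Types (f g: R -> R) (L M: R).
Local Notation mu := (@lebesgue_measure R).

Lemma eq_leq_R (a b: R): a = b -> a <= b.
by move=> ->. Qed.

Lemma contM1 f g: continuous f -> continuous g -> continuous (fun t=> f t * g t).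
by move=> cf cg t; exact: cont_atM (cf t) (cg t). Qed.

Lemma contZ1 (a: R) f: continuous f -> continuous (fun t=> a * f t).
by move=> cf; apply: contM1=>// t; exact: cst_continuous. Qed.

Lemma Rsupp_sum L (I: Type) (r: seq I) (F: I -> R -> R):
 (forall i, continuous (F i)) -> (forall i, supp1 L (F i)) ->
 \int[mu]_t (\sum_(i <- r) F i t) = \sum_(i <- r) \int[mu]_t F i t.
move=> cF sF; elim: r=> [|i r IH].
 rewrite big_nil (_: (fun t=> _) = fun=> 0); last by apply/funext=> t; rewrite big_nil.
 by rewrite /Rintegral integral0.
rewrite big_cons -IH -(RsuppD (L:=L))//.
- by congr (Rintegral _ _ _); apply/funext=> t; rewrite big_cons.
- by move=> t; apply: cont_sum=> j _; exact: cF.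
- by move=> t Lt; rewrite big1// => j _; exact: sF.
Qed.

Lemma Rint_sub L f (s t: R): continuous f -> supp1 L f -> (forall r, 0 <= f r) ->
 \int[mu]_(r in `[s, t]) f r <= \int[mu]_r f r.
move=> cf sf f0; rewrite Rintegral_mkcond; apply: le_Rintegral=>//.
- have H := int_itv s t cf; rewrite integrable_mkcond// restrict_EFin in H.
 exact: H.
- exact: (@intble_sp _ L).
by move=> r _; rewrite patchE; case: ifP.
Qed.

(** Cauchy-Schwarz, from the non-negative integral of [(f' - m) ^ 2] with [m] the mean slope. *)
Lemma diff_sqr L f f' (s t: R): continuous f' -> supp1 L f' -> (forall r: R, is_derive r 1 f (f' r)) ->
 s <= t -> (f t - f s) ^+ 2 <= (t - s) * \int[mu]_r (f' r * f' r).
move=> cf' sf' df; rewrite le_eqVlt=> /predU1P[->|st].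
 by rewrite !subrr expr0n mul0r.
have d0: 0 < t - s by rewrite subr_gt0.
have cff := contM1 cf' cf'.
have sff: supp1 L (fun r=> f' r * f' r) by move=> r /sf' ->; rewrite mul0r.
have le1: \int[mu]_(r in `[s, t]) (f' r * f' r) <= \int[mu]_r (f' r * f' r).
 by apply: (Rint_sub _ _ cff sff)=> r; rewrite -expr2 sqr_ge0.
apply: le_trans (ler_wpM2l (ltW d0) le1).
have cF r: {for r, continuous f}.
 by apply: differentiable_continuous; apply/derivable1_diffP; have [] := df r.
have F2: \int[mu]_(r in `[s, t]) f' r = f t - f s.
 rewrite /Rintegral (@continuous_FTC2 _ f' f) //.
 - exact: continuous_subspaceT.
 - split; first by move=> r _; have [] := df r.
   exact: cvg_at_right_filter (cF _).
  exact: cvg_at_left_filter (cF _).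
 - by move=> r _; rewrite derive1E; have [_ ->] := df r.
set D := f t - f s in F2 *; set d := t - s in d0 *; pose m := D / d.
have P0: 0 <= \int[mu]_(r in `[s, t]) ((f' r * f' r + (- (2 * m)) * f' r) + m ^+ 2).
 apply: Rintegral_ge0=> r _.
 by have := sqr_ge0 (f' r - m); rewrite sqrrB; congr (_ <= _); rewrite !expr2; ring.
have cc1: continuous (fun r=> (- (2 * m)) * f' r) by apply: contM1=>// r; exact: cst_continuous.
have cc2: continuous (fun _: R=> m ^+ 2) by move=> r; exact: cst_continuous.
have cD: continuous (fun r=> f' r * f' r + (- (2 * m)) * f' r).
 by move=> r; exact: cont_atD (cff r) (cc1 r).
move: P0; rewrite RintegralD//; [|exact: int_itv|exact: int_itv].
rewrite RintegralD//; [|exact: int_itv|exact: int_itv].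
rewrite RintegralZl//; last exact: int_itv.
rewrite F2 (Rint_cst _ (ltW st)) -/d; move: (\int[mu]_(r in _) _)=> I.
rewrite /m=> P0; have: 0 <= I * d - D ^+ 2.
 have -> : I * d - D ^+ 2 = (I + - (2 * (D / d)) * D + (D / d) ^+ 2 * d) * d by field; rewrite gt_eqF.
 by rewrite mulr_ge0// ltW.
by rewrite subr_ge0 mulrC.
Qed.

Definition hat (c d t: R) := Num.max 0 (d - `|t - c|).

Lemma hat_cont c d: continuous (hat c d).
move=> t; apply: (@continuous_max _ _ (fun=> 0) (fun t=> d - `|t - c|)); first exact: cst_continuous.
apply: (@continuousB _ _ _ (fun=> d) (fun t=> `|t - c|)); first exact: cst_continuous.
apply: continuous_comp; last exact: norm_continuous.
by apply: continuousB; [exact: cvg_id|exact: cst_continuous].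
Qed.

Lemma hat_ge0 c d t: 0 <= hat c d t. Proof. by rewrite /hat le_max lexx. Qed.
Lemma hat_out c d t: d <= `|t - c| -> hat c d t = 0.
by move=> h; rewrite /hat max_l// subr_le0. Qed.
Lemma hat_sp c d: supp1 (`|c| + d) (hat c d).
move=> t h; apply: hat_out; have := lerB_dist t c; move: (`|t|) (`|c|) (`|t - c|) h=> p q r h; lra.
Qed.
Lemma hat_center c d: 0 < d -> hat c d c = d.
by move=> d0; rewrite /hat subrr normr0 subr0 max_r// ltW. Qed.

(** The functionals are averages against hat functions centred at a [d]-net of the support. The
    value of [f] at a point differs from a neighbouring average by at most the root of [2 * d * I'],
    whence a pointwise bound for [f ^ 2], which is integrated over a segment of length [2 * L]. *)
Lemma finite_means L e: 0 < L -> 0 < e -> exists (T: finType) (w: T -> R -> R),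
 (forall q, continuous (w q) /\ exists L', supp1 L' (w q)) /\
 forall f f', continuous f -> continuous f' -> supp1 L f -> supp1 L f' -> (forall t: R, is_derive t 1 f (f' t)) ->
  \int[mu]_t (f t * f t) <= e * \int[mu]_t (f' t * f' t) + \sum_q (\int[mu]_t (w q t * f t)) ^+ 2.
(* The factor 8 is the 4 of the pointwise bound times the 2 of the length [2 * L]. *)
move=> L0 e0; pose d := e / (8 * L); have d0: 0 < d by rewrite divr_gt0// mulr_gt0.
have cK: compact `[- L, L]%classic by exact: segment_compact.
have [s sK cov] := finite_cover (N:=fun t=> ball t d) cK
 (fun t _=> ball_open t d) (fun t _=> ballxx t d0).
pose m q := \int[mu]_t hat (nth 0 s q) d t.
have m0 q: 0 < m q.
 apply: (@Rint_gt0 _ _ _ (nth 0 s q) _ (@hat_sp _ _))=> [|t|]; [exact: hat_cont|exact: hat_ge0|].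
 by rewrite hat_center.
pose w (q: 'I_(size s)) t := (m q)^-1 * hat (nth 0 s q) d t.
have cw q: continuous (w q).
 exact/contZ1/hat_cont.
have sw (q: 'I_(size s)): supp1 (`|nth 0 s q| + d) (w q) by move=> t /hat_sp h; rewrite /w h mulr0.
have w0 q t: 0 <= w q t by rewrite mulr_ge0 ?hat_ge0// invr_ge0 ltW.
have w1 q: \int[mu]_t w q t = 1.
 by rewrite (RsuppZ _ (@hat_cont _ _) (@hat_sp _ _)) -/(m q) mulVf// gt_eqF.
(* The factor [2 * (2 * L)] in front of the squared averages is absorbed into the weights. *)
pose r := Num.sqrt (4 * L).
have r2: r ^+ 2 = 4 * L by rewrite sqr_sqrtr// mulr_ge0// ltW.
exists 'I_(size s), (fun q t=> r * w q t); split=> [q|f f' cf cf' sf sf' df].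
 split; first exact/contZ1/cw.
 by exists (`|nth 0 s q| + d)=> t /sw ->; rewrite mulr0.
set I' := \int[mu]_t (f' t * f' t); set fq := fun q=> \int[mu]_t (w q t * f t).
have I0: 0 <= I' by apply: Rintegral_ge0=> t _; rewrite -expr2 sqr_ge0.
have E q: \int[mu]_t (r * w q t * f t) = r * fq q.
 rewrite -(RsuppZ (L:=L) r (contM1 (cw q) cf)); last by move=> t /sf ->; rewrite mulr0.
 by congr (Rintegral _ _ _); apply/funext=> t; rewrite mulrA.
rewrite (eq_bigr _ (fun q _=> congr1 (fun t=> t ^+ 2) (E q))).
pose B := Num.sqrt (2 * d * I').
have B0: 0 <= B by exact: sqrtr_ge0.
have B2: B ^+ 2 = 2 * d * I' by rewrite sqr_sqrtr// mulr_ge0// mulr_ge0// ltW.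
have near t u: `|t - u| <= 2 * d -> `|f t - f u| <= B.
 wlog ut: t u / u <= t.
  by move=> H h; have [/H|/ltW /H] := leP u t; [exact|rewrite distrC [in X in _ -> X]distrC; exact].
 rewrite ger0_norm ?subr_ge0// => h.
 rewrite -(ler_pXn2r (n:=2))// ?nnegrE// real_normK ?num_real// B2.
 by apply: (le_trans (diff_sqr cf' sf' df ut)); exact: ler_wpM2r.
have sup t: f t * f t <= 4 * d * I' + 2 * \sum_q (fq q) ^+ 2.
 have S0: 0 <= \sum_q (fq q) ^+ 2 by apply: sumr_ge0=> q _; exact: sqr_ge0.
 have [Lt|tL] := ltP L `|t|.
  by rewrite (sf _ Lt) mul0r; apply: addr_ge0; apply: mulr_ge0=>//; apply: mulr_ge0=>//; exact: ltW.
 have [|c cs] := cov t; first by rewrite /= in_itv /= -ler_norml.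
 rewrite -ball_normE /= distrC=> tc; have q1: (index c s < size s)%N by rewrite index_mem.
 pose q := Ordinal q1; have qE: nth 0 s q = c by exact: nth_index.
 have fqb: `|fq q - f t| <= B.
  have key u: `|w q u * f u - w q u * f t| <= w q u * B.
   rewrite -mulrBr normrM ger0_norm// /w qE.
   have [uc|uc] := leP d `|u - c|; first by rewrite hat_out// mulr0 !mul0r.
   apply: ler_wpM2l; first by rewrite mulr_ge0 ?hat_ge0// invr_ge0 ltW.
   apply: near; have := ler_distD c u t; rewrite (distrC c t)=> h.
   by apply: (le_trans h); rewrite mulr_natl mulr2n; apply: lerD; exact: ltW.
  have cfw: continuous (fun u=> w q u * f u) by exact: contM1.
  have scw: supp1 (`|nth 0 s q| + d) (fun u=> w q u * f u) by move=> u /sw ->; rewrite mul0r.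
  have cst t': \int[mu]_u (t' * w q u) = t'.
   by rewrite (RsuppZ _ (cw q) (sw q)) w1 mulr1.
  have cc t': continuous (fun u=> t' * w q u).
   exact/contZ1/cw.
  have sc t': supp1 (`|nth 0 s q| + d) (fun u=> t' * w q u) by move=> u /sw ->; rewrite mulr0.
  rewrite ler_distl; apply/andP; split.
   rewrite -[leLHS]cst; apply: (le_Rsupp (cc _) cfw (sc _) scw)=> u.
   have := key u; rewrite ler_norml=> /andP[h _]; rewrite mulrBl; move: h; rewrite ![w q u * _]mulrC; lra.
  rewrite -[leRHS]cst; apply: (le_Rsupp cfw (cc _) scw (sc _))=> u.
  have := key u; rewrite ler_norml=> /andP[_ h]; rewrite mulrDl; move: h; rewrite ![w q u * _]mulrC; lra.
 have le1: fq q ^+ 2 <= \sum_q (fq q) ^+ 2.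
  by rewrite (bigD1 q)//= lerDl sumr_ge0// => q' _; exact: sqr_ge0.
 have le2: (fq q - f t) ^+ 2 <= 2 * d * I'.
  by rewrite -B2 -(real_normK (num_real _)) ler_pXn2r// nnegrE.
 have K (a b S U: R): a ^+ 2 <= S -> (a - b) ^+ 2 <= U -> b * b <= 2 * U + 2 * S.
  by have := sqr_ge0 (2 * a - b); lra.
 by apply: (le_trans (K _ _ _ _ le1 le2)); rewrite !mulrA -natrM.
have sff: supp1 L (fun t=> f t * f t) by move=> t /sf ->; rewrite mul0r.
have M t: `|f t * f t| <= 4 * d * I' + 2 * \sum_q (fq q) ^+ 2.
 by rewrite ger0_norm -?expr2 ?sqr_ge0// expr2.
have := norm_Rsupp (ltW L0) (contM1 cf cf) sff M.
move=> /(le_trans (ler_norm _)) /le_trans; apply.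
have -> : \sum_q (r * fq q) ^+ 2 = 4 * L * \sum_q fq q ^+ 2.
 by rewrite mulr_sumr; apply: eq_bigr=> q _; rewrite exprMn r2.
rewrite /d; move: (\sum_q _)=> S.
apply: eq_leq_R; field; rewrite gt_eqF//.
Qed.

End Rellich1.

(** * Rellich estimate in several variables *)

Section Rellich.
Variable R: realType.
Local Notation mu := (@lebesgue_measure R).
Local Notation slice h t := (fun y=> h (row_mx (t%:M: 'rV[R]_1) y)).

Lemma cc_M n (f g: 'rV[R]_n -> R): cc f -> cc g -> cc (fun y=> f y * g y).
by move=> [cf _]; exact: cc_Mr. Qed.

(** [P s t] is the square norm of [s f + t g]; the values of [s] and [t] listed below give the
    discriminant inequality multiplied by [A] or by [B], and settle the case where both vanish. *)
Lemma iter_cauchy n (f g: 'rV[R]_n -> R): cc f -> cc g ->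
 (iint (fun y=> f y * g y)) ^+ 2 <= iint (fun y=> f y * f y) * iint (fun y=> g y * g y).
move=> cf cg; have [cff cgg cfg] := And3 (cc_M cf cf) (cc_M cg cg) (cc_M cf cg).
set A := iint (fun y=> f y * f y); set B := iint (fun y=> g y * g y); set C := iint _.
have P (s t: R): 0 <= s ^+ 2 * A + (2 * s * t) * C + t ^+ 2 * B.
 rewrite -(iintZ _ cff) -(iintZ _ cfg) -(iintZ _ cgg).
 rewrite -iintD; [|exact: cc_Z|exact: cc_Z].
 rewrite -iintD; [|by apply: cc_D; exact: cc_Z|exact: cc_Z].
 apply: iint_ge0=> [|y]; first by apply: cc_D; [apply: cc_D|]; exact: cc_Z.
 have := sqr_ge0 (s * f y + t * g y); congr (_ <= _); ring.
have A0: 0 <= A by have := P 1 0; rewrite expr1n expr0n !mulr0 !mul0r !addr0 mul1r.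
have := P C (- A); have := P B (- C); have := P 1 (-1); have := P 1 1; have := P (- C) A; have := P (- B) C.
have B0: 0 <= B by have := P 0 1; rewrite expr1n expr0n mulr0 !mul0r !add0r mul1r.
move: A B C A0 B0 {P} => a b c a0 b0 h1 h2 h3 h4 h5 h6.
have [a1|a1] := ltP 0 a; last first.
 have [b1|b1] := ltP 0 b; last by nra.
 have: 0 <= b * (a * b - c ^+ 2) by nra.
 by rewrite pmulr_rge0// subr_ge0.
have: 0 <= a * (a * b - c ^+ 2) by nra.
by rewrite pmulr_rge0// subr_ge0.
Qed.

Lemma rsubmx_cont n: continuous (fun y: 'rV[R]_n.+1=> (rsubmx (y: 'rV[R]_(1 + n)))).
move=> y; apply: cont_rV=> j; rewrite (_: (fun z=> _) = fun z: 'rV[R]_n.+1=> z 0 (rshift 1 j)).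
 exact: coord_cont.
by apply/funext=> z; rewrite mxE.
Qed.

Lemma head_cont n: continuous (fun y: 'rV[R]_n.+1=> y 0 0).
move=> y; exact: coord_cont. Qed.

Lemma is_der_line n (f g: 'rV[R]_n -> R) y v l: (forall s: R, f (s *: v + y) = g (s *: v + y)) ->
 is_derive y v g l -> is_derive y v f l.
move=> E [dg gl]; have E0: f y = g y by have := E 0; rewrite scale0r add0r.
have H: (fun h: R=> h^-1 *: ((f \o shift y) (h *: v) - f y)) = (fun h: R=> h^-1 *: ((g \o shift y) (h *: v) - g y)).
 by apply/funext=> h; rewrite /= E E0.
by split; [rewrite /derivable H|rewrite /derive H].
Qed.

(** Induction on the dimension: the estimate in the last [n] variables is applied to each slice, and
    the averages [g k] that it leaves are functions of the first variable, to which [finite_means]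
    applies. Their derivatives are controlled by Cauchy-Schwarz. *)
Lemma rellich n (L e: R): 0 < L -> 0 < e -> exists (T: finType) (w: T -> 'rV[R]_n -> R),
 (forall k, cc (w k)) /\ forall h, Ck 1 setT h -> supp L h ->
 iint (fun y=> h y * h y) <=
  e * \sum_(i < n) iint (fun y=> 'D_'e_i h y * 'D_'e_i h y)
  + \sum_k (iint (fun y=> w k y * h y)) ^+ 2.
move=> L0; elim: n e=> [|n IH] e e0.
 exists unit, (fun _ _=> 1); split=> [_|h ch sh].
  split; first by move=> y; exact: cst_continuous.
  by exists 0=> y; rewrite (_: y = 0) ?normr0 ?ltxx//; apply/matrixP=> i [].
 by rewrite big_ord0 mulr0 add0r (big_pred1 tt) /= ?mul1r ?expr2// => -[].
have [T [w [cw Hw]]] := IH e e0.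
pose M := \sum_k iint (fun y=> w k y * w k y).
have M0: 0 <= M by apply: sumr_ge0=> k _; apply: iint_ge0=> [|y]; [exact: cc_M|rewrite -expr2 sqr_ge0].
(* The Cauchy-Schwarz factors of all weights add up to [M], and [e1 * M] is at most [e]. *)
pose e1 := e / (1 + M); have e10: 0 < e1 by rewrite divr_gt0// ltr_pwDl.
have [T' [w' [cw' Hw']]] := finite_means L0 e10.
exists (T' * T)%type, (fun q (y: 'rV[R]_n.+1)=> w' q.1 (y 0 0) * w q.2 (rsubmx (y: 'rV[R]_(1 + n)))); split.
 move=> [q k] /=; have [cq [Lq sq]] := cw' q; have [ck [Lk sk]] := cw k; split.
  move=> y; apply: cont_atM.
   by apply: continuous_comp; [exact: head_cont|exact: cq].
  by apply: continuous_comp; [exact: rsubmx_cont|exact: ck].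
 exists (Num.max Lq Lk)=> y; rewrite -{1}(row_mx_head y) norm_row=> h.
 have [h1|h1] := ltP Lq `|y 0 0|; first by rewrite sq ?mul0r.
 have [h2|h2] := ltP Lk `|rsubmx (y: 'rV[R]_(1 + n))|; first by rewrite sk ?mulr0.
 move: h; rewrite ltNge=> /negP; case; rewrite ge_max !le_max h1 h2 orbT//.
move=> h ch sh.
have cch: cc h by exact: Ck_cc ch sh.
have ccd v: cc ('D_v h) by exact: Ck_cc_der ch sh.
have dd y v: derivable h y v by exact: (Ck_dvb ch).
have dh y v: is_derive y v h ('D_v h y) by apply: DeriveDef.
have hh: cc (fun y=> h y * h y) by exact: cc_M.
have hdd v: cc (fun y=> 'D_v h y * 'D_v h y) by exact: cc_M.
have [L1 L10 sL1] := cc_sp cch.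
pose g k t := iint (fun y=> w k y * slice h t y).
pose g' k t := iint (fun y=> w k y * slice ('D_'e_0 h) t y).
have cH (k: T) (H: 'rV[R]_n.+1 -> R): cc H -> cc (fun y=> w k (rsubmx (y: 'rV[R]_(1 + n))) * H y).
 move=> cHH; apply: cc_Mr=>// y; apply: continuous_comp; [exact: rsubmx_cont|exact: (cw k).1].
have gE (k: T) (H: 'rV[R]_n.+1 -> R) t: iint (fun y=> w k y * slice H t y) =
  iint (slice (fun y=> w k (rsubmx (y: 'rV[R]_(1 + n))) * H y) t).
 by congr iint; apply/funext=> y; rewrite row_mxKr.
have cg (k: T) H: cc H -> continuous (fun t=> iint (fun y=> w k y * slice H t y)).
 by move=> cHH; under eq_fun do rewrite gE; exact: slc_cont (cH k H cHH).
have sg (k: T) H: supp L H -> supp1 L (fun t=> iint (fun y=> w k y * slice H t y)).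
 move=> sH t Lt; have := slc_sp0 sH Lt=> E.
 rewrite -[RHS](iint0 R n); congr iint; apply/funext=> y.
 by rewrite -[H _]/((slice H t) y) E mulr0.
have dg k (t: R): is_derive t 1 (g k) (g' k t).
 rewrite (_: g k = fun t=> iint (slice (fun y=> w k (rsubmx (y: 'rV[R]_(1 + n))) * h y) t)); last first.
  by apply/funext=> s; exact: (gE k h s).
 rewrite (_: g' k t = iint (slice (fun y=> w k (rsubmx (y: 'rV[R]_(1 + n))) * 'D_'e_0 h y) t)); last exact: (gE k ('D_'e_0 h) t).
 apply: (slc_der (cH k h cch) (cH k _ (ccd 'e_0)))=> y.
 apply: (@is_der_line _ _ (fun z=> w k (rsubmx (y: 'rV[R]_(1 + n))) * h z)).
  move=> s; congr (w k _ * _).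
  by rewrite linearD linearZ /= row_mxKr scaler0 add0r.
 rewrite -delta_row0.
 have [D1 D2] := dh y 'e_0.
 by split; [exact: derivableZ|rewrite deriveZ// D2].
have sD v: supp L ('D_v h) by exact: supp_der.
have chS t: Ck 1 setT (slice h t).
 have D v: 'D_v (slice h t) = slice ('D_(row_mx (0: 'rV[R]_1) v) h) t.
  apply/funext=> y; have [_ ->] := @slc_derive _ _ h t v y (dd _ _).
  by [].
 split; first by move=> y _; exact: (slc_cc t cch).1.
 split=> [y v _|v]; last by split=>// y _; rewrite D; exact: (slc_cc t (ccd _)).1.
 by have [] := @slc_derive _ _ h t v y (dd _ _).
have DS t (i: 'I_n): 'D_'e_i (slice h t) = slice ('D_(delta_mx 0 (lift ord0 i)) h) t.
 apply/funext=> y; have [_ ->] := @slc_derive _ _ h t 'e_i y (dd _ _).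
 by rewrite -delta_rowS.
pose D i := iint (fun y=> 'D_'e_i h y * 'D_'e_i h y).
pose Di (i: 'I_n) t := iint (slice (fun y=> 'D_(delta_mx 0 (lift ord0 i)) h y * 'D_(delta_mx 0 (lift ord0 i)) h y) t).
have shh: supp L (fun y=> h y * h y) by move=> y /sh ->; rewrite mul0r.
have sdd v: supp L (fun y=> 'D_v h y * 'D_v h y) by move=> y /sD ->; rewrite mul0r.
have cgk k: continuous (fun t=> g k t * g k t) by apply: contM1; exact: cg.
have sgk k: supp1 L (fun t=> g k t * g k t) by move=> t Lt; rewrite /g (sg k h sh)// mul0r.
have cDi i: continuous (Di i) by exact: slc_cont (hdd _).
have sDi i: supp1 L (Di i) by exact: slc_sp (sdd _).
have cS1: continuous (fun t=> e * \sum_i Di i t).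
 by apply: contZ1=> t; apply: cont_sum=> i _; exact: cDi.
have cS2: continuous (fun t=> \sum_k g k t * g k t).
 by move=> t; apply: cont_sum=> k _; exact: cgk.
have sS1: supp1 L (fun t=> e * \sum_i Di i t).
 by move=> t Lt; rewrite big1 ?mulr0// => i _; exact: sDi.
have sS2: supp1 L (fun t=> \sum_k g k t * g k t).
 by move=> t Lt; rewrite big1// => k _; exact: sgk.
have le1: iint (fun y=> h y * h y) <= e * \sum_i D (lift ord0 i) + \sum_k \int[mu]_t (g k t * g k t).
 rewrite iintS.
 have -> : e * \sum_i D (lift ord0 i) + \sum_k \int[mu]_t (g k t * g k t) =
   \int[mu]_t (e * \sum_i Di i t + \sum_k g k t * g k t).
  rewrite (RsuppD cS1 cS2 sS1 sS2) (Rsupp_sum _ cgk sgk); congr (_ + _).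
  rewrite (RsuppZ (L:=L)) ?(Rsupp_sum _ cDi sDi)//.
   by move=> t; apply: cont_sum=> i _; exact: cDi.
  by move=> t Lt; rewrite big1// => i _; exact: sDi.
 apply: (le_Rsupp (slc_cont hh) _ (slc_sp shh)).
 - by move=> t; exact: cont_atD (cS1 t) (cS2 t).
 - by move=> t Lt; rewrite sS1// sS2// addr0.
 move=> t; have le0 := Hw (slice h t) (chS t) (@slc_supp R n L h t sh).
 apply: (le_trans le0).
 rewrite [in leRHS](eq_bigr (fun k=> g k t ^+ 2)); last by move=> k _; rewrite expr2.
 apply: lerD=>//; apply: ler_wpM2l; first exact: ltW.
 apply: ler_sum=> i _; apply: eq_leq_R; have E := DS t i.
 exact: (congr1 (fun F: 'rV[R]_n -> R=> iint (fun y=> F y * F y)) E).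
apply: (le_trans le1); rewrite big_ord_recl -/(D ord0) mulrDr -!addrA addrCA lerD2l.
have le2 k: \int[mu]_t (g k t * g k t) <= e1 * (iint (fun y=> w k y * w k y) * D ord0) +
  \sum_q (iint (fun y: 'rV[R]_n.+1=> w' q (y 0 0) * w k (rsubmx (y: 'rV[R]_(1 + n))) * h y)) ^+ 2.
 have cg': continuous (g' k) by exact: (cg k ('D_'e_0 h) (ccd _)).
 have sg': supp1 L (g' k) by exact: (sg k ('D_'e_0 h) (sD _)).
 apply: le_trans (Hw' _ _ (cg k h cch) cg' (sg k h sh) sg' (dg k)) _.
 apply: lerD.
  apply: ler_wpM2l; first exact: ltW.
  pose D0 t := iint (slice (fun y=> 'D_(delta_mx 0 ord0) h y * 'D_(delta_mx 0 ord0) h y) t).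
  have cD0: continuous D0 := slc_cont (hdd (delta_mx 0 ord0)).
  have sD0: supp1 L D0 := slc_sp (sdd (delta_mx 0 ord0)).
  rewrite (_: D ord0 = \int[mu]_t D0 t); last exact: iintS.
  rewrite -(RsuppZ _ cD0 sD0); apply: (@le_Rsupp _ L).
  - exact: contM1.
  - exact: contZ1.
  - by move=> t /sg' ->; rewrite mul0r.
  - by move=> t /sD0 ->; rewrite mulr0.
  by move=> t; have := iter_cauchy (cw k) (slc_cc t (ccd 'e_0)); rewrite expr2.
 apply: eq_leq_R; apply: eq_bigr=> q _; congr (_ ^+ 2); rewrite iintS.
 congr (Rintegral _ _ _); apply/funext=> t; rewrite /g -iintZ; last first.
  by apply: cc_M=>//; exact: slc_cc.
 congr iint; apply/funext=> y; rewrite row_mxKr mulrA; congr (w' q _ * _ * _).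
 by rewrite mxE; case: splitP=>// j _; rewrite ord1 mxE eqxx mulr1n.
apply: (le_trans (ler_sum _ (fun k _=> le2 k))); rewrite big_split /= -mulr_sumr -mulr_suml -/M.
apply: lerD.
 rewrite mulrA; apply: ler_wpM2r; first by apply: iint_ge0=>// y; rewrite -expr2 sqr_ge0.
 by rewrite /e1 mulrAC ler_pdivrMr ?ltr_pwDl// ler_pM2l// lerDr.
by rewrite exchange_big pair_bigA.
Qed.

End Rellich.

(** * Alternating forms in degrees one to three *)

Section Multilinear.
Variables (R: realType) (n: nat).
Local Notation V := 'rV[R]_n.
Implicit Types (u v w: V).

Definition vs k (s: seq V): 'I_k -> V := fun i=> nth 0 s i.

Lemma vs1E (v: 'I_1 -> V): v = vs [:: v ord0].
by apply/funext=> -[[|//] i]; congr v; apply: val_inj. Qed.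

Lemma vs2E (v: 'I_2 -> V): v = vs [:: v ord0; v ord_max].
by apply/funext=> -[[|[|//]] i]; congr v; apply: val_inj. Qed.

Definition ord31: 'I_3 := Ordinal (isT: 1 < 3)%N.
Lemma vs3E (v: 'I_3 -> V): v = vs [:: v ord0; v ord31; v ord_max].
by apply/funext=> -[[|[|[|//]]] i]; congr v; apply: val_inj. Qed.

Definition lin (F: V -> R) := forall t u w, F (t *: u + w) = t * F u + F w.
Definition alt2 (b: V -> V -> R) := [/\ forall w, lin (b^~ w), forall u, lin (b u) & forall u, b u u = 0].
Definition alt3 (b: V -> V -> V -> R) := [/\ forall v w, lin (fun u=> b u v w), forall u w, lin (fun v=> b u v w),
 forall u v, lin (b u v), forall u w, b u u w = 0 & (forall u w, b u w w = 0) /\ (forall u w, b u w u = 0)].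

Lemma lin0 F: lin F -> F 0 = 0.
by move=> /(_ 1 0 0); rewrite scale1r addr0 mul1r=> /eqP; rewrite -subr_eq subrr=> /eqP <-. Qed.
Lemma linD F u w: lin F -> F (u + w) = F u + F w.
by move=> lF; rewrite -[u]scale1r lF scale1r mul1r. Qed.
Lemma linZ F t u: lin F -> F (t *: u) = t * F u.
by move=> lF; rewrite -[t *: u]addr0 lF (lin0 lF) addr0. Qed.
Lemma linN F u: lin F -> F (- u) = - F u.
by move=> lF; rewrite -scaleN1r linZ// mulN1r. Qed.

Lemma lin_sum F (I: Type) (r: seq I) (P: pred I) (E: I -> V): lin F ->
 F (\sum_(i <- r | P i) E i) = \sum_(i <- r | P i) F (E i).
move=> lF; elim/big_rec2: _=> [|i x y _ <-]; first exact: lin0.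
by rewrite linD.
Qed.

Lemma lin_exp F u: lin F -> F u = \sum_i u 0 i * F 'e_i.
move=> lF; rewrite [u in LHS]row_sum_delta lin_sum//.
by apply: eq_bigr=> i _; rewrite linZ.
Qed.

Lemma alt2C b u w: alt2 b -> b u w = - b w u.
case=> l1 l2 d; have := d (u + w); rewrite (linD _ _ (l1 _)) !(linD _ _ (l2 _)) !d add0r addr0.
by move/eqP; rewrite addr_eq0=> /eqP.
Qed.

Lemma alt3C12 b u v w: alt3 b -> b u v w = - b v u w.
case=> l1 l2 l3 d _; have := d (u + v) w.
rewrite (linD _ _ (l1 _ _)) !(linD _ _ (l2 _ _)) !d add0r addr0.
by move/eqP; rewrite addr_eq0=> /eqP.
Qed.

Lemma alt3C23 b u v w: alt3 b -> b u v w = - b u w v.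
case=> l1 l2 l3 _ [d _]; have := d u (v + w).
rewrite (linD _ _ (l2 _ _)) !(linD _ _ (l3 _ _)) !d add0r addr0.
by move/eqP; rewrite addr_eq0=> /eqP.
Qed.

(** Curried versions in degrees 1, 2 and 3, on which multilinear algebra becomes plain rewriting. *)
Definition f1 (a: ('I_1 -> V) -> R) u := a (vs [:: u]).
Definition f2 (a: ('I_2 -> V) -> R) u v := a (vs [:: u; v]).
Definition f3 (a: ('I_3 -> V) -> R) u v w := a (vs [:: u; v; w]).
Definition mk1 (F: V -> R) (v: 'I_1 -> V) := F (v ord0).
Definition mk2 (b: V -> V -> R) (v: 'I_2 -> V) := b (v ord0) (v ord_max).
Definition mk3 (b: V -> V -> V -> R) (v: 'I_3 -> V) := b (v ord0) (v ord31) (v ord_max).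

Lemma f1K a: mk1 (f1 a) = a. Proof. by apply/funext=> v; rewrite /mk1 /f1 -vs1E. Qed.
Lemma f2K a: mk2 (f2 a) = a. Proof. by apply/funext=> v; rewrite /mk2 /f2 -vs2E. Qed.

Lemma dfwith_vs k (s: seq V) (i: 'I_k) u: size s = k ->
 dfwith (vs s) i u = vs (set_nth 0 s i u) :> ('I_k -> V).
move=> sk; apply/funext=> j; rewrite /vs nth_set_nth /=.
have [->|ij] := eqVneq i j; first by rewrite dfwithin eqxx.
by rewrite dfwithout// ifN// eq_sym.
Qed.

Lemma alternating1 a: alternating a <-> lin (f1 a).
split=> [[l _] t u w|l].
 by have := l (vs [:: 0]) ord0 t u w; rewrite !dfwith_vs.
split=> [v i t u w|v i j]; last by rewrite !ord1.
by rewrite -(f1K a) /mk1 (ord1 i) !dfwithin; exact: l.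
Qed.

Lemma alternating2 a: alternating a <-> alt2 (f2 a).
split=> [[l d]|[l1 l2 d]].
 split=> [w t u w'|u t w w'|u].
 - by have := l (vs [:: 0; w]) ord0 t u w'; rewrite !dfwith_vs.
 - by have := l (vs [:: u; 0]) ord_max t w w'; rewrite !dfwith_vs.
 - exact: (d (vs [:: u; u]) ord0 ord_max).
rewrite -(f2K a) /mk2; split=> [v i t u w|v i j].
 case: i=> -[|[|//]] i; rewrite ?dfwithin.
  rewrite (_: Ordinal i = ord0) ?dfwithin ?dfwithout//; last exact: val_inj.
  exact: (l1 (v ord_max)).
 rewrite (_: Ordinal i = ord_max) ?dfwithin ?dfwithout//; last exact: val_inj.
 exact: (l2 (v ord0)).
have E (x y: 'I_2): x != y -> v x = v y -> v ord0 = v ord_max.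
 have O0 (h: (0 < 2)%N): Ordinal h = ord0 by exact: val_inj.
 have O1 (h: (1 < 2)%N): Ordinal h = ord_max by exact: val_inj.
 by case: x y=> -[|[|//]] ix [[|[|//]] iy]//= _; rewrite ?O0 ?O1.
by move=> ij /(E _ _ ij) ->; exact: d.
Qed.

Lemma alt2_exp b u v: alt2 b -> b u v = \sum_i \sum_j u 0 i * v 0 j * b 'e_i 'e_j.
case=> l1 l2 _; rewrite (lin_exp u (l1 v)); apply: eq_bigr=> i _.
rewrite (lin_exp v (l2 _)) mulr_sumr; apply: eq_bigr=> j _; exact: mulrA.
Qed.

Lemma lift_vs2 (u v: V): (fun j=> vs [:: u; v] (lift ord0 j)) = vs [:: v] :> ('I_1 -> V) /\
 (fun j=> vs [:: u; v] (lift ord_max j)) = vs [:: u] :> ('I_1 -> V).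
by split; apply/funext=> -[[|//] i]. Qed.

Lemma lift_vs3 (u v w: V): [/\ (fun j=> vs [:: u; v; w] (lift ord0 j)) = vs [:: v; w] :> ('I_2 -> V),
 (fun j=> vs [:: u; v; w] (lift ord31 j)) = vs [:: u; w] :> ('I_2 -> V) &
 (fun j=> vs [:: u; v; w] (lift ord_max j)) = vs [:: u; v] :> ('I_2 -> V)].
by split; apply/funext=> -[[|[|//]] i]. Qed.

End Multilinear.

(** * Smooth forms in charts and naturality of the exterior derivative *)

Section Forms1.
Variables (R: realType) (n: nat) (X: manifold R n).
Local Notation V := 'rV[R]_n.
Implicit Types (c x p: X) (y u v w: V).

Definition l0 (a: rform X 0) c y := local_form a c y (fun=> 0).
Definition l1 (a: rform X 1) c y u := f1 (local_form a c y) u.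
Definition l2 (a: rform X 2) c y u v := f2 (local_form a c y) u v.
Definition l3 (a: rform X 3) c y u v w := f3 (local_form a c y) u v w.

Lemma fun0E (T: Type) (f g: 'I_0 -> T): f = g. Proof. by apply/funext=> -[]. Qed.

Lemma l0E a c y: l0 a c y = a (chart_inv c y) (fun=> 0).
by rewrite /l0 /local_form; congr a; exact: fun0E. Qed.
Lemma l1E a c y u: l1 a c y u = f1 (a (chart_inv c y)) (from_chart c y u).
by rewrite /l1 /f1 /local_form; congr a; apply/funext=> -[[|//] i]. Qed.
Lemma l2E a c y u v: l2 a c y u v = f2 (a (chart_inv c y)) (from_chart c y u) (from_chart c y v).
by rewrite /l2 /f2 /local_form; congr a; apply/funext=> -[[|[|//]] i]. Qed.
Lemma l3E a c y u v w: l3 a c y u v w =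
 f3 (a (chart_inv c y)) (from_chart c y u) (from_chart c y v) (from_chart c y w).
by rewrite /l3 /f3 /local_form; congr a; apply/funext=> -[[|[|[|//]]] i]. Qed.

Lemma fch_lin c y t u w: chart_im c y ->
 from_chart c y (t *: u + w) = t *: from_chart c y u + from_chart c y w.
by move=> cy; rewrite !fchE// mulmxDl -scalemxAl. Qed.

Lemma l1_lin a c y: chart_im c y -> lin (f1 (a (chart_inv c y))) -> lin (l1 a c y).
by move=> cy l t u w; rewrite !l1E fch_lin. Qed.

Lemma l2_alt a c y: chart_im c y -> alt2 (f2 (a (chart_inv c y))) -> alt2 (l2 a c y).
move=> cy [h1 h2 d]; split=> [w t u u'|w t u u'|u]; rewrite !l2E ?fch_lin//; [exact: h1|exact: h2].
Qed.

Lemma l3_alt a c y: chart_im c y -> alt3 (f3 (a (chart_inv c y))) -> alt3 (l3 a c y).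
move=> cy [h1 h2 h3 d1 [d2 d3]].
split=> [v w t u u'|v w t u u'|v w t u u'|u w|].
- by rewrite !l3E fch_lin//; exact: h1.
- by rewrite !l3E fch_lin//; exact: h2.
- by rewrite !l3E fch_lin//; exact: h3.
- rewrite l3E; exact: d1.
- by split=> u w; rewrite l3E; [exact: d2|exact: d3].
Qed.

Definition smooth1 (a: rform X 1) := (forall x, lin (f1 (a x))) /\
 forall c u k, Ck k (chart_im c) (fun y=> l1 a c y u).
Definition smooth2 (a: rform X 2) := (forall x, alt2 (f2 (a x))) /\
 forall c u v k, Ck k (chart_im c) (fun y=> l2 a c y u v).
Definition smooth3 (a: rform X 3) := (forall x, alt3 (f3 (a x))) /\
 forall c u v w k, Ck k (chart_im c) (fun y=> l3 a c y u v w).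

Lemma sm_form1 a: smooth_form a <-> smooth1 a.
split=> [[al s]|[al s]]; split=> [x|c u]; rewrite ?alternating1.
- exact/alternating1.
- by move=> k; apply/sm_onP: k; exact: s.
- exact: al.
- by apply/sm_onP=> k; rewrite (vs1E u); exact: s.
Qed.

Lemma sm_form2 a: smooth_form a <-> smooth2 a.
split=> [[al s]|[al s]]; split=> [x|c u].
- exact/alternating2.
- by move=> v k; apply/sm_onP: k; exact: s.
- exact/alternating2.
- by apply/sm_onP=> k; rewrite (vs2E u); exact: s.
Qed.

Lemma sm_form0 (a: rform X 0): smooth_form a <-> sfun (fun x=> a x (fun=> 0)).
split=> [[_ s] c k|s].
 have /sm_onP/(_ k) := s c (fun=> 0); rewrite (_: (fun y=> _) = (fun y=> a (chart_inv c y) (fun=> 0)))//.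
 by apply/funext=> y; exact: l0E.
split=> [x|c u]; first by split=> [v []|v []].
apply/sm_onP=> k; rewrite (fun0E u (fun=> 0)).
rewrite (_: (fun y=> _) = (fun y=> a (chart_inv c y) (fun=> 0))); first exact: s.
by apply/funext=> y; exact: l0E.
Qed.

Lemma fch_id x v: from_chart x (chart x x) v = v.
rewrite fchE; last exact/chimP/dom_self.
by rewrite chartK ?tmat_id ?mulmx1//; exact: dom_self.
Qed.

Lemma f1_local a x u: f1 (a x) u = l1 a x (chart x x) u.
by rewrite l1E chartK ?fch_id//; exact: dom_self. Qed.
Lemma f2_local a x u v: f2 (a x) u v = l2 a x (chart x x) u v.
by rewrite l2E chartK ?fch_id//; exact: dom_self. Qed.

Lemma ext_d0 (a: rform X 0) x u: f1 (ext_d a x) u = 'D_u (l0 a x) (chart x x).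
have E: (fun y=> local_form a x y (fun j=> vs [:: u] (lift (ord0: 'I_1) j))) = l0 a x.
 by apply/funext=> y; rewrite /l0 (fun0E (fun j=> _) (fun=> 0)).
by rewrite /f1 /ext_d big_ord1 expr0 mul1r E.
Qed.

Lemma ext_d1 (a: rform X 1) x u v: f2 (ext_d a x) u v =
 'D_u (fun y=> l1 a x y v) (chart x x) - 'D_v (fun y=> l1 a x y u) (chart x x).
rewrite /f2 /ext_d big_ord_recl big_ord1 expr0 mul1r /bump /= expr1 mulN1r.
have [E0 E1] := lift_vs2 u v; rewrite E0.
have -> : lift ord0 (ord0: 'I_1) = ord_max :> 'I_2 by exact: val_inj.
by rewrite E1.
Qed.

Lemma ext_d2 (a: rform X 2) x u v w: f3 (ext_d a x) u v w =
 'D_u (fun y=> l2 a x y v w) (chart x x) - 'D_v (fun y=> l2 a x y u w) (chart x x)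
 + 'D_w (fun y=> l2 a x y u v) (chart x x).
rewrite /f3 /ext_d !big_ord_recl big_ord0 expr0 mul1r /bump /= expr1 mulN1r addr0 sqrrN expr1n mul1r.
have [E0 E1 E2] := lift_vs3 u v w; rewrite E0.
have -> : lift ord0 (ord0: 'I_2) = ord31 :> 'I_3 by exact: val_inj.
have -> : lift ord0 (lift ord0 ord0) = ord_max :> 'I_3 by exact: val_inj.
by rewrite E1 E2 addrA.
Qed.

Section Naturality.
Variables (c: X) (y0: V).
Hypothesis cy0: chart_im c y0.
Let p := chart_inv c y0.
Let z0 := chart p p.
Let tau := trans p c.

Let cp: chart_dom c p. Proof. exact: chdomP. Qed.
Let pp: chart_dom p p. Proof. exact: dom_self. Qed.
Let oU := @olapO R n X p c.
Let Uz: olap p c z0. Proof. exact: olapP. Qed.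
Let tz: tau z0 = y0. Proof. by rewrite /tau /trans chartK// cinvK. Qed.
Let T := tmat c p p.

Let dtau w i := 'D_w (fun z=> tau z 0 i).

Let dtau_z u i: dtau (u *m T) i z0 = u 0 i.
by rewrite /dtau tmatE// -mulmxA tmat_comp// tmat_id// mulmx1. Qed.

Let fch_tau z w: olap p c z -> from_chart p z w = from_chart c (tau z) (\row_i dtau w i z).
move=> [pz cz]; have cz': chart_im c (tau z) by exact: chimP.
have pq := chdomP pz; set q := chart_inv p z in pq cz.
have Eq: chart_inv c (tau z) = q by rewrite /tau /trans chartK.
rewrite !fchE// Eq -/q -(tmat_comp pq cz (dom_self q)) mulmxA; congr (_ *m _).
apply/rowP=> i; rewrite [RHS]mxE; have := @tmatE _ _ X p c q i w pq cz.
by rewrite /q cinvK// => <-.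
Qed.

Let dtau_sm w i k: Ck k (olap p c) (dtau w i).
exact/Ck_der/trans_sm. Qed.

Let pull_sm k F: Ck k (chart_im c) F -> Ck k (olap p c) (fun z=> F (tau z)).
move=> cF; apply: (@Ck_comp _ _ _ _ _ (chart_im c) tau)=>//.
- exact: im_open.
- by move=> z [pz cz]; exact: chimP.
- by move=> i; exact: trans_sm.
Qed.

Let pull_der F u: Ck 1 (chart_im c) F -> 'D_(u *m T) (fun z=> F (tau z)) z0 = 'D_u F y0.
move=> cF; rewrite (der_comp (phi:=tau) (F:=F) (fun i=> trans_dvb Uz) _).2 ?tz.
 by congr ('D_ _ _ _); apply/rowP=> i; rewrite mxE; exact: dtau_z.
exact: (Ck_diff (@im_open _ _ X c) cF).
Qed.

Let dtau_sym u w i: 'D_u (dtau w i) z0 = 'D_w (dtau u i) z0.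
exact: (Schwarz u w oU (trans_sm p c i 2) Uz). Qed.

(** [ext_d] is evaluated at [p] in the chart attached to [p]. Here and in the next degrees it is
    expressed in one fixed chart [c], without which its smoothness in [c] could not be discussed. *)
Lemma natural_d0 (a: rform X 0) u: sfun (fun x=> a x (fun=> 0)) ->
 l1 (ext_d a) c y0 u = 'D_u (l0 a c) y0.
move=> sa; rewrite l1E -/p fchE// -/p ext_d0 -/z0 -/T.
have sl k: Ck k (chart_im c) (l0 a c).
 by apply: (Ck_ext (im_open (c:=c)) _ (sa c k))=> y _; rewrite l0E.
rewrite -(pull_der _ (sl 1%N)); apply: near_eq_derive; apply: (nearO oU Uz)=> z [pz cz].
by rewrite !l0E /tau /trans chartK.
Qed.

Lemma l1_tau (a: rform X 1) z w: (forall x, lin (f1 (a x))) -> olap p c z ->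
 l1 a p z w = \sum_i dtau w i z * l1 a c (tau z) 'e_i.
move=> al oz; rewrite l1E fch_tau//; have [pz cz] := oz.
have cz': chart_im c (tau z) by exact: chimP.
have -> : chart_inv p z = chart_inv c (tau z) by rewrite /tau /trans chartK.
rewrite -l1E (lin_exp _ (l1_lin cz' (al _))).
by apply: eq_bigr=> i _; rewrite mxE.
Qed.

Lemma l2_tau (a: rform X 2) z w w': (forall x, alt2 (f2 (a x))) -> olap p c z ->
 l2 a p z w w' = \sum_i \sum_j dtau w i z * dtau w' j z * l2 a c (tau z) 'e_i 'e_j.
move=> al oz; rewrite l2E !fch_tau//; have [pz cz] := oz.
have cz': chart_im c (tau z) by exact: chimP.
have -> : chart_inv p z = chart_inv c (tau z) by rewrite /tau /trans chartK.
rewrite -l2E (alt2_exp _ _ (l2_alt cz' (al _))).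
by apply: eq_bigr=> i _; apply: eq_bigr=> j _; rewrite !mxE.
Qed.

Let row_mxE (F: 'I_n -> R) i: (\row_j F j) 0 i = F i.
exact: mxE. Qed.

Let D_l1 (a: rform X 1) u w: smooth1 a ->
 'D_(u *m T) (fun z=> l1 a p z (w *m T)) z0 =
 \sum_i 'D_(u *m T) (dtau (w *m T) i) z0 * l1 a c y0 'e_i + 'D_u (fun y=> l1 a c y w) y0.
move=> [al sa].
have E: \forall z \near z0, l1 a p z (w *m T) =
  \sum_i dtau (w *m T) i z * l1 a c (tau z) 'e_i.
 by apply: (nearO oU Uz)=> z; exact: l1_tau.
rewrite (near_eq_derive _ E).
have d1 i: derivable (dtau (w *m T) i) z0 (u *m T) by exact: (Ck_dvb (dtau_sm (w *m T) i 1) Uz).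
have d2 i: derivable (fun z=> l1 a c (tau z) 'e_i) z0 (u *m T).
 exact: (Ck_dvb (pull_sm (sa c 'e_i 1%N)) Uz).
rewrite (der_sums _ (fun i _=> derivableM (d1 i) (d2 i))).2.
have -> : 'D_u (fun y=> l1 a c y w) y0 = \sum_i w 0 i * 'D_u (fun y=> l1 a c y 'e_i) y0.
 have E': \forall y \near y0, l1 a c y w = \sum_i w 0 i * l1 a c y 'e_i.
  by apply: (nearO (im_open (c:=c)) cy0)=> y cy; exact/lin_exp/l1_lin.
 have d3 i: derivable (fun y=> l1 a c y 'e_i) y0 u by exact: (Ck_dvb (sa c _ 1%N) cy0).
 have d4 i: derivable (fun y=> w 0 i * l1 a c y 'e_i) y0 u by apply: derivableM (d3 i).
 rewrite (near_eq_derive _ E') (der_sums _ (fun i _=> d4 i)).2.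
 by apply: eq_bigr=> i _; rewrite (deriveMc _ (d3 i)).2.
rewrite -big_split /=; apply: eq_bigr=> i _.
rewrite deriveM// (pull_der _ (sa c 'e_i 1%N)) dtau_z tz.
by rewrite addrC /GRing.scale /= [_ * 'D_ _ (dtau _ _) _]mulrC.
Qed.

(** Second derivatives of the transition map enter [D_l1] symmetrically in [u] and [w], and cancel
    in the antisymmetrization. *)
Lemma natural_d1 (a: rform X 1) u v: smooth1 a -> l2 (ext_d a) c y0 u v =
 'D_u (fun y=> l1 a c y v) y0 - 'D_v (fun y=> l1 a c y u) y0.
move=> sa; rewrite l2E -/p !fchE// -/p ext_d1 -/z0 -/T (D_l1 u v sa) (D_l1 v u sa) opprD addrACA.
rewrite [X in X + _](_: _ = 0) ?add0r// -sumrB big1// => i _.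
by rewrite dtau_sym subrr.
Qed.

(** The Hessian of the transition map, on the vectors whose coordinates in chart [c] are [u] and
    [w]. *)
Let hess u w: V := \row_i 'D_(u *m T) (dtau (w *m T) i) z0.

Let hess_sym u w: hess u w = hess w u.
apply/rowP=> i; apply: etrans (row_mxE _ i) _.
exact: etrans (dtau_sym _ _ i) (esym (row_mxE _ i)).
Qed.

Let D_l2 (a: rform X 2) u w w': smooth2 a ->
 'D_(u *m T) (fun z=> l2 a p z (w *m T) (w' *m T)) z0 =
 l2 a c y0 (hess u w) w' + l2 a c y0 w (hess u w') + 'D_u (fun y=> l2 a c y w w') y0.
move=> [al sa]; have al0 := l2_alt cy0 (al _).
have K (s t A L P Q h h': R): h = P -> h' = Q ->
  (s * t) *: A + L *: (s *: Q + t *: P) = h * t * L + s * h' * L + s * t * A.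
 by move=> -> ->; rewrite /GRing.scale /=; ring.
have E: \forall z \near z0, l2 a p z (w *m T) (w' *m T) =
  \sum_i \sum_j dtau (w *m T) i z * dtau (w' *m T) j z * l2 a c (tau z) 'e_i 'e_j.
 by apply: (nearO oU Uz)=> z; exact: l2_tau.
rewrite (near_eq_derive _ E).
have d1 b i: derivable (dtau (b *m T) i) z0 (u *m T) by exact: (Ck_dvb (dtau_sm (b *m T) i 1) Uz).
have d2 i j: derivable (fun z=> l2 a c (tau z) 'e_i 'e_j) z0 (u *m T).
 exact: (Ck_dvb (pull_sm (sa c 'e_i 'e_j 1%N)) Uz).
have d12 i j: derivable (fun z=> dtau (w *m T) i z * dtau (w' *m T) j z * l2 a c (tau z) 'e_i 'e_j) z0 (u *m T).
 by apply: derivableM=>//; exact: derivableM.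
rewrite (der_sums _ (fun i _=> (der_sums _ (fun j _=> d12 i j)).1)).2.
have -> : 'D_u (fun y=> l2 a c y w w') y0 = \sum_i \sum_j w 0 i * w' 0 j * 'D_u (fun y=> l2 a c y 'e_i 'e_j) y0.
 have E': \forall y \near y0, l2 a c y w w' = \sum_i \sum_j w 0 i * w' 0 j * l2 a c y 'e_i 'e_j.
  by apply: (nearO (im_open (c:=c)) cy0)=> y cy; exact/alt2_exp/l2_alt.
 have d3 i j: derivable (fun y=> w 0 i * w' 0 j * l2 a c y 'e_i 'e_j) y0 u.
  by apply: derivableM=>//; exact: (Ck_dvb (sa c _ _ 1%N) cy0).
 rewrite (near_eq_derive _ E') (der_sums _ (fun i _=> (der_sums _ (fun j _=> d3 i j)).1)).2.
 apply: eq_bigr=> i _; rewrite (der_sums _ (fun j _=> d3 i j)).2; apply: eq_bigr=> j _.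
 by rewrite (deriveMc _ (Ck_dvb (sa c 'e_i 'e_j 1%N) cy0 (v:=u))).2.
rewrite !(alt2_exp _ _ al0) -!big_split /=; apply: eq_bigr=> i _.
rewrite (der_sums _ (fun j _=> d12 i j)).2 -!big_split /=; apply: eq_bigr=> j _.
have dd: derivable (fun z=> dtau (w *m T) i z * dtau (w' *m T) j z) z0 (u *m T) by exact: derivableM.
rewrite (deriveM dd (d2 i j)) (pull_der _ (sa c 'e_i 'e_j 1%N)) (deriveM (d1 w i) (d1 w' j)) !dtau_z tz.
apply: K; exact: row_mxE.
Qed.

(** The six Hessian terms cancel in pairs, by symmetry of [hess] and antisymmetry of the form. *)
Lemma natural_d2 (a: rform X 2) u v w: smooth2 a -> l3 (ext_d a) c y0 u v w =
 'D_u (fun y=> l2 a c y v w) y0 - 'D_v (fun y=> l2 a c y u w) y0 + 'D_w (fun y=> l2 a c y u v) y0.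
move=> sa; have al0 := l2_alt cy0 (sa.1 _).
rewrite l3E !fchE// ext_d2.
have H (A B C A' B' C': R): A = A' -> B = B' -> C = C' -> A - B + C = A' - B' + C'.
 by move=> -> -> ->.
apply: etrans (H _ _ _ _ _ _ (D_l2 u v w sa) (D_l2 v u w sa) (D_l2 w u v sa)) _.
move: (hess_sym v u) (hess_sym w u) (hess_sym w v).
move: (hess u v) (hess u w) (hess v w) (hess v u) (hess w u) (hess w v)=> h1 h2 h3 _ _ _ -> -> ->.
rewrite (alt2C h1 w al0) (alt2C v h2 al0).
have K (A B C D E F: R): - D - E + A - (- D + F + B) + (E + F + C) = A - B + C by ring.
exact: K.
Qed.

End Naturality.

End Forms1.

(** * Hermitian linear algebra in real dimension four *)

Section Ord4.
Definition o0: 'I_4 := Ordinal (isT: 0 < 4)%N.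
Definition o1: 'I_4 := Ordinal (isT: 1 < 4)%N.
Definition o2: 'I_4 := Ordinal (isT: 2 < 4)%N.
Definition o3: 'I_4 := Ordinal (isT: 3 < 4)%N.

Lemma sum4 (M: nmodType) (E: 'I_4 -> M): \sum_i E i = E o0 + E o1 + E o2 + E o3.
rewrite !big_ord_recl big_ord0 addr0 !addrA.
by congr (_ + _ + _ + _); congr E; apply: val_inj.
Qed.

Lemma ord4P (P: 'I_4 -> Prop): P o0 -> P o1 -> P o2 -> P o3 -> forall i, P i.
move=> p0 p1 p2 p3 [[|[|[|[|//]]]] i].
- by rewrite (_: Ordinal i = o0)//; exact: val_inj.
- by rewrite (_: Ordinal i = o1)//; exact: val_inj.
- by rewrite (_: Ordinal i = o2)//; exact: val_inj.
- by rewrite (_: Ordinal i = o3)//; exact: val_inj.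
Qed.
End Ord4.

Section Pointwise.
Variables (R: realType).
Local Notation V := 'rV[R]_4.
Local Notation e := (fun i: 'I_4=> delta_mx 0 i: V).
Implicit Types (u v w: V) (a b: V -> V -> R) (A: 'M[R]_4).

(** The determinant as a polynomial in entries indexed by numbers, so that [ring] can expand it. *)
Definition pdet4 (m: nat -> nat -> R) :=
 m 0 0 * (m 1 1 * (m 2 2 * m 3 3 - m 2 3 * m 3 2) - m 1 2 * (m 2 1 * m 3 3 - m 2 3 * m 3 1) + m 1 3 * (m 2 1 * m 3 2 - m 2 2 * m 3 1))
 - m 0 1 * (m 1 0 * (m 2 2 * m 3 3 - m 2 3 * m 3 2) - m 1 2 * (m 2 0 * m 3 3 - m 2 3 * m 3 0) + m 1 3 * (m 2 0 * m 3 2 - m 2 2 * m 3 0))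
 + m 0 2 * (m 1 0 * (m 2 1 * m 3 3 - m 2 3 * m 3 1) - m 1 1 * (m 2 0 * m 3 3 - m 2 3 * m 3 0) + m 1 3 * (m 2 0 * m 3 1 - m 2 1 * m 3 0))
 - m 0 3 * (m 1 0 * (m 2 1 * m 3 2 - m 2 2 * m 3 1) - m 1 1 * (m 2 0 * m 3 2 - m 2 2 * m 3 0) + m 1 2 * (m 2 0 * m 3 1 - m 2 1 * m 3 0)).

Lemma det4E A: \det A = pdet4 (fun i j=> A (inord i) (inord j)).
set m := fun i j: nat=> A (inord i) (inord j).
have E i j: A i j = m i j by rewrite /m !inord_val.
rewrite (expand_det_row _ ord0) !big_ord_recl big_ord0 /cofactor.
rewrite !(expand_det_row _ ord0) !big_ord_recl !big_ord0 /cofactor.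
rewrite !(expand_det_row _ ord0) !big_ord_recl !big_ord0 /cofactor !det_mx11 !mxE !E /= /bump /=.
rewrite /pdet4 /=; ring.
Qed.

(** The wedge of two 2-forms, and next that of a 1-form with a 3-form, evaluated on four vectors. *)
Definition W22 (v0 v1 v2 v3: V) a b := a v0 v1 * b v2 v3 - a v0 v2 * b v1 v3 + a v0 v3 * b v1 v2
 + a v1 v2 * b v0 v3 - a v1 v3 * b v0 v2 + a v2 v3 * b v0 v1.
Definition W13 (v0 v1 v2 v3: V) (z: V -> R) (h: V -> V -> V -> R) :=
 z v0 * h v1 v2 v3 - z v1 * h v0 v2 v3 + z v2 * h v0 v1 v3 - z v3 * h v0 v1 v2.

Lemma alt2_6 b u v: alt2 b -> b u v =
 (u 0 o0 * v 0 o1 - u 0 o1 * v 0 o0) * b (e o0) (e o1) +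
 (u 0 o0 * v 0 o2 - u 0 o2 * v 0 o0) * b (e o0) (e o2) +
 (u 0 o0 * v 0 o3 - u 0 o3 * v 0 o0) * b (e o0) (e o3) +
 (u 0 o1 * v 0 o2 - u 0 o2 * v 0 o1) * b (e o1) (e o2) +
 (u 0 o1 * v 0 o3 - u 0 o3 * v 0 o1) * b (e o1) (e o3) +
 (u 0 o2 * v 0 o3 - u 0 o3 * v 0 o2) * b (e o2) (e o3).
move=> ab; rewrite (alt2_exp u v ab) !sum4.
have [_ _ d] := ab; rewrite !d.
rewrite (alt2C (e o1) (e o0) ab) (alt2C (e o2) (e o0) ab) (alt2C (e o3) (e o0) ab).
rewrite (alt2C (e o2) (e o1) ab) (alt2C (e o3) (e o1) ab) (alt2C (e o3) (e o2) ab).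
ring.
Qed.

Lemma det4_rows v0 v1 v2 v3: \det (\matrix_(i < 4) nth 0 [:: v0; v1; v2; v3] i) =
 pdet4 (fun i j=> nth 0 [:: v0; v1; v2; v3] i 0 (nth o0 [:: o0; o1; o2; o3] j)).
rewrite det4E; have E (i j: nat): (i < 4)%N -> (j < 4)%N ->
  (\matrix_(i < 4) nth 0 [:: v0; v1; v2; v3] i) (inord i) (inord j: 'I_4) =
  nth 0 [:: v0; v1; v2; v3] i 0 (nth o0 [:: o0; o1; o2; o3] j).
 move=> i4 j4; rewrite mxE inordK//; congr (fun_of_matrix _ _ _); apply: val_inj; rewrite /= inordK//.
 by case: j j4=> [|[|[|[|]]]].
by rewrite /pdet4 !E.
Qed.

Lemma W22_det v0 v1 v2 v3 a b: alt2 a -> alt2 b ->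
 W22 v0 v1 v2 v3 a b = \det (\matrix_(i < 4) nth 0 [:: v0; v1; v2; v3] i) * W22 (e o0) (e o1) (e o2) (e o3) a b.
move=> aa ab; rewrite det4_rows /W22 /pdet4 /=.
rewrite !(alt2_6 v0 _ aa) !(alt2_6 v1 _ aa) (alt2_6 v2 v3 aa).
rewrite !(alt2_6 v0 _ ab) !(alt2_6 v1 _ ab) (alt2_6 v2 v3 ab).
move: (a (e o0) (e o1)) (a (e o0) (e o2)) (a (e o0) (e o3)) (a (e o1) (e o2)) (a (e o1) (e o3)) (a (e o2) (e o3)).
move: (b (e o0) (e o1)) (b (e o0) (e o2)) (b (e o0) (e o3)) (b (e o1) (e o2)) (b (e o1) (e o3)) (b (e o2) (e o3)).
move: (v0 0 o0) (v0 0 o1) (v0 0 o2) (v0 0 o3) (v1 0 o0) (v1 0 o1) (v1 0 o2) (v1 0 o3).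
move: (v2 0 o0) (v2 0 o1) (v2 0 o2) (v2 0 o3) (v3 0 o0) (v3 0 o1) (v3 0 o2) (v3 0 o3).
intros; ring.
Qed.

Lemma alt3_alt2 (h: V -> V -> V -> R) u: alt3 h -> alt2 (h u).
by case=> l1 l2 l3 d1 [d2 d3]; split=> [w|v|v]; [exact: l2|exact: l3|exact: d2]. Qed.

Lemma alt3_4 (h: V -> V -> V -> R) u v w: alt3 h -> h u v w =
 (u 0 o0 * (v 0 o1 * w 0 o2 - v 0 o2 * w 0 o1) - u 0 o1 * (v 0 o0 * w 0 o2 - v 0 o2 * w 0 o0)
  + u 0 o2 * (v 0 o0 * w 0 o1 - v 0 o1 * w 0 o0)) * h (e o0) (e o1) (e o2) +
 (u 0 o0 * (v 0 o1 * w 0 o3 - v 0 o3 * w 0 o1) - u 0 o1 * (v 0 o0 * w 0 o3 - v 0 o3 * w 0 o0)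
  + u 0 o3 * (v 0 o0 * w 0 o1 - v 0 o1 * w 0 o0)) * h (e o0) (e o1) (e o3) +
 (u 0 o0 * (v 0 o2 * w 0 o3 - v 0 o3 * w 0 o2) - u 0 o2 * (v 0 o0 * w 0 o3 - v 0 o3 * w 0 o0)
  + u 0 o3 * (v 0 o0 * w 0 o2 - v 0 o2 * w 0 o0)) * h (e o0) (e o2) (e o3) +
 (u 0 o1 * (v 0 o2 * w 0 o3 - v 0 o3 * w 0 o2) - u 0 o2 * (v 0 o1 * w 0 o3 - v 0 o3 * w 0 o1)
  + u 0 o3 * (v 0 o1 * w 0 o2 - v 0 o2 * w 0 o1)) * h (e o1) (e o2) (e o3).
move=> ah; have [l1 _ _ d1 [d2 d3]] := ah.
rewrite (lin_exp u (l1 v w)) sum4 !(alt2_6 v w (alt3_alt2 _ ah)) ?d1 ?d2.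
have C12 i j k: h (e i) (e j) (e k) = - h (e j) (e i) (e k) by exact: alt3C12.
have C23 i j k: h (e i) (e j) (e k) = - h (e i) (e k) (e j) by exact: alt3C23.
rewrite (C12 o1 o0 o2) (C12 o1 o0 o3) (C12 o2 o0 o3) (C12 o2 o1 o3).
rewrite (C12 o2 o0 o1) (C12 o3 o0 o1) (C12 o3 o0 o2) (C12 o3 o1 o2).
rewrite (C23 o0 o2 o1) (C23 o0 o3 o1) (C23 o0 o3 o2) (C23 o1 o3 o2).
rewrite ?d1 ?d2 ?d3; ring.
Qed.

Lemma W13_det v0 v1 v2 v3 z h: lin z -> alt3 h ->
 W13 v0 v1 v2 v3 z h = \det (\matrix_(i < 4) nth 0 [:: v0; v1; v2; v3] i) * W13 (e o0) (e o1) (e o2) (e o3) z h.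
move=> lz ah; rewrite det4_rows /W13 /pdet4 /=.
rewrite (lin_exp v0 lz) (lin_exp v1 lz) (lin_exp v2 lz) (lin_exp v3 lz) !sum4.
rewrite (alt3_4 v1 v2 v3 ah) (alt3_4 v0 v2 v3 ah) (alt3_4 v0 v1 v3 ah) (alt3_4 v0 v1 v2 ah).
move: (z (e o0)) (z (e o1)) (z (e o2)) (z (e o3)).
move: (h (e o0) (e o1) (e o2)) (h (e o0) (e o1) (e o3)) (h (e o0) (e o2) (e o3)) (h (e o1) (e o2) (e o3)).
move: (v0 0 o0) (v0 0 o1) (v0 0 o2) (v0 0 o3) (v1 0 o0) (v1 0 o1) (v1 0 o2) (v1 0 o3).
move: (v2 0 o0) (v2 0 o1) (v2 0 o2) (v2 0 o3) (v3 0 o0) (v3 0 o1) (v3 0 o2) (v3 0 o3).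
intros; ring.
Qed.

Definition met (G: 'M[R]_4) u v := (u *m G *m v^T) 0 0.
Definition bil a := (forall w, lin (a^~ w)) /\ forall u, lin (a u).
(** Trace of a bilinear form with respect to the inverse metric; [tr2_basis] computes it in any
    basis. *)
Definition tr2 (G: 'M[R]_4) a := \sum_i \sum_j invmx G i j * a (e i) (e j).

Lemma alt2_bil b: alt2 b -> bil b. Proof. by case. Qed.

Lemma bil_exp b u v: bil b -> b u v = \sum_i \sum_j u 0 i * v 0 j * b (e i) (e j).
case=> l1 l2; rewrite (lin_exp u (l1 v)); apply: eq_bigr=> i _.
rewrite (lin_exp v (l2 _)) mulr_sumr; apply: eq_bigr=> j _; exact: mulrA.
Qed.

Lemma met_bil G: bil (met G).
split=> [w t u u'|u t w w']; rewrite /met.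
 by rewrite !mulmxDl -!scalemxAl !mxE.
by rewrite linearP /= mulmxDr -scalemxAr !mxE.
Qed.

Lemma tr2_basis G A b: G \in unitmx -> A \in unitmx -> bil b ->
 \sum_i \sum_j invmx (A *m G *m A^T) i j * b (row i A) (row j A) = tr2 G b.
move=> uG uA bb; pose B: 'M[R]_4 := \matrix_(i, j) b (e i) (e j).
have trE (M N: 'M[R]_4): \sum_i \sum_j M i j * N i j = \tr (M^T *m N).
 rewrite /mxtrace; under [RHS]eq_bigr do rewrite mxE.
 rewrite exchange_big; apply: eq_bigr=> i _; apply: eq_bigr=> j _; by rewrite mxE.
transitivity (\tr ((invmx (A *m G *m A^T))^T *m (A *m B *m A^T))).
 rewrite -trE; apply: eq_bigr=> i _; apply: eq_bigr=> j _; congr (_ * _).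
 rewrite bil_exp// [RHS]mxE exchange_big; apply: eq_bigr=> l _.
 rewrite [(A *m B) i l]mxE mulr_suml; apply: eq_bigr=> k _; rewrite !mxE; ring.
have uAT: A^T \in unitmx by rewrite unitmx_tr.
have -> : invmx (A *m G *m A^T) = invmx A^T *m invmx G *m invmx A.
 apply: (can_inj (mulmxK (_: A *m G *m A^T \in unitmx))); first by rewrite !unitmx_mul uA uG.
 rewrite mulVmx ?unitmx_mul ?uA ?uG// !mulmxA mulmxKV// -!mulmxA (mulmxA (invmx G)) mulVmx// mul1mx.
 by rewrite mulVmx.
rewrite !trmx_mul !trmx_inv trmxK mxtrace_mulC !mulmxA -[X in \tr X]mulmxA.
rewrite mulmxK// mulmxA mxtrace_mulC !mulmxA mulVmx// mul1mx.
rewrite /tr2; transitivity (\sum_i \sum_j invmx G i j * B i j); last first.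
 by apply: eq_bigr=> i _; apply: eq_bigr=> j _; rewrite mxE.
by rewrite trE trmx_inv mxtrace_mulC.
Qed.

(** A unitary frame, given by the rows of [F]. The pointwise identities below are checked in such a
    frame, where they are polynomial in the coefficients. *)
Record uframe (J G F: 'M[R]_4): Prop := UFrame {
 uframe_J0: row o0 F *m J = row o1 F; uframe_J1: row o1 F *m J = - row o0 F;
 uframe_J2: row o2 F *m J = row o3 F; uframe_J3: row o3 F *m J = - row o2 F;
 uframe_G: F *m G *m F^T = 1%:M }.

Definition uframe_J (J G F: 'M[R]_4) (uf: uframe J G F) :=
 (uframe_J0 uf, uframe_J1 uf, uframe_J2 uf, uframe_J3 uf).

Definition herm (J G: 'M[R]_4) := [/\ J *m J = - 1%:M, G^T = G, forall v, v != 0 -> 0 < met G v v &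
 forall v w, met G (v *m J) (w *m J) = met G v w].

Lemma met_rows (A G: 'M[R]_4) i j: (A *m G *m A^T) i j = met G (row i A) (row j A).
rewrite /met -row_mul [LHS]mxE [RHS]mxE; apply: eq_bigr=> k _.
by rewrite !mxE.
Qed.

Lemma met_sym G u v: G^T = G -> met G u v = met G v u.
move=> sG; have -> : met G u v = ((u *m G *m v^T)^T) 0 0 by rewrite mxE.
by rewrite !trmx_mul sG trmxK mulmxA.
Qed.

(** Gram-Schmidt by complex lines: a unit vector, its image under [J], a unit vector orthogonal to
    both, and its image. The third vector exists because two linear equations in four unknowns have
    a nonzero solution. *)
Lemma uframeP J G: herm J G -> exists F, uframe J G F.
move=> [J2 sG pG JG]; have [ml mr] := met_bil G.
have JJ v: v *m J *m J = - v by rewrite -mulmxA J2 mulmxN mulmx1.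
have mN u v: met G (- u) v = - met G u v by exact: linN (ml v).
have mN' u v: met G u (- v) = - met G u v by exact: linN (mr u).
have orth v: met G v (v *m J) = 0.
 have := JG v (v *m J); rewrite JJ mN' (met_sym (v *m J) v sG); lra.
have unit v: v != 0 -> exists2 u, met G u u = 1 & exists t: R, u = t *: v.
 move=> v0; have p := pG v v0; exists ((Num.sqrt (met G v v))^-1 *: v); last by eexists.
 rewrite (linZ _ _ (ml _)) (linZ _ _ (mr _)) mulrA -invfM -expr2 sqr_sqrtr ?ltW//.
 by rewrite mulVf// gt_eqF.
have [|f0 n0 _] := unit (e o0).
 by apply/eqP=> /rowP/(_ o0); rewrite !mxE !eqxx=> /eqP; rewrite oner_eq0.
pose f1 := f0 *m J.
pose K := kermx (G *m (col_mx f0 f1)^T).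
have [w w0 [w1 w2]] : exists2 w, w != 0 & met G w f0 = 0 /\ met G w f1 = 0.
 have: K != 0.
  rewrite -mxrank_eq0 mxrank_ker; have := rank_leq_col (G *m (col_mx f0 f1)^T).
  by case: (\rank _)=> [|[|[|]]].
 move=> /rowV0Pn[w wK w0]; exists w=>//.
 have := sub_kermxP wK; rewrite mulmxA tr_col_mx mul_mx_row=> /eqP.
 by rewrite -row_mx0=> /eqP/eq_row_mx[h1 h2]; rewrite /met h1 h2 mxE.
have [f2 n2 [t Ef2]] := unit w w0; pose f3 := f2 *m J.
have m20: met G f2 f0 = 0 by rewrite Ef2 (linZ _ _ (ml _)) w1 mulr0.
have m21: met G f2 f1 = 0 by rewrite Ef2 (linZ _ _ (ml _)) w2 mulr0.
have m31: met G f3 f1 = 0 by rewrite JG.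
have m30: met G f3 f0 = 0.
 have -> : met G f3 f0 = - met G f3 (f1 *m J) by rewrite JJ mN' opprK.
 by rewrite JG m21 oppr0.
have m01: met G f0 f1 = 0 by exact: orth.
have m23: met G f2 f3 = 0 by exact: orth.
have n1: met G f1 f1 = 1 by rewrite JG.
have n3: met G f3 f3 = 1 by rewrite JG.
pose F: 'M[R]_4 := \matrix_(i < 4) nth 0 [:: f0; f1; f2; f3] i.
have r0: row o0 F = f0 by rewrite rowK.
have r1: row o1 F = f1 by rewrite rowK.
have r2: row o2 F = f2 by rewrite rowK.
have r3: row o3 F = f3 by rewrite rowK.
exists F; split; rewrite ?r0 ?r1 ?r2 ?r3 // /f1 /f3 ?JJ //.
apply/matrixP=> i j; rewrite met_rows.
have S u v: met G u v = met G v u by exact: met_sym.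
rewrite mxE; move: i j; do 2!apply: ord4P; rewrite ?r0 ?r1 ?r2 ?r3 //=; by rewrite S.
Qed.

(** Contraction with the fundamental form; in a unitary frame it is [b f0 f1 + b f2 f3]. *)
Definition Lam (J G: 'M[R]_4) b := 2^-1 * tr2 G (fun u v=> b u (v *m J)).
(** The same contraction on 3-forms. In dimension 4 it inverts the wedge of 1-forms with the
    fundamental form, so 3-forms are handled through 1-forms from here on. *)
Definition Lam3 (J G: 'M[R]_4) (h: V -> V -> V -> R) w := 2^-1 * tr2 G (fun u v=> h u (v *m J) w).
Definition om (J G: 'M[R]_4) u v := met G (u *m J) v.
(** The Hodge star on 2-forms, written through [J] and the contraction, without volume form or
    frame. It is matched with [hodge_star2] in [hodge_star2E]. *)
Definition star (J G: 'M[R]_4) b u v := Lam J G b * om J G u v - b (u *m J) (v *m J).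
Definition N (G: 'M[R]_4) (z z': V -> R) := tr2 G (fun u v=> z u * z' v).
Definition wd (z: V -> R) b u v w := z u * b v w - z v * b u w + z w * b u v.
Definition wd1 (z z': V -> R) u v := z u * z' v - z v * z' u.
Definition I2 (G: 'M[R]_4) a b := 2^-1 * \sum_(i < 4) \sum_(j < 4) \sum_(k < 4) \sum_(l < 4)
 (invmx G i k * invmx G j l * a (e i) (e j) * b (e k) (e l)).

Section Frame.
Variables (J G F: 'M[R]_4).
Hypotheses (hJG: herm J G) (uf: uframe J G F).
Local Notation f0 := (row o0 F).
Local Notation f1 := (row o1 F).
Local Notation f2 := (row o2 F).
Local Notation f3 := (row o3 F).

Lemma uframe_unit: F \in unitmx /\ G \in unitmx.
have E := uframe_G uf; have [u1 _] := mulmx1_unit (etrans (mulmxA _ _ _) E).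
split=>//; case: (mulmx1_unit E)=> h _; move: h; rewrite unitmx_mul=> /andP[_ ->].
by [].
Qed.

Lemma uframe_inv: invmx G = F^T *m F.
have [uF uG] := uframe_unit; have E := uframe_G uf.
apply: (can_inj (mulmxK uG)); rewrite mulVmx// -mulmxA.
have: F^T *m (F *m G *m F^T) = F^T by rewrite E mulmx1.
rewrite !mulmxA=> H; have uFT: F^T \in unitmx by rewrite unitmx_tr.
apply: (can_inj (mulmxK uFT)); by rewrite mul1mx H.
Qed.

Lemma tr2F b: bil b -> tr2 G b = b f0 f0 + b f1 f1 + b f2 f2 + b f3 f3.
move=> bb; have [uF uG] := uframe_unit; rewrite -(tr2_basis uG uF bb) (uframe_G uf) invmx1.
by rewrite !sum4 !mxE /= !mul1r !mul0r !(addr0, add0r).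
Qed.

Lemma frame_exp u: u = met G u f0 *: f0 + met G u f1 *: f1 + met G u f2 *: f2 + met G u f3 *: f3.
have [uF uG] := uframe_unit.
have E: u = u *m G *m F^T *m F by rewrite -mulmxA -uframe_inv mulmxK.
rewrite {1}E mulmx_sum_row sum4.
have H i: (u *m G *m F^T) 0 i = met G u (row i F).
 by rewrite /met rowE trmx_mul trmx_delta !mulmxA -colE [RHS]mxE.
by rewrite !H.
Qed.

Lemma lin_fext (z z': V -> R): lin z -> lin z' -> z f0 = z' f0 -> z f1 = z' f1 -> z f2 = z' f2 ->
 z f3 = z' f3 -> z = z'.
move=> l l' e0 e1 e2 e3; apply/funext=> u; rewrite (frame_exp u).
by rewrite !(linD _ _ l) !(linD _ _ l') !(linZ _ _ l) !(linZ _ _ l') e0 e1 e2 e3.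
Qed.

Lemma alt2_fext a b: alt2 a -> alt2 b -> a f0 f1 = b f0 f1 -> a f0 f2 = b f0 f2 ->
 a f0 f3 = b f0 f3 -> a f1 f2 = b f1 f2 -> a f1 f3 = b f1 f3 -> a f2 f3 = b f2 f3 -> a = b.
move=> aa ab e01 e02 e03 e12 e13 e23; have [l1 l2 d] := aa; have [l1' l2' d'] := ab.
have C u v: a u v = - a v u by exact: alt2C.
have C' u v: b u v = - b v u by exact: alt2C.
have K0: a^~ f0 = b^~ f0.
 by apply: lin_fext=>//; rewrite ?d ?d'// C C' ?(e01, e02, e03).
have K1: a^~ f1 = b^~ f1.
 by apply: lin_fext=>//; rewrite ?d ?d' ?e01// C C' ?(e12, e13).
have K2: a^~ f2 = b^~ f2.
 by apply: lin_fext=>//; rewrite ?d ?d' ?e02 ?e12// C C' e23.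
have K3: a^~ f3 = b^~ f3.
 by apply: lin_fext=>//; rewrite ?d ?d' ?e03 ?e13 ?e23.
apply/funext=> u; exact: (lin_fext (l2 u) (l2' u) (congr1 (@^~ u) K0) (congr1 (@^~ u) K1)
 (congr1 (@^~ u) K2) (congr1 (@^~ u) K3)).
Qed.

Lemma alt3_fext (h k: V -> V -> V -> R): alt3 h -> alt3 k ->
 h f0 f1 f2 = k f0 f1 f2 -> h f0 f1 f3 = k f0 f1 f3 -> h f0 f2 f3 = k f0 f2 f3 ->
 h f1 f2 f3 = k f1 f2 f3 -> h = k.
move=> ah ak e012 e013 e023 e123.
have C12 u v w: h u v w = - h v u w by exact: alt3C12.
have C12' u v w: k u v w = - k v u w by exact: alt3C12.
have C23 u v w: h u v w = - h u w v by exact: alt3C23.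
have C23' u v w: k u v w = - k u w v by exact: alt3C23.
have [l1 _ _ d1 [d2 d3]] := ah; have [l1' _ _ d1' [d2' d3']] := ak.
have e0: h f0 = k f0 by apply: alt2_fext; rewrite ?d1 ?d1' //; exact: alt3_alt2.
have K0 v w: h v f0 w = k v f0 w by rewrite C12 C12' e0.
have K0' v w: h v w f0 = k v w f0 by rewrite C23 C23' K0.
have e1: h f1 = k f1 by apply: alt2_fext; rewrite ?K0 ?d1 ?d1' //; exact: alt3_alt2.
have K1 v w: h v f1 w = k v f1 w by rewrite C12 C12' e1.
have e2: h f2 = k f2 by apply: alt2_fext; rewrite ?K0 ?K1 ?d1 ?d1' //; exact: alt3_alt2.
have K2 v w: h v f2 w = k v f2 w by rewrite C12 C12' e2.
have e3: h f3 = k f3 by apply: alt2_fext; rewrite ?K0 ?K1 ?K2 //; exact: alt3_alt2.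
apply: funext2=> u v; apply/funext=> w.
have E: (fun u=> h u v w) = (fun u=> k u v w) by apply: lin_fext; rewrite ?e0 ?e1 ?e2 ?e3.
exact: (congr1 (@^~ u) E).
Qed.

Lemma om_alt2: alt2 (om J G).
have [J2 sG pG JG] := hJG; have [ml mr] := met_bil G; split=> [w t u u'|u|u].
- by rewrite /om mulmxDl -scalemxAl ml.
- exact: mr.
- have := JG u (u *m J); rewrite -mulmxA J2 mulmxN mulmx1 (linN _ (mr _)) (met_sym _ _ sG) /om.
 by rewrite [met G u _]met_sym//; lra.
Qed.

Lemma met_frame i j: met G (row i F) (row j F) = (i == j)%:R.
by have := uframe_G uf=> /matrixP/(_ i j); rewrite [RHS]mxE=> <-; rewrite met_rows.
Qed.

Lemma om_frame: [/\ om J G f0 f1 = 1, om J G f0 f2 = 0, om J G f0 f3 = 0 &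
 [/\ om J G f1 f2 = 0, om J G f1 f3 = 0 & om J G f2 f3 = 1]].
have [ml _] := met_bil G.
by rewrite /om (uframe_J0 uf) (uframe_J1 uf) (uframe_J2 uf) !(linN _ (ml _)) !met_frame /= oppr0.
Qed.

Lemma lin_J (z: V -> R): lin z -> lin (fun v=> z (v *m J)).
by move=> l t u w; rewrite mulmxDl -scalemxAl l. Qed.

Lemma bil_J b: bil b -> bil (fun u v=> b u (v *m J)).
by case=> l1 l2; split=> [w|u]; [exact: l1|exact: lin_J]. Qed.

Lemma alt2_JJ b: alt2 b -> alt2 (fun u v=> b (u *m J) (v *m J)).
by case=> l1 l2 d; split=> [w|u|u]; [exact: (lin_J (l1 _))|exact: lin_J|exact: d]. Qed.

Lemma Lam_frame b: alt2 b -> Lam J G b = b f0 f1 + b f2 f3.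
move=> ab; have [l1 l2 d] := ab; rewrite /Lam tr2F; last exact/bil_J/alt2_bil.
rewrite !(uframe_J uf) !(linN _ (l2 _)).
by rewrite (alt2C f1 f0 ab) (alt2C f3 f2 ab); field.
Qed.

Lemma Lam3F h: alt3 h -> [/\ Lam3 J G h f0 = h f0 f2 f3, Lam3 J G h f1 = h f1 f2 f3,
 Lam3 J G h f2 = h f0 f1 f2 & Lam3 J G h f3 = h f0 f1 f3].
move=> ah; have [l1 l2 l3 d1 [d2 d3]] := ah.
have C12 u v w: h u v w = - h v u w by exact: alt3C12.
have C23 u v w: h u v w = - h u w v by exact: alt3C23.
have E w: Lam3 J G h w = h f0 f1 w + h f2 f3 w.
 rewrite /Lam3 tr2F; last by apply: (bil_J (b:=fun u v=> h u v w)).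
 rewrite !(uframe_J uf) !(linN _ (l2 _ _)).
 by rewrite (C12 f1 f0) (C12 f3 f2); field.
split; rewrite E ?d1 ?d2 ?d3 ?addr0 ?add0r //.
- by rewrite C23 C12 opprK.
- by rewrite C23 C12 opprK.
Qed.

Lemma Lam3_lin h: alt3 h -> lin (Lam3 J G h).
move=> ah; have [l1 l2 l3 d1 [d2 d3]] := ah=> t u w.
rewrite /Lam3 /tr2 mulrCA -mulrDr; congr (_ * _); rewrite mulr_sumr -big_split; apply: eq_bigr=> i _ /=.
rewrite mulr_sumr -big_split; apply: eq_bigr=> j _ /=; rewrite l3; ring.
Qed.

Lemma N_frame z z': lin z -> lin z' -> N G z z' = z f0 * z' f0 + z f1 * z' f1 + z f2 * z' f2 + z f3 * z' f3.
move=> l l'; rewrite /N tr2F//; split=> [w t u u'|u t w w']; first by rewrite l mulrDl mulrA.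
by rewrite l'; ring.
Qed.

Lemma wd_alt3 z b: lin z -> alt2 b -> alt3 (wd z b).
move=> lz ab; have [l1 l2 d] := ab; have C u v: b u v = - b v u by exact: alt2C.
split=> [v w t u u'|u w t v v'|u v t w w'|u w|]; rewrite /wd.
- by rewrite lz !l1; ring.
- by rewrite lz !l1 !l2; ring.
- by rewrite lz !l2; ring.
- by rewrite d; ring.
- by split=> u w; rewrite ?d ?(C w u); ring.
Qed.

Lemma Lam_om: Lam J G (om J G) = 2.
by rewrite (Lam_frame om_alt2); have [-> _ _ [_ _ ->]] := om_frame. Qed.

Lemma starA b: alt2 b -> alt2 (star J G b).
move=> ab; have [l1 l2 d] := alt2_JJ ab; have [m1 m2 d'] := om_alt2.
split=> [w t u u'|u t w w'|u]; rewrite /star.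
- by rewrite m1 (l1 w t u u'); ring.
- by rewrite m2 (l2 u t w w'); ring.
- by rewrite d' d; ring.
Qed.

Lemma starF b: alt2 b -> [/\ star J G b f0 f1 = b f2 f3, star J G b f0 f2 = - b f1 f3,
 star J G b f0 f3 = b f1 f2 & [/\ star J G b f1 f2 = b f0 f3, star J G b f1 f3 = - b f0 f2 &
 star J G b f2 f3 = b f0 f1]].
move=> ab; have [l1 l2 d] := ab; have [w01 w02 w03 [w12 w13 w23]] := om_frame.
rewrite /star w01 w02 w03 w12 w13 w23 (Lam_frame ab).
rewrite !(uframe_J uf) !(linN _ (l2 _)) !(linN _ (l1 _)).
rewrite (alt2C f1 f0 ab) (alt2C f3 f2 ab).
by split=>//; [ring|ring|ring|split; ring].
Qed.

Lemma star_star b: alt2 b -> star J G (star J G b) = b.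
move=> ab; have ab' := starA ab; have [s1 s2 s3 [s4 s5 s6]] := starF ab.
have [t1 t2 t3 [t4 t5 t6]] := starF ab'.
by apply: alt2_fext; rewrite ?t1 ?t2 ?t3 ?t4 ?t5 ?t6 ?s1 ?s2 ?s3 ?s4 ?s5 ?s6 ?opprK//; exact: starA.
Qed.

Lemma Lam3_wd z: lin z -> Lam3 J G (wd z (om J G)) = z.
move=> lz; have ah := wd_alt3 lz om_alt2; have [w01 w02 w03 [w12 w13 w23]] := om_frame.
have [E0 E1 E2 E3] := Lam3F ah.
apply: lin_fext=>//; first exact: Lam3_lin.
- by rewrite E0 /wd w23 w03 w02; ring.
- by rewrite E1 /wd w23 w12 w13; ring.
- by rewrite E2 /wd w12 w02 w01; ring.
- by rewrite E3 /wd w13 w03 w01; ring.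
Qed.

Lemma wd_Lam3 h: alt3 h -> wd (Lam3 J G h) (om J G) = h.
move=> ah; have lz := Lam3_lin ah; have [w01 w02 w03 [w12 w13 w23]] := om_frame.
have [E0 E1 E2 E3] := Lam3F ah.
apply: alt3_fext=>//; first exact: (wd_alt3 lz om_alt2).
- by rewrite /wd w12 w02 w01 E2; ring.
- by rewrite /wd w13 w03 w01 E3; ring.
- by rewrite /wd w23 w03 w02 E0; ring.
- by rewrite /wd w23 w13 w12 E1; ring.
Qed.

Lemma pf_frame: W22 f0 f1 f2 f3 (om J G) (om J G) = 2.
by rewrite /W22; have [-> -> -> [-> -> ->]] := om_frame; ring. Qed.

(** Up to sign, [v |-> Lam3 J G h (v *m J)] is therefore the Hodge dual of the 3-form [h]. *)
Lemma W13_frame z h: lin z -> alt3 h -> W13 f0 f1 f2 f3 z h = N G z (fun v=> Lam3 J G h (v *m J)).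
move=> lz ah; have lh := Lam3_lin ah; have [E0 E1 E2 E3] := Lam3F ah.
rewrite N_frame//; last exact: lin_J.
rewrite !(uframe_J uf) !(linN _ lh) E0 E1 E2 E3 /W13.
ring.
Qed.

Lemma I2_tr2 (G0: 'M[R]_4) a b: I2 G0 a b = 2^-1 * tr2 G0 (fun u v=> tr2 G0 (fun u' v'=> a u u' * b v v')).
rewrite /I2 /tr2; congr (_ * _); apply: eq_bigr=> i _.
rewrite exchange_big; apply: eq_bigr=> k _; rewrite mulr_sumr; apply: eq_bigr=> j _.
by rewrite mulr_sumr; apply: eq_bigr=> l _; ring.
Qed.

Lemma I2_frame a b: alt2 a -> alt2 b -> I2 G a b =
 a f0 f1 * b f0 f1 + a f0 f2 * b f0 f2 + a f0 f3 * b f0 f3 + a f1 f2 * b f1 f2 + a f1 f3 * b f1 f3 + a f2 f3 * b f2 f3.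
move=> aa ab; have [l1 l2 d] := aa; have [l1' l2' d'] := ab.
rewrite I2_tr2 tr2F; last first.
 split=> [w t u u'|u t w w']; rewrite /tr2 mulr_sumr -big_split; apply: eq_bigr=> i _ /=;
 rewrite mulr_sumr -big_split; apply: eq_bigr=> j _ /=.
  by rewrite l1; ring.
 by rewrite l1'; ring.
rewrite !tr2F; try by split=> [w t u u'|u t w w']; rewrite ?l2 ?l2'; ring.
rewrite !d !d' (alt2C f1 f0 aa) (alt2C f2 f0 aa) (alt2C f3 f0 aa) (alt2C f2 f1 aa) (alt2C f3 f1 aa) (alt2C f3 f2 aa).
rewrite (alt2C f1 f0 ab) (alt2C f2 f0 ab) (alt2C f3 f0 ab) (alt2C f2 f1 ab) (alt2C f3 f1 ab) (alt2C f3 f2 ab).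
by field.
Qed.

Lemma W22_star_frame a b: alt2 a -> alt2 b -> W22 f0 f1 f2 f3 a (star J G b) = I2 G a b.
move=> aa ab; rewrite (I2_frame aa ab) /W22; have [-> -> -> [-> -> ->]] := starF ab; ring.
Qed.

End Frame.

Lemma alt2_scale (t: R) b: alt2 b -> alt2 (fun u v=> t * b u v).
case=> l1 l2 d; split=> [w x u u'|u x w w'|u]; first by rewrite l1; ring.
 by rewrite l2; ring.
by rewrite d mulr0.
Qed.

Lemma alt2_add a b: alt2 a -> alt2 b -> alt2 (fun u v=> a u v + b u v).
case=> l1 l2 d [l1' l2' d']; split=> [w x u u'|u x w w'|u]; first by rewrite l1 l1'; ring.
 by rewrite l2 l2'; ring.
by rewrite d d' addr0.
Qed.

(** The Pfaffian of the fundamental form: a square root of [\det G] whose sign compares the standard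
    basis with the orientation of [J]. *)
Definition pf (J G: 'M[R]_4) := 2^-1 * W22 (e o0) (e o1) (e o2) (e o3) (om J G) (om J G).

Section Herm.
Variables (J G: 'M[R]_4).
Hypothesis hJG: herm J G.

Lemma frame_rows (F: 'M[R]_4): F = \matrix_(i < 4) nth 0 [:: row o0 F; row o1 F; row o2 F; row o3 F] i.
by apply/row_matrixP; apply: ord4P; rewrite rowK. Qed.

(** Half the square of the fundamental form takes the value 1 on a unitary frame. *)
Lemma pf_det F: uframe J G F -> \det F * pf J G = 1.
move=> uf; have := W22_det (row o0 F) (row o1 F) (row o2 F) (row o3 F) (om_alt2 hJG) (om_alt2 hJG).
rewrite (pf_frame uf) -frame_rows /pf=> E; rewrite mulrCA -E.
by rewrite mulVf// pnatr_eq0.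
Qed.

Lemma pf_neq0: pf J G != 0.
have [F /pf_det E] := uframeP hJG; apply/eqP=> p0.
by move/eqP: E; rewrite p0 mulr0 eq_sym oner_eq0.
Qed.

Lemma pf_sqr: pf J G ^+ 2 = \det G.
have [F uf] := uframeP hJG; have E := pf_det uf.
have := congr1 determinant (uframe_G uf); rewrite !det_mulmx det_tr det1=> E'.
have: (\det F * pf J G) ^+ 2 * \det G = (\det F * \det G * \det F) * pf J G ^+ 2 by ring.
by rewrite E E' expr1n !mul1r.
Qed.

Lemma W22_I2 a b: alt2 a -> alt2 b ->
 W22 (e o0) (e o1) (e o2) (e o3) a (star J G b) = pf J G * I2 G a b.
move=> aa ab; have [F uf] := uframeP hJG; rewrite -(W22_star_frame uf aa ab).
rewrite (W22_det (row o0 F) (row o1 F) (row o2 F) (row o3 F) aa (starA hJG ab)) -frame_rows mulrA [pf J G * _]mulrC.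
by rewrite (pf_det uf) mul1r.
Qed.

Lemma W13_N z h: lin z -> alt3 h ->
 W13 (e o0) (e o1) (e o2) (e o3) z h = pf J G * N G z (fun v=> Lam3 J G h (v *m J)).
move=> lz ah; have [F uf] := uframeP hJG; rewrite -(W13_frame uf lz ah).
rewrite (W13_det (row o0 F) (row o1 F) (row o2 F) (row o3 F) lz ah) -frame_rows mulrA [pf J G * _]mulrC.
by rewrite (pf_det uf) mul1r.
Qed.

Lemma N_sym z z': lin z -> lin z' -> N G z z' = N G z' z.
by move=> lz lz'; have [F uf] := uframeP hJG; rewrite !(N_frame uf)//; ring.
Qed.

Lemma N_ge0 z: lin z -> 0 <= N G z z.
move=> lz; have [F uf] := uframeP hJG; rewrite (N_frame uf)//.
by rewrite !addr_ge0// -expr2 sqr_ge0.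
Qed.

Lemma N_eq0 z: lin z -> N G z z = 0 -> z = fun=> 0.
move=> lz; have [F uf] := uframeP hJG; rewrite (N_frame uf)// => E.
have l0: lin (fun _: V=> 0: R) by move=> t u w; rewrite mulr0 addr0.
by apply: (lin_fext uf)=>//; nra.
Qed.

Lemma N_JJ z z': lin z -> lin z' -> N G (fun v=> z (v *m J)) (fun v=> z' (v *m J)) = N G z z'.
move=> lz lz'; have [F uf] := uframeP hJG; rewrite !(N_frame uf)//; try exact: lin_J.
rewrite !(uframe_J uf) !(linN _ lz) !(linN _ lz').
ring.
Qed.

Lemma I2_sym a b: alt2 a -> alt2 b -> I2 G a b = I2 G b a.
by move=> aa ab; have [F uf] := uframeP hJG; rewrite !(I2_frame uf)//; ring.
Qed.

Lemma I2_ge0 a: alt2 a -> 0 <= I2 G a a.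
move=> aa; have [F uf] := uframeP hJG; rewrite (I2_frame uf)//.
by rewrite !addr_ge0// -expr2 sqr_ge0.
Qed.

Lemma I2_eq0 a: alt2 a -> I2 G a a = 0 -> a = fun _ _=> 0.
move=> aa; have [F uf] := uframeP hJG; rewrite (I2_frame uf)// => E.
have l0: alt2 (fun _ _: V=> 0: R) by split=>// [w t u u'|u t w w']; rewrite mulr0 addr0.
by apply: (alt2_fext uf)=>//; nra.
Qed.

Lemma star_om: star J G (om J G) = om J G.
apply: funext2=> u v; rewrite /star.
have [F uf] := uframeP hJG; rewrite (Lam_om hJG uf).
have [_ _ _ JG] := hJG; have -> : om J G (u *m J) (v *m J) = om J G u v by rewrite /om JG.
ring.
Qed.

Lemma om_JJ u v: om J G (u *m J) (v *m J) = om J G u v.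
by have [_ _ _ JG] := hJG; rewrite /om JG. Qed.

Lemma Lam_omE: Lam J G (om J G) = 2.
by have [F uf] := uframeP hJG; exact: Lam_om uf. Qed.

Lemma asdP b: alt2 b -> (forall u v, star J G b u v = - b u v) <->
 Lam J G b = 0 /\ forall u v, b (u *m J) (v *m J) = b u v.
move=> ab; have [F uf] := uframeP hJG; split=> [H|[L bJ] u v]; last first.
 by rewrite /star L mul0r bJ sub0r.
have L: Lam J G b = 0.
 have [E _ _ _] := starF uf ab.
 by rewrite (Lam_frame uf ab) -E H subrr.
split=>// u v; have := H u v; rewrite /star L mul0r sub0r=> /eqP.
by rewrite eqr_opp=> /eqP.
Qed.

(** The right-hand side is the squared modulus of the complex determinant of [u] and [w], with
    complex coordinates [a0 + i a1] and [a2 + i a3] in the frame. *)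
Lemma om_frames F u w: uframe J G F -> forall a b: 'I_4 -> R,
 u = \sum_i a i *: row i F -> w = \sum_i b i *: row i F ->
 om J G u (u *m J) * om J G w (w *m J) - om J G u w * om J G (u *m J) (w *m J) +
  om J G u (w *m J) * om J G (u *m J) w =
 (a o0 * b o2 - a o1 * b o3 - a o2 * b o0 + a o3 * b o1) ^+ 2 +
 (a o0 * b o3 + a o1 * b o2 - a o2 * b o1 - a o3 * b o0) ^+ 2.
move=> uf a b Eu Ew; have [J2 _ _ JG] := hJG.
have JJ v: v *m J *m J = - v by rewrite -mulmxA J2 mulmxN mulmx1.
have [ml mr] := met_bil G.
have M (x y: 'I_4 -> R): met G (\sum_i x i *: row i F) (\sum_i y i *: row i F) = \sum_i x i * y i.
 rewrite (lin_sum _ _ _ (ml _)); apply: eq_bigr=> i _; rewrite (linZ _ _ (ml _)); congr (_ * _).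
 rewrite (lin_sum _ _ _ (mr _)) (bigD1 i)//= big1 ?addr0=> [|j ji]; rewrite (linZ _ _ (mr _)) (met_frame uf).
  by rewrite eqxx mulr1.
 by rewrite eq_sym (negbTE ji) mulr0.
have EJ: u *m J = \sum_(i < 4) (nth 0 [:: - a o1; a o0; - a o3; a o2] i) *: row i F.
 rewrite Eu !sum4 /= !mulmxDl -!scalemxAl !(uframe_J uf).
 by rewrite !scalerN !scaleNr; rewrite [X in X + _ + _]addrC -!addrA; congr (_ + (_ + _)); rewrite addrC.
rewrite om_JJ /om !JG !JJ (linN _ (ml _)) EJ Eu Ew !M !sum4 /=; ring.
Qed.

(** Half the square of the fundamental form on these four vectors is a sum of two squares; so all
    bases of this shape have one orientation. *)
Lemma positive_det u w: 0 <= \det (\matrix_(i < 4) nth 0 [:: u; u *m J; w; w *m J] i) * pf J G.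
have [F uf] := uframeP hJG.
have ex v: exists a: 'I_4 -> R, v = \sum_i a i *: row i F.
 by exists (fun i=> met G v (row i F)); rewrite sum4 -(frame_exp uf).
have [a Ea] := ex u; have [b Eb] := ex w.
have E := W22_det u (u *m J) w (w *m J) (om_alt2 hJG) (om_alt2 hJG).
have -> : \det (\matrix_(i < 4) nth 0 [:: u; u *m J; w; w *m J] i) * pf J G =
  2^-1 * W22 u (u *m J) w (w *m J) (om J G) (om J G) by rewrite E /pf mulrCA.
have -> : W22 u (u *m J) w (w *m J) (om J G) (om J G) = 2 * (om J G u (u *m J) * om J G w (w *m J) -
  om J G u w * om J G (u *m J) (w *m J) + om J G u (w *m J) * om J G (u *m J) w).
 by rewrite /W22; ring.
by rewrite mulrA mulVf ?pnatr_eq0// mul1r (om_frames uf Ea Eb) addr_ge0// sqr_ge0.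
Qed.

Definition volD (s t u v: V) := \det (\matrix_(i < 4) nth 0 [:: s; t; u; v] i).

Lemma volD_alt2l u v: alt2 (fun s t=> volD s t u v).
by split=> [w t s s'|s t w w'|w]; rewrite /volD !det4_rows /pdet4 /= ?mxE; ring.
Qed.

Lemma volD_alt2r s t: alt2 (volD s t).
by split=> [w x u u'|u x w w'|w]; rewrite /volD !det4_rows /pdet4 /= ?mxE; ring.
Qed.

Lemma volD_mul (F: 'M[R]_4) (i j k l: 'I_4): volD (row i F) (row j F) (row k F) (row l F) =
 volD (e i) (e j) (e k) (e l) * \det F.
rewrite /volD -det_mulmx; congr (\det _); apply/row_matrixP; apply: ord4P;
 by rewrite row_mul !rowK /= rowE.
Qed.

(** Both sides are alternating in [u] and [v], and they agree on the vectors of a unitary frame. *)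
Lemma star_volD a u v: alt2 a -> pf J G * I2 G a (fun s t=> volD s t u v) = star J G a u v.
move=> aa; have [F uf] := uframeP hJG.
have D := pf_det uf.
have V1 i j k l: pf J G * volD (row i F) (row j F) (row k F) (row l F) = volD (e i) (e j) (e k) (e l).
 by rewrite volD_mul mulrCA [_ * \det F]mulrC D mulr1.
pose t i j u v := a (row i F) (row j F) * (pf J G * volD (row i F) (row j F) u v).
have -> : pf J G * I2 G a (fun s t=> volD s t u v) =
  t o0 o1 u v + (t o0 o2 u v + (t o0 o3 u v + (t o1 o2 u v + (t o1 o3 u v + t o2 o3 u v)))).
 by rewrite (I2_frame uf aa (volD_alt2l _ _)) /t; ring.
have at2 i j: alt2 (t i j) by apply: alt2_scale; apply: alt2_scale; exact: volD_alt2r.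
have [s01 s02 s03 [s12 s13 s23]] := starF uf aa.
apply: (congr1 (fun F: V -> V -> R=> F u v) (_: (fun u v=> t o0 o1 u v + (t o0 o2 u v + (t o0 o3 u v + (t o1 o2 u v + (t o1 o3 u v + t o2 o3 u v))))) = star J G a)).
apply: (alt2_fext uf).
- by do 5!(apply: alt2_add; first exact: at2).
- exact: starA.
- by rewrite /t !V1 /volD !det4_rows /pdet4 /= !mxE /= s01; ring.
- by rewrite /t !V1 /volD !det4_rows /pdet4 /= !mxE /= s02; ring.
- by rewrite /t !V1 /volD !det4_rows /pdet4 /= !mxE /= s03; ring.
- by rewrite /t !V1 /volD !det4_rows /pdet4 /= !mxE /= s12; ring.
- by rewrite /t !V1 /volD !det4_rows /pdet4 /= !mxE /= s13; ring.
- by rewrite /t !V1 /volD !det4_rows /pdet4 /= !mxE /= s23; ring.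
Qed.

End Herm.

(** * Behaviour of the pointwise operators under a linear change of coordinates *)

Section Pullback.
Variables (J G A: 'M[R]_4).
Hypotheses (hJG: herm J G) (uA: A \in unitmx).
Let J' := A *m J *m invmx A.
Let G' := A *m G *m A^T.

Lemma pull_J v: v *m J' *m A = v *m A *m J.
by rewrite /J' !mulmxA mulmxKV. Qed.

Lemma pull_met u v: met G' u v = met G (u *m A) (v *m A).
by rewrite /met /G' trmx_mul !mulmxA. Qed.

Lemma pull_om u v: om J' G' u v = om J G (u *m A) (v *m A).
by rewrite /om pull_met pull_J. Qed.

Lemma pull_herm: herm J' G'.
have [J2 sG pG JG] := hJG; split.
- by rewrite /J' !mulmxA mulmxKV// -[A *m J *m J]mulmxA J2 mulmxN mulmx1 mulNmx mulmxV.
- by rewrite /G' !trmx_mul trmxK sG mulmxA.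
- move=> v v0; rewrite pull_met; apply: pG; apply: contra v0=> /eqP v0.
 by apply/eqP; rewrite -(mulmxK uA v) v0 mul0mx.
- by move=> v w; rewrite !pull_met !pull_J JG.
Qed.

Lemma herm_unit: G \in unitmx.
by have [F uf] := uframeP hJG; case: (uframe_unit uf). Qed.

Lemma pull_tr2 b: bil b -> tr2 G' (fun u v=> b (u *m A) (v *m A)) = tr2 G b.
move=> bb; rewrite -(tr2_basis herm_unit uA bb) /tr2 -/G'.
by apply: eq_bigr=> i _; apply: eq_bigr=> j _; rewrite -!rowE.
Qed.

Lemma pull_Lam b: alt2 b -> Lam J' G' (fun u v=> b (u *m A) (v *m A)) = Lam J G b.
move=> ab; rewrite /Lam -(pull_tr2 (bil_J J (alt2_bil ab))); congr (_ * tr2 _ _).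
by apply: funext2=> u v; rewrite pull_J.
Qed.

Lemma pull_star b u v: alt2 b ->
 star J' G' (fun u v=> b (u *m A) (v *m A)) u v = star J G b (u *m A) (v *m A).
by move=> ab; rewrite /star pull_Lam// pull_om !pull_J. Qed.

Lemma pull_Lam3 h w: alt3 h ->
 Lam3 J' G' (fun u v w=> h (u *m A) (v *m A) (w *m A)) w = Lam3 J G h (w *m A).
move=> ah; have [l1 l2 l3 _ _] := ah; rewrite /Lam3.
have bb: bil (fun u v=> h u (v *m J) (w *m A)) by apply: (bil_J J (b:=fun u v=> h u v (w *m A))).
rewrite -(pull_tr2 bb); congr (_ * tr2 _ _).
by apply: funext2=> u v; rewrite pull_J.
Qed.

Lemma pull_N z z': lin z -> lin z' -> N G' (fun v=> z (v *m A)) (fun v=> z' (v *m A)) = N G z z'.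
move=> lz lz'; rewrite /N -(pull_tr2 (b:=fun u v=> z u * z' v))//.
split=> [w t u u'|u t w w']; first by rewrite lz mulrDl mulrA.
by rewrite lz'; ring.
Qed.

Lemma pull_I2 a b: alt2 a -> alt2 b ->
 I2 G' (fun u v=> a (u *m A) (v *m A)) (fun u v=> b (u *m A) (v *m A)) = I2 G a b.
move=> [l1 l2 d] [l1' l2' d']; rewrite !I2_tr2; congr (_ * _).
have bb u v: bil (fun u' v'=> a u u' * b v v').
 by split=> [w t x x'|x t w w']; rewrite ?l2 ?l2'; ring.
have bb': bil (fun u v=> tr2 G (fun u' v'=> a u u' * b v v')).
 split=> [w t u u'|u t w w']; rewrite /tr2 mulr_sumr -big_split; apply: eq_bigr=> i _ /=;
 rewrite mulr_sumr -big_split; apply: eq_bigr=> j _ /=.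
  by rewrite l1; ring.
 by rewrite l1'; ring.
rewrite -(pull_tr2 bb'); congr (tr2 _ _); apply: funext2=> u v.
exact: (pull_tr2 (bb _ _)).
Qed.

End Pullback.

End Pointwise.

(** * Smooth functions in a chart *)

Section LocalSmooth.
Variables (R: realType) (n: nat) (X: manifold R n).
Local Notation V := 'rV[R]_n.
Implicit Types (c x p: X) (y u v w: V).

Definition sm c (F: V -> R) := forall k, Ck k (chart_im c) F.

Lemma sm_ext c F G: (forall y, chart_im c y -> F y = G y) -> sm c F -> sm c G.
by move=> FG sF k; apply: (Ck_ext (im_open (c:=c)) FG). Qed.
Lemma sm_cst c (t: R): sm c (fun=> t). Proof. by move=> k; exact: Ck_cst. Qed.
Lemma sm_D c F G: sm c F -> sm c G -> sm c (fun y=> F y + G y).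
by move=> sF sG k; exact: (Ck_D (im_open (c:=c))). Qed.
Lemma sm_M c F G: sm c F -> sm c G -> sm c (fun y=> F y * G y).
by move=> sF sG k; exact: (Ck_M (im_open (c:=c))). Qed.
Lemma sm_N c F: sm c F -> sm c (fun y=> - F y).
by move=> sF k; exact: (Ck_N (im_open (c:=c))). Qed.
Lemma sm_B c F G: sm c F -> sm c G -> sm c (fun y=> F y - G y).
by move=> sF sG; apply: sm_D=>//; exact: sm_N. Qed.
Lemma sm_V c F: (forall y, chart_im c y -> F y != 0) -> sm c F -> sm c (fun y=> (F y)^-1).
by move=> F0 sF k; exact: (Ck_V (im_open (c:=c))). Qed.
Lemma sm_sum c (I: Type) (r: seq I) (P: pred I) (F: I -> V -> R):
 (forall i, P i -> sm c (F i)) -> sm c (fun y=> \sum_(i <- r | P i) F i y).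
move=> sF k; apply: Ck_sum; first exact: im_open.
by move=> i Pi; exact: sF.
Qed.
Lemma sm_der c F v: sm c F -> sm c ('D_v F).
by move=> sF k; exact: Ck_der (sF k.+1). Qed.

Lemma sm_lin c (F: V -> V -> R) (E: V -> V): (forall y, chart_im c y -> lin (F y)) ->
 (forall i, sm c (fun y=> F y 'e_i)) -> (forall i, sm c (fun y=> E y 0 i)) ->
 sm c (fun y=> F y (E y)).
move=> lF sF sE; apply: (sm_ext (F:=fun y=> \sum_i E y 0 i * F y 'e_i)).
 by move=> y cy; rewrite -lin_exp//; exact: lF.
by apply: sm_sum=> i _; exact: sm_M.
Qed.

Lemma sm_invmx c (M: V -> 'M[R]_n) i j: (forall y, chart_im c y -> \det (M y) != 0) ->
 (forall i j, sm c (fun y=> M y i j)) -> sm c (fun y=> invmx (M y) i j).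
move=> dM sM.
apply: (sm_ext (F:=fun y=> (\det (M y))^-1 * cofactor (M y) j i)).
 by move=> y cy; rewrite /invmx unitmxE unitfE dM// !mxE.
apply: sm_M.
 by apply: sm_V=>// k; apply: Ck_det=> [|a b]; [exact: im_open|exact: sM].
by move=> k; apply: Ck_cofactor=> [|a b]; [exact: im_open|exact: sM].
Qed.

Lemma sm_mulmx c m l o (M: V -> 'M[R]_(m, l)) (M': V -> 'M[R]_(l, o)) i j:
 (forall i j, sm c (fun y=> M y i j)) -> (forall i j, sm c (fun y=> M' y i j)) ->
 sm c (fun y=> (M y *m M' y) i j).
move=> sM sM'; apply: (sm_ext (F:=fun y=> \sum_k M y i k * M' y k j)).
 by move=> y _; rewrite mxE.
by apply: sm_sum=> k _; exact: sm_M.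
Qed.

Lemma sfun_cst (t: R): sfun (fun _: X=> t).
by move=> c; exact: sm_cst. Qed.
Lemma sfunD (f h: X -> R): sfun f -> sfun h -> sfun (fun x=> f x + h x).
by move=> sf sh c; exact: sm_D (sf c) (sh c). Qed.
Lemma sfunM (f h: X -> R): sfun f -> sfun h -> sfun (fun x=> f x * h x).
by move=> sf sh c; exact: sm_M (sf c) (sh c). Qed.
Lemma sfunN (f: X -> R): sfun f -> sfun (fun x=> - f x).
by move=> sf c; exact: sm_N (sf c). Qed.

End LocalSmooth.

(** * Alternation and smoothness of exterior derivatives *)

Section ExtD.
Variables (R: realType) (n: nat) (X: manifold R n).
Local Notation V := 'rV[R]_n.
Implicit Types (c x p: X) (y u v w: V).

Lemma im_self x: chart_im x (chart x x).
exact/chimP/dom_self. Qed.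

Lemma sm_diff c F y: sm c F -> chart_im c y -> differentiable F y.
by move=> sF; exact: (Ck_diff (im_open (c:=c)) (sF 1%N)). Qed.

Lemma sm_dvb c F y v: sm c F -> chart_im c y -> derivable F y v.
by move=> sF cy; exact: (Ck_dvb (sF 1%N) cy). Qed.

Lemma sm_der_lin c F y: sm c F -> chart_im c y -> lin (fun v=> 'D_v F y).
move=> sF cy t u w; have dF := sm_diff sF cy.
rewrite !(der_coord _ dF) mulr_sumr -big_split; apply: eq_bigr=> i _ /=.
by rewrite !mxE mulrDl mulrA.
Qed.

Lemma sm_der_comb c (F G H: V -> R) y v (t: R): sm c F -> sm c G -> chart_im c y ->
 (forall y, chart_im c y -> H y = t * F y + G y) -> 'D_v H y = t * 'D_v F y + 'D_v G y.
move=> sF sG cy E; have dF := sm_dvb (v:=v) sF cy; have dG := sm_dvb (v:=v) sG cy.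
have [dtF DtF] := deriveMc t dF.
rewrite -DtF -(deriveD dtF dG); apply: near_eq_derive.
exact: (nearO (im_open (c:=c)) cy).
Qed.

Lemma ext_d0_lin (a: rform X 0) x: sfun (fun x=> a x (fun=> 0)) -> lin (f1 (ext_d a x)).
move=> sa; rewrite (_: f1 (ext_d a x) = fun u=> 'D_u (l0 a x) (chart x x)); last first.
 by apply/funext=> u; rewrite ext_d0.
apply: (sm_der_lin (c:=x)); last exact: im_self.
by apply: sm_ext (sa x)=> y _; rewrite l0E.
Qed.

Lemma sm_d0 (a: rform X 0): sfun (fun x=> a x (fun=> 0)) -> smooth1 (ext_d a).
move=> sa; split=> [x|c u k]; first exact: ext_d0_lin.
apply: (sm_ext (F:='D_u (l0 a c))) k=> [y cy|]; first by rewrite natural_d0.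
by apply: sm_der; apply: sm_ext (sa c)=> y _; rewrite l0E.
Qed.

Lemma alt2_skew (D: V -> V -> R): (forall u v t w, D u (t *: v + w) = t * D u v + D u w) ->
 (forall v, lin (fun u=> D u v)) -> alt2 (fun u v=> D u v - D v u).
move=> L L'; split=> [w t u u'|u t w w'|u].
- by rewrite L [D (t *: u + u') w]L'; ring.
- by rewrite L [D (t *: w + w') u]L'; ring.
- by rewrite subrr.
Qed.

Lemma alt3_skew (D: V -> V -> V -> R):
 (forall z u v t w, D z (t *: v + w) u = t * D z v u + D z w u) ->
 (forall z u v t w, D z u (t *: v + w) = t * D z u v + D z u w) ->
 (forall u v, lin (fun z=> D z u v)) -> (forall z u, D z u u = 0) -> (forall z u v, D z u v = - D z v u) ->
 alt3 (fun u v w=> D u v w - D v u w + D w u v).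
move=> L1 L2 L Z C; split=> [v w t u u'|u w t v v'|u v t w w'|u w|].
- by rewrite !L1 [D (t *: u + u') v w]L; ring.
- by rewrite L1 L2 [D (t *: v + v') u w]L; ring.
- by rewrite !L2 [D (t *: w + w') u v]L; ring.
- by rewrite Z; ring.
- by split=> u w; rewrite Z ?(C w u u) ?(C u w u); ring.
Qed.

Lemma ext_d1_alt (a: rform X 1) x: smooth1 a -> alt2 (f2 (ext_d a x)).
move=> [al sa]; have cx := im_self x.
have L u v t w: 'D_u (fun y=> l1 a x y (t *: v + w)) (chart x x) =
  t * 'D_u (fun y=> l1 a x y v) (chart x x) + 'D_u (fun y=> l1 a x y w) (chart x x).
 apply: (sm_der_comb u (sa x v) (sa x w) cx)=> y cy.
 exact: (l1_lin cy (al _)).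
have L' u := sm_der_lin (sa x u) cx.
have E: f2 (ext_d a x) = fun u v=> 'D_u (fun y=> l1 a x y v) (chart x x) - 'D_v (fun y=> l1 a x y u) (chart x x).
 by apply: funext2=> u v; rewrite ext_d1.
rewrite E; exact: (alt2_skew (D:=fun u v=> 'D_u (fun y=> l1 a x y v) (chart x x)) (fun u v t w=> L u v t w) L').
Qed.

Lemma sm_d1 (a: rform X 1): smooth1 a -> smooth2 (ext_d a).
move=> sa; split=> [x|c u v k]; first exact: ext_d1_alt.
apply: (sm_ext (F:=fun y=> 'D_u (fun y=> l1 a c y v) y - 'D_v (fun y=> l1 a c y u) y)) k=> [y cy|].
 by rewrite natural_d1.
by apply: sm_B; apply: sm_der=> k; exact: sa.2.
Qed.

Lemma ext_d2_alt (a: rform X 2) x: smooth2 a -> alt3 (f3 (ext_d a x)).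
move=> [al sa]; have cx := im_self x.
have L1 z u v t w: 'D_z (fun y=> l2 a x y (t *: v + w) u) (chart x x) =
  t * 'D_z (fun y=> l2 a x y v u) (chart x x) + 'D_z (fun y=> l2 a x y w u) (chart x x).
 apply: (sm_der_comb z (sa x v u) (sa x w u) cx)=> y cy.
 by have [h _ _] := l2_alt cy (al _); exact: h.
have L2 z u v t w: 'D_z (fun y=> l2 a x y u (t *: v + w)) (chart x x) =
  t * 'D_z (fun y=> l2 a x y u v) (chart x x) + 'D_z (fun y=> l2 a x y u w) (chart x x).
 apply: (sm_der_comb z (sa x u v) (sa x u w) cx)=> y cy.
 by have [_ h _] := l2_alt cy (al _); exact: h.
have L u v := sm_der_lin (fun k=> sa x u v k) cx.
have Z z u: 'D_z (fun y=> l2 a x y u u) (chart x x) = 0.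
 rewrite -(derive_cst (0: R) (chart x x) z); apply: near_eq_derive.
 apply: (nearO (im_open (c:=x)) cx)=> y cy.
 by have [_ _ ->] := l2_alt cy (al _).
have C z u v: 'D_z (fun y=> l2 a x y u v) (chart x x) = - 'D_z (fun y=> l2 a x y v u) (chart x x).
 have E y: chart_im x y -> l2 a x y u v = -1 * l2 a x y v u + 0.
  by move=> cy; rewrite addr0 mulN1r; exact: alt2C (l2_alt cy (al _)).
 by rewrite (sm_der_comb z (sa x v u) (sm_cst x 0) cx E) derive_cst addr0 mulN1r.
have E: f3 (ext_d a x) = fun u v w=> 'D_u (fun y=> l2 a x y v w) (chart x x)
  - 'D_v (fun y=> l2 a x y u w) (chart x x) + 'D_w (fun y=> l2 a x y u v) (chart x x).
 by apply: funext2=> u v; apply/funext=> w; rewrite ext_d2.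
rewrite E; exact: (alt3_skew (D:=fun u v w=> 'D_u (fun y=> l2 a x y v w) (chart x x))
 (fun z u v t w=> L1 z u v t w) (fun z u v t w=> L2 z u v t w) (fun u v=> L u v) (fun z u=> Z z u) (fun z u v=> C z u v)).
Qed.

Lemma sm_d2 (a: rform X 2): smooth2 a -> smooth3 (ext_d a).
move=> sa; split=> [x|c u v w k]; first exact: ext_d2_alt.
apply: (sm_ext (F:=fun y=> 'D_u (fun y=> l2 a c y v w) y - 'D_v (fun y=> l2 a c y u w) y + 'D_w (fun y=> l2 a c y u v) y)) k=> [y cy|].
 by rewrite natural_d2.
by apply: sm_D; [apply: sm_B|]; apply: sm_der=> k; exact: sa.2.
Qed.

End ExtD.

(** * Bilinearity of the pointwise products *)

Section Bilinear.
Variables (R: realType) (G: 'M[R]_4).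
Local Notation V := 'rV[R]_4.
Implicit Types (a b: V -> V -> R) (z: V -> R).

Lemma tr2_sum m (a: 'I_m -> V -> V -> R): tr2 G (fun u v=> \sum_k a k u v) = \sum_k tr2 G (a k).
rewrite /tr2 [RHS]exchange_big; apply: eq_bigr=> i _; rewrite [RHS]exchange_big; apply: eq_bigr=> j _.
exact: mulr_sumr.
Qed.

Lemma tr2_Z (t: R) a: tr2 G (fun u v=> t * a u v) = t * tr2 G a.
rewrite /tr2 mulr_sumr; apply: eq_bigr=> i _; rewrite mulr_sumr; apply: eq_bigr=> j _; ring.
Qed.

Lemma tr2_D a b: tr2 G (fun u v=> a u v + b u v) = tr2 G a + tr2 G b.
rewrite /tr2 -big_split; apply: eq_bigr=> i _; rewrite -big_split; apply: eq_bigr=> j _ /=; ring.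
Qed.

Lemma N_suml m (z: 'I_m -> V -> R) z': N G (fun v=> \sum_k z k v) z' = \sum_k N G (z k) z'.
rewrite /N -tr2_sum; congr tr2; apply: funext2=> u v; exact: mulr_suml.
Qed.

Lemma N_Zl t z z': N G (fun v=> t * z v) z' = t * N G z z'.
rewrite /N -tr2_Z; congr tr2; apply: funext2=> u v; exact/esym/mulrA.
Qed.

Lemma N_Zr t z z': N G z (fun v=> t * z' v) = t * N G z z'.
rewrite /N -tr2_Z; congr tr2; apply: funext2=> u v; exact: mulrCA.
Qed.

Lemma N_Dl z1 z2 z': N G (fun v=> z1 v + z2 v) z' = N G z1 z' + N G z2 z'.
rewrite /N -tr2_D; congr tr2; apply: funext2=> u v; exact: mulrDl.
Qed.

Lemma N_Dr z1 z2 z': N G z' (fun v=> z1 v + z2 v) = N G z' z1 + N G z' z2.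
rewrite /N -tr2_D; congr tr2; apply: funext2=> u v; exact: mulrDr.
Qed.

Lemma I2_suml m (a: 'I_m -> V -> V -> R) b: I2 G (fun u v=> \sum_k a k u v) b = \sum_k I2 G (a k) b.
rewrite [LHS]I2_tr2 (eq_bigr _ (fun k _=> I2_tr2 G (a k) b)) -mulr_sumr -tr2_sum; congr (_ * tr2 _ _).
apply: funext2=> u v; rewrite -tr2_sum; congr tr2.
apply/funext=> u'; apply/funext=> v'; exact: mulr_suml.
Qed.

Lemma I2_Zl t a b: I2 G (fun u v=> t * a u v) b = t * I2 G a b.
rewrite !I2_tr2 mulrCA -[in RHS]tr2_Z; congr (_ * _); congr tr2.
apply: funext2=> u v; rewrite -tr2_Z; congr tr2.
apply/funext=> u'; apply/funext=> v'; exact/esym/mulrA.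
Qed.

Lemma I2_Zr t a b: I2 G a (fun u v=> t * b u v) = t * I2 G a b.
rewrite !I2_tr2 mulrCA -[in RHS]tr2_Z; congr (_ * _); congr tr2.
apply: funext2=> u v; rewrite -tr2_Z; congr tr2.
apply/funext=> u'; apply/funext=> v'; exact: mulrCA.
Qed.

Lemma I2_Dl a1 a2 b: I2 G (fun u v=> a1 u v + a2 u v) b = I2 G a1 b + I2 G a2 b.
rewrite !I2_tr2 -mulrDr -tr2_D; congr (_ * tr2 _ _).
apply: funext2=> u v; rewrite -tr2_D; congr tr2.
apply/funext=> u'; apply/funext=> v'; exact: mulrDl.
Qed.

Lemma I2_Dr a b1 b2: I2 G a (fun u v=> b1 u v + b2 u v) = I2 G a b1 + I2 G a b2.
rewrite !I2_tr2 -mulrDr -tr2_D; congr (_ * tr2 _ _).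
apply: funext2=> u v; rewrite -tr2_D; congr tr2.
apply/funext=> u'; apply/funext=> v'; exact: mulrDr.
Qed.

End Bilinear.

(** * Linearity of the Riemannian integral *)

Section IntegralVol.
Variables (R: realType) (n: nat) (X: manifold R n) (g: X -> 'M[R]_n).
Hypotheses (cptX: compact [set: X]) (n0: n != 0%N) (g_dens: cont_dens g).

Lemma ivol0: integral_vol g (fun=> 0) = 0.
have c0: continuous (fun _: X=> 0: R) by move=> x; exact: cont_cst.
apply: etrans (etrans (ivolZ cptX n0 g_dens 0 c0) (mul0r _)).
by congr integral_vol; apply/funext=> x; exact/esym/mul0r.
Qed.

Lemma ivolN (f: X -> R): continuous f -> integral_vol g (fun x=> - f x) = - integral_vol g f.
move=> cf; rewrite -mulN1r -(ivolZ cptX n0 g_dens _ cf).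
congr integral_vol; apply/funext=> x; exact/esym/mulN1r.
Qed.

Lemma ivolB (f h: X -> R): continuous f -> continuous h ->
 integral_vol g (fun x=> f x - h x) = integral_vol g f - integral_vol g h.
move=> cf ch; rewrite -(ivolN ch) -(ivolD cptX n0 g_dens cf)//.
by move=> x; exact: (cont_atN (ch x)).
Qed.

Lemma ivol_sum m (f: 'I_m -> X -> R): (forall i, continuous (f i)) ->
 integral_vol g (fun x=> \sum_i f i x) = \sum_i integral_vol g (f i).
elim: m f=> [|m IH] f cf.
 rewrite big_ord0 -[RHS]ivol0; congr integral_vol; apply/funext=> x; exact: big_ord0.
rewrite big_ord_recl -(IH (fun i=> f (lift ord0 i)))//.
rewrite -(ivolD cptX n0 g_dens (cf ord0)).
 by congr integral_vol; apply/funext=> x; exact: big_ord_recl.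
by move=> x; apply: cont_sum=> i _; exact: cf.
Qed.

End IntegralVol.

(** * Explicit sums over subsets and functions of small finite sets *)

Section SetSums.
Variable M: nmodType.

(** Subsets of ['I_k] as lists of bits, so that the sums over subsets in [extC] and [component]
    unfold into explicit terms. *)
Definition bset k (s: seq bool): {set 'I_k} := [set i: 'I_k | nth false s i].

Lemma sum_bool (F: bool -> M): \sum_b F b = F true + F false.
exact: big_bool. Qed.

Lemma sum_set1 (F: {set 'I_1} -> M): \sum_T F T = \sum_b0 F (bset 1 [:: b0]).
apply: (reindex (fun b=> bset 1 [:: b])); apply: onW_bij.
exists (fun T: {set 'I_1} => ord0 \in T)=> [b|T]; first by rewrite inE.
by apply/setP=> i; rewrite inE (ord1 i).
Qed.

Lemma sum_set2 (F: {set 'I_2} -> M): \sum_T F T = \sum_b0 \sum_b1 F (bset 2 [:: b0; b1]).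
rewrite (pair_bigA _ (fun b0 b1=> F (bset 2 [:: b0; b1]))) /=.
apply: (reindex (fun b: bool * bool=> bset 2 [:: b.1; b.2])); apply: onW_bij.
exists (fun T: {set 'I_2} => (ord0 \in T, ord_max \in T))=> [[b0 b1]|T]; first by rewrite !inE.
apply/setP=> -[[|[|//]] i]; rewrite inE /=; congr (_ \in T); exact: val_inj.
Qed.

Lemma sum_set3 (F: {set 'I_3} -> M): \sum_T F T = \sum_b0 \sum_b1 \sum_b2 F (bset 3 [:: b0; b1; b2]).
rewrite (eq_bigr _ (fun b0 _=> pair_bigA _ (fun b1 b2=> F (bset 3 [:: b0; b1; b2])))) /=.
rewrite (pair_bigA _ (fun b0 (b: bool * bool)=> F (bset 3 [:: b0; b.1; b.2]))) /=.
apply: (reindex (fun b: bool * (bool * bool)=> bset 3 [:: b.1; b.2.1; b.2.2])); apply: onW_bij.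
exists (fun T: {set 'I_3} => (ord0 \in T, (ord31 \in T, ord_max \in T)))=> [[b0 [b1 b2]]|T]; first by rewrite !inE.
apply/setP=> -[[|[|[|//]]] i]; rewrite inE /=; congr (_ \in T); exact: val_inj.
Qed.

Lemma card_bset1 b0: #|bset 1 [:: b0]| = b0.
by rewrite -sum1_card big_mkcond big_ord_recl big_ord0 !inE /=; case: b0. Qed.
Lemma card_bset2 b0 b1: #|bset 2 [:: b0; b1]| = (b0 + b1)%N.
by rewrite -sum1_card big_mkcond !big_ord_recl big_ord0 !inE /=; case: b0; case: b1. Qed.
Lemma card_bset3 b0 b1 b2: #|bset 3 [:: b0; b1; b2]| = (b0 + b1 + b2)%N.
by rewrite -sum1_card big_mkcond !big_ord_recl big_ord0 !inE /=; case: b0; case: b1; case: b2. Qed.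

Variable T: finType.
Lemma sum_ffun1 (F: {ffun 'I_1 -> T} -> M): \sum_s F s = \sum_i F [ffun=> i].
apply: (reindex (fun i=> [ffun _: 'I_1=> i])); apply: onW_bij.
exists (fun s: {ffun 'I_1 -> T} => s ord0)=> [i|s]; first by rewrite ffunE.
by apply/ffunP=> i; rewrite ffunE (ord1 i).
Qed.

Lemma sum_ffun2 (F: {ffun 'I_2 -> T} -> M):
 \sum_s F s = \sum_i \sum_j F [ffun k: 'I_2=> nth i [:: i; j] k].
rewrite (pair_bigA _ (fun i j=> F [ffun k: 'I_2=> nth i [:: i; j] k])) /=.
apply: (reindex (fun p: T * T=> [ffun k: 'I_2=> nth p.1 [:: p.1; p.2] k])); apply: onW_bij.
exists (fun s: {ffun 'I_2 -> T} => (s ord0, s ord_max))=> [[i j]|s]; first by rewrite !ffunE.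
apply/ffunP=> -[[|[|//]] i]; rewrite ffunE /=; congr (s _); exact: val_inj.
Qed.

Lemma sum_ffun3 (F: {ffun 'I_3 -> T} -> M):
 \sum_s F s = \sum_i \sum_j \sum_l F [ffun k: 'I_3=> nth i [:: i; j; l] k].
rewrite (eq_bigr _ (fun i _=> pair_bigA _ (fun j l=> F [ffun k: 'I_3=> nth i [:: i; j; l] k]))) /=.
rewrite (pair_bigA _ (fun i (p: T * T)=> F [ffun k: 'I_3=> nth i [:: i; p.1; p.2] k])) /=.
apply: (reindex (fun p: T * (T * T)=> [ffun k: 'I_3=> nth p.1 [:: p.1; p.2.1; p.2.2] k])); apply: onW_bij.
exists (fun s: {ffun 'I_3 -> T} => (s ord0, (s ord31, s ord_max)))=> [[i [j l]]|s]; first by rewrite !ffunE.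
apply/ffunP=> -[[|[|[|//]]] i]; rewrite ffunE /=; congr (s _); exact: val_inj.
Qed.
End SetSums.

Local Notation Re := (@complex.Re _).
Local Notation Im := (@complex.Im _).

Section Complexes.
Variable R: realType.
Implicit Types (z w: R[i]).

Lemma ReD z w: Re (z + w) = Re z + Re w. Proof. by case: z w=> [a b] [c d]. Qed.
Lemma ImD z w: Im (z + w) = Im z + Im w. Proof. by case: z w=> [a b] [c d]. Qed.
Lemma ReN z: Re (- z) = - Re z. Proof. by case: z. Qed.
Lemma ImN z: Im (- z) = - Im z. Proof. by case: z. Qed.
Lemma ReM z w: Re (z * w) = Re z * Re w - Im z * Im w. Proof. by case: z w=> [a b] [c d]. Qed.
Lemma ImM z w: Im (z * w) = Re z * Im w + Im z * Re w.
by case: z w=> [a b] [c d] /=; rewrite addrC addrC. Qed.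
Lemma Re_real (t: R): Re (real_complex R t) = t. Proof. by []. Qed.
Lemma Im_real (t: R): Im (real_complex R t) = 0. Proof. by []. Qed.
Lemma Re_conj z: Re (conjc z) = Re z. Proof. by case: z. Qed.
Lemma Im_conj z: Im (conjc z) = - Im z. Proof. by case: z. Qed.
Lemma C_ext z w: Re z = Re w -> Im z = Im w -> z = w. Proof. by case: z w=> [a b] [c d] /= -> ->. Qed.
Lemma Re_sum (I: Type) (r: seq I) (P: pred I) (F: I -> R[i]):
 Re (\sum_(i <- r | P i) F i) = \sum_(i <- r | P i) Re (F i).
by apply: (big_morph _ ReD). Qed.
Lemma Im_sum (I: Type) (r: seq I) (P: pred I) (F: I -> R[i]):
 Im (\sum_(i <- r | P i) F i) = \sum_(i <- r | P i) Im (F i).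
by apply: (big_morph _ ImD). Qed.
Lemma half_real: 2^-1 = real_complex R 2^-1 :> R[i].
by rewrite fmorphV rmorph_nat. Qed.
Lemma i2: Complex 0 1 * Complex 0 1 = -1 :> R[i].
by apply: C_ext; rewrite ?ReM ?ImM ?ReN ?ImN /=; ring. Qed.

End Complexes.

(** * Bidegree components in terms of real and imaginary parts *)

Section Components.
Variables (R: realType) (X: manifold R 4) (J g: X -> 'M[R]_4).
Local Notation V := 'rV[R]_4.
Implicit Types (x: X) (u v w: V).

Lemma proj10_ReIm x v: let p := proj10 J x (map_mx (real_complex R) v) in
 map_mx Re p = 2^-1 *: v /\ map_mx Im p = - (2^-1 *: (v *m J x)).
rewrite /proj10 half_real -map_mxM /=; split; apply/matrixP=> i j; rewrite !mxE.
 by rewrite ReM ReD ReN ReM /=; ring.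
by rewrite ImM ImD ImN ImM /=; ring.
Qed.

Lemma proj01_ReIm x v: let p := proj01 J x (map_mx (real_complex R) v) in
 map_mx Re p = 2^-1 *: v /\ map_mx Im p = 2^-1 *: (v *m J x).
rewrite /proj01 half_real -map_mxM /=; split; apply/matrixP=> i j; rewrite !mxE.
 by rewrite ReM ReD ReM /=; ring.
by rewrite ImM ImD ImM /=; ring.
Qed.

(** The vector put into one slot: [s] selects the projection to type (1,0) rather than (0,1), and
    [t] its imaginary rather than its real part. *)
Definition pick_vec x (s t: bool) v :=
 (if s && t then - 2^-1 else 2^-1) *: (if t then v *m J x else v).

Lemma comp_gen k p (a: cform X k) x (v: 'I_k -> V): component J p a x v =
 \sum_(S: {set 'I_k}) if #|S| == p then \sum_(T: {set 'I_k}) Complex 0 1 ^+ #|T| *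
  a x (fun j=> pick_vec x (j \in S) (j \in T) (v j)) else 0.
rewrite /component big_mkcond; apply: eq_bigr=> S _; case: ifP=>// _.
rewrite /extC; apply: eq_bigr=> T _; congr (_ * a x _); apply/funext=> j; rewrite /pick_vec.
have [[r1 i1] [r0 i0]] := (proj10_ReIm x (v j), proj01_ReIm x (v j)).
by case: (j \in T); case: (j \in S)=>//=; rewrite i1 scaleNr.
Qed.

Lemma Re_ipow n (z: R[i]): (n < 4)%N -> Re (Complex 0 1 ^+ n * z) =
 match n with 0%N=> Re z | 1%N=> - Im z | 2%N=> - Re z | _=> Im z end.
by case: n=> [|[|[|[|]]]]// _; rewrite ?exprS expr0 ?mulr1 ReM ?ReM ?ImM /=; ring. Qed.

Lemma Im_ipow n (z: R[i]): (n < 4)%N -> Im (Complex 0 1 ^+ n * z) =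
 match n with 0%N=> Im z | 1%N=> Re z | 2%N=> - Im z | _=> - Re z end.
by case: n=> [|[|[|[|]]]]// _; rewrite ?exprS expr0 ?mulr1 ImM ?ReM ?ImM /=; ring. Qed.

(** The (1,0) part of a 1-form [a] is half of [a - i a o J]. *)
Lemma comp1E (a: cform X 1) x u: lin (f1 (re_form a x)) -> lin (f1 (im_form a x)) ->
 f1 (re_form (component J 1 a) x) u = 2^-1 * (f1 (re_form a x) u + f1 (im_form a x) (u *m J x)) /\
 f1 (im_form (component J 1 a) x) u = 2^-1 * (f1 (im_form a x) u - f1 (re_form a x) (u *m J x)).
move=> lr li.
have E S T: (fun j: 'I_1=> pick_vec x (j \in bset 1 [:: S]) (j \in bset 1 [:: T]) (vs [:: u] j)) =
  vs [:: pick_vec x S T u] by rewrite [LHS]vs1E !inE.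
have r S T: Re (a x (vs [:: pick_vec x S T u])) =
  (if S && T then - 2^-1 else 2^-1) * f1 (re_form a x) (if T then u *m J x else u).
 by rewrite -(linZ _ _ lr).
have i S T: Im (a x (vs [:: pick_vec x S T u])) =
  (if S && T then - 2^-1 else 2^-1) * f1 (im_form a x) (if T then u *m J x else u).
 by rewrite -(linZ _ _ li).
rewrite {1 4}/f1 {1}/re_form {2}/im_form !comp_gen !sum_set1 !sum_bool !card_bset1 /= addr0 !sum_set1 !sum_bool !card_bset1.
rewrite !E !ReD !ImD !Re_ipow// !Im_ipow// !r !i /=; split; ring.
Qed.

(** The (1,1) part of a 2-form is its [J]-invariant part. *)
Lemma comp2E (a: cform X 2) x u v: alt2 (f2 (re_form a x)) -> alt2 (f2 (im_form a x)) ->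
 f2 (re_form (component J 1 a) x) u v =
  2^-1 * (f2 (re_form a x) u v + f2 (re_form a x) (u *m J x) (v *m J x)) /\
 f2 (im_form (component J 1 a) x) u v =
  2^-1 * (f2 (im_form a x) u v + f2 (im_form a x) (u *m J x) (v *m J x)).
move=> ar ai.
have E S0 S1 T0 T1: (fun j: 'I_2=> pick_vec x (j \in bset 2 [:: S0; S1]) (j \in bset 2 [:: T0; T1]) (vs [:: u; v] j)) =
  vs [:: pick_vec x S0 T0 u; pick_vec x S1 T1 v] by rewrite [LHS]vs2E !inE.
have Z b s t w w': alt2 b -> b (s *: w) (t *: w') = s * t * b w w'.
 by move=> [l1 l2 _]; rewrite (linZ s w (l1 _)) (linZ _ _ (l2 _)) mulrA.
have r S0 S1 T0 T1: Re (a x (vs [:: pick_vec x S0 T0 u; pick_vec x S1 T1 v])) =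
  (if S0 && T0 then - 2^-1 else 2^-1) * (if S1 && T1 then - 2^-1 else 2^-1) *
  f2 (re_form a x) (if T0 then u *m J x else u) (if T1 then v *m J x else v) by rewrite -Z.
have i S0 S1 T0 T1: Im (a x (vs [:: pick_vec x S0 T0 u; pick_vec x S1 T1 v])) =
  (if S0 && T0 then - 2^-1 else 2^-1) * (if S1 && T1 then - 2^-1 else 2^-1) *
  f2 (im_form a x) (if T0 then u *m J x else u) (if T1 then v *m J x else v) by rewrite -Z.
rewrite -[f2 (re_form (component J 1 a) x) u v]/(Re (component J 1 a x (vs [:: u; v]))) -[f2 (im_form (component J 1 a) x) u v]/(Im (component J 1 a x (vs [:: u; v]))) !comp_gen !sum_set2 !sum_bool !card_bset2 /addn /= !addr0 !add0r !sum_set2 !sum_bool !card_bset2.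
rewrite !E !ReD !ImD !Re_ipow// !Im_ipow// !r !i /addn /=; split; by field.
Qed.

(** A 3-form is [L /\ om], and [om] has type (1,1), so its (1,2) part is the (0,1) part of [L], half
    of [L + i L o J], wedged with [om]. *)
Lemma comp3E (a: cform X 3) x u v w: herm (J x) (g x) -> alt3 (f3 (re_form a x)) -> alt3 (f3 (im_form a x)) ->
 let L z := Lam3 (J x) (g x) (f3 z) in
 f3 (re_form (component J 1 a) x) u v w =
  wd (fun t=> 2^-1 * (L (re_form a x) t - L (im_form a x) (t *m J x))) (om (J x) (g x)) u v w /\
 f3 (im_form (component J 1 a) x) u v w =
  wd (fun t=> 2^-1 * (L (im_form a x) t + L (re_form a x) (t *m J x))) (om (J x) (g x)) u v w.
move=> h ar ai /=.
have E S0 S1 S2 T0 T1 T2: (fun j: 'I_3=> pick_vec x (j \in bset 3 [:: S0; S1; S2]) (j \in bset 3 [:: T0; T1; T2]) (vs [:: u; v; w] j)) =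
  vs [:: pick_vec x S0 T0 u; pick_vec x S1 T1 v; pick_vec x S2 T2 w] by rewrite [LHS]vs3E !inE.
have Z b s t q w1 w2 w3: alt3 b -> b (s *: w1) (t *: w2) (q *: w3) = s * t * q * b w1 w2 w3.
 by move=> [l1 l2 l3 _ _]; rewrite (linZ s w1 (l1 _ _)) (linZ _ _ (l2 _ _)) (linZ _ _ (l3 _ _)); ring.
pose c (S T: bool): R := if S && T then - 2^-1 else 2^-1.
pose y (T: bool) (t: V) := if T then t *m J x else t.
have r S0 S1 S2 T0 T1 T2: Re (a x (vs [:: pick_vec x S0 T0 u; pick_vec x S1 T1 v; pick_vec x S2 T2 w])) =
  c S0 T0 * c S1 T1 * c S2 T2 * f3 (re_form a x) (y T0 u) (y T1 v) (y T2 w) by rewrite -Z.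
have i S0 S1 S2 T0 T1 T2: Im (a x (vs [:: pick_vec x S0 T0 u; pick_vec x S1 T1 v; pick_vec x S2 T2 w])) =
  c S0 T0 * c S1 T1 * c S2 T2 * f3 (im_form a x) (y T0 u) (y T1 v) (y T2 w) by rewrite -Z.
have [F uf] := uframeP h.
have Er := wd_Lam3 h uf ar; have Ei := wd_Lam3 h uf ai.
set Lr := Lam3 _ _ (f3 (re_form a x)) in Er *; set Li := Lam3 _ _ (f3 (im_form a x)) in Ei *.
have oJ s t: om (J x) (g x) (s *m J x) t = - om (J x) (g x) s (t *m J x).
 rewrite -(om_JJ h s (t *m J x)) -mulmxA; have [-> _ _ _] := h.
 by rewrite mulmxN mulmx1 (linN _ (let: And3 _ l _ := om_alt2 h in l _)) opprK.
rewrite -[f3 (re_form (component J 1 a) x) u v w]/(Re (component J 1 a x (vs [:: u; v; w]))) -[f3 (im_form (component J 1 a) x) u v w]/(Im (component J 1 a x (vs [:: u; v; w]))).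
rewrite !comp_gen !sum_set3 !sum_bool !card_bset3 /addn /= !addr0 !add0r !sum_set3 !sum_bool !card_bset3.
rewrite !E !ReD !ImD !Re_ipow// !Im_ipow// !r !i /addn /c /y /= -Er -Ei /wd !(om_JJ h) !oJ.
move: Lr Li {r i Er Ei} => Lr Li; split; by field.
Qed.

End Components.

(** * Inner products of forms *)

Section Inner.
Variables (R: realType) (X: manifold R 4) (g: X -> 'M[R]_4).
Local Notation V := 'rV[R]_4.
Local Notation e := (fun i: 'I_4=> delta_mx 0 i: V).
Implicit Types (x: X) (u v w: V).

(** The real bilinear product behind [inner]; real and imaginary parts are treated separately from
    here on. *)
Definition Bk k (a b: rform X k) x := (k`!%:R)^-1 *
 \sum_(s: {ffun 'I_k -> 'I_4}) \sum_(t: {ffun 'I_k -> 'I_4}) (\prod_i invmx (g x) (s i) (t i)) *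
  a x (fun i=> e (s i)) * b x (fun i=> e (t i)).

Lemma inner_Bk k (a b: cform X k) x:
 Re (inner g a b x) = Bk (re_form a) (re_form b) x + Bk (im_form a) (im_form b) x /\
 Im (inner g a b x) = Bk (im_form a) (re_form b) x - Bk (re_form a) (im_form b) x.
rewrite /inner /Bk (_: (k`!%:R)^-1 = real_complex R (k`!%:R)^-1); last by rewrite fmorphV rmorph_nat.
rewrite ReM ImM Re_real Im_real !mul0r subr0 addr0 -mulrDr -mulrBr !Re_sum !Im_sum -big_split -sumrB /=.
split; congr (_ * _); apply: eq_bigr=> s _; rewrite ?Re_sum ?Im_sum -?big_split -?sumrB /=.
 apply: eq_bigr=> t _; rewrite ReM ReM ImM Re_real Im_real Re_conj Im_conj /re_form /im_form; ring.
apply: eq_bigr=> t _; rewrite ImM ReM ImM Re_real Im_real Re_conj Im_conj /re_form /im_form; ring.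
Qed.

Lemma Bk1 (a b: rform X 1) x: Bk a b x = N (g x) (f1 (a x)) (f1 (b x)).
rewrite /Bk invr1 mul1r sum_ffun1 /N /tr2; apply: eq_bigr=> i _; rewrite sum_ffun1; apply: eq_bigr=> j _.
rewrite big_ord1 !ffunE -mulrA; congr (_ * (a x _ * b x _)); rewrite [LHS]vs1E !ffunE//.
Qed.

Lemma Bk2 (a b: rform X 2) x: Bk a b x = I2 (g x) (f2 (a x)) (f2 (b x)).
rewrite /Bk /I2; congr (_ * _); rewrite sum_ffun2; apply: eq_bigr=> i _; apply: eq_bigr=> j _.
rewrite sum_ffun2; apply: eq_bigr=> k _; apply: eq_bigr=> l _.
rewrite !big_ord_recl big_ord0 mulr1 !ffunE /=.
by congr (_ * a x _ * b x _); rewrite [LHS]vs2E !ffunE.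
Qed.

(** In a unitary frame the four values of the contraction are the four coefficients of the 3-form,
    each of which occurs [3!] times in the sum. *)
Lemma Bk3 (a b: rform X 3) x (J: 'M[R]_4): herm J (g x) -> alt3 (f3 (a x)) -> alt3 (f3 (b x)) ->
 Bk a b x = N (g x) (Lam3 J (g x) (f3 (a x))) (Lam3 J (g x) (f3 (b x))).
move=> h aa ab; have [F uf] := uframeP h.
set A := f3 (a x) in aa *; set B := f3 (b x) in ab *.
have -> : Bk a b x = 6^-1 * tr2 (g x) (fun u u'=> tr2 (g x) (fun v v'=> tr2 (g x) (fun w w'=> A u v w * B u' v' w'))).
 rewrite /Bk (_: 3`! = 6)//; congr (_ * _); rewrite sum_ffun3 /tr2; apply: eq_bigr=> i _.
 transitivity (\sum_j \sum_l \sum_i' \sum_j' \sum_l' invmx (g x) i i' * invmx (g x) j j' * invmx (g x) l l' *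
   A (e i) (e j) (e l) * B (e i') (e j') (e l')).
  apply: eq_bigr=> j _; apply: eq_bigr=> l _; rewrite sum_ffun3.
  apply: eq_bigr=> i' _; apply: eq_bigr=> j' _; apply: eq_bigr=> l' _.
  rewrite !big_ord_recl big_ord0 mulr1 !ffunE /= mulrA.
  by congr (_ * a x _ * b x _); rewrite [LHS]vs3E !ffunE.
 rewrite (eq_bigr _ (fun j _=> exchange_big _ _ _ _ _ _)) exchange_big; apply: eq_bigr=> i' _ /=.
 rewrite mulr_sumr; apply: eq_bigr=> j _.
 rewrite exchange_big mulr_sumr; apply: eq_bigr=> j' _; rewrite mulrCA !mulr_sumr; apply: eq_bigr=> l _.
 rewrite !mulr_sumr; apply: eq_bigr=> l' _; ring.
have [a1 a2 a3 a4 [a5 a6]] := aa; have [b1 b2 b3 b4 [b5 b6]] := ab.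
have T3 u u' v v': tr2 (g x) (fun w w'=> A u v w * B u' v' w') =
  A u v (row o0 F) * B u' v' (row o0 F) + A u v (row o1 F) * B u' v' (row o1 F) +
  A u v (row o2 F) * B u' v' (row o2 F) + A u v (row o3 F) * B u' v' (row o3 F).
 apply: (tr2F uf); split=> [w t p q|w t p q]; rewrite ?a3 ?b3; ring.
have T2 u u': tr2 (g x) (fun v v'=> tr2 (g x) (fun w w'=> A u v w * B u' v' w')) =
  \sum_i \sum_j A u (row i F) (row j F) * B u' (row i F) (row j F).
 rewrite (_: (fun v v'=> _) = fun v v'=> \sum_j A u v (row j F) * B u' v' (row j F)); last first.
  by apply: funext2=> v v'; rewrite T3 sum4.
 rewrite (tr2F uf) ?[RHS]sum4//.
 by split=> [w t p q|w t p q]; rewrite mulr_sumr -big_split; apply: eq_bigr=> k _ /=; rewrite ?a2 ?b2; ring.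
rewrite (_: (fun u u'=> _) = fun u u'=> \sum_i \sum_j A u (row i F) (row j F) * B u' (row i F) (row j F)); last first.
 by apply: funext2=> u u'; exact: T2.
rewrite (tr2F uf); last first.
 split=> [w t p q|w t p q]; rewrite mulr_sumr -big_split; apply: eq_bigr=> k _ /=;
 by rewrite mulr_sumr -big_split; apply: eq_bigr=> l _ /=; rewrite ?a1 ?b1; ring.
rewrite (N_frame uf (Lam3_lin J (g x) aa) (Lam3_lin J (g x) ab)).
have [-> -> -> ->] := Lam3F uf aa; have [-> -> -> ->] := Lam3F uf ab.
pose P u v w := A u v w * B u v w.
have sym u v w: ((P v u w = P u v w) * (P u w v = P u v w) * (P w u v = P u v w) * (P v w u = P u v w) * (P w v u = P u v w))%type.
 have s12 u' v' w': P v' u' w' = P u' v' w' by rewrite /P (alt3C12 _ _ _ aa) (alt3C12 _ _ _ ab); ring.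
 have s23 u' v' w': P u' w' v' = P u' v' w' by rewrite /P (alt3C23 _ _ _ aa) (alt3C23 _ _ _ ab); ring.
 have E1: P v u w = P u v w by exact: s12.
 have E2: P u w v = P u v w by exact: s23.
 have E3: P w u v = P u v w by rewrite s12.
 have E4: P v w u = P u v w by rewrite s23.
 have E5: P w v u = P u v w by rewrite s23.
 by [].
have z u v: ((P u u v = 0) * (P u v v = 0) * (P u v u = 0))%type by rewrite /P a4 a5 a6 !mul0r.
rewrite (eq_bigr (fun i=> \sum_j P (row o0 F) (row i F) (row j F)))//.
rewrite [X in _ * (_ + X + _ + _)](eq_bigr (fun i=> \sum_j P (row o1 F) (row i F) (row j F)))//.
rewrite [X in _ * (_ + _ + X + _)](eq_bigr (fun i=> \sum_j P (row o2 F) (row i F) (row j F)))//.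
rewrite [X in _ * (_ + _ + _ + X)](eq_bigr (fun i=> \sum_j P (row o3 F) (row i F) (row j F)))//.
rewrite !sum4 -!/(P _ _ _); move: (row o0 F) (row o1 F) (row o2 F) (row o3 F)=> p q r s.
rewrite !z !(sym p q r) !(sym p q s) !(sym p r s) !(sym q r s).
by field.
Qed.

End Inner.

(** * Compatibility of the products with [J] and with the star *)

Section Pointwise2.
Variables (R: realType) (J G: 'M[R]_4).
Hypothesis hJG: herm J G.
Local Notation V := 'rV[R]_4.
Implicit Types (a b: V -> V -> R) (z: V -> R).

Lemma JJ u: u *m J *m J = - u :> V.
by rewrite -mulmxA; have [-> _ _ _] := hJG; rewrite mulmxN mulmx1. Qed.

Lemma I2_JJ a b: alt2 a -> alt2 b ->
 I2 G (fun u v=> a (u *m J) (v *m J)) (fun u v=> b (u *m J) (v *m J)) = I2 G a b.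
move=> aa ab; have [F uf] := uframeP hJG.
rewrite (I2_frame uf (alt2_JJ J aa) (alt2_JJ J ab)) (I2_frame uf aa ab).
rewrite !(uframe_J uf).
have Nl (c: V -> V -> R) u v: alt2 c -> c (- u) v = - c u v by move=> [l _ _]; rewrite (linN _ (l _)).
have Nr (c: V -> V -> R) u v: alt2 c -> c u (- v) = - c u v by move=> [_ l _]; rewrite (linN _ (l _)).
rewrite !(Nl a)// !(Nl b)// !(Nr a)// !(Nr b)//.
rewrite (alt2C (row o1 F) (row o0 F) aa) (alt2C (row o1 F) (row o0 F) ab) (alt2C (row o3 F) (row o2 F) aa) (alt2C (row o3 F) (row o2 F) ab).
ring.
Qed.

Lemma I2_star a b: alt2 a -> alt2 b -> I2 G (star J G a) b = I2 G a (star J G b).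
move=> aa ab; have [F uf] := uframeP hJG.
have [E1 E2 E3 [E4 E5 E6]] := starF uf aa; have [D1 D2 D3 [D4 D5 D6]] := starF uf ab.
rewrite (I2_frame uf (starA hJG aa) ab) (I2_frame uf aa (starA hJG ab)).
rewrite E1 E2 E3 E4 E5 E6 D1 D2 D3 D4 D5 D6; ring.
Qed.

(** [J] acts by isometries, so a [J]-invariant [b] pairs equally with [a] and with its transform
    under [J]. *)
Lemma I2_c11 a b: alt2 a -> alt2 b -> (forall u v, b (u *m J) (v *m J) = b u v) ->
 I2 G (fun u v=> 2^-1 * (a u v + a (u *m J) (v *m J))) b = I2 G a b.
move=> aa ab bJ; rewrite I2_Zl I2_Dl.
have {2}-> : b = fun u v=> b (u *m J) (v *m J) by apply: funext2=> u v.
rewrite (I2_JJ aa ab); lra.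
Qed.

Lemma N_Jl z z': lin z -> lin z' -> N G (fun v=> z (v *m J)) z' = - N G z (fun v=> z' (v *m J)).
move=> lz lz'; rewrite -(N_JJ hJG (lin_J J lz) lz').
have -> : (fun v=> z (v *m J *m J)) = fun v=> -1 * z v.
 by apply/funext=> v; rewrite JJ (linN _ lz) mulN1r.
by rewrite N_Zl mulN1r.
Qed.

End Pointwise2.

Section LamLinear.
Variables (R: realType) (J G: 'M[R]_4).
Local Notation V := 'rV[R]_4.

Lemma Lam_D a b: Lam J G (fun u v=> a u v + b u v) = Lam J G a + Lam J G b.
by rewrite /Lam tr2_D mulrDr. Qed.
Lemma Lam_Z t a: Lam J G (fun u v=> t * a u v) = t * Lam J G a.
by rewrite /Lam tr2_Z mulrCA. Qed.
Lemma star_D a b u v: star J G (fun u v=> a u v + b u v) u v = star J G a u v + star J G b u v.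
rewrite /star Lam_D; ring. Qed.
Lemma star_Z t a u v: star J G (fun u v=> t * a u v) u v = t * star J G a u v.
rewrite /star Lam_Z; ring. Qed.
Lemma Lam3_D h k w: Lam3 J G (fun u v w=> h u v w + k u v w) w = Lam3 J G h w + Lam3 J G k w.
by rewrite /Lam3 tr2_D mulrDr. Qed.
Lemma Lam3_Z t h w: Lam3 J G (fun u v w=> t * h u v w) w = t * Lam3 J G h w.
by rewrite /Lam3 tr2_Z mulrCA. Qed.

End LamLinear.

Lemma ln_le_sub1 (R: realType) (t: R): 0 < t -> ln t <= t - 1.
by move=> t0; have := @le_ln1Dx R (t - 1); rewrite addrCA subrr addr0; apply; rewrite ltrBDr addrC subrr.
Qed.

Lemma weight_bd_ge0 (R: realType) (M c p q: R): 0 <= M -> 0 <= p -> 0 <= q ->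
 0 <= 2 * M * p + 2^-1 * c ^+ 2 * q.
by move=> M0 p0 q0; apply: addr_ge0; apply: mulr_ge0=>//; apply: mulr_ge0=>//; rewrite ?invr_ge0// sqr_ge0. Qed.

(** The arithmetic of [int_dh]: [P] stands for [r ^ 2], [n] and [n'] for entrywise norms, [I] and
    [I'] for squared norms, and [D] for the density. *)
Lemma wtd_sqr_le (R: realType) (C2 Cd B Md t d n n' I I' P D: R): 0 <= C2 -> 0 <= Cd -> 0 <= B -> 0 <= P -> P <= B -> 0 <= n -> 0 <= n' -> 0 <= I -> 0 <= I' ->
 `|t| <= n -> `|d| <= Cd * n' -> n ^+ 2 <= C2 * I -> n' ^+ 2 <= C2 * I' -> 1 <= Md * D ->
 (t + P * d) * (t + P * d) <= 2 * C2 * (1 + B * Cd ^+ 2) * Md * (I + P * I') * D.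
move=> C20 Cd0 B0 P0 PB n0 n'0 I0 I'0 tn dn nI nI' MD.
have t2: t ^+ 2 <= C2 * I.
 by apply: le_trans nI; rewrite -(real_normK (num_real t)) ler_pXn2r// nnegrE.
have d2: d ^+ 2 <= Cd ^+ 2 * (C2 * I').
 apply: (@le_trans _ _ ((Cd * n') ^+ 2)).
  by rewrite -(real_normK (num_real d)) ler_pXn2r// nnegrE ?mulr_ge0.
 by rewrite exprMn ler_wpM2l// sqr_ge0.
have s1: (t + P * d) * (t + P * d) <= 2 * t ^+ 2 + 2 * (P * P * d ^+ 2).
 have := sqr_ge0 (t - P * d); rewrite !expr2; lra.
have s2: P * P * d ^+ 2 <= B * P * (Cd ^+ 2 * (C2 * I')).
 by apply: ler_pM; [exact: mulr_ge0|exact: sqr_ge0|exact: ler_wpM2r|exact: d2].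
have s3: (t + P * d) * (t + P * d) <= 2 * C2 * (1 + B * Cd ^+ 2) * (I + P * I').
 have z1: 0 <= C2 * (B * Cd ^+ 2 * I) by rewrite !mulr_ge0 ?sqr_ge0.
 have z2: 0 <= C2 * (P * I') by rewrite !mulr_ge0.
 have E: 2 * C2 * (1 + B * Cd ^+ 2) * (I + P * I') = 2 * (C2 * I) + 2 * (B * P * (Cd ^+ 2 * (C2 * I')))
  + 2 * (C2 * (B * Cd ^+ 2 * I)) + 2 * (C2 * (P * I')) by ring.
 rewrite E; move: (C2 * (B * _ * _)) (C2 * (P * I')) z1 z2 s1 s2 t2=> z1 z2; lra.
apply: (le_trans s3).
have Q0: 0 <= 2 * C2 * (1 + B * Cd ^+ 2) * (I + P * I').
 by apply: mulr_ge0; [rewrite !mulr_ge0// addr_ge0// mulr_ge0 ?sqr_ge0|rewrite addr_ge0// mulr_ge0].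
have := ler_wpM2l Q0 MD; rewrite mulr1=> /le_trans; apply; apply: eq_leq_R; ring.
Qed.

Lemma young_half (R: realType) (A B D: R): - (-1 * A) <= 2^-1 * (B + (-1) ^+ 2 * D) -> A <= 2^-1 * B + 2^-1 * D.
lra. Qed.

Lemma half_le (R: realType) (A B C: R): A <= 2^-1 * A + 2^-1 * B -> B <= C -> A <= C.
lra. Qed.

Lemma form_comb (R: realType) (n: nat) (X: manifold R n) k (d: nat) (a: 'I_d -> R) (b: 'I_d -> X -> ('I_k -> 'rV[R]_n) -> R) x s:
 (\sum_i a i *: b i) x s = \sum_i a i * b i x s.
by apply: (big_morph (fun F: X -> ('I_k -> 'rV[R]_n) -> R=> F x s)). Qed.

Definition lincomb_on (R: realType) (V: lmodType R) (A: set V) (l: V -> R) :=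
 forall d (a: 'I_d -> R) (b: 'I_d -> V), (forall i, A (b i)) -> l (\sum_i a i *: b i) = \sum_i a i * l (b i).

(** * The almost-Hermitian structure in charts and the operators on forms *)

Section Hermitian4.
Variables (R: realType) (X: manifold R 4) (J g: X -> 'M[R]_4).
Hypotheses (cptX: compact [set: X]) (acJ: almost_complex J) (hg: hermitian_metric J g).
Local Notation V := 'rV[R]_4.
Local Notation e := (fun i: 'I_4=> delta_mx 0 i: V).
Local Notation form := (X -> ('I_2 -> V) -> R).
Local Notation intg := (integral_vol g).
Local Notation asd := (asd_harmonic J g).

Section Hermitian.
Implicit Types (c x p: X) (y u v w: V).

Lemma herm_at x: herm (J x) (g x).
have [J2 _] := acJ; have [[sG pG _] JG] := hg.
by split; [exact: J2|exact: sG|exact: pG|exact: JG].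
Qed.

(** Takes coordinates in chart [c] to the model tangent space at the point; conjugation and
    congruence by it give [Jc] and [Gc], the matrices of [J] and [g] in the coordinates of [c]. *)
Definition Amat c y := let p := chart_inv c y in tmat c p p.
Definition Jc c y := Amat c y *m J (chart_inv c y) *m invmx (Amat c y).
Definition Gc c y := Amat c y *m g (chart_inv c y) *m (Amat c y)^T.

Lemma AmatU c y: chart_im c y -> Amat c y \in unitmx.
by move=> cy; apply: tmat_unit; [exact: chdomP|exact: dom_self]. Qed.

Lemma fchA c y v: chart_im c y -> from_chart c y v = v *m Amat c y.
exact: fchE. Qed.

Lemma herm_c c y: chart_im c y -> herm (Jc c y) (Gc c y).
by move=> cy; apply: pull_herm; [exact: herm_at|exact: AmatU]. Qed.

Lemma sm_Jc c i j: sm c (fun y=> Jc c y i j).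
have [_ sJ] := acJ.
have /sm_onP s := sJ c 'e_i j; apply: sm_ext s=> y cy.
have cp := chdomP cy; have pp := dom_self (chart_inv c y).
cbv zeta; rewrite tchgE// fchA// /Jc.
have -> : tmat (chart_inv c y) c (chart_inv c y) = invmx (Amat c y).
 apply: (can_inj (mulKmx (AmatU cy))); rewrite mulmxV ?AmatU//.
 by rewrite /Amat tmat_comp// tmat_id.
by rewrite -!mulmxA -rowE mxE !mulmxA.
Qed.

Lemma sm_Gc c i j: sm c (fun y=> Gc c y i j).
have [[_ _ sg] _] := hg.
have /sm_onP s := sg c 'e_i 'e_j; apply: sm_ext s=> y cy.
by rewrite !fchA// /Gc met_rows !rowE.
Qed.

Lemma pf_c_sqr c y: chart_im c y -> pf (Jc c y) (Gc c y) ^+ 2 = density g c y ^+ 2.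
move=> cy; rewrite (pf_sqr (herm_c cy)) densE// exprMn -normrX ger0_norm ?sqr_ge0// sqr_sqrtr.
 by rewrite /Gc /Amat; move: (tmat _ _ _)=> A; rewrite !det_mulmx det_tr; ring.
by rewrite -(pf_sqr (herm_at _)) sqr_ge0.
Qed.

Lemma dens_gt0 c y: chart_im c y -> 0 < density g c y.
move=> cy; rewrite lt_neqAle dens_ge0 andbT eq_sym; apply/eqP=> d0.
have := pf_c_sqr cy; rewrite d0 expr0n /= => /eqP; rewrite sqrf_eq0; apply/negP.
exact: pf_neq0 (herm_c cy).
Qed.

Lemma det_Gc_neq0 c y: chart_im c y -> \det (Gc c y) != 0.
by move=> cy; rewrite -(pf_sqr (herm_c cy)) sqrf_eq0 pf_neq0//; exact: herm_c. Qed.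

Lemma sm_dens c: sm c (density g c).
move=> k; apply: (Ck_ext (f:=fun y=> Num.sqrt (\det (Gc c y))))=> [|y cy|].
- exact: im_open.
- rewrite -(pf_sqr (herm_c cy)) (pf_c_sqr cy) sqrtr_sqr ger0_norm//.
 exact: dens_ge0.
- apply: Ck_sqrt=> [|y cy|]; first exact: im_open.
  by rewrite lt_neqAle eq_sym det_Gc_neq0//= -(pf_sqr (herm_c cy)) sqr_ge0.
 by apply: Ck_det=> [|i j]; [exact: im_open|exact: sm_Gc].
Qed.

Lemma g_cont_dens: cont_dens g.
by move=> c y cy; exact: (Ck_cont (sm_dens c 0%N) cy). Qed.

Lemma sm_invGc c i j: sm c (fun y=> invmx (Gc c y) i j).
by apply: sm_invmx=> [y|]; [exact: det_Gc_neq0|exact: sm_Gc]. Qed.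

Lemma sm_tr2 c (b: V -> V -> V -> R):
 (forall i j, sm c (fun y=> b y 'e_i 'e_j)) -> sm c (fun y=> tr2 (Gc c y) (b y)).
move=> sb; apply: sm_sum=> i _; apply: sm_sum=> j _.
by apply: sm_M; [exact: sm_invGc|exact: sb].
Qed.

Lemma sm_rowJ c u i: sm c (fun y=> (u *m Jc c y) 0 i).
by apply: sm_mulmx=> a b; [exact: sm_cst|exact: sm_Jc]. Qed.

Definition Lfun (b: rform X 2) x := Lam (J x) (g x) (f2 (b x)).
Definition Sform (b: rform X 2): rform X 2 := fun x=> mk2 (star (J x) (g x) (f2 (b x))).
Definition L3form (h: rform X 3): rform X 1 := fun x=> mk1 (Lam3 (J x) (g x) (f3 (h x))).
Definition J1form (z: rform X 1): rform X 1 := fun x=> mk1 (fun v=> f1 (z x) (v *m J x)).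
Definition wdform (z: rform X 1) (b: rform X 2): rform X 3 := fun x=> mk3 (wd (f1 (z x)) (f2 (b x))).
Definition Nfun (z z': rform X 1) x := N (g x) (f1 (z x)) (f1 (z' x)).
Definition I2fun (a b: rform X 2) x := I2 (g x) (f2 (a x)) (f2 (b x)).
Definition Om: rform X 2 := fundamental_form J g.
Definition scalf k (f: X -> R) (a: rform X k): rform X k := fun x s=> f x * a x s.
Definition addf k (a b: rform X k): rform X k := fun x s=> a x s + b x s.

Lemma f2_Om x: f2 (Om x) = om (J x) (g x).
by []. Qed.
Lemma f2_mk2 (b: V -> V -> R): f2 (mk2 b) = b. Proof. by []. Qed.
Lemma f1_mk1 (b: V -> R): f1 (mk1 b) = b. Proof. by []. Qed.
Lemma f3_mk3 (b: V -> V -> V -> R): f3 (mk3 b) = b. Proof. by []. Qed.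

Lemma l1_pull (z: rform X 1) c y: chart_im c y -> l1 z c y = fun v=> f1 (z (chart_inv c y)) (v *m Amat c y).
by move=> cy; apply/funext=> v; rewrite l1E fchA. Qed.
Lemma l2_pull (b: rform X 2) c y: chart_im c y ->
 l2 b c y = fun u v=> f2 (b (chart_inv c y)) (u *m Amat c y) (v *m Amat c y).
by move=> cy; apply: funext2=> u v; rewrite l2E !fchA. Qed.
Lemma l3_pull (h: rform X 3) c y: chart_im c y ->
 l3 h c y = fun u v w=> f3 (h (chart_inv c y)) (u *m Amat c y) (v *m Amat c y) (w *m Amat c y).
by move=> cy; apply: funext2=> u v; apply/funext=> w; rewrite l3E !fchA. Qed.

Lemma l2_Om c y: chart_im c y -> l2 Om c y = om (Jc c y) (Gc c y).
move=> cy; rewrite l2_pull//; apply: funext2=> u v.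
by rewrite /Jc /Gc (pull_om _ _ (AmatU cy)) f2_Om.
Qed.

Lemma Lfun_local b c y: smooth2 b -> chart_im c y -> Lfun b (chart_inv c y) = Lam (Jc c y) (Gc c y) (l2 b c y).
by move=> [ab _] cy; rewrite l2_pull// /Jc /Gc (pull_Lam (herm_at _) (AmatU cy) (ab _)). Qed.

Lemma l2_Sform b c y: smooth2 b -> chart_im c y -> l2 (Sform b) c y = star (Jc c y) (Gc c y) (l2 b c y).
move=> [ab _] cy; rewrite (l2_pull b)// l2_pull//; apply: funext2=> u v.
by rewrite /Jc /Gc (pull_star (herm_at _) (AmatU cy) _ _ (ab _)).
Qed.

Lemma l1_L3form h c y: smooth3 h -> chart_im c y -> l1 (L3form h) c y = Lam3 (Jc c y) (Gc c y) (l3 h c y).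
move=> [ah _] cy; rewrite (l3_pull h)// l1_pull//; apply/funext=> v.
by rewrite /Jc /Gc (pull_Lam3 (herm_at _) (AmatU cy) _ (ah _)).
Qed.

Lemma l1_J1form z c y v: chart_im c y -> l1 (J1form z) c y v = l1 z c y (v *m Jc c y).
by move=> cy; rewrite !l1_pull// /Jc (pull_J _ (AmatU cy)). Qed.

Lemma Nfun_local z z' c y: smooth1 z -> smooth1 z' -> chart_im c y ->
 Nfun z z' (chart_inv c y) = N (Gc c y) (l1 z c y) (l1 z' c y).
move=> [lz _] [lz' _] cy; rewrite !l1_pull// /Gc.
by rewrite (pull_N (herm_at _) (AmatU cy) (lz _) (lz' _)).
Qed.

Lemma I2funE a b c y: smooth2 a -> smooth2 b -> chart_im c y ->
 I2fun a b (chart_inv c y) = I2 (Gc c y) (l2 a c y) (l2 b c y).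
move=> [aa _] [ab _] cy; rewrite !l2_pull// /Gc.
by rewrite (pull_I2 (herm_at _) (AmatU cy) (aa _) (ab _)).
Qed.

End Hermitian.

Local Notation hx := herm_at.
Local Notation hc := herm_c.
Local Notation L3 := L3form.
Local Notation J1 := J1form.
Local Notation S := Sform.
Local Notation dens := g_cont_dens.
Local Notation ivD := (ivolD cptX isT dens).
Local Notation ivB := (ivolB cptX isT dens).
Local Notation ivZ := (ivolZ cptX isT dens).
Local Notation A10 := (@Apq R 4 X J 1 0).
Local Notation A11 := (@Apq R 4 X J 1 1).

(** * Leibniz rules for the exterior derivative *)

Section Leibniz.
Implicit Types (c x p: X) (y u v w: V).

Definition form0 (f: X -> R): rform X 0 := fun x _=> f x.
Definition df (f: X -> R): rform X 1 := ext_d (form0 f).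

Lemma sm_df f: sfun f -> smooth1 (df f).
exact: sm_d0. Qed.

Lemma l1_df f c y v: sfun f -> chart_im c y -> l1 (df f) c y v = 'D_v (fun y=> f (chart_inv c y)) y.
by move=> sf cy; rewrite (natural_d0 cy). Qed.

Lemma f1_df f x v: f1 (df f x) v = 'D_v (fun y=> f (chart_inv x y)) (chart x x).
rewrite ext_d0; suff -> : l0 (form0 f) x = fun y=> f (chart_inv x y) by [].
by apply/funext=> z; rewrite l0E.
Qed.

Lemma cinv_self x: chart_inv x (chart x x) = x.
exact/chartK/dom_self. Qed.

Lemma der_prod_at x (f: X -> R) (F: V -> R) u: sfun f -> sm x F ->
 'D_u (fun y=> f (chart_inv x y) * F y) (chart x x) =
 f x * 'D_u F (chart x x) + F (chart x x) * f1 (df f x) u.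
move=> sf sF; have cx := im_self x.
rewrite f1_df (deriveM (sm_dvb (sf x) cx) (sm_dvb sF cx)) cinv_self.
by [].
Qed.

Lemma scal_d1 f (z: rform X 1) x u v: sfun f -> smooth1 z ->
 f2 (ext_d (scalf f z) x) u v = wd1 (f1 (df f x)) (f1 (z x)) u v + f x * f2 (ext_d z x) u v.
move=> sf [lz sz].
have D u' w: 'D_u' (fun y=> l1 (scalf f z) x y w) (chart x x) =
  f x * 'D_u' (fun y=> l1 z x y w) (chart x x) + l1 z x (chart x x) w * f1 (df f x) u'.
 have -> : (fun y=> l1 (scalf f z) x y w) = (fun y=> f (chart_inv x y) * l1 z x y w).
  by apply/funext=> y; rewrite !l1E.
 exact: (der_prod_at _ sf (sz x w)).
have K (t A B a b a' b' P Q: R): P = t * A + a * a' -> Q = t * B + b * b' ->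
 P - Q = a' * a - b' * b + t * (A - B) by move=> -> ->; ring.
rewrite /wd1 !(f1_local z) !ext_d1; exact: K (D u v) (D v u).
Qed.

Lemma scal_d2 f (b: rform X 2) x u v w: sfun f -> smooth2 b ->
 f3 (ext_d (scalf f b) x) u v w = wd (f1 (df f x)) (f2 (b x)) u v w + f x * f3 (ext_d b x) u v w.
move=> sf [lb sb].
have D u' v' w': 'D_u' (fun y=> l2 (scalf f b) x y v' w') (chart x x) =
  f x * 'D_u' (fun y=> l2 b x y v' w') (chart x x) + l2 b x (chart x x) v' w' * f1 (df f x) u'.
 have -> : (fun y=> l2 (scalf f b) x y v' w') = (fun y=> f (chart_inv x y) * l2 b x y v' w').
  by apply/funext=> y; rewrite !l2E.
 exact: (der_prod_at _ sf (sb x v' w')).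
have K (t A B C a1 b1 c1 a' b' c' P Q S: R): P = t * A + a1 * a' -> Q = t * B + b1 * b' -> S = t * C + c1 * c' ->
 P - Q + S = a' * a1 - b' * b1 + c' * c1 + t * (A - B + C) by move=> -> -> ->; ring.
rewrite /wd !(f2_local b) !ext_d2; exact: K (D u v w) (D v u w) (D w u v).
Qed.

Lemma sum_d1 m (a: 'I_m -> rform X 1) x u v: (forall i, smooth1 (a i)) ->
 f2 (ext_d (fun x s=> \sum_i a i x s) x) u v = \sum_i f2 (ext_d (a i) x) u v.
move=> sa; have cx := im_self x.
have E w: (fun y=> l1 (fun x s=> \sum_i a i x s) x y w) = (fun y=> \sum_i l1 (a i) x y w).
 by apply/funext=> y; rewrite l1E; apply: eq_bigr=> i _; rewrite l1E.
have D w w': 'D_w (fun y=> l1 (fun x s=> \sum_i a i x s) x y w') (chart x x) =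
  \sum_i 'D_w (fun y=> l1 (a i) x y w') (chart x x).
 by rewrite E (der_sums _ (fun i _=> sm_dvb ((sa i).2 x w') cx)).2.
rewrite ext_d1 !D -sumrB; apply: eq_bigr=> i _; exact/esym/ext_d1.
Qed.

Lemma add_d2 (a b: rform X 2) x u v w: smooth2 a -> smooth2 b ->
 f3 (ext_d (addf a b) x) u v w = f3 (ext_d a x) u v w + f3 (ext_d b x) u v w.
move=> [_ sa] [_ sb]; have cx := im_self x.
have D z u' v': 'D_z (fun y=> l2 (addf a b) x y u' v') (chart x x) =
  'D_z (fun y=> l2 a x y u' v') (chart x x) + 'D_z (fun y=> l2 b x y u' v') (chart x x).
 by rewrite -(deriveD (sm_dvb (sa x u' v') cx) (sm_dvb (sb x u' v') cx)).
have K (A B C A' B' C' P Q S: R): P = A + A' -> Q = B + B' -> S = C + C' ->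
 P - Q + S = A - B + C + (A' - B' + C') by move=> -> -> ->; ring.
rewrite !ext_d2; exact: K (D u v w) (D v u w) (D w u v).
Qed.

Lemma ddf f x u v: sfun f -> f2 (ext_d (df f) x) u v = 0.
move=> sf; have cx := im_self x; rewrite ext_d1.
have E u' w: 'D_u' (fun y=> l1 (df f) x y w) (chart x x) =
  'D_u' ('D_w (fun y=> f (chart_inv x y))) (chart x x).
 apply: near_eq_derive; apply: (nearO (im_open (c:=x)) cx)=> y cy.
 exact: l1_df.
have S := Schwarz u v (im_open (c:=x)) (sf x 2%N) cx.
have K (A B A' B': R): A = A' -> B = B' -> A' = B' -> A - B = 0 by move=> -> -> ->; exact: subrr.
exact: K (E u v) (E v u) S.
Qed.

End Leibniz.

(** * Smoothness of the operators on forms *)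

Section FormOps.
Implicit Types (c x p: X) (y u v w: V) (z: rform X 1) (b: rform X 2) (h: rform X 3).

Lemma sm_l1 z c (E: V -> V): smooth1 z -> (forall i, sm c (fun y=> E y 0 i)) -> sm c (fun y=> l1 z c y (E y)).
move=> [lz sz] sE; apply: sm_lin=>// [y cy|i]; first exact: l1_lin cy (lz _).
exact: sz.
Qed.

Lemma sm_l2 b c (E E': V -> V): smooth2 b -> (forall i, sm c (fun y=> E y 0 i)) ->
 (forall i, sm c (fun y=> E' y 0 i)) -> sm c (fun y=> l2 b c y (E y) (E' y)).
move=> [lb sb] sE sE'; apply: (sm_lin (F:=fun y u=> l2 b c y u (E' y)))=>// [y cy|i].
 by have [h _ _] := l2_alt cy (lb _); exact: h.
apply: (sm_lin (F:=fun y v=> l2 b c y 'e_i v))=>// [y cy|j]; last exact: sb.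
by have [_ h _] := l2_alt cy (lb _); exact: h.
Qed.

Lemma sm_l3 h c u w (E: V -> V): smooth3 h -> (forall i, sm c (fun y=> E y 0 i)) ->
 sm c (fun y=> l3 h c y u (E y) w).
move=> [lh sh] sE; apply: (sm_lin (F:=fun y v=> l3 h c y u v w))=>// [y cy|i]; last exact: sh.
by have [_ l _ _ _] := l3_alt cy (lh _); exact: l.
Qed.

Lemma smooth2_Om: smooth2 Om.
split=> [x|c u v]; first exact: om_alt2 (hx x).
apply: (sm_ext (F:=fun y=> met (Gc c y) (u *m Jc c y) v))=> [y cy|].
 by rewrite (l2_Om cy).
rewrite /met; apply: sm_mulmx=> a d; last exact: sm_cst.
apply: sm_mulmx=> a' d'; last exact: sm_Gc.
by rewrite ord1; exact: sm_rowJ.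
Qed.

Lemma sm_Lfun b: smooth2 b -> sfun (Lfun b).
move=> sb c; apply: (sm_ext (F:=fun y=> 2^-1 * tr2 (Gc c y) (fun u v=> l2 b c y u (v *m Jc c y))))=> [y cy|].
 by rewrite (Lfun_local sb cy).
apply: sm_M; first exact: sm_cst.
apply: sm_tr2=> i j; apply: sm_l2=>// k; first exact: sm_cst.
exact: sm_rowJ.
Qed.

Lemma sm_S b: smooth2 b -> smooth2 (Sform b).
move=> sb; split=> [x|c u v]; first exact: (starA (hx x) (sb.1 x)).
apply: (sm_ext (F:=fun y=> Lfun b (chart_inv c y) * l2 Om c y u v - l2 b c y (u *m Jc c y) (v *m Jc c y)))=> [y cy|].
 by rewrite (l2_Sform sb cy) /star (Lfun_local sb cy) (l2_Om cy).
apply: sm_B; last by apply: sm_l2=>// i; exact: sm_rowJ.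
by apply: sm_M; [exact: sm_Lfun|exact: smooth2_Om.2].
Qed.

Lemma sm_L3 h: smooth3 h -> smooth1 (L3form h).
move=> sh; split=> [x|c u]; first exact: (@Lam3_lin _ (J x) (g x) _ (sh.1 x)).
apply: (sm_ext (F:=fun y=> 2^-1 * tr2 (Gc c y) (fun v w=> l3 h c y v (w *m Jc c y) u)))=> [y cy|].
 by rewrite (l1_L3form sh cy).
apply: sm_M; first exact: sm_cst.
apply: sm_tr2=> i j; apply: sm_l3=>// k; exact: sm_rowJ.
Qed.

Lemma sm_J1 z: smooth1 z -> smooth1 (J1form z).
move=> sz; split=> [x|c u]; first exact: (lin_J _ (sz.1 x)).
apply: (sm_ext (F:=fun y=> l1 z c y (u *m Jc c y)))=> [y cy|]; first by rewrite l1_J1form.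
by apply: sm_l1=>// i; exact: sm_rowJ.
Qed.

Lemma sm_wd z b: smooth1 z -> smooth2 b -> smooth3 (wdform z b).
move=> sz sb; split=> [x|c u v w]; first exact: wd_alt3 (sz.1 x) (sb.1 x).
apply: (sm_ext (F:=fun y=> l1 z c y u * l2 b c y v w - l1 z c y v * l2 b c y u w + l1 z c y w * l2 b c y u v))=> [y cy|].
 by rewrite l3E !l1E !l2E.
by apply: sm_D; [apply: sm_B|]; apply: sm_M; first [exact: sz.2|exact: sb.2].
Qed.

Lemma wd1_alt2 (l l': V -> R): lin l -> lin l' -> alt2 (wd1 l l').
by move=> ll ll'; split=> [w t u u'|u t w w'|u]; rewrite /wd1 ?ll ?ll'; ring.
Qed.

Lemma sm_scal1 f z: sfun f -> smooth1 z -> smooth1 (scalf f z).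
move=> sf sz; split=> [x t u w|c u]; first by rewrite /f1 /scalf -!/(f1 _ _) (sz.1 x); ring.
apply: (sm_ext (F:=fun y=> f (chart_inv c y) * l1 z c y u))=> [y cy|]; first by rewrite !l1E.
by apply: sm_M; [exact: sf|exact: sz.2].
Qed.

Lemma sm_scal2 f b: sfun f -> smooth2 b -> smooth2 (scalf f b).
move=> sf sb; split=> [x|c u v]; first exact: (alt2_scale (f x) (sb.1 x)).
apply: (sm_ext (F:=fun y=> f (chart_inv c y) * l2 b c y u v))=> [y cy|]; first by rewrite !l2E.
by apply: sm_M; [exact: sf|exact: sb.2].
Qed.

Lemma sm_add1 z z': smooth1 z -> smooth1 z' -> smooth1 (addf z z').
move=> sz sz'; split=> [x t u w|c u].
 by rewrite /f1 /addf -!/(f1 _ _) (sz.1 x) (sz'.1 x); ring.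
apply: (sm_ext (F:=fun y=> l1 z c y u + l1 z' c y u))=> [y cy|]; first by rewrite !l1E.
by apply: sm_D; [exact: sz.2|exact: sz'.2].
Qed.

Lemma sm_add2 b b': smooth2 b -> smooth2 b' -> smooth2 (addf b b').
move=> sb sb'; split=> [x|c u v]; first exact: (alt2_add (sb.1 x) (sb'.1 x)).
apply: (sm_ext (F:=fun y=> l2 b c y u v + l2 b' c y u v))=> [y cy|]; first by rewrite !l2E.
by apply: sm_D; [exact: sb.2|exact: sb'.2].
Qed.

Lemma sm_Nfun z z': smooth1 z -> smooth1 z' -> sfun (Nfun z z').
move=> sz sz' c; apply: (sm_ext (F:=fun y=> N (Gc c y) (l1 z c y) (l1 z' c y)))=> [y cy|].
 by rewrite (Nfun_local sz sz' cy).
by apply: sm_tr2=> i j; apply: sm_M; [exact: sz.2|exact: sz'.2].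
Qed.

Lemma sm_I2fun b b': smooth2 b -> smooth2 b' -> sfun (I2fun b b').
move=> sb sb' c; apply: (sm_ext (F:=fun y=> I2 (Gc c y) (l2 b c y) (l2 b' c y)))=> [y cy|].
 by rewrite (I2funE sb sb' cy).
rewrite /I2; apply: sm_M; first exact: sm_cst.
do 4!(apply: sm_sum=> ? _); apply: sm_M; last exact: sb'.2.
apply: sm_M; last exact: sb.2.
by apply: sm_M; exact: sm_invGc.
Qed.

End FormOps.

Local Notation sOm := smooth2_Om.

(** * Stokes' formula *)

Section Stokes.
Implicit Types (c x p: X) (y u v w: V) (z: rform X 1) (b: rform X 2) (h: rform X 3).

(** The sign, 1 or -1, that compares the chart with the orientation of [J]. Charts carry no
    orientation condition, so this sign is what turns the density into a volume form; by
    [orient_der] it is locally constant. *)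
Definition orient c y := density g c y * (pf (Jc c y) (Gc c y))^-1.

Lemma orient_pf c y: chart_im c y -> pf (Jc c y) (Gc c y) * orient c y = density g c y.
by move=> cy; rewrite /orient mulrCA divff ?mulr1//; exact: pf_neq0 (hc cy). Qed.

Lemma orient_sqr c y: chart_im c y -> orient c y * orient c y = 1.
move=> cy; have p0 := pf_neq0 (hc cy).
rewrite -expr2 exprMn -(pf_c_sqr cy) -exprMn divff//; exact: expr1n.
Qed.

Lemma sm_orient c: sm c (orient c).
apply: sm_M; first exact: sm_dens.
apply: sm_V=> [y cy|]; first exact: pf_neq0 (hc cy).
have so i j: sm c (fun y=> om (Jc c y) (Gc c y) (e i) (e j)).
 apply: (sm_ext (F:=fun y=> l2 Om c y (e i) (e j))); last exact: (smooth2_Om).2.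
 by move=> y cy; rewrite (l2_Om cy).
apply: sm_M; first exact: sm_cst.
by do !apply: sm_D; try (apply: sm_N); apply: sm_M.
Qed.

(** Differentiation of the identity in [orient_sqr]. *)
Lemma orient_der c y v: chart_im c y -> 'D_v (orient c) y = 0.
move=> cy; have s2 := orient_sqr cy; have so := sm_dvb (v:=v) (sm_orient c) cy.
have D: 'D_v (fun y=> orient c y * orient c y) y = 0.
 rewrite -(derive_cst (1: R) y v); apply: near_eq_derive.
 apply: (nearO (im_open (c:=c)) cy)=> y' cy'; exact: orient_sqr.
move: D; rewrite (deriveM so so).
have K (t D: R): t * t = 1 -> t *: D + t *: D = 0 -> D = 0.
 by move=> tt; rewrite -scalerDr=> /eqP; rewrite scaler_eq0=> /orP[/eqP t0|/eqP]; [move: tt; rewrite t0; lra|lra].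
exact: K s2.
Qed.

(** The coefficient of [d h] on the coordinate basis, for a 3-form [h]. *)
Definition div3 h c y := 'D_(e o0) (fun y=> l3 h c y (e o1) (e o2) (e o3)) y
 - 'D_(e o1) (fun y=> l3 h c y (e o0) (e o2) (e o3)) y
 + 'D_(e o2) (fun y=> l3 h c y (e o0) (e o1) (e o3)) y
 - 'D_(e o3) (fun y=> l3 h c y (e o0) (e o1) (e o2)) y.

Definition zext c (F: V -> R) y := if y \in chart_im c then F y else 0.

Lemma zext_in c F y: chart_im c y -> zext c F y = F y.
by move=> cy; rewrite /zext mem_set. Qed.

(** The bound [L] is chosen before [F] and depends on [K] only, so that one Rellich estimate later
    serves all forms. *)
Lemma zext_Ck c (K: set X): compact K -> K `<=` chart_dom c -> exists2 L, 0 < L & forall F, sm c F ->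
 (forall y, chart_im c y -> ~ K (chart_inv c y) -> F y = 0) ->
 (forall k, Ck k setT (zext c F)) /\ supp L (zext c F).
move=> cK Kc; have cI := cimg_cpt cK Kc.
have cl: closed (chart c @` K) by apply: compact_closed=>//; exact: Rhausdorff.
have [M [_ HM]] := compact_bounded cI; exists (`|M| + 1); first by rewrite ltr_wpDl.
move=> F sF F0.
have out y: ~ (chart c @` K) y -> zext c F y = 0.
 move=> ny; have [cy|ncy] := pselect (chart_im c y); last by rewrite /zext memNset.
 rewrite zext_in// F0// => Ky; apply: ny; exists (chart_inv c y)=>//; exact: cinvK.
split.
 move=> k; apply: (@Ck_zero_ext _ _ _ (chart_im c) (~` (chart c @` K)) _ F)=>//.
 - exact: im_open.
 - exact: closed_openC.
 - apply/seteqP; split=>// y _; have [[p Kp <-]|] := pselect ((chart c @` K) y); last by right.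
  by left; apply: chimP; exact: Kc.
 - by move=> y cy; rewrite zext_in.
move=> y My; apply: out=> Ky.
by have := HM (`|M| + 1) _ y Ky; rewrite /= leNgt My=> /(_ (le_lt_trans (ler_norm M) (ltr_pwDr ltr01 (lexx _)))).
Qed.

Lemma zext_der_in c F v y: chart_im c y -> 'D_v (zext c F) y = 'D_v F y.
move=> cy; apply: near_eq_derive; apply: (nearO (im_open (c:=c)) cy)=> y' cy'.
exact: zext_in.
Qed.

Lemma zext_der_out c F v y (K: set X): compact K -> K `<=` chart_dom c ->
 (forall y, chart_im c y -> ~ K (chart_inv c y) -> F y = 0) -> ~ chart_im c y -> 'D_v (zext c F) y = 0.
move=> cK Kc F0 cy; have cI := cimg_cpt cK Kc.
have cl: closed (chart c @` K) by apply: compact_closed=>//; exact: Rhausdorff.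
rewrite -(derive_cst (0: R) y v); apply: near_eq_derive.
apply: (nearO (closed_openC cl))=> [[p Kp py]|y' ny].
 by apply: cy; rewrite -py; apply: chimP; exact: Kc.
have [cy'|ncy] := pselect (chart_im c y'); last by rewrite /zext memNset.
rewrite zext_in// F0// => Ky; apply: ny; exists (chart_inv c y')=>//; exact: cinvK.
Qed.

Lemma zext_der c F v i (K: set X): compact K -> K `<=` chart_dom c -> sm c F ->
 (forall y, chart_im c y -> ~ K (chart_inv c y) -> F y = 0) ->
 v = e i ->
 [/\ forall y, chart_im c y -> 'D_v (zext c F) y = 'D_v F y,
   forall y, ~ chart_im c y -> 'D_v (zext c F) y = 0,
   iint ('D_v (zext c F)) = 0 & cc ('D_v (zext c F))].
move=> cK Kc sF F0 ->; have [L _ /(_ F sF F0) [CK sL]] := zext_Ck cK Kc.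
split.
- by move=> y; exact: zext_der_in.
- by move=> y; exact: zext_der_out F0.
- exact: (int_der0 i (CK 1%N) sL).
- exact: (Ck_cc_der (e i) (CK 1%N) sL).
Qed.

(** Each coefficient extended by 0 has compact support, so its derivatives have integral 0; the
    locally constant [orient] passes through the derivatives. *)
Lemma int_div3 h c (K: set X): compact K -> K `<=` chart_dom c -> smooth3 h ->
 (forall x, ~ K x -> f3 (h x) = fun _ _ _=> 0) ->
 iint (fun y=> if y \in chart_im c then orient c y * div3 h c y else 0) = 0.
move=> cK Kc sh h0.
pose G u v w := zext c (fun y=> orient c y * l3 h c y u v w).
have sG u v w: sm c (fun y=> orient c y * l3 h c y u v w).
 by apply: sm_M; [exact: sm_orient|exact: sh.2].
have zG u v w i := zext_der cK Kc (sG u v w) _ (erefl (e i)).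
have G0 u v w y: chart_im c y -> ~ K (chart_inv c y) -> orient c y * l3 h c y u v w = 0.
 by move=> cy nK; rewrite (l3_pull h cy) h0// mulr0.
have {}zG := zG G0.
have E u v w i y: chart_im c y ->
  'D_(e i) (G u v w) y = orient c y * 'D_(e i) (fun y=> l3 h c y u v w) y.
 move=> cy; have [-> // _ _ _] := zG u v w i.
 rewrite (deriveM (sm_dvb (sm_orient c) cy) (sm_dvb (sh.2 c u v w) cy)) (orient_der _ cy).
 exact: (etrans (congr1 _ (scaler0 _ _)) (addr0 _)).
transitivity (iint (fun y=> ('D_(e o0) (G (e o1) (e o2) (e o3)) y - 'D_(e o1) (G (e o0) (e o2) (e o3)) y)
 + ('D_(e o2) (G (e o0) (e o1) (e o3)) y - 'D_(e o3) (G (e o0) (e o1) (e o2)) y))).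
 congr iint; apply/funext=> y; case: ifPn=> [/set_mem cy|/negP ncy].
  have K4 (s a1 b1 c1 d1 A B C D: R): A = s * a1 -> B = s * b1 -> C = s * c1 -> D = s * d1 ->
   s * (a1 - b1 + c1 - d1) = (A - B) + (C - D) by move=> -> -> -> ->; ring.
  exact: K4 (E _ _ _ _ _ cy) (E _ _ _ _ _ cy) (E _ _ _ _ _ cy) (E _ _ _ _ _ cy).
 have {}ncy: ~ chart_im c y by move=> cy; apply: ncy; exact: mem_set.
 have Z u v w i: 'D_(e i) (G u v w) y = 0 by have [_ H _ _] := zG u v w i; exact: H.
 have K4 (A B C D: R): A = 0 -> B = 0 -> C = 0 -> D = 0 -> 0 = (A - B) + (C - D).
  by move=> -> -> -> ->; ring.
 exact: K4 (Z _ _ _ _) (Z _ _ _ _) (Z _ _ _ _) (Z _ _ _ _).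
have I0 u v w i: iint ('D_(e i) (G u v w)) = 0 by have [_ _ H _] := zG u v w i.
have C u v w i: cc ('D_(e i) (G u v w)) by have [_ _ _ H] := zG u v w i.
have CB u v w i u' v' w' i': cc (fun y=> 'D_(e i) (G u v w) y - 'D_(e i') (G u' v' w') y).
 by apply: cc_D (C _ _ _ _) _; exact: cc_N (C _ _ _ _).
rewrite (iintD (CB _ _ _ _ _ _ _ _) (CB _ _ _ _ _ _ _ _)).
have K0 (A B: R): A = 0 -> B = 0 -> A - B = 0 by move=> -> ->; exact: subr0.
have K1 (A B: R): A = 0 -> B = 0 -> A + B = 0 by move=> -> ->; exact: addr0.
have IB u v w i u' v' w' i': iint (fun y=> 'D_(e i) (G u v w) y - 'D_(e i') (G u' v' w') y) = 0.
 exact: etrans (iintB (C u v w i) (C u' v' w' i')) (K0 _ _ (I0 u v w i) (I0 u' v' w' i')).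
exact: K1 (IB _ _ _ _ _ _ _ _) (IB _ _ _ _ _ _ _ _).
Qed.

Lemma der_sum3 c (F G H: V -> R) y u: sm c F -> sm c G -> sm c H -> chart_im c y ->
 'D_u (fun y=> F y - G y + H y) y = 'D_u F y - 'D_u G y + 'D_u H y.
move=> sF sG sH cy; have [[dF dG] dH] := (sm_dvb (v:=u) sF cy, sm_dvb (v:=u) sG cy, sm_dvb (v:=u) sH cy).
by rewrite -(deriveB dF dG) -(deriveD (derivableB dF dG) dH).
Qed.

(** This is [d (z /\ b) = dz /\ b - z /\ db] in coordinates. *)
Lemma div3_wd z b c y: smooth1 z -> smooth2 b -> chart_im c y -> div3 (wdform z b) c y =
 W22 (e o0) (e o1) (e o2) (e o3) (l2 (ext_d z) c y) (l2 b c y)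
 - W13 (e o0) (e o1) (e o2) (e o3) (l1 z c y) (l3 (ext_d b) c y).
move=> sz sb cy.
set DZ := fun u v=> 'D_u (fun y=> l1 z c y v) y.
set DB := fun u v w=> 'D_u (fun y=> l2 b c y v w) y.
have EZ u v: l2 (ext_d z) c y u v = DZ u v - DZ v u by exact: natural_d1.
have EB u v w: l3 (ext_d b) c y u v w = DB u v w - DB v u w + DB w u v by exact: natural_d2.
have P u v w t: 'D_u (fun y=> l1 z c y v * l2 b c y w t) y = DZ u v * l2 b c y w t + l1 z c y v * DB u w t.
 rewrite (deriveM (sm_dvb (sz.2 c v) cy) (sm_dvb (sb.2 c w t) cy)).
 have K (p q r s: R): p *: s + q *: r = r * q + p * s by rewrite addrC /GRing.scale /= (mulrC q).
 exact: K.
have sP v w t: sm c (fun y=> l1 z c y v * l2 b c y w t) by apply: sm_M; [exact: sz.2|exact: sb.2].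
have D u v w t: 'D_u (fun y=> l3 (wdform z b) c y v w t) y =
 (DZ u v * l2 b c y w t + l1 z c y v * DB u w t) - (DZ u w * l2 b c y v t + l1 z c y w * DB u v t) +
 (DZ u t * l2 b c y v w + l1 z c y t * DB u v w).
 have K (A B C a' b' c': R): A = a' -> B = b' -> C = c' -> A - B + C = a' - b' + c' by move=> -> -> ->.
 have E: (fun y=> l3 (wdform z b) c y v w t) = fun y=> l1 z c y v * l2 b c y w t - l1 z c y w * l2 b c y v t + l1 z c y t * l2 b c y v w.
  by apply/funext=> y'; rewrite l3E !l1E !l2E.
 rewrite E; exact: (etrans (der_sum3 u (sP v w t) (sP w v t) (sP t v w) cy) (K _ _ _ _ _ _ (P u v w t) (P u w v t) (P u t v w))).
rewrite /W22 /W13 !EZ !EB /div3.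
have K (Z: V -> R) (B F: V -> V -> R) (H: V -> V -> V -> R) (d0 d1 d2 d3: R):
 let T u v w t := (F u v * B w t + Z v * H u w t) - (F u w * B v t + Z w * H u v t) + (F u t * B v w + Z t * H u v w) in
 d0 = T (e o0) (e o1) (e o2) (e o3) -> d1 = T (e o1) (e o0) (e o2) (e o3) ->
 d2 = T (e o2) (e o0) (e o1) (e o3) -> d3 = T (e o3) (e o0) (e o1) (e o2) ->
 d0 - d1 + d2 - d3 =
 W22 (e o0) (e o1) (e o2) (e o3) (fun u v=> F u v - F v u) B
 - W13 (e o0) (e o1) (e o2) (e o3) Z (fun u v w=> H u v w - H v u w + H w u v).
 by move=> /= -> -> -> ->; rewrite /W22 /W13; ring.
exact: K (D _ _ _ _) (D _ _ _ _) (D _ _ _ _) (D _ _ _ _).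
Qed.

Lemma ext_d1_sptd z (K: set X): compact K -> (forall x, ~ K x -> f1 (z x) = fun=> 0) ->
 forall x, ~ K x -> f2 (ext_d z x) = fun _ _=> 0.
move=> cK z0 x nK; have cx := im_self x.
have oK: open (~` K) := closed_openC (cpt_closed cK).
have D u v: 'D_u (fun y=> l1 z x y v) (chart x x) = 0.
 rewrite -(derive_cst (0: R) (chart x x) u); apply: near_eq_derive.
 have oW := cinv_open (c:=x) oK.
 apply: (nearO oW)=> [|y [cy Wy]]; first by split=>//=; rewrite cinv_self.
 by rewrite (l1_pull z cy) z0.
have K0 (A B: R): A = 0 -> B = 0 -> A - B = 0 by move=> -> ->; exact: subr0.
by apply: funext2=> u v; rewrite ext_d1; exact: K0 (D u v) (D v u).
Qed.

(** Times the volume form this is [d (z /\ b)]: [dz /\ b] pairs [dz] with the star of [b], and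
    [z /\ db] pairs [z] with the dual of [db]. *)
Definition stk z b x :=
 I2fun (ext_d z) (Sform b) x - Nfun z (J1form (L3form (ext_d b))) x.

Lemma sm_stk z b: smooth1 z -> smooth2 b -> sfun (stk z b).
move=> sz sb; apply: sfunD; last apply: sfunN.
 apply: sm_I2fun; first exact: sm_d1.
 exact: sm_S.
apply: sm_Nfun=>//; apply: sm_J1; apply: sm_L3.
exact: sm_d2.
Qed.

Lemma stk_local z b c y: smooth1 z -> smooth2 b -> chart_im c y ->
 stk z b (chart_inv c y) * density g c y = orient c y * div3 (wdform z b) c y.
move=> sz sb cy; have h := hc cy; have sdz := sm_d1 sz; have sdb := sm_d2 sb.
have sS := sm_S sb; have sL := sm_L3 sdb.
rewrite (div3_wd sz sb cy) /stk (I2funE sdz sS cy).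
rewrite (Nfun_local sz (sm_J1 sL) cy) (l2_Sform sb cy).
have lb := l2_alt cy (sb.1 _); have ldz := l2_alt cy (sdz.1 _).
have ldb := l3_alt cy (sdb.1 _); have lz := l1_lin cy (sz.1 _).
rewrite (_: l1 (J1form _) c y = fun v=> Lam3 (Jc c y) (Gc c y) (l3 (ext_d b) c y) (v *m Jc c y)); last first.
 by apply/funext=> v; rewrite (l1_J1form _ _ cy) (l1_L3form sdb cy).
have [F uf] := uframeP h.
rewrite (W13_N h lz ldb) -[X in W22 _ _ _ _ _ X](star_star h uf lb).
rewrite (W22_I2 h ldz (starA h lb)) -(orient_pf cy); ring.
Qed.

Lemma stokes_local z b c (K: set X): compact K -> K `<=` chart_dom c -> smooth1 z -> smooth2 b ->
 (forall x, ~ K x -> f1 (z x) = fun=> 0) -> integral_vol g (stk z b) = 0.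
move=> cK Kc sz sb z0; have dz0 := ext_d1_sptd cK z0.
have cf := sf_cont (sm_stk sz sb).
have Kf: sptd K (stk z b).
 move=> x nK; rewrite /stk /I2fun /Nfun z0// dz0// /I2 /N /tr2.
 rewrite !big1 ?mulr0 ?subr0// => i _.
  by rewrite big1 // => j _; rewrite mul0r mulr0.
 by do 3!rewrite big1 // => ? _; rewrite mulr0 mul0r.
rewrite (ivol_chart cptX isT (g_cont_dens) cf cK Kc Kf).
rewrite /cint -(int_div3 cK Kc (sm_wd sz sb))=> [|x nK].
 congr iint; apply/funext=> y; rewrite /cintd; case: ifPn=>// /set_mem cy.
 exact: stk_local.
by apply: funext2=> u v; apply/funext=> w; rewrite f3_mk3 z0// /wd; ring.
Qed.

(** The partition of unity cuts [z] only; [stk] is linear in [z], and each piece is supported in one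
    chart. *)
Theorem stokes z b: smooth1 z -> smooth2 b ->
 integral_vol g (I2fun (ext_d z) (Sform b)) = integral_vol g (Nfun z (J1form (L3form (ext_d b)))).
move=> sz sb.
have dens := g_cont_dens.
have [m [c [r [sr r0 Hr r1]]]] := sm_part cptX isT (fun=> openT) (fun=> I).
have sdz := sm_d1 sz; have sS := sm_S sb.
have sL := sm_J1 (sm_L3 (sm_d2 sb)).
have ci := sf_cont (sm_I2fun sdz sS).
have cn := sf_cont (sm_Nfun sz sL).
have szi i: smooth1 (scalf (r i) z) by exact: sm_scal1.
have zE: z = fun x s=> \sum_i scalf (r i) z x s.
 by apply: funext2=> x s; rewrite /scalf -mulr_suml r1 mul1r.
have f1_sum x u: f1 (z x) u = \sum_i f1 (scalf (r i) z x) u.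
 by rewrite /f1 /scalf -mulr_suml r1 mul1r.
have E: stk z b = fun x=> \sum_i stk (scalf (r i) z) b x.
 apply/funext=> x; rewrite /stk sumrB; congr (_ - _).
  rewrite /I2fun -I2_suml; congr I2; apply: funext2=> u v.
  by rewrite -sum_d1 // -zE.
 rewrite /Nfun -N_suml; congr N; apply/funext=> u; exact: f1_sum.
have I0: integral_vol g (stk z b) = 0.
 rewrite E (ivol_sum cptX isT dens).
  rewrite big1 // => i _; have [K [cK _ Kc Kr]] := Hr i.
  apply: (stokes_local cK Kc (szi i) sb)=> x nK; apply/funext=> u.
  by rewrite /f1 /scalf Kr ?mul0r.
 by move=> i; exact: (sf_cont (sm_stk (szi i) sb)).
by move: I0; rewrite (ivolB cptX isT dens ci cn)=> /eqP; rewrite subr_eq0=> /eqP.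
Qed.

End Stokes.

(** * The Hodge star and anti-self-dual forms *)

Section HodgeStar.
Implicit Types (x: X) (u v w: V).

(** The root of the Gram determinant is [|p * D|]; by [positive_det] and the existence of a unitary
    frame, the sign chosen in [vol_form] is that of [p * D] wherever this is nonzero. *)
Lemma vol_formE x (v: 'I_4 -> V): vol_form J g x v = pf (J x) (g x) * \det (\matrix_(i < 4) v i).
have h := herm_at x; set D := \det (\matrix_(i < 4) v i); set p := pf _ _.
have p0: p != 0 := pf_neq0 h.
have p2: p * p = \det (g x) by rewrite -expr2; exact: pf_sqr.
have -> : vol_form J g x v = (if `[< positive_basis J x v >] then 1 else -1) * `|p * D|.
 rewrite /vol_form; congr (_ * _); rewrite -sqrtr_sqr; congr Num.sqrt.
 rewrite (_: \matrix_(i, j) _ = (\matrix_(i < 4) v i) *m g x *m (\matrix_(i < 4) v i)^T).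
  rewrite !det_mulmx det_tr -p2 -/D; ring.
 by apply/matrixP=> i j; rewrite [LHS]mxE met_rows !rowK.
case: asboolP=> [[u [w pos]]|npos].
 have := positive_det h u w; rewrite -/p; rewrite -/D in pos; move: pos; set E := \det (\matrix_i [:: u; _; _; _]`_i)=> pos Ep.
 rewrite mul1r ger0_norm//; have E0: E != 0 by apply: contraTneq pos=> ->; rewrite mulr0 ltxx.
 have E2: 0 < E ^+ 2 by rewrite exprn_even_gt0.
 rewrite -(pmulr_lge0 _ E2); have -> : p * D * E ^+ 2 = (D * E) * (E * p) by ring.
 by apply: mulr_ge0=>//; exact: ltW.
rewrite mulN1r; suff: p * D <= 0 by move=> /ler0_norm ->; rewrite opprK.
rewrite leNgt; apply/negP=> pD; apply: npos.
have [F uf] := uframeP h; have Fp := pf_det h uf.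
exists (row o0 F), (row o2 F); rewrite -/D (uframe_J0 uf) (uframe_J2 uf) -(frame_rows F).
have E: D * \det F = p * D * (\det F ^+ 2).
 rewrite -[LHS]mulr1 -[X in _ * X]Fp -/p; ring.
by rewrite E pmulr_rgt0// exprn_even_gt0//; apply: contraTneq isT=> F0; move: Fp; rewrite F0 mul0r=> /eqP; rewrite eq_sym oner_eq0.
Qed.

Lemma hodge_star2E (a: rform X 2) x: alt2 (f2 (a x)) ->
 f2 (hodge_star2 J g a x) = star (J x) (g x) (f2 (a x)).
move=> aa; have h := herm_at x; apply: funext2=> u v.
rewrite -(star_volD h u v aa) /f2 /hodge_star2 /I2 mulrCA; congr (_ * _).
rewrite mulr_sumr; apply: eq_bigr=> i _; rewrite mulr_sumr; apply: eq_bigr=> j _.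
rewrite mulr_sumr; apply: eq_bigr=> k _; rewrite mulr_sumr; apply: eq_bigr=> l _.
rewrite vol_formE.
have -> : \det (\matrix_i tnth [tuple e k; e l; vs [:: u; v] (ord0: 'I_2); vs [:: u; v] (ord_max: 'I_2)] i) = volD (e k) (e l) u v.
 congr (\det _); apply/matrixP=> i' j'; rewrite !mxE (tnth_nth 0) //.
have -> : tnth [tuple e i; e j] = vs [:: e i; e j].
 by apply/funext=> i'; rewrite (tnth_nth 0).
ring.
Qed.

Definition Jinv (b: rform X 2) := forall x u v, f2 (b x) (u *m J x) (v *m J x) = f2 (b x) u v.

(** Pointwise, anti-self-dual forms are the primitive real (1,1)-forms. *)
Lemma asd_hP (a: rform X 2): asd a <->
 [/\ smooth2 a, forall x, Lfun a x = 0, Jinv a & closed_form a].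
split=> [[/sm_form2 sa st cl]|[sa L0 Ja cl]].
 have st' x: Lam (J x) (g x) (f2 (a x)) = 0 /\ forall u v, f2 (a x) (u *m J x) (v *m J x) = f2 (a x) u v.
  apply/(asdP (herm_at x) (sa.1 x))=> u v.
  by rewrite -(hodge_star2E (sa.1 x)) st.
 by split=>// x; have [] := st' x.
split=>//; first exact/sm_form2.
apply: funext2=> x v; rewrite (vs2E v).
have E := hodge_star2E (sa.1 x); rewrite -[LHS]/(f2 (hodge_star2 J g a x) (v ord0) (v ord_max)) E.
have [_ st] := asdP (herm_at x) (sa.1 x); apply: st; split; [exact: L0|exact: Ja].
Qed.

End HodgeStar.

(** * Complex forms as pairs of real forms *)

Section ComplexForms.
Implicit Types (x: X) (u v w: V).

Definition cpx k (a b: rform X k): cform X k := fun x s=> Complex (a x s) (b x s).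

Lemma re_cpx k (a b: rform X k): re_form (cpx a b) = a. Proof. by []. Qed.
Lemma im_cpx k (a b: rform X k): im_form (cpx a b) = b. Proof. by []. Qed.
Lemma cpx_ReIm k (a: cform X k): cpx (re_form a) (im_form a) = a.
by apply: funext2=> x v; rewrite /cpx /re_form /im_form; case: (a x v). Qed.

Lemma cform_ext k (a b: cform X k): re_form a = re_form b -> im_form a = im_form b -> a = b.
by move=> r i; rewrite -(cpx_ReIm a) r i cpx_ReIm. Qed.

Lemma r1_ext (a b: rform X 1): (forall x u, f1 (a x) u = f1 (b x) u) -> a = b.
by move=> E; apply: funext2=> x v; rewrite (vs1E v); exact: E. Qed.
Lemma r2_ext (a b: rform X 2): (forall x u v, f2 (a x) u v = f2 (b x) u v) -> a = b.
by move=> E; apply: funext2=> x v; rewrite (vs2E v); exact: E. Qed.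
Lemma r3_ext (a b: rform X 3): (forall x u v w, f3 (a x) u v w = f3 (b x) u v w) -> a = b.
by move=> E; apply: funext2=> x v; rewrite (vs3E v); exact: E. Qed.

(** With [c10im], the real and imaginary parts of the (1,0) part of [a + i b]. *)
Definition c10re (a b: rform X 1): rform X 1 := fun x=> mk1 (fun u=> 2^-1 * (f1 (a x) u + f1 (b x) (u *m J x))).
Definition c10im (a b: rform X 1): rform X 1 := fun x=> mk1 (fun u=> 2^-1 * (f1 (b x) u - f1 (a x) (u *m J x))).
Definition c11 (a: rform X 2): rform X 2 := fun x=> mk2 (fun u v=> 2^-1 * (f2 (a x) u v + f2 (a x) (u *m J x) (v *m J x))).

Lemma comp1 (a b: rform X 1): (forall x, lin (f1 (a x))) -> (forall x, lin (f1 (b x))) ->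
 component J 1 (cpx a b) = cpx (c10re a b) (c10im a b).
move=> la lb; apply: cform_ext; apply: r1_ext=> x u;
by have [E1 E2] := @comp1E _ _ J (cpx a b) x u (la x) (lb x).
Qed.

Lemma comp2 (a b: rform X 2): (forall x, alt2 (f2 (a x))) -> (forall x, alt2 (f2 (b x))) ->
 component J 1 (cpx a b) = cpx (c11 a) (c11 b).
move=> la lb; apply: cform_ext; apply: r2_ext=> x u v;
by have [E1 E2] := @comp2E _ _ J (cpx a b) x u v (la x) (lb x).
Qed.

(** If [s + i t] represents a complex 3-form through the wedge with [Om], then [p12 s t] and
    [p12 t (negf s)] are the real and imaginary parts of its (0,1) part, which represents the (1,2)
    component. *)
Definition p12 (s t: rform X 1): rform X 1 := fun x=> mk1 (fun u=> 2^-1 * (f1 (s x) u - f1 (t x) (u *m J x))).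
Definition negf k (a: rform X k): rform X k := fun x s=> - a x s.

Lemma comp3 (a b: rform X 3): (forall x, alt3 (f3 (a x))) -> (forall x, alt3 (f3 (b x))) ->
 let s := L3form a in let t := L3form b in
 component J 1 (cpx a b) = cpx (wdform (p12 s t) Om) (wdform (p12 t (negf s)) Om).
move=> la lb s t; apply: cform_ext; apply: r3_ext=> x u v w;
have [E1 E2] := @comp3E _ _ J g (cpx a b) x u v w (hx x) (la x) (lb x).
 by rewrite E1 f3_mk3 f2_Om.
by rewrite E2 f3_mk3 f2_Om /wd !f1_mk1 /f1 /negf !opprK.
Qed.

Lemma Apq10P (a b: rform X 1): @Apq R 4 X J 1 0 (cpx a b) <->
 [/\ smooth1 a, smooth1 b & forall x u, f1 (b x) u = - f1 (a x) (u *m J x)].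
have JJ x u: u *m J x *m J x = - u by rewrite -mulmxA; have [-> _ _ _] := hx x; rewrite mulmxN mulmx1.
split=> [[[/sm_form1 sa /sm_form1 sb]]|[sa sb E]].
 rewrite re_cpx in sa; rewrite im_cpx in sb.
 have sla := sa.1; have slb := sb.1; rewrite (comp1 sla slb)=> /(congr1 (@re_form _ _ _ _)).
 rewrite !re_cpx=> E.
 split=>// x u; have := congr1 (fun c: rform X 1=> f1 (c x) (u *m J x)) E.
 rewrite f1_mk1 JJ (linN _ (slb x)); lra.
split; first by split; apply/sm_form1.
rewrite (comp1 sa.1 sb.1); congr cpx; apply: r1_ext=> x u; rewrite f1_mk1 E ?JJ ?(linN _ (sa.1 x)); lra.
Qed.

Lemma Apq11P (a b: rform X 2): @Apq R 4 X J 1 1 (cpx a b) <-> [/\ smooth2 a, smooth2 b, Jinv a & Jinv b].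
split=> [[[/sm_form2 sa /sm_form2 sb]]|[sa sb Ea Eb]].
 rewrite re_cpx in sa; rewrite im_cpx in sb; rewrite (comp2 sa.1 sb.1)=> E.
 have Er: c11 a = a := congr1 (@re_form _ _ _ _) E; have Ei: c11 b = b := congr1 (@im_form _ _ _ _) E.
 split=>// x u v.
  have := congr1 (fun c: rform X 2=> f2 (c x) u v) Er; rewrite f2_mk2; lra.
 have := congr1 (fun c: rform X 2=> f2 (c x) u v) Ei; rewrite f2_mk2; lra.
split; first by split; apply/sm_form2.
by rewrite (comp2 sa.1 sb.1); congr cpx; apply: r2_ext=> x u v; rewrite f2_mk2 ?Ea ?Eb; lra.
Qed.

Lemma dbar10 (a b: rform X 1): smooth1 a -> smooth1 b ->
 @dbar R 4 X J 1 0 (cpx a b) = cpx (c11 (ext_d a)) (c11 (ext_d b)).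
by move=> sa sb; apply: comp2=> x; exact: ext_d1_alt. Qed.

Lemma dbar11 (a b: rform X 2): smooth2 a -> smooth2 b ->
 let s := L3form (ext_d a) in let t := L3form (ext_d b) in
 @dbar R 4 X J 1 1 (cpx a b) = cpx (wdform (p12 s t) Om) (wdform (p12 t (negf s)) Om).
by move=> sa sb; apply: comp3=> x; exact: ext_d2_alt. Qed.

Lemma Jinv_c11 (a: rform X 2): smooth2 a -> Jinv (c11 a).
have JJ x u: u *m J x *m J x = - u by rewrite -mulmxA; have [-> _ _ _] := hx x; rewrite mulmxN mulmx1.
move=> sa x u v; have [l1 l2 _] := sa.1 x; rewrite !f2_mk2 !JJ (linN _ (l1 _)) (linN _ (l2 _)) opprK; lra.
Qed.

Lemma sm_c11 (a: rform X 2): smooth2 a -> smooth2 (c11 a).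
move=> sa; split=> [x|c u v].
 have [l1 l2 l3] := sa.1 x; have [k1 k2 k3] := alt2_JJ (J x) (sa.1 x).
 split=> [w t p q|w t p q|w]; rewrite !f2_mk2 ?l1 ?l2 ?l3 ?k1 ?k2 ?k3; last by rewrite addr0 mulr0.
  by ring.
 by ring.
apply: (sm_ext (F:=fun y=> 2^-1 * (l2 a c y u v + l2 a c y (u *m Jc c y) (v *m Jc c y))))=> [y cy|].
 by rewrite (l2_pull (c11 a) cy) f2_mk2 !(l2_pull a cy); congr (_ * (_ + f2 _ _ _)); rewrite /Jc !mulmxA mulmxKV//; exact: AmatU.
apply: sm_M; first exact: sm_cst.
apply: sm_D; first exact: sa.2.
by apply: sm_l2=>// i; exact: sm_rowJ.
Qed.

Lemma sm_c10 (a b: rform X 1) (t: R): smooth1 a -> smooth1 b ->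
 smooth1 (fun x=> mk1 (fun u=> 2^-1 * (f1 (a x) u + t * f1 (b x) (u *m J x)))).
move=> sa sb; split=> [x s u v|c u].
 by rewrite !f1_mk1 (sa.1 x) mulmxDl -scalemxAl (sb.1 x); ring.
apply: (sm_ext (F:=fun y=> 2^-1 * (l1 a c y u + t * l1 b c y (u *m Jc c y))))=> [y cy|].
 rewrite !(l1_pull _ cy) f1_mk1; congr (_ * (_ + _ * f1 _ _)).
 by rewrite /Jc !mulmxA mulmxKV//; exact: AmatU.
apply: sm_M; first exact: sm_cst.
apply: sm_D; first exact: sa.2.
apply: sm_M; first exact: sm_cst.
by apply: sm_l1=>// i; exact: sm_rowJ.
Qed.

End ComplexForms.

#[local] Opaque integral_vol iint ext_d inner.

(** * Formal adjoints of dbar by integration by parts *)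

Section Adjoint.
Implicit Types (x: X) (u v w: V).

Lemma cN a b: smooth1 a -> smooth1 b -> continuous (Nfun a b).
by move=> sa sb; exact: sf_cont (sm_Nfun sa sb). Qed.
Lemma cI2 a b: smooth2 a -> smooth2 b -> continuous (I2fun a b).
by move=> sa sb; exact: sf_cont (sm_I2fun sa sb). Qed.

Lemma L2_cpx k (a b c d: rform X k):
 (forall a' b', a' = a \/ a' = b -> b' = c \/ b' = d -> continuous (Bk g a' b')) ->
 L2 g (cpx a b) (cpx c d) = Complex (intg (Bk g a c) + intg (Bk g b d)) (intg (Bk g b c) - intg (Bk g a d)).
move=> cB.
have [c1 c2] := (cB a c (or_introl erefl) (or_introl erefl), cB b d (or_intror erefl) (or_intror erefl)).
have [c3 c4] := (cB b c (or_intror erefl) (or_introl erefl), cB a d (or_introl erefl) (or_intror erefl)).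
have E1: (fun x=> complex.Re (inner g (cpx a b) (cpx c d) x)) = fun x=> Bk g a c x + Bk g b d x.
 by apply/funext=> x; have [E _] := inner_Bk g (cpx a b) (cpx c d) x.
have E2: (fun x=> complex.Im (inner g (cpx a b) (cpx c d) x)) = fun x=> Bk g b c x - Bk g a d x.
 by apply/funext=> x; have [_ E] := inner_Bk g (cpx a b) (cpx c d) x.
exact: f_equal2 (etrans (congr1 intg E1) (ivD c1 c2)) (etrans (congr1 intg E2) (ivB c3 c4)).
Qed.

Lemma Bk1E (a b: rform X 1): Bk g a b = Nfun a b.
by apply/funext=> x; exact: Bk1. Qed.
Lemma Bk2E (a b: rform X 2): Bk g a b = I2fun a b.
by apply/funext=> x; exact: Bk2. Qed.
Lemma Bk3E (a b: rform X 3): (forall x, alt3 (f3 (a x))) -> (forall x, alt3 (f3 (b x))) ->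
 Bk g a b = Nfun (L3 a) (L3 b).
by move=> sa sb; apply/funext=> x; exact: (Bk3 (hx x) (sa x) (sb x)). Qed.

Lemma L2_1 a b c d: smooth1 a -> smooth1 b -> smooth1 c -> smooth1 d -> L2 g (cpx a b) (cpx c d) =
 Complex (intg (Nfun a c) + intg (Nfun b d)) (intg (Nfun b c) - intg (Nfun a d)).
move=> sa sb sc sd; rewrite L2_cpx ?Bk1E//.
by move=> ? ? [->|->] [->|->]; rewrite Bk1E; exact: cN.
Qed.

Lemma L2_2 a b c d: smooth2 a -> smooth2 b -> smooth2 c -> smooth2 d -> L2 g (cpx a b) (cpx c d) =
 Complex (intg (I2fun a c) + intg (I2fun b d)) (intg (I2fun b c) - intg (I2fun a d)).
move=> sa sb sc sd; rewrite L2_cpx ?Bk2E//.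
by move=> ? ? [->|->] [->|->]; rewrite Bk2E; exact: cI2.
Qed.

Lemma L3_wd t: (forall x, lin (f1 (t x))) -> L3 (wdform t Om) = t.
move=> lt; apply: r1_ext=> x u; have [F uf] := uframeP (hx x).
by rewrite f1_mk1 f3_mk3 f2_Om (Lam3_wd (hx x) uf (lt x)).
Qed.

Lemma L2_3 a b c d: smooth1 a -> smooth1 b -> smooth1 c -> smooth1 d ->
 L2 g (cpx (wdform a Om) (wdform b Om)) (cpx (wdform c Om) (wdform d Om)) =
 Complex (intg (Nfun a c) + intg (Nfun b d)) (intg (Nfun b c) - intg (Nfun a d)).
move=> sa sb sc sd; have w3 t: smooth1 t -> forall x, alt3 (f3 (wdform t Om x)).
 by move=> st; exact: (sm_wd st (smooth2_Om)).1.
have E s t: smooth1 s -> smooth1 t -> Bk g (wdform s Om) (wdform t Om) = Nfun s t.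
 by move=> ss st; rewrite (Bk3E (w3 _ ss) (w3 _ st)) (L3_wd ss.1) (L3_wd st.1).
rewrite L2_cpx ?E//.
by move=> ? ? [->|->] [->|->]; rewrite E//; exact: cN.
Qed.

Lemma sm_LdS p: smooth2 p -> smooth1 (L3 (ext_d (S p))).
by move=> sp; apply: sm_L3; apply: sm_d2; exact: sm_S.
Qed.

Lemma sm_Ld p: smooth2 p -> smooth1 (L3 (ext_d p)).
by move=> sp; apply: sm_L3; exact: sm_d2. Qed.

Lemma sm_c10re a b: smooth1 a -> smooth1 b -> smooth1 (c10re a b).
move=> sa sb; have := sm_c10 1 sa sb; congr smooth1; apply: r1_ext=> x u.
by rewrite !f1_mk1 mul1r.
Qed.

Lemma sm_c10im a b: smooth1 a -> smooth1 b -> smooth1 (c10im a b).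
move=> sa sb; have := sm_c10 (-1) sb sa; congr smooth1; apply: r1_ext=> x u.
by rewrite !f1_mk1 mulN1r.
Qed.

Lemma SS p: smooth2 p -> S (S p) = p.
move=> sp; apply: r2_ext=> x u v; have [F uf] := uframeP (hx x).
by rewrite f2_mk2 f2_mk2 (star_star (hx x) uf (sp.1 x)).
Qed.

Lemma c10_A10 P Q: smooth1 P -> smooth1 Q -> A10 (cpx (c10re P Q) (c10im P Q)).
move=> sP sQ; apply/(Apq10P); split; [exact: sm_c10re|exact: sm_c10im|move=> x u].
by rewrite !f1_mk1 (JJ (hx x)) (linN _ (sQ.1 x)); ring.
Qed.

Lemma I2fun_c11 a p: smooth2 a -> smooth2 p -> Jinv p -> I2fun (c11 a) p = I2fun a p.
by move=> sa sp jp; apply/funext=> x; exact: (I2_c11 (hx x) (sa.1 x) (sp.1 x) (jp x)). Qed.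

Lemma I2fun_sym a p: smooth2 a -> smooth2 p -> I2fun a p = I2fun p a.
by move=> sa sp; apply/funext=> x; exact: (I2_sym (hx x) (sa.1 x) (sp.1 x)). Qed.

Lemma Nfun_sym a p: smooth1 a -> smooth1 p -> Nfun a p = Nfun p a.
by move=> sa sp; apply/funext=> x; exact: (N_sym (hx x) (sa.1 x) (sp.1 x)). Qed.

(** Types (1,0) and (0,1) are orthogonal, so a (1,0) form pairs only with the (1,0) part of
    [P + i Q]. *)
Lemma L2_c10 a b P Q: A10 (cpx a b) -> smooth1 P -> smooth1 Q ->
 L2 g (cpx a b) (cpx (c10re P Q) (c10im P Q)) = L2 g (cpx a b) (cpx P Q).
move=> /(Apq10P)[sa sb ab] sP sQ.
have [sr si] := (sm_c10re sP sQ, sm_c10im sP sQ).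
rewrite (L2_1 sa sb sr si) (L2_1 sa sb sP sQ).
have bE x: f1 (b x) = fun u=> -1 * f1 (a x) (u *m J x) by apply/funext=> u; rewrite ab mulN1r.
have aE x: f1 (a x) = fun u=> f1 (b x) (u *m J x).
 by apply/funext=> u; rewrite ab (JJ (hx x)) (linN _ (sa.1 x)) opprK.
have K x c: smooth1 c -> N (g x) (f1 (b x)) (fun u=> f1 (c x) (u *m J x)) = - N (g x) (f1 (a x)) (f1 (c x)).
 by move=> sc; rewrite [f1 (a x)]aE (N_Jl (hx x) (sb.1 x) (sc.1 x)) opprK.
have K' x c: smooth1 c -> N (g x) (f1 (a x)) (fun u=> f1 (c x) (u *m J x)) = N (g x) (f1 (b x)) (f1 (c x)).
 by move=> sc; rewrite [f1 (b x)]bE N_Zl (N_Jl (hx x) (sa.1 x) (sc.1 x)) mulN1r opprK.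
have C1 x (z: V -> R): N (g x) z (f1 (c10re P Q x)) = 2^-1 * (N (g x) z (f1 (P x)) + N (g x) z (fun u=> f1 (Q x) (u *m J x))).
 by rewrite -N_Dr -N_Zr.
have C2 x (z: V -> R): N (g x) z (f1 (c10im P Q x)) = 2^-1 * (N (g x) z (f1 (Q x)) - N (g x) z (fun u=> f1 (P x) (u *m J x))).
 by rewrite -mulN1r -(N_Zr _ (-1)) -N_Dr -N_Zr; congr N; apply/funext=> u; rewrite f1_mk1 mulN1r.
have E1 x: Nfun a (c10re P Q) x + Nfun b (c10im P Q) x = Nfun a P x + Nfun b Q x.
 rewrite /Nfun C1 C2 (K x P sP) (K' x Q sQ); lra.
have E2 x: Nfun b (c10re P Q) x - Nfun a (c10im P Q) x = Nfun b P x - Nfun a Q x.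
 rewrite /Nfun C1 C2 (K x Q sQ) (K' x P sP); lra.
exact: f_equal2 (etrans (esym (ivD (cN sa sr) (cN sb si))) (etrans (congr1 intg (funext E1)) (ivD (cN sa sP) (cN sb sQ))))
 (etrans (esym (ivB (cN sb sr) (cN sa si))) (etrans (congr1 intg (funext E2)) (ivB (cN sb sP) (cN sa sQ)))).
Qed.

(** The projection to type (1,1) is invisible to the [J]-invariant [p] and [q], and [stokes] applied
    to their stars moves [d] to the other side, the star being an involution. *)
Lemma adjoint1 a b p q: A10 (cpx a b) -> A11 (cpx p q) ->
 L2 g (@dbar R 4 X J 1 0 (cpx a b)) (cpx p q) = L2 g (cpx a b) (cpx (J1 (L3 (ext_d (S p)))) (J1 (L3 (ext_d (S q))))).
move=> /(Apq10P)[sa sb ab] /Apq11P[sp sq jp jq].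
have sP := sm_J1 (sm_LdS sp); have sQ := sm_J1 (sm_LdS sq).
have [sda sdb] := (sm_d1 sa, sm_d1 sb).
rewrite (dbar10 sa sb) (L2_2 (sm_c11 sda) (sm_c11 sdb) sp sq) (L2_1 sa sb sP sQ).
rewrite (I2fun_c11 sda sp jp) (I2fun_c11 sda sq jq) (I2fun_c11 sdb sp jp) (I2fun_c11 sdb sq jq).
have st a' p': smooth1 a' -> smooth2 p' -> intg (I2fun (ext_d a') p') = intg (Nfun a' (J1 (L3 (ext_d (S p'))))).
 by move=> sa' sp'; rewrite -{1}(SS sp'); exact: (stokes sa' (sm_S sp')).
have K4 (A B C D A' B' C' D': R): A = A' -> B = B' -> C = C' -> D = D' ->
 Complex (A + B) (C - D) = Complex (A' + B') (C' - D') by move=> -> -> -> ->.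
exact: K4 (st a p sa sp) (st b q sb sq) (st b p sb sp) (st a q sa sq).
Qed.

(** [J] is an isometry and the star is symmetric, so [stokes] can be read from right to left with
    [J1 t] as the 1-form. *)
Lemma stokes_L3 a t: smooth2 a -> smooth1 t ->
 intg (Nfun (L3 (ext_d a)) t) = intg (I2fun a (S (ext_d (J1 t)))).
move=> sa st; have sJ := sm_J1 st; have sL := sm_Ld sa.
have sS := sm_S (sm_d1 sJ).
transitivity (intg (Nfun (J1 t) (J1 (L3 (ext_d a))))).
 congr integral_vol; apply/funext=> x; rewrite (Nfun_sym sL st) /Nfun.
 exact/esym/(N_JJ (hx x) (st.1 x) (sL.1 x)).
rewrite -(stokes sJ sa); congr integral_vol; apply/funext=> x.
rewrite (I2fun_sym sa sS) /I2fun; have aa := sa.1 x; have ad := (sm_d1 sJ).1 x.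
exact/esym/(I2_star (hx x) ad aa).
Qed.

Lemma sm_p12 s t: smooth1 s -> smooth1 t -> smooth1 (p12 s t).
move=> sa sb; have := sm_c10 (-1) sa sb; congr smooth1; apply: r1_ext=> x u.
by rewrite !f1_mk1 mulN1r.
Qed.

Lemma sm_negf1 (s: rform X 1): smooth1 s -> smooth1 (negf s).
move=> ss; split=> [x t u w|c u]; first by rewrite /f1 /negf -!/(f1 _ _) (ss.1 x); ring.
by apply: (sm_ext (F:=fun y=> - l1 s c y u))=> [y cy|]; [rewrite !l1E|exact: sm_N (ss.2 c u)].
Qed.

Lemma sm_c11S (w: rform X 1): smooth1 w -> smooth2 (c11 (S (ext_d (J1 w)))).
move=> sw; apply: sm_c11; apply: sm_S; apply: sm_d1.
exact: sm_J1.
Qed.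

(** [B] has type (1,2), which reads [v = u o J]; the product with it therefore does not see the
    projection of [d (a + i b)], and [stokes_L3] moves the derivative. *)
Lemma adjoint2 (a b: rform X 2) (s t: rform X 1): A11 (cpx a b) -> smooth1 s -> smooth1 t ->
 let u := p12 s t in let v := p12 t (negf s) in
 let B := cpx (wdform u Om) (wdform v Om) in
 let c (w: rform X 1) := c11 (S (ext_d (J1 w))) in
 L2 g (@dbar R 4 X J 1 1 (cpx a b)) B = L2 g (cpx a b) (cpx (c u) (c v)).
move=> /Apq11P[sa sb ja jb] ss st u v B c.
have su: smooth1 u by exact: sm_p12.
have sv: smooth1 v by apply: sm_p12=>//; exact: sm_negf1.
have vE x: f1 (v x) = fun w=> f1 (u x) (w *m J x).
 apply/funext=> w; rewrite !f1_mk1 (JJ (hx x)) (linN _ (st.1 x)) opprK.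
 by rewrite /f1 /negf opprK addrC.
have uE x: f1 (u x) = fun w=> -1 * f1 (v x) (w *m J x).
 by apply/funext=> w; rewrite vE (JJ (hx x)) (linN _ (su.1 x)) mulN1r opprK.
clearbody u v; rewrite {}/B.
have [sA sB] := (sm_Ld sa, sm_Ld sb).
have sp := sm_p12 sA sB; have sq := sm_p12 sB (sm_negf1 sA).
have [scu scv] := (sm_c11S su, sm_c11S sv).
rewrite (dbar11 sa sb) (L2_3 sp sq su sv) (L2_2 sa sb scu scv).
have I (a': rform X 2) (w: rform X 1): smooth2 a' -> smooth1 w -> Jinv a' -> intg (I2fun a' (c w)) = intg (Nfun (L3 (ext_d a')) w).
 move=> sa' sw ja'; have sS := sm_S (sm_d1 (sm_J1 sw)).
 by rewrite (stokes_L3 sa' sw) /c (I2fun_sym sa' (sm_c11S sw)) (I2fun_c11 sS sa' ja') (I2fun_sym sS sa').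
have K4 (A B C D A' B' C' D': R): A = A' -> B = B' -> C = C' -> D = D' ->
 Complex (A + B) (C - D) = Complex (A' + B') (C' - D') by move=> -> -> -> ->.
refine (etrans _ (esym (K4 _ _ _ _ _ _ _ _ (I a u sa su ja) (I b v sb sv jb) (I b u sb su jb) (I a v sa sv ja)))).
clear I c scu scv K4; move: (L3 (ext_d a)) (L3 (ext_d b)) sA sB sp sq=> A D sA sD sp sq.
have C1 x (w: rform X 1): smooth1 w -> N (g x) (f1 (p12 A D x)) (f1 (w x)) =
  2^-1 * (N (g x) (f1 (A x)) (f1 (w x)) + N (g x) (f1 (D x)) (fun v=> f1 (w x) (v *m J x))).
 move=> sw; rewrite -[X in _ + X]opprK -(N_Jl (hx x) (sD.1 x) (sw.1 x)) -mulN1r -(N_Zl _ (-1)) -N_Dl -N_Zl.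
 by congr N; apply/funext=> ?; rewrite f1_mk1 mulN1r.
have C2 x (w: rform X 1): smooth1 w -> N (g x) (f1 (p12 D (negf A) x)) (f1 (w x)) =
  2^-1 * (N (g x) (f1 (D x)) (f1 (w x)) - N (g x) (f1 (A x)) (fun v=> f1 (w x) (v *m J x))).
 move=> sw; rewrite -(N_Jl (hx x) (sA.1 x) (sw.1 x)) -N_Dl -N_Zl.
 by congr N; apply/funext=> ?; rewrite f1_mk1 /f1 /negf opprK.
have Ku x z: N (g x) z (fun w=> f1 (u x) (w *m J x)) = N (g x) z (f1 (v x)) by rewrite vE.
have Kv x z: N (g x) z (fun w=> f1 (v x) (w *m J x)) = - N (g x) z (f1 (u x)).
 by rewrite [f1 (u x)]uE N_Zr mulN1r opprK.
have E1 x: Nfun (p12 A D) u x + Nfun (p12 D (negf A)) v x = Nfun A u x + Nfun D v x.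
 rewrite /Nfun (C1 x u su) (C2 x v sv) Ku Kv; lra.
have E2 x: Nfun (p12 D (negf A)) u x - Nfun (p12 A D) v x = Nfun D u x - Nfun A v x.
 rewrite /Nfun (C1 x v sv) (C2 x u su) Ku Kv; lra.
exact: f_equal2 (etrans (esym (ivD (cN sp su) (cN sq sv))) (etrans (congr1 intg (funext E1)) (ivD (cN sA su) (cN sD sv))))
 (etrans (esym (ivB (cN sq su) (cN sp sv))) (etrans (congr1 intg (funext E2)) (ivB (cN sD su) (cN sA sv)))).
Qed.

End Adjoint.

(** * The harmonic equation as a pair of first order equations *)

Section Harmonic.
Implicit Types (x: X).

Definition zerof k: rform X k := fun _ _=> 0.
Definition subf k (a b: rform X k): rform X k := addf a (scalf (fun=> -1) b).

Lemma sm_sub1 (a b: rform X 1): smooth1 a -> smooth1 b -> smooth1 (subf a b).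
by move=> sa sb; apply: sm_add1=>//; apply: sm_scal1=>//; exact: sfun_cst. Qed.
Lemma sm_sub2 (a b: rform X 2): smooth2 a -> smooth2 b -> smooth2 (subf a b).
by move=> sa sb; apply: sm_add2=>//; apply: sm_scal2=>//; exact: sfun_cst. Qed.

Lemma f1_sub (a b: rform X 1) x u: f1 (subf a b x) u = f1 (a x) u + -1 * f1 (b x) u. Proof. by []. Qed.
Lemma f2_sub (a b: rform X 2) x u v: f2 (subf a b x) u v = f2 (a x) u v + -1 * f2 (b x) u v. Proof. by []. Qed.

Lemma intN_subr (w a c: rform X 1): smooth1 w -> smooth1 a -> smooth1 c ->
 intg (Nfun w (subf a c)) = intg (Nfun w a) - intg (Nfun w c).
move=> sw sa sc; apply: etrans (ivB (cN sw sa) (cN sw sc)).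
congr integral_vol; apply/funext=> x; rewrite /Nfun -mulN1r -N_Zr -N_Dr; congr N.
Qed.

Lemma intI2_subr (w a c: rform X 2): smooth2 w -> smooth2 a -> smooth2 c ->
 intg (I2fun w (subf a c)) = intg (I2fun w a) - intg (I2fun w c).
move=> sw sa sc; apply: etrans (ivB (cI2 sw sa) (cI2 sw sc)).
congr integral_vol; apply/funext=> x; rewrite /I2fun -mulN1r -I2_Zr -I2_Dr; congr I2.
Qed.

Lemma intN_ge0 (w: rform X 1): smooth1 w -> 0 <= intg (Nfun w w).
move=> sw; apply: (ivol_ge0 cptX isT dens (cN sw sw))=> x.
exact: (N_ge0 (hx x) (sw.1 x)).
Qed.

Lemma intI2_ge0 (w: rform X 2): smooth2 w -> 0 <= intg (I2fun w w).
move=> sw; apply: (ivol_ge0 cptX isT dens (cI2 sw sw))=> x.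
exact: (I2_ge0 (hx x) (sw.1 x)).
Qed.

Lemma intN_eq0 (w: rform X 1): smooth1 w -> intg (Nfun w w) = 0 -> w = @zerof 1.
move=> sw I0; apply: r1_ext=> x u.
have E := ivol_eq0 cptX isT dens (dens_gt0) (cN sw sw)
 (fun x=> N_ge0 (hx x) (sw.1 x)) I0 x.
by rewrite (N_eq0 (hx x) (sw.1 x) E).
Qed.

Lemma intI2_eq0 (w: rform X 2): smooth2 w -> intg (I2fun w w) = 0 -> w = @zerof 2.
move=> sw I0; apply: r2_ext=> x u v.
have E := ivol_eq0 cptX isT dens (dens_gt0) (cI2 sw sw)
 (fun x=> I2_ge0 (hx x) (sw.1 x)) I0 x.
by rewrite (I2_eq0 (hx x) (sw.1 x) E).
Qed.

Lemma subf_eq0 k (a b: rform X k): subf a b = @zerof k -> a = b.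
move=> E; apply: funext2=> x s; have := congr1 (fun c=> c x s) E.
rewrite /subf /addf /scalf /zerof; lra.
Qed.

(** The difference of two candidates for an adjoint is an admissible test form; the hypothesis says
    that its squared norm is 0. *)
Lemma adjoint_unique k (sm: rform X k -> Prop) (B: rform X k -> rform X k -> R) (a b c d: rform X k):
 (forall w a c, sm w -> sm a -> sm c -> B w (subf a c) = B w a - B w c) ->
 (forall w, sm w -> 0 <= B w w) -> (forall w, sm w -> B w w = 0 -> w = @zerof k) ->
 (forall a b, sm a -> sm b -> sm (subf a b)) -> sm a -> sm b -> sm c -> sm d ->
 B (subf a c) a + B (subf b d) b = B (subf a c) c + B (subf b d) d -> a = c /\ b = d.
move=> Bs B0 B1 ss sa sb sc sd E; have [s1 s2] := (ss _ _ sa sc, ss _ _ sb sd).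
have := B0 _ s1; have := B0 _ s2; have := Bs _ _ _ s1 sa sc; have := Bs _ _ _ s2 sb sd.
move=> E2 E1 P2 P1; split; apply: subf_eq0; apply: B1=>//; rewrite ?E1 ?E2; rewrite ?E1 ?E2 in P1 P2; lra.
Qed.

(** The computed form meets the condition in [dbar_star], and it is the only one to do so; hence
    [xget] returns it. *)
Lemma dbar_star1 p q: A11 (cpx p q) ->
 let P := J1 (L3 (ext_d (S p))) in let Q := J1 (L3 (ext_d (S q))) in
 @dbar_star R 4 X J g 1 0 (cpx p q) = cpx (c10re P Q) (c10im P Q).
move=> A P Q; have /Apq11P[sp sq jp jq] := A.
have sP := sm_J1 (sm_LdS sp).
have sQ := sm_J1 (sm_LdS sq).
have [sr si] := (sm_c10re sP sQ, sm_c10im sP sQ).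
have adj z: A10 z -> L2 g (@dbar R 4 X J 1 0 z) (cpx p q) = L2 g z (cpx (c10re P Q) (c10im P Q)).
 rewrite -(cpx_ReIm z)=> Az; rewrite (L2_c10 Az sP sQ).
 exact: (adjoint1 Az A).
apply: xget_unique; first by split; [exact: (c10_A10 sP sQ)|exact: adj].
move=> y; rewrite -(cpx_ReIm y); move: (re_form y) (im_form y)=> a b [Aab Hab].
have A0 := c10_A10 sP sQ.
have /(Apq10P)[sa sb ab] := Aab; have /(Apq10P)[_ _ cd] := A0.
have Aw: A10 (cpx (subf a (c10re P Q)) (subf b (c10im P Q))).
 apply/(Apq10P); split; [exact: (sm_sub1 sa sr)|exact: (sm_sub1 sb si)|move=> x u].
 by rewrite !f1_sub ab cd; ring.
have [s1 s2] := (sm_sub1 sa sr, sm_sub1 sb si).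
have := congr1 (@complex.Re R) (etrans (esym (Hab _ Aw)) (adj _ Aw)).
rewrite (L2_1 s1 s2 sa sb) (L2_1 s1 s2 sr si) /= => E.
have [-> ->] // := adjoint_unique intN_subr intN_ge0 intN_eq0 sm_sub1 sa sb sr si E.
Qed.

(** Stated for (1,2) forms of the shape produced by [dbar11], the only ones at which the Laplacian
    on (1,1) forms evaluates this adjoint. *)
Lemma dbar_star2 (s t: rform X 1): smooth1 s -> smooth1 t ->
 let u := p12 s t in let v := p12 t (negf s) in
 let c (w: rform X 1) := c11 (S (ext_d (J1 w))) in
 @dbar_star R 4 X J g 1 1 (cpx (wdform u Om) (wdform v Om)) = cpx (c u) (c v).
move=> ss st u v c.
have su: smooth1 u by exact: sm_p12.
have sv: smooth1 v by exact: (sm_p12 st (sm_negf1 ss)).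
have [scu scv] := (sm_c11S su, sm_c11S sv).
have Jc11 w: smooth1 w -> Jinv (c11 (S (ext_d (J1 w)))).
 move=> sw; apply: (Jinv_c11); apply: sm_S; apply: sm_d1.
 exact: sm_J1.
have A0: A11 (cpx (c u) (c v)).
 by apply/Apq11P; split; [exact: scu|exact: scv|exact: Jc11|exact: Jc11].
have adj z: A11 z -> L2 g (@dbar R 4 X J 1 1 z) (cpx (wdform u Om) (wdform v Om)) = L2 g z (cpx (c u) (c v)).
 rewrite -(cpx_ReIm z)=> Az; exact: (adjoint2 Az ss st).
apply: xget_unique; first by split; [exact: A0|exact: adj].
move=> y; rewrite -(cpx_ReIm y); move: (re_form y) (im_form y)=> a b [Aab Hab].
have /Apq11P[sa sb ja jb] := Aab; have /Apq11P[_ _ jc jd] := A0.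
have Aw: A11 (cpx (subf a (c u)) (subf b (c v))).
 apply/Apq11P; split; [exact: (sm_sub2 sa scu)|exact: (sm_sub2 sb scv)|move=> x w w'|move=> x w w'].
  by rewrite !f2_sub ja jc.
 by rewrite !f2_sub jb jd.
have [s1 s2] := (sm_sub2 sa scu, sm_sub2 sb scv).
have := congr1 (@complex.Re R) (etrans (esym (Hab _ Aw)) (adj _ Aw)).
rewrite (L2_2 s1 s2 sa sb) (L2_2 s1 s2 scu scv) /= => E.
have [-> ->] // := adjoint_unique intI2_subr intI2_ge0 intI2_eq0 sm_sub2 sa sb scu scv E.
Qed.

Lemma ext_d1_0: ext_d (@zerof 1) = @zerof 2.
apply: r2_ext=> x u v; rewrite ext_d1.
have E w: l1 (@zerof 1) x ^~ w = cst 0 by apply/funext=> y; rewrite l1E.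
have K (A B: R): A = 0 -> B = 0 -> A - B = 0 by move=> -> ->; exact: subr0.
have D w w': 'D_w (fun y=> l1 (@zerof 1) x y w') (chart x x) = 0.
 by rewrite (E w') derive_cst.
exact: K.
Qed.

Lemma c11_0: c11 (@zerof 2) = @zerof 2.
by apply: r2_ext=> x u v; rewrite f2_mk2 /f2 /zerof; lra. Qed.

Lemma S_0: S (@zerof 2) = @zerof 2.
apply: r2_ext=> x u v; rewrite f2_mk2 /star /Lam /tr2.
by rewrite !big1 ?mulr0 ?mul0r ?subr0// => i _; rewrite big1// => j _; rewrite mulr0.
Qed.

Lemma J1_0: J1 (@zerof 1) = @zerof 1. Proof. by apply: r1_ext. Qed.

Lemma intI2_opp (m c r: rform X 2): smooth2 m -> smooth2 c -> smooth2 r ->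
 (forall x w, m x w + c x w = 0) -> intg (I2fun r c) = - intg (I2fun m r).
move=> sm sc sr' mc; apply: etrans (ivolN cptX isT dens (cI2 sm sr')).
congr integral_vol; apply/funext=> x; rewrite (I2fun_sym sr' sc) -mulN1r /I2fun -I2_Zl; congr I2.
by apply: funext2=> w w'; rewrite /f2; have := mc x (vs [:: w; w']); lra.
Qed.

Lemma p12_eq0 (s t: rform X 1): p12 s t = @zerof 1 -> forall x w, f1 (s x) w = f1 (t x) (w *m J x).
move=> Z x w; have := congr1 (fun m: rform X 1=> f1 (m x) w) Z; rewrite f1_mk1 /zerof [RHS]/f1.
move: (f1 _ _) (f1 _ _)=> r1 r2; lra.
Qed.

Lemma c10re_eq0 (s t: rform X 1): (forall x, lin (f1 (t x))) -> c10re (J1 s) (J1 t) = @zerof 1 ->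
 forall x w, f1 (s x) (w *m J x) = f1 (t x) w.
move=> lt Z x w; have := congr1 (fun m: rform X 1=> f1 (m x) w) Z.
rewrite !f1_mk1 (JJ (hx x)) (linN _ (lt x)) /zerof [RHS]/f1; move: (f1 _ _) (f1 _ _)=> r1 r2; lra.
Qed.

Lemma c10_eq0 (s t: rform X 1): (forall x, lin (f1 (t x))) ->
 (forall x w, f1 (s x) (w *m J x) = f1 (t x) w) ->
 c10re (J1 s) (J1 t) = @zerof 1 /\ c10im (J1 s) (J1 t) = @zerof 1.
move=> lt C; split; apply: r1_ext=> x w.
 by rewrite !f1_mk1 (JJ (hx x)) C (linN _ (lt x)) subrr mulr0.
by rewrite !f1_mk1 -C subrr mulr0.
Qed.

(** The arithmetic of a vanishing sum of squared norms. One real part of each of the two forms is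
    enough, since for a given type the imaginary part is the real part composed with [J] up to
    sign. *)
Lemma sqrs_eq0 (A B C D U W P Q: R): A + B = C + D -> U + W = P + Q -> P = - A -> Q = - B ->
 0 <= U -> 0 <= W -> 0 <= C -> 0 <= D -> U = 0 /\ C = 0.
by move=> *; split; lra. Qed.

(** Pairing the Laplacian with the form itself makes dbar and its adjoint vanish. The first equation
    annihilates the (0,1) part of [L3 (ext_d p) + i L3 (ext_d q)], the second the (1,0) part found
    in [dbar_star1]. *)
Lemma harmP p q: @harmonic_dbar R 4 X J g 1 1 (cpx p q) <-> [/\ A11 (cpx p q),
 forall x u, f1 (L3 (ext_d p) x) u = f1 (L3 (ext_d q) x) (u *m J x) &
 forall x u, f1 (L3 (ext_d (S p)) x) (u *m J x) = f1 (L3 (ext_d (S q)) x) u].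
(* On (1,1) forms the Laplacian is rewritten with the explicit adjoints. *)
have lapE: A11 (cpx p q) -> let s := L3 (ext_d p) in let t := L3 (ext_d q) in
 let P := J1 (L3 (ext_d (S p))) in let Q := J1 (L3 (ext_d (S q))) in
 let a := c10re P Q in let b := c10im P Q in let u := p12 s t in let v := p12 t (negf s) in
 let c (w: rform X 1) := c11 (S (ext_d (J1 w))) in
 @laplacian_dbar R 4 X J g 1 1 (cpx p q) = fun x r=> cpx (c11 (ext_d a)) (c11 (ext_d b)) x r + cpx (c u) (c v) x r.
 move=> A s t P Q a b u v c; have /Apq11P[sp sq jp jq] := A.
 have [ss st] := (sm_Ld sp, sm_Ld sq).
 have sP := sm_J1 (sm_LdS sp).
 have sQ := sm_J1 (sm_LdS sq).
 have [sr si] := (sm_c10re sP sQ, sm_c10im sP sQ).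
 by rewrite /laplacian_dbar (dbar_star1 A) (dbar10 sr si) (dbar11 sp sq) (dbar_star2 ss st).
split=> [[A]|[A C1 C2]].
 have /Apq11P[sp sq jp jq] := A.
 rewrite (lapE A); cbv zeta.
 have [ss st] := (sm_Ld sp, sm_Ld sq).
 have sP := sm_J1 (sm_LdS sp).
 have sQ := sm_J1 (sm_LdS sq).
 have [sr si] := (sm_c10re sP sQ, sm_c10im sP sQ).
 have EA: A10 (cpx (c10re (J1 (L3 (ext_d (S p)))) (J1 (L3 (ext_d (S q))))) (c10im (J1 (L3 (ext_d (S p)))) (J1 (L3 (ext_d (S q)))))).
  exact: (c10_A10 sP sQ).
 have L1 := etrans (adjoint1 EA A) (esym (L2_c10 EA sP sQ)).
 have {}L2 := adjoint2 A ss st.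
 have su: smooth1 (p12 (L3 (ext_d p)) (L3 (ext_d q))) by exact: (sm_p12 ss st).
 have sv: smooth1 (p12 (L3 (ext_d q)) (negf (L3 (ext_d p)))).
  exact: (sm_p12 st (sm_negf1 ss)).
 have [scu scv] := (sm_c11S su, sm_c11S sv).
 have [sca scb] := (sm_c11 (sm_d1 sr), sm_c11 (sm_d1 si)).
 move: L1 L2; cbv zeta; rewrite (dbar10 sr si) (dbar11 sp sq).
 rewrite (L2_2 sca scb sp sq) (L2_1 sr si sr si).
 rewrite (L2_3 su sv su sv) (L2_2 sp sq scu scv).
 move=> /(congr1 (@complex.Re R)) /= L1 /(congr1 (@complex.Re R)) /= L2 E.
 have O1 := intI2_opp sca scu sp (fun x w=> congr1 (fun h=> complex.Re (h x w)) E).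
 have O2 := intI2_opp scb scv sq (fun x w=> congr1 (fun h=> complex.Im (h x w)) E).
 have [N1 N2 N3 N4] := And4 (intN_ge0 su) (intN_ge0 sv) (intN_ge0 sr) (intN_ge0 si).
 have [Z1 Z2] := sqrs_eq0 L1 L2 O1 O2 N1 N2 N3 N4.
 have {}Z1 := intN_eq0 su Z1; have {}Z2 := intN_eq0 sr Z2.
 split; [exact: A|exact: (p12_eq0 Z1)|].
 exact: (c10re_eq0 (sm_LdS sq).1 Z2).
have /Apq11P[sp sq jp jq] := A.
have [l1 l2] := ((sm_Ld sp).1, (sm_Ld sq).1).
have [k1 k2] := ((sm_LdS sp).1, (sm_LdS sq).1).
split=>//; rewrite (lapE A); cbv zeta.
have -> : p12 (L3 (ext_d p)) (L3 (ext_d q)) = @zerof 1.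
 by apply: r1_ext=> x w; rewrite f1_mk1 C1 subrr mulr0.
have -> : p12 (L3 (ext_d q)) (negf (L3 (ext_d p))) = @zerof 1.
 apply: r1_ext=> x w; rewrite f1_mk1 -[f1 (negf _ _) _]/(- f1 (L3 (ext_d p) x) _) C1 (JJ (hx x)) (linN _ (l2 x)).
 by rewrite opprK subrr mulr0.
have [-> ->] := c10_eq0 k2 C2.
rewrite J1_0 !ext_d1_0 S_0 c11_0; apply: funext2=> x w.
by apply: C_ext; rewrite ?ReD ?ImD /= addr0.
Qed.

End Harmonic.

(** * Differentials of products and compositions of functions *)

Section Functions.
Implicit Types (x: X) (f h: X -> R).

Lemma df_M f h x (u: V): sfun f -> sfun h ->
 f1 (df (fun x=> f x * h x) x) u = f x * f1 (df h x) u + h x * f1 (df f x) u.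
move=> sf sh; rewrite !f1_df; have := der_prod_at u sf (sh x).
by rewrite f1_df cinv_self.
Qed.

Lemma df_D f h x (u: V): sfun f -> sfun h ->
 f1 (df (fun x=> f x + h x) x) u = f1 (df f x) u + f1 (df h x) u.
move=> sf sh; rewrite !f1_df; have cx := im_self x.
by rewrite -(deriveD (sm_dvb (sf x) cx) (sm_dvb (sh x) cx)).
Qed.

Lemma df_cst (t: R) x (u: V): f1 (df (fun=> t) x) u = 0.
by rewrite f1_df; exact: derive_cst. Qed.

Lemma sm_sqrt f: (forall x, 0 < f x) -> sfun f -> sfun (fun x=> Num.sqrt (f x)).
by move=> f0 sf c k; apply: Ck_sqrt=>//; solve [exact: im_open|exact: sf]. Qed.

Lemma sm_ln f: (forall x, 0 < f x) -> sfun f -> sfun (fun x=> ln (f x)).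
by move=> f0 sf c k; apply: Ck_ln=>//; solve [exact: im_open|exact: sf]. Qed.

Lemma sm_exp f: sfun f -> sfun (fun x=> expR (f x)).
by move=> sf c k; apply: Ck_exp=>//; solve [exact: im_open|exact: sf]. Qed.

Lemma smooth_V f: (forall x, f x != 0) -> sfun f -> sfun (fun x=> (f x)^-1).
by move=> f0 sf c k; apply: Ck_V=>//; solve [exact: im_open|exact: sf]. Qed.

Lemma df_comp (G: R -> R) f x (u: V) (G': R): sfun f -> is_derive (f x) 1 G G' ->
 f1 (df (fun x=> G (f x)) x) u = G' * f1 (df f x) u.
move=> sf dG; rewrite !f1_df; have cx := im_self x.
have dG': derivable G (f (chart_inv x (chart x x))) 1 by rewrite cinv_self; exact: ex_derive.
have [_ ->] := der_cmp1 (sm_dvb (v:=u) (sf x) cx) dG'.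
by rewrite derive1E cinv_self (derive_val (f:=G)).
Qed.

Lemma df_ln f x (u: V): (forall x, 0 < f x) -> sfun f ->
 f1 (df (fun x=> ln (f x)) x) u = (f x)^-1 * f1 (df f x) u.
by move=> f0 sf; apply: df_comp=>//; exact: is_derive1_ln. Qed.

Lemma df_exp f x (u: V): sfun f ->
 f1 (df (fun x=> expR (f x)) x) u = expR (f x) * f1 (df f x) u.
by move=> sf; apply: df_comp=>//; exact: is_derive_expR. Qed.

Lemma df_sqrt f x (u: V): (forall x, 0 < f x) -> sfun f ->
 f1 (df (fun x=> Num.sqrt (f x)) x) u = (2 * Num.sqrt (f x))^-1 * f1 (df f x) u.
by move=> f0 sf; apply: df_comp=>//; exact: is_derive1_sqrt. Qed.

Lemma df_V f x (u: V): (forall x, f x != 0) -> sfun f ->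
 f1 (df (fun x=> (f x)^-1) x) u = - (f x) ^- 2 * f1 (df f x) u.
move=> f0 sf; have := df_M x u sf (smooth_V f0 sf).
rewrite (_: (fun x=> _ * _) = fun=> 1); last by apply/funext=> y; rewrite divff.
rewrite df_cst; move: (f1 _ _) (f1 (df f x) u) (f0 x)=> d e f00 E.
have: f x * d = - ((f x)^-1 * e) by lra.
move=> /(congr1 (fun t=> (f x)^-1 * t)); rewrite mulrA mulVf// mul1r=> ->; field.
by rewrite f00.
Qed.

End Functions.

(** * The logarithmic weight *)

Section Weight.
Variables (f: X -> R) (s: R).
Hypotheses (sf: sfun f) (s0: 0 < s).
Implicit Types (x: X) (u: V).

(* For A(t) = t k(t) with k(t) = (1 + ln (r / s)) / r and r = sqrt (t ^ 2 + s ^ 2), *)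
(* A' = 1 / r + s ^ 2 ln (r / s) / r ^ 3 satisfies |t A'(t)| <= 2 for every s, while *)
(* k tends to infinity with 1 / s, uniformly on compact sets.                         *)
Definition wr x := Num.sqrt (f x * f x + s * s).
Definition wl x := ln (wr x) - ln s.
Definition wk x := (1 + wl x) * (wr x)^-1.
Definition wm x := (wr x)^-1 + s * s * wl x * ((wr x)^-1 * (wr x)^-1 * (wr x)^-1).

Lemma wq_gt0 x: 0 < f x * f x + s * s.
by rewrite ltr_wpDl ?mulr_gt0// -expr2 sqr_ge0. Qed.

Lemma wr_gt0 x: 0 < wr x. Proof. by rewrite sqrtr_gt0 wq_gt0. Qed.
Lemma wr_neq0 x: wr x != 0. Proof. by rewrite gt_eqF ?wr_gt0. Qed.

Lemma wr_sqr x: wr x * wr x = f x * f x + s * s.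
by rewrite -expr2 sqr_sqrtr// ltW ?wq_gt0. Qed.

Lemma wr_ge x: s <= wr x.
by have := wr_sqr x; have := wr_gt0 x; move: (wr x) (f x) s0=> r t *; nra. Qed.

Lemma sm_wr: sfun wr.
apply: sm_sqrt; first exact: wq_gt0.
by apply: sfunD; [exact: sfunM|exact: sfun_cst].
Qed.

Lemma sm_wrV: sfun (fun x=> (wr x)^-1).
by apply: smooth_V; [exact: wr_neq0|exact: sm_wr]. Qed.

Lemma sm_wl: sfun wl.
by apply: sfunD; [apply: sm_ln; [exact: wr_gt0|exact: sm_wr]|exact: sfun_cst]. Qed.

Lemma sm_wk: sfun wk.
by apply: sfunM; [apply: sfunD; [exact: sfun_cst|exact: sm_wl]|exact: sm_wrV]. Qed.

Lemma sm_wm: sfun wm.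
apply: sfunD; first exact: sm_wrV.
apply: sfunM; first by apply: sfunM; [exact: sfun_cst|exact: sm_wl].
by apply: sfunM; [apply: sfunM|]; exact: sm_wrV.
Qed.

Lemma df_wr x u: f1 (df wr x) u = f x / wr x * f1 (df f x) u.
rewrite (df_sqrt x u wq_gt0); last by apply: sfunD; [exact: sfunM|exact: sfun_cst].
rewrite df_D; [|exact: sfunM|exact: sfun_cst].
rewrite (df_M x u sf sf) df_cst -/(wr x); have := wr_neq0 x; move: (f1 _ _)=> d r0; by field.
Qed.

Lemma df_wrV x u: f1 (df (fun x=> (wr x)^-1) x) u = - (f x * (wr x)^-1 ^+ 3) * f1 (df f x) u.
rewrite (df_V x u wr_neq0 sm_wr) df_wr; have := wr_neq0 x; move: (f1 _ _)=> d r0; by field.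
Qed.

Lemma df_wl x u: f1 (df wl x) u = f x * (wr x)^-1 ^+ 2 * f1 (df f x) u.
rewrite df_D; [|by apply: sm_ln; [exact: wr_gt0|exact: sm_wr]|exact: sfun_cst].
rewrite df_cst (df_ln x u wr_gt0 sm_wr) df_wr; have := wr_neq0 x; move: (f1 _ _)=> d r0; by field.
Qed.

Lemma df_wk x u: f1 (df wk x) u = - (f x * wl x * (wr x)^-1 ^+ 3) * f1 (df f x) u.
rewrite df_M; [|by apply: sfunD; [exact: sfun_cst|exact: sm_wl]|exact: sm_wrV].
rewrite (df_D x u (sfun_cst 1) sm_wl).
rewrite df_cst df_wrV df_wl; move: (f1 _ _) ((wr x)^-1) (wl x)=> d r l; ring.
Qed.

Lemma df_wA x u: f1 (df (fun x=> f x * wk x) x) u = wm x * f1 (df f x) u.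
rewrite (df_M x u sf sm_wk) df_wk /wk /wm; have := wr_neq0 x; have E: s * s = wr x * wr x - f x * f x by rewrite wr_sqr; ring.
rewrite E; move: (f1 _ _) (wl x) (wr x)=> d l r r0; by field.
Qed.

(** Only proportionality to [df f] matters: it makes [m ^ 2 df] a closed form. *)
Lemma df_wm2 x: exists h, forall u, f1 (df (fun x=> wm x * wm x) x) u = h * f1 (df f x) u.
have: exists h, forall u, f1 (df wm x) u = h * f1 (df f x) u.
 have sS: sfun (fun x=> s * s * wl x) by apply: sfunM; [exact: sfun_cst|exact: sm_wl].
 have s2 := sfunM sm_wrV sm_wrV; have s3 := sfunM s2 sm_wrV.
 exists (- (f x * (wr x)^-1 ^+ 3) + (s * s * wl x * (- 3 * f x * (wr x)^-1 ^+ 5) + (wr x)^-1 ^+ 3 * (s * s * f x * (wr x)^-1 ^+ 2)))=> u.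
 rewrite (df_D x u sm_wrV (sfunM sS s3)) (df_M x u sS s3) (df_M x u s2 sm_wrV) (df_M x u sm_wrV sm_wrV).
 rewrite (df_M x u (sfun_cst (s * s)) sm_wl) df_cst df_wl df_wrV.
 by move: (f1 _ _) ((wr x)^-1) (wl x)=> d r l; ring.
move=> [h H]; exists (2 * wm x * h)=> u; rewrite (df_M x u sm_wm sm_wm) H; ring.
Qed.

Lemma wl_ge0 x: 0 <= wl x.
by rewrite /wl subr_ge0 ler_ln ?posrE// ?wr_gt0// wr_ge. Qed.

Lemma wl_le x: wl x <= wr x / s - 1.
by rewrite /wl -ln_div ?posrE ?wr_gt0//; apply: ln_le_sub1; rewrite divr_gt0 ?wr_gt0.
Qed.

(** As [|f| <= r], it suffices that [m * r <= 2]: the first term of [m] contributes 1, and the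
    second at most 1 because [s * wl <= r - s] and [s <= r]. *)
Lemma wm_bd x: (wm x * f x) ^+ 2 <= 4.
have r0 := wr_gt0 x; have rs := wr_ge x; have l0 := wl_ge0 x; have l1 := wl_le x; have rr := wr_sqr x.
have m0: 0 <= wm x.
 have v0: 0 <= (wr x)^-1 by rewrite invr_ge0 ltW.
 apply: addr_ge0=>//; apply: mulr_ge0; first by apply: mulr_ge0=>//; apply: mulr_ge0; exact: ltW.
 by apply: mulr_ge0=>//; exact: mulr_ge0.
have m1: wm x * wr x <= 2.
 have -> : wm x * wr x = 1 + s * s * wl x * ((wr x)^-1 * (wr x)^-1).
  by rewrite /wm; move: (wl x) r0=> l /gt_eqF/negbT r0; field.
 rewrite (_: 2 = 1 + 1) ?lerD2l; last by lra.
 rewrite -[leRHS](divff (x:=wr x * wr x)) ?mulf_neq0 ?wr_neq0// invfM.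
 apply: ler_wpM2r; first by rewrite mulr_ge0// invr_ge0 ltW.
 have: s * wl x <= wr x - s.
  have -> : wr x - s = s * (wr x / s - 1) by move: (wr x) (gt_eqF s0)=> r /negbT sn; field.
  by rewrite ler_pM2l.
 move=> h; have := ler_wpM2l (ltW s0) h; move: (wl x) (wr x) l0 r0 rs=> l r *; nra.
have f2: f x ^+ 2 <= wr x ^+ 2 by rewrite [leRHS]expr2 rr expr2 lerDl mulr_ge0 ?ltW.
rewrite exprMn; apply: (le_trans (ler_wpM2l (sqr_ge0 _) f2)); rewrite -exprMn.
have: 0 <= wm x * wr x by rewrite mulr_ge0// ltW.
by move: (wm x * wr x) m1=> t *; nra.
Qed.

(** The function [(1 + ln (r / s)) / r] decreases for [r >= s], so on [r <= K] it is least at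
    [K]. *)
Lemma wk_bd (K: R) x: wr x <= K -> (1 + (ln K - ln s)) / K <= wk x.
move=> rK; have r0 := wr_gt0 x; have K0: 0 < K := lt_le_trans r0 rK.
have xK: 1 <= K / wr x by rewrite ler_pdivlMr// mul1r.
have lx: ln K - ln (wr x) <= K / wr x - 1.
 by rewrite -ln_div ?posrE//; apply: ln_le_sub1; rewrite divr_gt0.
have l0 := wl_ge0 x; rewrite /wk ler_pdivrMr// mulrAC ler_pdivlMr//.
have -> : ln K - ln s = (ln K - ln (wr x)) + wl x by rewrite /wl; ring.
move: lx xK; have [E ->] : exists y, K = y * wr x by exists (K / wr x); rewrite divfK ?wr_neq0.
rewrite mulfK ?wr_neq0//; move: (ln (E * wr x) - ln (wr x))=> a; move: (wl x) l0 (wr x) r0=> l l0 r r0 h1 h2.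
rewrite -subr_ge0; have -> : (1 + l) * (E * r) - (1 + (a + l)) * r = r * ((E - 1 - a) + (E - 1) * l) by ring.
by rewrite mulr_ge0 ?(ltW r0)// addr_ge0 ?mulr_ge0 ?subr_ge0.
Qed.

End Weight.

#[local] Opaque wr wl wk wm.

(** * Vanishing of the twisted differential *)

Section Vanishing.
Implicit Types (x: X).

Lemma sfun_bdd (f: X -> R): sfun f -> exists2 M, 0 <= M & forall x, `|f x| <= M.
move=> /sf_cont cf; have cI: compact (f @` [set: X]).
 by apply: continuous_compact=>//; exact: continuous_subspaceT.
have [M [_ HM]] := compact_bounded cI; exists (`|M| + 1); first by rewrite addr_ge0.
by move=> x; apply: (HM (`|M| + 1)); [rewrite ltr_pwDr// ler_norm|exists x].
Qed.

Lemma intg_le (f h: X -> R): continuous f -> continuous h -> (forall x, f x <= h x) -> intg f <= intg h.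
move=> cf ch fh; rewrite -subr_ge0; have := ivol_ge0 cptX isT dens (f:=fun x=> h x - f x).
rewrite (ivB ch cf); apply; last by move=> x; rewrite subr_ge0.
move=> x; exact: (cont_atD (ch x) (cont_atN (cf x))).
Qed.

Variable alpha: rform X 1.
Hypotheses (sa: smooth1 alpha) (da: forall x u v, f2 (ext_d alpha x) u v = 0).

Definition theta (f: X -> R): rform X 1 := addf (df f) (scalf f alpha).

Lemma sm_theta f: sfun f -> smooth1 (theta f).
by move=> sf; apply: sm_add1; [exact: sm_df|exact: sm_scal1]. Qed.

Lemma f1_theta f x u: f1 (theta f x) u = f1 (df f x) u + f x * f1 (alpha x) u. Proof. by []. Qed.

Variables (f: X -> R) (gam: rform X 2) (c: R).
Hypotheses (sf: sfun f) (sg: smooth2 gam) (sasd: forall x u v, f2 (S gam x) u v = - f2 (gam x) u v).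
Hypothesis rel: forall x u, f1 (theta f x) u = c * f1 (L3 (ext_d gam) x) (u *m J x).

(** By [rel], [theta f] is [c] times the dual of the differential of [gam]; [stokes] moves the
    derivative to [z], and the star of [gam] is its opposite. *)
Lemma int_theta z: smooth1 z ->
 intg (Nfun z (theta f)) = - (c * intg (I2fun (ext_d z) gam)).
move=> sz; have sL := sm_J1 (sm_Ld sg).
transitivity (c * intg (Nfun z (J1 (L3 (ext_d gam))))).
 apply: etrans (ivZ c (cN sz sL)); congr integral_vol; apply/funext=> x.
 by rewrite /Nfun -N_Zr; congr N; apply/funext=> u; exact: rel.
rewrite -(stokes sz sg) -mulrN; congr (_ * _).
have sI := cI2 (sm_d1 sz) sg.
apply: etrans (ivolN cptX isT dens sI); congr integral_vol; apply/funext=> x.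
rewrite -mulN1r /I2fun -I2_Zr; congr I2; apply: funext2=> u v.
by rewrite sasd mulN1r.
Qed.

Lemma int_theta0 z: smooth1 z -> (forall x u v, f2 (ext_d z x) u v = 0) -> intg (Nfun z (theta f)) = 0.
move=> sz dz; rewrite (int_theta sz); suff -> : I2fun (ext_d z) gam = fun=> 0.
 by rewrite (ivol0 cptX isT dens) mulr0 oppr0.
apply/funext=> x; rewrite /I2fun; have -> : f2 (ext_d z x) = fun u v=> 0 * f2 (ext_d z x) u v.
 by apply: funext2=> u v; rewrite dz mul0r.
by rewrite I2_Zl mul0r.
Qed.

(** The wedge of [df h] and [df f] vanishes when one is pointwise a multiple of the other. *)
Lemma closed_dep (h: X -> R): sfun h -> (forall x, exists m, forall u, f1 (df h x) u = m * f1 (df f x) u) ->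
 forall x u v, f2 (ext_d (scalf h (df f)) x) u v = 0.
move=> sh dep x u v; have [m E] := dep x.
have K (p q h': R): m * p * q - m * q * p + h' * 0 = 0 by ring.
by rewrite (scal_d1 x u v sh (sm_df sf)) (ddf x u v sf) /wd1 !E; exact: K.
Qed.

(** Lagrange's identity: the difference of the two sides is the square of the product of [z] and
    [w]. *)
Lemma wd1_bd x (z w: V -> R): lin z -> lin w ->
 I2 (g x) (wd1 z w) (wd1 z w) <= N (g x) z z * N (g x) w w.
move=> lz lw; have [F uf] := uframeP (hx x).
rewrite (I2_frame uf (wd1_alt2 lz lw) (wd1_alt2 lz lw)) (N_frame uf lz lz) (N_frame uf lw lw) /wd1.
move: (z (row o0 F)) (z (row o1 F)) (z (row o2 F)) (z (row o3 F)) (w (row o0 F)) (w (row o1 F)) (w (row o2 F)) (w (row o3 F)).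
move=> z0 z1 z2 z3 w0 w1 w2 w3; rewrite -subr_ge0.
rewrite (_: _ - _ = (z0 * w0 + z1 * w1 + z2 * w2 + z3 * w3) ^+ 2); first exact: sqr_ge0.
ring.
Qed.

Lemma I2_young x (a b: V -> V -> R) (t: R): alt2 a -> alt2 b ->
 - (t * I2 (g x) a b) <= 2^-1 * (I2 (g x) a a + t ^+ 2 * I2 (g x) b b).
move=> aa ab; have := I2_ge0 (hx x) (alt2_add aa (alt2_scale t ab)).
rewrite I2_Dl !I2_Dr !I2_Zl !I2_Zr (I2_sym (hx x) ab aa); move: (I2 _ _ _) (I2 _ _ _) (I2 _ _ _)=> p q r; nra.
Qed.

Lemma N_young x (a b: V -> R) (t: R): lin a -> lin b ->
 - (t * N (g x) a b) <= 2^-1 * (N (g x) a a + t ^+ 2 * N (g x) b b).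
move=> la lb; have lab: lin (fun u=> a u + t * b u) by move=> s u v; rewrite la lb; ring.
have := N_ge0 (hx x) lab.
rewrite N_Dl !N_Dr !N_Zl !N_Zr (N_sym (hx x) lb la); move: (N _ _ _) (N _ _ _) (N _ _ _)=> p q r; nra.
Qed.

(** Write [k theta] as [k df + A alpha] with [A = f k]. The first term is closed and drops out; the
    second has differential [m df /\ alpha], whose product with [gam] is split by Young's
    inequality. What remains of [m ^ 2 |df| ^ 2] is absorbed by [2 m ^ 2 <df, theta>], of integral
    0, and by [4 |alpha| ^ 2]. The bound is free of [s]. *)
Lemma weight_bd (M s: R): 0 < s -> (forall x, Nfun alpha alpha x <= M) ->
 intg (fun x=> wk f s x * Nfun (theta f) (theta f) x) <=
 2 * M * intg (Nfun alpha alpha) + 2^-1 * c ^+ 2 * intg (I2fun gam gam).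
move=> s0 aM; set k := wk f s; set m := wm f s.
have sk: sfun k := sm_wk sf s0; have sm: sfun m := sm_wm sf s0.
have st := sm_theta sf; have sdf := sm_df sf.
have sA := sfunM sf sk.
have s1 := sm_scal1 sk sdf; have s2 := sm_scal1 (sfunM sm sm) sdf; have s3 := sm_scal1 sA sa.
have I1: intg (Nfun (scalf k (df f)) (theta f)) = 0.
 apply: (int_theta0 s1); apply: (closed_dep sk)=> x.
 by exists (- (f x * wl f s x * (wr f s x)^-1 ^+ 3))=> u; exact: (df_wk sf s0).
have I2': intg (Nfun (scalf (fun x=> m x * m x) (df f)) (theta f)) = 0.
 by apply: (int_theta0 s2); apply: (closed_dep (sfunM sm sm))=> x; exact: (df_wm2 sf s0).
have I3 := int_theta s3.
have Nsc h z w x: Nfun (scalf h z) w x = h x * Nfun z w x by exact: N_Zl.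
have dA x: f2 (ext_d (scalf (fun x=> f x * k x) alpha) x) = fun u v=> m x * wd1 (f1 (df f x)) (f1 (alpha x)) u v.
 apply: funext2=> u v; rewrite (scal_d1 x u v sA sa).
 have K (A B D p q r t h' m': R): A = m' * p -> B = m' * t -> D = 0 ->
  A * q - B * r + h' * D = m' * (p * q - t * r) by move=> -> -> ->; ring.
 exact: K (df_wA sf s0 x u) (df_wA sf s0 x v) (da x u v).
have cNN z w: smooth1 z -> smooth1 w -> continuous (Nfun z w) by move=> *; exact: cN.
have sdA := sm_d1 s3.
have cI := cI2 sdA sg; have cg := cI2 sg sg.
have E: intg (fun x=> k x * Nfun (theta f) (theta f) x) = - (c * intg (I2fun (ext_d (scalf (fun x=> f x * k x) alpha)) gam)).
 rewrite -I3 -[RHS]add0r -I1; apply: etrans (ivD (cNN _ _ s1 st) (cNN _ _ s3 st)).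
 congr integral_vol; apply/funext=> x; rewrite !Nsc -mulrA mulrCA -mulrDr; congr (_ * _).
 by rewrite /Nfun -N_Zl -N_Dl; congr N.
have cm (h: X -> R) t: continuous h -> continuous (fun x=> t * h x).
 by move=> ch x; apply: cont_atM (ch x); exact: cont_cst.
have cD (h h': X -> R): continuous h -> continuous h' -> continuous (fun x=> h x + h' x).
 by move=> ch ch' x; exact: cont_atD (ch x) (ch' x).
(* The pointwise form of the estimate; its term with [m ^ 2 df] has integral 0 by [I2']. *)
have P x: - c * I2fun (ext_d (scalf (fun x=> f x * k x) alpha)) gam x <=
  M * Nfun (scalf (fun x=> m x * m x) (df f)) (theta f) x +
  (2 * M * Nfun alpha alpha x + 2^-1 * c ^+ 2 * I2fun gam gam x).
 have ll := sdf.1 x; have la := sa.1 x; have y := I2_young x c (sdA.1 x) (sg.1 x).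
 have w := wd1_bd x ll la; have n := N_young x (f x) ll la; have b := wm_bd f s0 x; have aMx := aM x; rewrite /Nfun in aMx.
 have n0 := N_ge0 (hx x) ll; have a0 := N_ge0 (hx x) la.
 have T: Nfun (df f) (theta f) x = N (g x) (f1 (df f x)) (f1 (df f x)) + f x * N (g x) (f1 (df f x)) (f1 (alpha x)).
  by rewrite /Nfun -N_Zr -N_Dr; congr N.
 have D: I2 (g x) (f2 (ext_d (scalf (fun x=> f x * k x) alpha) x)) (f2 (ext_d (scalf (fun x=> f x * k x) alpha) x)) =
   m x * m x * I2 (g x) (wd1 (f1 (df f x)) (f1 (alpha x))) (wd1 (f1 (df f x)) (f1 (alpha x))).
  by rewrite dA I2_Zl I2_Zr mulrA.
 rewrite Nsc T /Nfun /I2fun mulNr; move: y; rewrite D.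
 move: (I2 (g x) (wd1 _ _) _) w (I2 (g x) (f2 (gam x)) _) (I2 (g x) _ (f2 (gam x)))=> w wb gg i y.
 move: (N (g x) (f1 (alpha x)) _) (N (g x) (f1 (df f x)) (f1 (df f x))) n0 n a0 aMx wb=> a d d0.
 move: (N (g x) (f1 (df f x)) (f1 (alpha x)))=> nda n a0 aM' wb.
 move: b y n; rewrite -/m; move: (m x) (f x)=> mm ff b y n.
 clear - d0 a0 aM' wb b y n.
 have m2: 0 <= mm * mm by rewrite -expr2 sqr_ge0.
 have M0: 0 <= M := le_trans a0 aM'.
 have h1: mm * mm * w <= M * (mm * mm * d).
  rewrite [leRHS]mulrCA; apply: ler_wpM2l=>//; apply: (le_trans wb); rewrite mulrC; exact: ler_wpM2r.
 have h2: mm * mm * d <= 2 * (mm * mm * (d + ff * nda)) + 4 * a.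
  have: d <= 2 * (d + ff * nda) + ff ^+ 2 * a by lra.
  move=> /(ler_wpM2l m2) h; apply: (le_trans h); rewrite mulrDr mulrCA lerD2l mulrA.
  by apply: ler_wpM2r=>//; move: b; rewrite exprMn expr2.
 have h3: M * (mm * mm * d) <= M * (2 * (mm * mm * (d + ff * nda)) + 4 * a) by exact: ler_wpM2l.
 lra.
rewrite E -mulNr -(ivZ _ cI).
apply: (le_trans (intg_le (cm _ _ cI) _ P)).
 exact: (cD _ _ (cm _ _ (cNN _ _ s2 st)) (cD _ _ (cm _ _ (cNN _ _ sa sa)) (cm _ _ cg))).
rewrite (ivD (cm _ _ (cNN _ _ s2 st)) (cD _ _ (cm _ _ (cNN _ _ sa sa)) (cm _ _ cg))).
rewrite (ivD (cm _ _ (cNN _ _ sa sa)) (cm _ _ cg)) (ivZ _ (cNN _ _ s2 st)) I2' (ivZ _ (cNN _ _ sa sa)) (ivZ _ cg).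
by rewrite mulr0 add0r.
Qed.

(** If the squared norm of [theta f] were positive, a small [s] would push the weighted integral
    beyond the bound [C], which does not depend on [s]. *)
Lemma theta_eq0 x u: f1 (theta f x) u = 0.
have st := sm_theta sf.
suff I0: intg (Nfun (theta f) (theta f)) = 0 by rewrite (intN_eq0 st I0).
have In := intN_ge0 st.
apply/eqP; rewrite eq_le In andbT leNgt; apply/negP=> I0.
have [F F0 fF] := sfun_bdd sf.
have [M M0 aM] := sfun_bdd (sm_Nfun sa sa).
set C := 2 * M * intg (Nfun alpha alpha) + 2^-1 * c ^+ 2 * intg (I2fun gam gam).
have B s: 0 < s -> intg (fun x=> wk f s x * Nfun (theta f) (theta f) x) <= C.
 by move=> s0; apply: weight_bd=>// y; exact: le_trans (ler_norm _) (aM y).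
have cth := cN st st.
have C0: 0 <= C.
 have a0 := intN_ge0 sa; have g0 := intI2_ge0 sg.
 exact: weight_bd_ge0.
pose K := F + 1; have K0: 0 < K by rewrite ltr_wpDl.
pose I := intg (Nfun (theta f) (theta f)).
(* For [s = expR (- T)] the weight is at least [T / K], and this [T] makes [T / K * I] equal to
   [C + 1]. *)
pose T := K * (C + 1) / I.
have T0: 0 <= T by exact: (divr_ge0 (mulr_ge0 (ltW K0) (addr_ge0 C0 ler01)) In).
pose s := expR (- T).
have s0: 0 < s := expR_gt0 _.
have s1: s <= 1 by rewrite -[leRHS]expR0 ler_expR oppr_le0.
have kT y: T / K <= wk f s y.
 have rK: wr f s y <= K.
  have := wr_gt0 f s0 y; have := wr_sqr f s0 y; have := fF y; rewrite ler_norml=> /andP[].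
  rewrite /K; move: (wr f s y) (f y)=> r t h1 h2 h3 h4; nra.
 apply: le_trans (wk_bd s0 rK); rewrite ler_pM2r ?invr_gt0// /s expRK.
 have: 0 <= ln K by rewrite ln_ge0// /K lerDr.
 lra.
have := B s s0; rewrite leNgt=> /negP; apply.
apply: (@lt_le_trans _ _ (T / K * I)).
 rewrite /T (_: _ / K * I = C + 1); first by rewrite ltrDl.
 by field; rewrite !gt_eqF.
rewrite /I -(ivZ _ cth); apply: intg_le.
- by move=> y; apply: cont_atM (cth y); exact: cont_cst.
- move=> y; apply: cont_atM (cth y); exact: (sf_cont (sm_wk sf s0)).
- by move=> y; apply: ler_wpM2r; [exact: (N_ge0 (hx y) (st.1 y))|exact: kT].
Qed.

End Vanishing.

(** * Splitting of harmonic (1,1) forms *)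

Section Split.
Implicit Types (x: X).

Variable alpha: rform X 1.
Hypotheses (sa: smooth1 alpha) (da: forall x u v, f2 (ext_d alpha x) u v = 0).
Hypothesis dOm: forall x, f3 (ext_d Om x) = wd (f1 (alpha x)) (f2 (Om x)).
Local Notation theta := (theta alpha).

(** Anti-self-duality without closedness, which is known only once the twisted differentials have
    been shown to vanish. *)
Record asdf (c: rform X 2): Prop := Asdf {
 asdf_smooth: smooth2 c; asdf_Lam: forall x, Lfun c x = 0; asdf_J: Jinv c }.

Lemma asdf_star c: asdf c -> forall x u v, f2 (S c x) u v = - f2 (c x) u v.
move=> [sc lc jc] x u v; have [_ st] := asdP (hx x) (sc.1 x).
by rewrite f2_mk2; apply: st; split; [exact: lc|exact: jc].
Qed.

Lemma Om_J: Jinv Om. Proof. by move=> x u v; rewrite f2_Om (om_JJ (hx x)). Qed.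

(** The coefficient is half the contraction, because the contraction of [Om] is 2. *)
Lemma asd_split p: smooth2 p -> Jinv p -> exists f c, [/\ sfun f, asdf c & p = addf (scalf f Om) c].
move=> sp jp; pose f x := 2^-1 * Lfun p x.
have sf: sfun f by apply: sfunM; [exact: sfun_cst|exact: sm_Lfun].
have sfO := sm_scal2 sf sOm; exists f, (subf p (scalf f Om)); split=>//.
 split; first exact: sm_sub2.
  move=> x; rewrite /Lfun; have -> : f2 (subf p (scalf f Om) x) = fun u v=> f2 (p x) u v + - f x * f2 (Om x) u v.
   by apply: funext2=> u v; rewrite f2_sub /f2 /scalf; ring.
  rewrite Lam_D Lam_Z f2_Om (Lam_omE (hx x)) -/(Lfun p x) /f.
  by field.
 by move=> x u v; rewrite !f2_sub jp /f2 /scalf -!/(f2 _ _ _) Om_J.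
by apply: funext2=> x s; rewrite /addf /subf /addf /scalf; ring.
Qed.

Lemma d_split f c x u v w: sfun f -> smooth2 c ->
 f3 (ext_d (addf (scalf f Om) c) x) u v w = wd (f1 (theta f x)) (f2 (Om x)) u v w + f3 (ext_d c x) u v w.
move=> sf sc; rewrite (add_d2 x u v w (sm_scal2 sf sOm) sc) (scal_d2 x u v w sf sOm) dOm.
congr (_ + _); rewrite /wd /theta; have E t: f1 (addf (df f) (scalf f alpha) x) t = f1 (df f x) t + f x * f1 (alpha x) t by [].
rewrite !E; move: (f1 _ _) (f1 _ _) (f1 _ _) (f1 _ _) (f1 _ _) (f1 _ _) (f2 _ _ _) (f2 _ _ _) (f2 _ _ _)=> *; ring.
Qed.

Lemma L3_split f c x u: sfun f -> smooth2 c ->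
 f1 (L3 (ext_d (addf (scalf f Om) c)) x) u = f1 (theta f x) u + f1 (L3 (ext_d c) x) u.
move=> sf sc; rewrite !f1_mk1.
have -> : f3 (ext_d (addf (scalf f Om) c) x) = fun u v w=> wd (f1 (theta f x)) (f2 (Om x)) u v w + f3 (ext_d c x) u v w.
 by apply/funext=> ?; apply/funext=> ?; apply/funext=> ?; exact: d_split.
have [F uf] := uframeP (hx x).
by rewrite Lam3_D f2_Om (Lam3_wd (hx x) uf ((sm_theta sa sf).1 x)).
Qed.

Lemma S_split f c: sfun f -> asdf c -> S (addf (scalf f Om) c) = addf (scalf f Om) (scalf (fun=> -1) c).
move=> sf ac; apply: r2_ext=> x u v; have st := asdf_star ac x u v; rewrite f2_mk2 in st.
rewrite f2_mk2; have -> : f2 (addf (scalf f Om) c x) = fun u v=> f x * f2 (Om x) u v + f2 (c x) u v by [].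
have -> : f2 (addf (scalf f Om) (scalf (fun=> -1) c) x) u v = f x * f2 (Om x) u v + -1 * f2 (c x) u v by [].
by rewrite star_D star_Z st f2_Om (star_om (hx x)) mulN1r.
Qed.

Lemma L3_opp c x u: smooth2 c -> f1 (L3 (ext_d (scalf (fun=> -1) c)) x) u = - f1 (L3 (ext_d c) x) u.
move=> sc; rewrite !f1_mk1 -[RHS]mulN1r -[RHS]Lam3_Z; congr (Lam3 _ _ _ u).
apply: funext2=> r s; apply/funext=> t.
rewrite (scal_d2 x r s t (sfun_cst (-1)) sc) /wd !df_cst; move: (f3 _ _ _ _)=> *; ring.
Qed.

Lemma L3_Ssplit f c x u: sfun f -> asdf c ->
 f1 (L3 (ext_d (S (addf (scalf f Om) c))) x) u = f1 (theta f x) u - f1 (L3 (ext_d c) x) u.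
move=> sf ac; have sc := asdf_smooth ac; rewrite (S_split sf ac) L3_split//; last first.
 exact: (sm_scal2 (sfun_cst (-1)) sc).
by rewrite L3_opp.
Qed.

Lemma closed_L3 c: smooth2 c -> closed_form c <-> forall x u, f1 (L3 (ext_d c) x) u = 0.
move=> sc; split=> [cl x u|L0].
 rewrite f1_mk1 cl; have -> : f3 (fun _: 'I_3 -> V=> 0) = fun u v w=> 0 * (fun _ _ _: V=> 0: R) u v w.
  by apply: funext2=> r s; apply/funext=> t; rewrite mul0r.
 by rewrite Lam3_Z mul0r.
apply: r3_ext=> x u v w; have [F uf] := uframeP (hx x).
rewrite -(wd_Lam3 (hx x) uf ((sm_d2 sc).1 x)) /wd.
have E t: Lam3 (J x) (g x) (f3 (ext_d c x)) t = 0 by exact: L0.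
by rewrite !E !mul0r subrr addr0.
Qed.

(** Sum and difference of the two equations of [harmP] couple each function with the anti-self-dual
    part of the other component: [R1] and [R2] are the relations that [theta_eq0] asks for, with
    constants 1 and -1. Once the twisted differentials vanish, the same relations give closedness of
    [c1] and [c2]. *)
Lemma harm_split p q: @harmonic_dbar R 4 X J g 1 1 (cpx p q) <->
 exists f1' f2' c1 c2, [/\ sfun f1', sfun f2', asd c1, asd c2 &
  [/\ forall x u, f1 (theta f1' x) u = 0, forall x u, f1 (theta f2' x) u = 0,
   p = addf (scalf f1' Om) c1 & q = addf (scalf f2' Om) c2]].
rewrite harmP; split.
 move=> [/Apq11P[sp sq jp jq] C1 C2].
 have [fa [c1 [s1 a1 Ep]]] := asd_split sp jp; have [fb [c2 [s2 a2 Eq]]] := asd_split sq jq.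
 have [sc1 sc2] := (asdf_smooth a1, asdf_smooth a2).
 have lt1 := (sm_theta sa s1).1; have lt2 := (sm_theta sa s2).1.
 have le1 := (sm_Ld sc1).1; have le2 := (sm_Ld sc2).1.
 have D1 x u: f1 (theta fa x) u + f1 (L3 (ext_d c1) x) u = f1 (theta fb x) (u *m J x) + f1 (L3 (ext_d c2) x) (u *m J x).
  by rewrite -(L3_split x u s1 sc1) -(L3_split x (u *m J x) s2 sc2) -Ep -Eq; exact: C1.
 have D2 x u: f1 (theta fa x) (u *m J x) - f1 (L3 (ext_d c1) x) (u *m J x) = f1 (theta fb x) u - f1 (L3 (ext_d c2) x) u.
  by rewrite -(L3_Ssplit x (u *m J x) s1 a1) -(L3_Ssplit x u s2 a2) -Ep -Eq; exact: C2.
 have R1 x u: f1 (theta fa x) u = 1 * f1 (L3 (ext_d c2) x) (u *m J x).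
  have := D1 x u; have := D2 x (u *m J x); rewrite (JJ (hx x)) (linN _ (lt1 x)) (linN _ (le1 x)).
  move: (f1 _ _) (f1 _ _) (f1 _ _) (f1 _ _)=> *; lra.
 have R2 x u: f1 (theta fb x) u = -1 * f1 (L3 (ext_d c1) x) (u *m J x).
  have := D1 x (u *m J x); have := D2 x u; rewrite (JJ (hx x)) (linN _ (lt2 x)) (linN _ (le2 x)).
  move: (f1 _ _) (f1 _ _) (f1 _ _) (f1 _ _)=> *; lra.
 have T1 := theta_eq0 sa da s1 sc2 (asdf_star a2) R1.
 have T2 := theta_eq0 sa da s2 sc1 (asdf_star a1) R2.
 have Z (c: rform X 2) (t: R) (lc: forall x, lin (f1 (L3 (ext_d c) x))) (f: X -> R): t != 0 ->
   (forall x u, f1 (theta f x) u = t * f1 (L3 (ext_d c) x) (u *m J x)) ->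
   (forall x u, f1 (theta f x) u = 0) -> forall x u, f1 (L3 (ext_d c) x) u = 0.
  move=> t0 H T x u; have := H x (u *m J x); rewrite T (JJ (hx x)) (linN _ (lc x)) mulrN=> /esym/eqP.
  by rewrite oppr_eq0 mulf_eq0 (negbTE t0)=> /eqP.
 have m1: (-1: R) != 0 by rewrite oppr_eq0 oner_neq0.
 have cl1 := (closed_L3 sc1).2 (Z _ _ le1 _ m1 R2 T2).
 have cl2 := (closed_L3 sc2).2 (Z _ _ le2 _ (oner_neq0 _) R1 T1).
 exists fa, fb, c1, c2; split=>//; apply/asd_hP.
  by split=>//; [exact: asdf_Lam|exact: asdf_J].
 by split=>//; [exact: asdf_Lam|exact: asdf_J].
move=> [fa [fb [c1 [c2 [s1 s2 h1 h2 [T1 T2 -> ->]]]]]].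
have /asd_hP[sc1 lc1 jc1 cl1] := h1; have /asd_hP[sc2 lc2 jc2 cl2] := h2.
have a1 := Asdf sc1 lc1 jc1; have a2 := Asdf sc2 lc2 jc2.
have L1 := (closed_L3 sc1).1 cl1; have {}L2 := (closed_L3 sc2).1 cl2.
have jO f c: Jinv c -> Jinv (addf (scalf f Om) c).
 by move=> jc x u v; rewrite /f2 /addf /scalf -!/(f2 _ _ _) Om_J jc.
have Z f c x u: sfun f -> smooth2 c -> (forall x u, f1 (theta f x) u = 0) ->
  (forall x u, f1 (L3 (ext_d c) x) u = 0) -> f1 (L3 (ext_d (addf (scalf f Om) c)) x) u = 0.
 by move=> sf sc T L; rewrite (L3_split x u sf sc) (T x u) (L x u) addr0.
have ZS f c x u: sfun f -> asdf c -> (forall x u, f1 (theta f x) u = 0) ->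
  (forall x u, f1 (L3 (ext_d c) x) u = 0) -> f1 (L3 (ext_d (S (addf (scalf f Om) c))) x) u = 0.
 by move=> sf ac T L; rewrite (L3_Ssplit x u sf ac) (T x u) (L x u) subr0.
split.
- by apply/Apq11P; split; [apply: sm_add2=>//; exact: (sm_scal2 s1 sOm)|
  apply: sm_add2=>//; exact: (sm_scal2 s2 sOm)|exact: jO|exact: jO].
- by move=> x u; exact: (etrans (Z fa c1 x u s1 sc1 T1 L1) (esym (Z fb c2 x _ s2 sc2 T2 L2))).
- by move=> x u; exact: (etrans (ZS fa c1 x _ s1 a1 T1 L1) (esym (ZS fb c2 x u s2 a2 T2 L2))).
Qed.

End Split.

Local Notation asdP := asd_hP.

(** * A priori estimates for closed anti-self-dual forms in a chart *)

Section ChartLocal.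
Variables (c: X) (r: X -> R) (K: set X).
Hypotheses (cK: compact K) (Kc: K `<=` chart_dom c) (sr: sfun r) (rK: sptd K r).
Implicit Types (x: X) (y u v: V) (F: V -> R).

(** A function of the coordinates, multiplied by the cut-off [r] and extended by 0 to the whole of
    [X]. *)
Definition glob F x := if `[< chart_dom c x >] then r x * F (chart c x) else 0.

Lemma glob_out F x: ~ K x -> glob F x = 0.
by move=> nK; rewrite /glob rK// mul0r; case: ifP. Qed.

Lemma glob_in F y: chart_im c y -> glob F (chart_inv c y) = r (chart_inv c y) * F y.
by move=> cy; rewrite /glob asboolT ?cinvK//; exact: chdomP. Qed.

Lemma sm_glob F: sm c F -> sfun (glob F).
move=> sF c' k; have oK := closed_openC (cpt_closed cK).
have oW := @cinv_open _ _ _ c' _ oK.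
apply: (@Ck_sub _ _ _ _ (olap c' c `|` (chart_im c' `&` chart_inv c' @^-1` (~` K)))).
 move=> y cy; have [Ky|nK] := pselect (K (chart_inv c' y)); [left|right]; split=>//.
 exact: Kc.
apply: Ck_setU.
 apply: (@Ck_ext _ _ _ _ (fun y=> r (chart_inv c' y) * F (trans c' c y))).
 - exact: olapO.
 - by move=> y [cy py]; rewrite /glob asboolT.
 - apply: Ck_M; first exact: olapO.
   by apply: (Ck_sub _ (sr c' k))=> y [].
  apply: (@Ck_comp _ _ _ _ _ (chart_im c) (trans c' c))=>//.
  + exact: olapO.
  + exact: im_open.
  + by move=> y [_]; exact: chimP.
  + by move=> i; exact: trans_sm.
apply: (@Ck_ext _ _ _ _ (fun=> 0))=>//; last exact: Ck_cst.
by move=> y [_ nK]; rewrite glob_out.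
Qed.

Lemma sm_pull f: sfun f -> sm c (fun y=> f (chart_inv c y)). Proof. exact. Qed.

Lemma sm_coord k: sm c (fun y=> y 0 k). Proof. by move=> m; exact: Ck_coord. Qed.

Lemma D_prod F G y v: sm c F -> sm c G -> chart_im c y ->
 'D_v (fun y=> F y * G y) y = F y * 'D_v G y + G y * 'D_v F y.
by move=> sF sG cy; apply: deriveM; exact: sm_dvb. Qed.

Definition dcoord k: rform X 1 :=
 addf (scalf r (df (glob (fun y=> y 0 k)))) (scalf (fun x=> - glob (fun y=> y 0 k) x) (df r)).

Lemma sm_dcoord k: smooth1 (dcoord k).
have sX := sm_glob (sm_coord k).
by apply: sm_add1; apply: sm_scal1=>//; first [exact: sm_df|exact: sfunN].
Qed.

Lemma f1_dcoord k x u: f1 (dcoord k x) u = r x * f1 (df (glob (fun y=> y 0 k)) x) u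
 + - glob (fun y=> y 0 k) x * f1 (df r x) u.
by []. Qed.

(* [r d(r y_k) - (r y_k) dr = r^2 dy_k], which extends [dy_k] to a global form up to a weight *)
Lemma l1_dcoord k y v: chart_im c y -> l1 (dcoord k) c y v = r (chart_inv c y) ^+ 2 * v 0 k.
move=> cy; have sX := sm_glob (sm_coord k).
have E1: l1 (df (glob (fun y=> y 0 k))) c y v =
  r (chart_inv c y) * v 0 k + y 0 k * 'D_v (fun y=> r (chart_inv c y)) y.
 rewrite l1_df//; have [_ Dk] := der_rV k y v.
 rewrite -Dk -(D_prod _ (sm_pull sr) (sm_coord k) cy); apply: near_eq_derive.
 by apply: (nearO (im_open (c:=c)) cy)=> z cz; rewrite glob_in.
have E2 := l1_df v sr cy.
rewrite l1E f1_dcoord -!l1E E1 E2 glob_in//.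
by move: ('D_v _ y)=> d; ring.
Qed.

Section Contraction.
Variables (b: rform X 2) (i: 'I_4).
Hypothesis sb: smooth2 b.

Definition gam u v y := l2 b c y u v.
(** The cube arises because [iota] multiplies a coefficient cut off by [r] with the form
    [r ^ 2 dy_k]. *)
Definition q y := r (chart_inv c y) ^+ 3.

Lemma sm_gam u v: sm c (gam u v). Proof. exact: sb.2. Qed.
Lemma sm_q: sm c q.
have s2 := sfunM sr (sfunM sr sr).
apply: sm_ext (sm_pull s2)=> y cy; rewrite /q; ring.
Qed.

(** The contraction of [b] with [q] times the [i]-th coordinate field, as a global 1-form. *)
Definition iota: rform X 1 := fun x s=> \sum_k glob (gam (e i) (e k)) x * dcoord k x s.

Lemma sm_iota: smooth1 iota.
have s1 k: smooth1 (scalf (glob (gam (e i) (e k))) (dcoord k)).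
 by apply: sm_scal1; [exact/sm_glob/sm_gam|exact: sm_dcoord].
split=> [x t u w|d u m].
 have E v: f1 (iota x) v = \sum_k f1 (scalf (glob (gam (e i) (e k))) (dcoord k) x) v by [].
 by rewrite !E mulr_sumr -big_split; apply: eq_bigr=> k _; exact: (s1 k).1.
by apply: (@sm_sum _ _ _ _ _ _ _ (fun k y=> l1 (scalf (glob (gam (e i) (e k))) (dcoord k)) d y u))=> k _; exact: (s1 k).2.
Qed.

Lemma l1_iota y v: chart_im c y -> l1 iota c y v = q y * gam (e i) v y.
move=> cy; have lg := (l2_alt cy (sb.1 _)); have [_ l _] := lg.
rewrite /gam (lin_exp v (l (e i))) mulr_sumr.
transitivity (\sum_k glob (gam (e i) (e k)) (chart_inv c y) * l1 (dcoord k) c y v); first by [].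
apply: eq_bigr=> k _; rewrite glob_in// l1_dcoord// /q /gam; move: (l2 _ _ _ _ _)=> t; ring.
Qed.

Lemma f1_iota_out x: ~ K x -> f1 (iota x) = fun=> 0.
move=> nK; apply/funext=> u; transitivity (\sum_(k < 4) glob (gam (e i) (e k)) x * f1 (dcoord k x) u); first by [].
by rewrite big1// => k _; rewrite glob_out// mul0r.
Qed.

Hypothesis db: closed_form b.

Lemma closed_gam u v w y: chart_im c y ->
 'D_u (gam v w) y - 'D_v (gam u w) y + 'D_w (gam u v) y = 0.
move=> cy; rewrite -(natural_d2 cy u v w sb) db l3E //.
Qed.

(** Cartan's formula: as [b] is closed, this is its Lie derivative along the cut-off field. *)
Lemma l2_d_iota y u v: chart_im c y -> l2 (ext_d iota) c y u v =
 q y * 'D_(e i) (gam u v) y + 'D_u q y * gam (e i) v y - 'D_v q y * gam (e i) u y.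
move=> cy; have D u' w: 'D_u' (fun y=> l1 iota c y w) y = q y * 'D_u' (gam (e i) w) y + gam (e i) w y * 'D_u' q y.
 rewrite -(D_prod _ sm_q (sm_gam _ _) cy); apply: near_eq_derive.
 by apply: (nearO (im_open (c:=c)) cy)=> z cz; exact: l1_iota.
rewrite (natural_d1 cy u v sm_iota).
have key (A B C p P Q a a' d d': R): P = p * A + a * d -> Q = p * B + a' * d' -> C - A + B = 0 ->
  P - Q = p * C + d * a - d' * a'.
 move=> -> -> E; have -> : C = A - B by move/eqP: E; rewrite addr_eq0 subr_eq=> /eqP ->; ring.
 ring.
have E := closed_gam (e i) u v cy.
exact: key (D u v) (D v u) E.
Qed.

Lemma closed_d_iota: closed_form (ext_d iota).
have sz := sm_iota; apply: r3_ext=> x u v w; rewrite ext_d2.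
have cx := im_self x.
have E t a a': 'D_t (fun y=> l2 (ext_d iota) x y a a') (chart x x) =
  'D_t ('D_a (fun y=> l1 iota x y a')) (chart x x) - 'D_t ('D_a' (fun y=> l1 iota x y a)) (chart x x).
 have d1 := sm_dvb (v:=t) (sm_der a (sz.2 x a')) cx.
 have d2 := sm_dvb (v:=t) (sm_der a' (sz.2 x a)) cx.
 rewrite -(deriveB d1 d2); apply: near_eq_derive.
 by apply: (nearO (im_open (c:=x)) cx)=> y cy; exact: (natural_d1 cy a a' sz).
have S a t t' := Schwarz t t' (im_open (c:=x)) (sz.2 x a 2%N) cx.
have key (P Q T a a' b' d0 d d': R): P = a - d0 -> Q = a' - d -> T = b' - d' -> a = a' -> d0 = b' -> d = d' ->
 P - Q + T = 0 by move=> -> -> -> -> -> ->; ring.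
exact: key (E u v w) (E v u w) (E w u v) (S w u v) (S v u w) (S u v w).
Qed.

End Contraction.

(** Expressions of order zero in [b]: bounded on [K] by the coefficients of [b] without derivatives,
    with a constant common to all [b]. *)
Definition ordz (E: rform X 2 -> V -> R) := exists2 C, 0 <= C & forall b, asd b ->
 forall y, chart_im c y -> K (chart_inv c y) ->
 `|E b y| <= C * \sum_i \sum_j `|l2 b c y (e i) (e j)|.

Lemma sm_bdd F: sm c F -> exists2 M, 0 <= M & forall y, chart_im c y -> K (chart_inv c y) -> `|F y| <= M.
move=> sF; have cI := cimg_cpt cK Kc.
have [|M M0 HM] := cpt_bd (F:=F) cI.
 by move=> _ [x Kx <-]; apply: (Ck_cont (sF 0%N)); apply: chimP; exact: Kc.
exists M; first exact: ltW.
by move=> y cy Ky; apply: HM; exists (chart_inv c y)=>//; exact: cinvK.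
Qed.

Lemma ordz_ext E E': ordz E -> (forall b y, asd b -> chart_im c y -> K (chart_inv c y) -> E b y = E' b y) ->
 ordz E'.
by move=> [C C0 HC] EE; exists C=>// b hb y cy Ky; rewrite -EE//; exact: HC. Qed.

Lemma ordz_D E E': ordz E -> ordz E' -> ordz (fun b y=> E b y + E' b y).
move=> [C C0 HC] [C' C'0 HC']; exists (C + C')=> [|b hb y cy Ky]; first exact: addr_ge0.
rewrite mulrDl; apply: le_trans (ler_normD _ _) (lerD _ _); [exact: HC|exact: HC'].
Qed.

Lemma ordz_M F E: sm c F -> ordz E -> ordz (fun b y=> F y * E b y).
move=> /sm_bdd[M M0 HM] [C C0 HC]; exists (M * C)=> [|b hb y cy Ky]; first exact: mulr_ge0.
by rewrite normrM -mulrA; apply: ler_pM=>//; [exact: HM|exact: HC].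
Qed.

Lemma ordz_sum (I: Type) (s: seq I) (E: I -> rform X 2 -> V -> R): (forall i, ordz (E i)) ->
 ordz (fun b y=> \sum_(i <- s) E i b y).
move=> oE; elim: s=> [|i s IH].
 exists 0=>// b _ y _ _; rewrite big_nil normr0 mul0r//.
apply: ordz_ext (ordz_D (oE i) IH) _=> b y _ _ _; by rewrite big_cons.
Qed.

Lemma le_sum2 (F: 'I_4 -> 'I_4 -> R) j k: (forall a a', 0 <= F a a') -> F j k <= \sum_a \sum_a' F a a'.
move=> F0; rewrite (bigD1 j)//= (bigD1 k)//= -addrA lerDl addr_ge0//; apply: sumr_ge0=> a _ //.
exact: sumr_ge0.
Qed.

Lemma ordz_gam j k: ordz (fun b y=> l2 b c y (e j) (e k)).
exists 1=>// b _ y _ _; rewrite mul1r.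
exact: (@le_sum2 (fun a a'=> `|l2 b c y (e a) (e a')|) j k).
Qed.

(** The coefficients of the star in the chart, read off on the elementary bilinear forms; these are
    not alternating, hence [bil] rather than [alt2] in [starcE]. *)
Definition starc a a' j k y: R := star (Jc c y) (Gc c y) (fun u v=> u 0 a * v 0 a') (e j) (e k).

Lemma starcE (b: V -> V -> R) j k y: bil b ->
 star (Jc c y) (Gc c y) b (e j) (e k) = \sum_a \sum_a' starc a a' j k y * b (e a) (e a').
move=> bb; have -> : b = fun u v=> \sum_a \sum_a' b (e a) (e a') * (u 0 a * v 0 a').
 apply: funext2=> u v; rewrite (bil_exp u v bb).
 by apply: eq_bigr=> a _; apply: eq_bigr=> a' _; rewrite mulrC.
have S1 (I: Type) (s: seq I) (F: I -> V -> V -> R):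
  star (Jc c y) (Gc c y) (fun u v=> \sum_(i <- s) F i u v) (e j) (e k) =
  \sum_(i <- s) star (Jc c y) (Gc c y) (F i) (e j) (e k).
 elim: s=> [|i s IH].
  have -> : (fun u v: V=> \sum_(i <- [::]) F i u v) = fun u v=> 0 * (fun _ _: V=> 0: R) u v.
   by apply: funext2=> u v; rewrite big_nil mul0r.
  by rewrite star_Z mul0r big_nil.
 rewrite big_cons -IH -star_D; congr star.
 by apply: funext2=> u v; rewrite big_cons.
rewrite S1; apply: eq_bigr=> a _; rewrite S1; apply: eq_bigr=> a' _.
rewrite star_Z mulrC; congr (_ * _).
rewrite (bigD1 a)//= (bigD1 a')//= !mxE !eqxx !mulr1 !big1 ?addr0//.
 by move=> i /negPf ia; rewrite big1// => j' _; rewrite !mxE ia mul0r mulr0.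
by move=> i /negPf ia; rewrite !mxE ia !mulr0.
Qed.

Lemma sm_starc a a' j k: sm c (starc a a' j k).
rewrite /starc /star; apply: sm_B.
 apply: sm_M.
  apply: sm_M; first exact: sm_cst.
  apply: (@sm_tr2 c (fun y u v=> u 0 a * (v *m Jc c y) 0 a'))=> i i'.
  apply: sm_M; first exact: sm_cst.
  exact: sm_rowJ.
 rewrite /om /met; apply: sm_mulmx=> m m'.
  apply: sm_mulmx=> [m1 m2|]; last by move=> ? ?; exact: sm_Gc.
  by rewrite ord1; exact: sm_rowJ.
 exact: sm_cst.
by apply: sm_M; exact: sm_rowJ.
Qed.

Local Notation rho := (fun y=> r (chart_inv c y)).

Lemma der_q v y: chart_im c y -> 'D_v q y = r (chart_inv c y) ^+ 2 * (3 * 'D_v rho y).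
move=> cy; have s1 := sm_pull sr; have s2 := sm_M s1 s1.
rewrite (_: q = fun y=> rho y * (rho y * rho y)); last by apply/funext=> z; rewrite /q; ring.
rewrite (D_prod _ s1 s2 cy) (D_prod _ s1 s1 cy); move: ('D_v _ y)=> d; ring.
Qed.

Section Errors.
Variables i j k: 'I_4.
Local Notation be b := (ext_d (iota b i)).

Definition dq_gam a a' (b: rform X 2) y := 'D_(e a) q y * l2 b c y (e i) (e a') - 'D_(e a') q y * l2 b c y (e i) (e a).

Lemma ordz_dq_gam a a': ordz (dq_gam a a').
have o1 m m': ordz (fun b y=> 'D_(e m) q y * l2 b c y (e i) (e m')).
 by apply: ordz_M (ordz_gam _ _); apply: sm_der; exact: sm_q.
have o2 := ordz_D (o1 a a') (ordz_M (sm_cst c (-1)) (o1 a' a)).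
by apply: ordz_ext o2 _=> b y _ _ _; rewrite mulN1r.
Qed.

Lemma asd_gam b y: asd b -> chart_im c y ->
 \sum_a \sum_a' starc a a' j k y * l2 b c y (e a) (e a') = - l2 b c y (e j) (e k).
move=> hb cy; have [sb lb jb _] := (iffLR (asd_hP b)) hb.
have ab := l2_alt cy (sb.1 _).
rewrite -starcE; last exact: alt2_bil.
rewrite -(l2_Sform sb cy) !l2E.
by have st := asdf_star (Asdf sb lb jb); exact: st.
Qed.

(** Differentiating the equation in [asd_gam] shows that derivatives of [b] are anti-self-dual up to
    terms in which the derivative falls on the coefficients of the star. *)
Lemma der_asd_gam b y v: asd b -> chart_im c y ->
 \sum_a \sum_a' starc a a' j k y * 'D_v (gam b (e a) (e a')) y =
 - 'D_v (gam b (e j) (e k)) y - \sum_a \sum_a' 'D_v (starc a a' j k) y * l2 b c y (e a) (e a').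
move=> hb cy; have [sb _ _ _] := (iffLR (asd_hP b)) hb.
pose T a a' := fun y=> starc a a' j k y * gam b (e a) (e a') y.
have sT a a': sm c (T a a') by apply: sm_M; [exact: sm_starc|exact: sm_gam].
have dT a a': derivable (T a a') y v := sm_dvb (sT a a') cy.
have [_ D1] := der_sums (index_enum 'I_4) (P:=xpredT) (f:=fun a y=> \sum_a' T a a' y) (y:=y) (v:=v) (fun a _ =>
 (der_sums (index_enum 'I_4) (P:=xpredT) (fun a' _=> dT a a')).1).
have D2: 'D_v (fun y=> \sum_a \sum_a' T a a' y) y = - 'D_v (gam b (e j) (e k)) y.
 rewrite -(deriveN (sm_dvb (sm_gam sb (e j) (e k)) cy)); apply: near_eq_derive.
 by apply: (nearO (im_open (c:=c)) cy)=> z cz; exact: asd_gam.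
rewrite -D2 D1 -sumrB; apply: eq_bigr=> a _.
have [_ ->] := der_sums (index_enum 'I_4) (P:=xpredT) (fun a' _=> dT a a').
rewrite -sumrB; apply: eq_bigr=> a' _.
have E := D_prod v (sm_starc a a' j k) (sm_gam sb (e a) (e a')) cy.
have key (A B C D F: R): A = B * C + D * F -> B * C = A - F * D by move=> ->; ring.
exact: key E.
Qed.

(** Up to order zero, the Lie derivative is [q] times a derivative of [b], and such a derivative is
    anti-self-dual up to order zero. *)
Lemma ordz_err: ordz (fun b y=> l2 (addf (S (be b)) (be b)) c y (e j) (e k)).
have o1 a a': ordz (fun b y=> starc a a' j k y * dq_gam a a' b y).
 by apply: ordz_M (ordz_dq_gam _ _); exact: sm_starc.
have o2 a a': ordz (fun b y=> - q y * 'D_(e i) (starc a a' j k) y * l2 b c y (e a) (e a')).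
 apply: ordz_M (ordz_gam _ _); apply: sm_M; first by apply: sm_N; exact: sm_q.
 by apply: sm_der; exact: sm_starc.
have o3 := ordz_D (ordz_sum (index_enum 'I_4) (fun a=> ordz_sum (index_enum 'I_4) (fun a'=> ordz_D (o1 a a') (o2 a a'))))
 (ordz_dq_gam j k).
apply: ordz_ext o3 _=> b y hb cy _; have [sb _ _ db] := (iffLR (asd_hP b)) hb.
have sz := sm_iota i sb; have sB := sm_d1 sz; have aB := l2_alt cy (sB.1 _).
have LB a a': l2 (be b) c y (e a) (e a') = q y * 'D_(e i) (gam b (e a) (e a')) y + dq_gam a a' b y.
 by rewrite (l2_d_iota i sb db _ _ cy) -addrA.
have -> : l2 (addf (S (be b)) (be b)) c y (e j) (e k) = l2 (S (be b)) c y (e j) (e k) + l2 (be b) c y (e j) (e k).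
 by rewrite !l2E.
rewrite (l2_Sform sB cy) starcE; last exact: alt2_bil.
rewrite LB; under [in RHS]eq_bigr=> a _ do under eq_bigr=> a' _ do rewrite LB mulrDr mulrCA.
have spl (F G: 'I_4 -> 'I_4 -> R): \sum_a \sum_a' (F a a' + G a a') = \sum_a \sum_a' F a a' + \sum_a \sum_a' G a a'.
 by rewrite -big_split; apply: eq_bigr=> a _; rewrite -big_split.
have scl (t: R) (F: 'I_4 -> 'I_4 -> R): \sum_a \sum_a' t * F a a' = t * \sum_a \sum_a' F a a'.
 by rewrite mulr_sumr; apply: eq_bigr=> a _; rewrite mulr_sumr.
rewrite (spl _ (fun a a'=> starc a a' j k y * dq_gam a a' b y)) (scl (q y)) (der_asd_gam (e i) hb cy).
rewrite (spl (fun a a'=> starc a a' j k y * dq_gam a a' b y)).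
have -> : \sum_a \sum_a' (- q y * 'D_(e i) (starc a a' j k) y * l2 b c y (e a) (e a')) =
  - q y * \sum_a \sum_a' 'D_(e i) (starc a a' j k) y * l2 b c y (e a) (e a').
 by rewrite -scl; apply: eq_bigr=> a _; apply: eq_bigr=> a' _; rewrite mulrA.
move: (\sum_a \sum_a' starc a a' j k y * dq_gam a a' b y) (dq_gam j k b y) (\sum_a \sum_a' _) ('D_(e i) _ y)=> A B C D.
ring.
Qed.

(** What the derivative of [q b] contains besides the Lie derivative, with the factor [r ^ 2] taken
    out; this factor later confines the estimate to [K]. *)
Definition dh_err (b: rform X 2) y := 3 * 'D_(e i) rho y * l2 b c y (e j) (e k)
 + (-3 * 'D_(e j) rho y * l2 b c y (e i) (e k) + 3 * 'D_(e k) rho y * l2 b c y (e i) (e j)).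

Lemma ordz_dh_err: ordz dh_err.
have o (t: R) m m1 m2: ordz (fun b y=> t * 'D_(e m) rho y * l2 b c y (e m1) (e m2)).
 by apply: ordz_M (ordz_gam _ _); apply: sm_M; [exact: sm_cst|apply: sm_der; exact: sm_pull].
by apply: ordz_D (o _ _ _ _) (ordz_D (o _ _ _ _) (o _ _ _ _)).
Qed.

Lemma der_qgam b y: smooth2 b -> closed_form b -> chart_im c y ->
 'D_(e i) (fun y=> q y * gam b (e j) (e k) y) y =
 l2 (be b) c y (e j) (e k) + r (chart_inv c y) ^+ 2 * dh_err b y.
move=> sb db cy; rewrite (D_prod _ sm_q (sm_gam sb _ _) cy) (l2_d_iota i sb db _ _ cy) !der_q// /dh_err /gam.
move: ('D_(e i) rho y) ('D_(e j) rho y) ('D_(e k) rho y) ('D_(e i) _ y) (l2 b c y (e i) (e j)) (l2 b c y (e i) (e k)) (l2 b c y (e j) (e k))=> a1 a2 a3 a4 a5 a6 a7.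
ring.
Qed.

End Errors.

Definition nrm (b: V -> V -> R): R := \sum_i \sum_j `|b (e i) (e j)|.

Lemma nrm_ge0 b: 0 <= nrm b.
by apply: sumr_ge0=> i _; exact: sumr_ge0. Qed.

Lemma ordz_nrm (E: 'I_4 -> 'I_4 -> rform X 2 -> V -> R): (forall j k, ordz (E j k)) ->
 exists2 C, 0 <= C & forall b, asd b -> forall y, chart_im c y -> K (chart_inv c y) ->
 \sum_j \sum_k `|E j k b y| <= C * nrm (l2 b c y).
move=> oE; have oA j k: ordz (fun b y=> `|E j k b y|).
 by have [C C0 HC] := oE j k; exists C=>// b hb y cy Ky; rewrite normr_id; exact: HC.
have [C C0 HC] := ordz_sum (index_enum 'I_4) (fun j=> ordz_sum (index_enum 'I_4) (oA j)).
by exists C=>// b hb y cy Ky; apply: (le_trans (ler_norm _)); exact: HC.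
Qed.

Lemma sm_bdd_fam (I: finType) (F: I -> V -> R): (forall i, sm c (F i)) ->
 exists2 M, 0 <= M & forall i y, chart_im c y -> K (chart_inv c y) -> `|F i y| <= M.
move=> sF; have /choice[M HM] : forall i, exists M, 0 <= M /\ forall y, chart_im c y -> K (chart_inv c y) -> `|F i y| <= M.
 by move=> i; have [M M0 H] := sm_bdd (sF i); exists M.
exists (\sum_i M i); first by apply: sumr_ge0=> i _; case: (HM i).
move=> i y cy Ky; apply: (le_trans ((HM i).2 y cy Ky)).
by rewrite (bigD1 i)//= lerDl; apply: sumr_ge0=> i' _; case: (HM i').
Qed.

Lemma I2_nrm: exists2 C, 0 <= C & forall b y, chart_im c y -> K (chart_inv c y) -> I2 (Gc c y) b b <= C * nrm b ^+ 2.
have [M M0 HM] := sm_bdd_fam (F:=fun (p: 'I_4 * 'I_4) y=> invmx (Gc c y) p.1 p.2) (fun p=> sm_invGc c p.1 p.2).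
exists (M * M)=> [|b y cy Ky]; first exact: mulr_ge0.
have I i j: `|invmx (Gc c y) i j| <= M := HM (i, j) y cy Ky.
have le1: \sum_(i < 4) \sum_(j < 4) \sum_(k < 4) \sum_(l < 4)
 (invmx (Gc c y) i k * invmx (Gc c y) j l * b (e i) (e j) * b (e k) (e l)) <= M * M * nrm b ^+ 2.
 rewrite expr2 /nrm mulr_suml mulr_sumr; apply: ler_sum=> i _.
 rewrite mulr_suml mulr_sumr; apply: ler_sum=> j _.
 rewrite mulr_sumr mulr_sumr; apply: ler_sum=> k _.
 rewrite mulr_sumr mulr_sumr; apply: ler_sum=> l _.
 apply: (le_trans (ler_norm _)); rewrite !normrM -!mulrA.
 have key (x z t: R): 0 <= x -> 0 <= z -> 0 <= t -> x <= M -> z <= M -> x * (z * t) <= M * (M * t).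
  by move=> x0 z0 t0 xM zM; apply: ler_pM=>//; [exact: mulr_ge0|exact: ler_wpM2r].
 by apply: key=>//; exact: mulr_ge0.
have le0: 0 <= M * M * nrm b ^+ 2 by rewrite mulr_ge0 ?sqr_ge0// mulr_ge0.
rewrite /I2; move: (\sum_(i < 4) _) (M * M * _) le1 le0=> A B; lra.
Qed.

(** The wedge of the metric duals of [u] and [v] represents evaluation at [u] and [v];
    Cauchy-Schwarz then bounds coefficients by the norm. *)
Lemma I2_dual (G F: 'M[R]_4) JG b u v: herm JG G -> uframe JG G F -> alt2 b ->
 I2 G b (wd1 (met G u) (met G v)) = b u v.
move=> h uf ab; have [ml mr] := met_bil G; have [l1' l2' d] := ab.
rewrite (I2_frame uf ab (wd1_alt2 (mr u) (mr v))) /wd1.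
rewrite [in RHS](frame_exp uf u) [in RHS](frame_exp uf v).
rewrite !(linD _ _ (l1' _)) !(linZ _ _ (l1' _)) !(linD _ _ (l2' _)) !(linZ _ _ (l2' _)) !d.
rewrite (alt2C (row o1 F) (row o0 F) ab) (alt2C (row o2 F) (row o0 F) ab) (alt2C (row o3 F) (row o0 F) ab)
 (alt2C (row o2 F) (row o1 F) ab) (alt2C (row o3 F) (row o1 F) ab) (alt2C (row o3 F) (row o2 F) ab).
ring.
Qed.

(** Each of the 16 coefficients is at most the root of [(M + 1) * I2], whence the constant
    [256 = 16 ^ 2]. *)
Lemma nrm_I2: exists2 C, 0 <= C & forall b y, alt2 b -> chart_im c y -> K (chart_inv c y) -> nrm b ^+ 2 <= C * I2 (Gc c y) b b.
pose A (p: 'I_4 * 'I_4) y := wd1 (met (Gc c y) (e p.1)) (met (Gc c y) (e p.2)).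
have sA p i j: sm c (fun y=> A p y (e i) (e j)).
 have sm_met u v: sm c (fun y=> met (Gc c y) u v).
  apply: sm_mulmx=> [m m'|m m']; last exact: sm_cst.
  by apply: sm_mulmx=> [m1 m2|? ?]; [exact: sm_cst|exact: sm_Gc].
 by apply: sm_B; apply: sm_M.
have sI p: sm c (fun y=> I2 (Gc c y) (A p y) (A p y)).
 under eq_fun do rewrite I2_tr2.
 apply: sm_M; first exact: sm_cst.
 apply: (@sm_tr2 c (fun y u v=> tr2 (Gc c y) (fun u' v'=> A p y u u' * A p y v v')))=> i j.
 apply: (@sm_tr2 c (fun y u' v'=> A p y (e i) u' * A p y (e j) v'))=> i' j'.
 exact: sm_M.
have [M M0 HM] := sm_bdd_fam sI; exists (256 * (M + 1))=> [|b y ab cy Ky].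
 by apply: mulr_ge0; [exact: ler0n|exact: addr_ge0].
have h := hc cy; have [F uf] := uframeP h; have [ml mr] := met_bil (Gc c y).
have I0 := I2_ge0 h ab.
have ent i j: `|b (e i) (e j)| <= Num.sqrt ((M + 1) * I2 (Gc c y) b b).
 have aA: alt2 (A (i, j) y) by exact: wd1_alt2.
 have E: I2 (Gc c y) b (A (i, j) y) = b (e i) (e j) := I2_dual _ _ h uf ab.
 have AM := le_trans (ler_norm _) (HM (i, j) y cy Ky).
 (* The minimizing multiple in the proof of Cauchy-Schwarz, with [M + 1] in place of the squared
    norm of [A]; the summand 1 keeps it positive. *)
 pose s: R := b (e i) (e j) / (M + 1).
 have asb: alt2 (fun u v=> b u v + - s * A (i, j) y u v) by apply: alt2_add=>//; exact: alt2_scale.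
 have := I2_ge0 h asb; rewrite !I2_Dl !I2_Dr !I2_Zl !I2_Zr (I2_sym h aA ab) E.
 have M1: 0 < M + 1 by exact: ltr_wpDl.
 have P0: 0 <= (M + 1) * I2 (Gc c y) b b by apply: mulr_ge0=>//; exact: ltW.
 rewrite -sqrtr_sqr ler_sqrt// /s.
 have key (N a t U: R): 0 < N -> t <= N -> 0 <= U + - (a / N) * a + (- (a / N) * a + - (a / N) * (- (a / N) * t)) -> a ^+ 2 <= N * U.
  move=> N0 tN H; have {H} H: 0 <= N * (U + - (a / N) * a + (- (a / N) * a + - (a / N) * (- (a / N) * t))) by rewrite mulr_ge0// ltW.
  have E1: N * (U + - (a / N) * a + (- (a / N) * a + - (a / N) * (- (a / N) * t))) = N * U - 2 * a ^+ 2 + a ^+ 2 * (t / N).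
   by field; rewrite gt_eqF.
  have tN1: t / N <= 1 by rewrite ler_pdivrMr// mul1r.
  have := ler_wpM2l (sqr_ge0 a) tN1; rewrite E1 in H; move: (t / N) H=> w; lra.
 by apply: key=>//; apply: (le_trans AM); rewrite lerDl.
have s0 := sqrtr_ge0 ((M + 1) * I2 (Gc c y) b b).
have le1: nrm b <= 16 * Num.sqrt ((M + 1) * I2 (Gc c y) b b).
 rewrite /nrm !sum4; have := ent; move: (Num.sqrt _)=> t H.
 have H4 i: `|b (e i) (e o0)| + `|b (e i) (e o1)| + `|b (e i) (e o2)| + `|b (e i) (e o3)| <= 4 * t.
  by have := H i o0; have := H i o1; have := H i o2; have := H i o3; lra.
 have -> : 16 * t = 4 * t + 4 * t + 4 * t + 4 * t by ring.
 by do 3 (apply: lerD=>//).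
apply: (@le_trans _ _ ((16 * Num.sqrt ((M + 1) * I2 (Gc c y) b b)) ^+ 2)).
 by rewrite ler_pXn2r// nnegrE ?nrm_ge0 ?mulr_ge0.
have P0: 0 <= (M + 1) * I2 (Gc c y) b b by apply: mulr_ge0=>//; exact: addr_ge0.
have key (t U: R): t ^+ 2 = (M + 1) * U -> (16 * t) ^+ 2 <= 256 * (M + 1) * U by move=> E; rewrite -mulrA -E; lra.
exact: key (sqr_sqrtr P0).
Qed.

Local Notation be i b := (ext_d (iota b i)).

Lemma asd_sm b: asd b -> smooth2 b.
by move=> /(iffLR (asd_hP b))[]. Qed.

Lemma asd_closed b: asd b -> closed_form b.
by move=> /(iffLR (asd_hP b))[]. Qed.

Lemma sm_be i b: asd b -> smooth2 (be i b).
by move=> hb; apply: sm_d1; apply: sm_iota; exact: asd_sm. Qed.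

Lemma be_out i b x: ~ K x -> f2 (be i b x) = fun _ _=> 0.
by apply: (ext_d1_sptd cK)=> z; exact: f1_iota_out. Qed.

(** Twice the self-dual part of the exact form [be i b]. *)
Definition err i b := addf (S (be i b)) (be i b).

Lemma sm_err i b: asd b -> smooth2 (err i b).
by move=> hb; have sB := sm_be i hb; apply: sm_add2=>//; exact: sm_S. Qed.

Lemma f2_err i b x u v: f2 (err i b x) u v = star (J x) (g x) (f2 (be i b x)) u v + f2 (be i b x) u v.
by rewrite -[star _ _ _ u v]/(mk2 (star (J x) (g x) (f2 (be i b x))) (vs [:: u; v])). Qed.

Lemma err_out i b x: ~ K x -> f2 (err i b x) = fun _ _=> 0.
move=> nK; apply: funext2=> u v; rewrite f2_err be_out//.
rewrite (_: (fun _ _: V=> 0: R) = fun u v=> 0 * (fun _ _: V=> 0) u v) ?star_Z ?mul0r ?addr0//.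
Qed.

Lemma I2_zero (G: 'M[R]_4): I2 G (fun _ _=> 0) (fun _ _=> 0) = 0.
rewrite (_: (fun _ _: V=> 0: R) = fun u v=> 0 * (fun _ _: V=> 0) u v) ?I2_Zl ?mul0r//.
Qed.

Lemma I2fun_ge0 b x: smooth2 b -> 0 <= I2fun b b x.
by move=> sb; exact: (I2_ge0 (hx x) (sb.1 x)). Qed.

Lemma chart_ofK x: K x -> exists y, [/\ chart_im c y, K (chart_inv c y) & x = chart_inv c y].
by move=> Kx; exists (chart c x); rewrite chartK; [split=>//; exact/chimP/Kc|exact: Kc].
Qed.

Lemma I2_err i: exists2 C, 0 <= C & forall b, asd b -> forall x, I2fun (err i b) (err i b) x <= C * I2fun b b x.
have [C C0 HC] := ordz_nrm (fun j k=> ordz_err i j k).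
have [C1 C10 H1] := I2_nrm; have [C2 C20 H2] := nrm_I2.
exists (C1 * (C ^+ 2 * C2))=> [|b hb x]; first by rewrite !mulr_ge0 ?sqr_ge0.
have sb := asd_sm hb; have sE := sm_err i hb.
have [Kx|nK] := pselect (K x); last first.
 rewrite {1}/I2fun err_out// I2_zero mulr_ge0 ?I2fun_ge0// !mulr_ge0 ?sqr_ge0//.
have [y [cy Ky ->]] := chart_ofK Kx; rewrite !(I2funE)//.
have h1 := H1 (l2 (err i b) c y) y cy Ky; have h2 := H2 _ y (l2_alt cy (sb.1 _)) cy Ky.
apply: (le_trans h1); rewrite -mulrA ler_wpM2l//.
have h3: nrm (l2 (err i b) c y) <= C * nrm (l2 b c y) := HC b hb y cy Ky.
have {}h3: nrm (l2 (err i b) c y) ^+ 2 <= (C * nrm (l2 b c y)) ^+ 2.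
 by rewrite ler_pXn2r// nnegrE ?mulr_ge0 ?nrm_ge0.
by apply: (le_trans h3); rewrite exprMn -mulrA ler_wpM2l ?sqr_ge0.
Qed.

(** An exact form is orthogonal to its star, so its squared norm equals its product with [err].
    Young's inequality then bounds it by the squared norm of [err], which has order zero. *)
Lemma int_be i: exists2 C, 0 <= C & forall b, asd b ->
 intg (I2fun (be i b) (be i b)) <= C * intg (I2fun b b).
have [C C0 HC] := I2_err i; exists C=>// b hb.
have sb := asd_sm hb; have sB := sm_be i hb; have sE := sm_err i hb.
have sz := sm_iota i sb; have sS := sm_S sB.
have cBB := cI2 sB sB; have cEE := cI2 sE sE; have cBE := cI2 sB sE.
have cBS := cI2 sB sS; have cbb := cI2 sb sb.
have St: intg (I2fun (be i b) (S (be i b))) = 0.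
 rewrite (stokes sz sB).
 rewrite (_: Nfun _ _ = fun=> 0) ?(ivol0 cptX isT dens)//; apply/funext=> x.
 have cl := closed_d_iota i sb.
 have E := iffLR (closed_L3 sB) cl x.
 have key (Z: rform X 1): (forall u, f1 (Z x) u = 0) -> f1 (J1form Z x) = fun v=> 0 * (fun _: V=> 0) v.
  by move=> Z0; apply/funext=> v; rewrite mul0r; exact: Z0.
 by rewrite /Nfun (key _ E) N_Zr mul0r.
have eq1: intg (I2fun (be i b) (err i b)) = intg (I2fun (be i b) (be i b)).
 rewrite -[RHS]add0r -St -(ivD cBS cBB); congr integral_vol; apply/funext=> x.
 by rewrite /I2fun -I2_Dr.
have c1: continuous (fun x=> 2^-1 * I2fun (be i b) (be i b) x) := contfZ (c:=2^-1) cBB.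
have c2: continuous (fun x=> 2^-1 * I2fun (err i b) (err i b) x) := contfZ (c:=2^-1) cEE.
have c12: continuous (fun x=> 2^-1 * I2fun (be i b) (be i b) x + 2^-1 * I2fun (err i b) (err i b) x).
 by move=> x; exact: (cont_atD (c1 x) (c2 x)).
have pt x: I2fun (be i b) (err i b) x <= 2^-1 * I2fun (be i b) (be i b) x + 2^-1 * I2fun (err i b) (err i b) x.
 exact: young_half (I2_young x (-1) (sB.1 x) (sE.1 x)).
have le1 := intg_le cBE c12 pt.
have le2 := intg_le cEE (contfZ (c:=C) cbb) (HC b hb).
rewrite (ivD c1 c2) (ivZ _ cBB) (ivZ _ cEE) eq1 in le1; rewrite (ivZ _ cbb) in le2.
exact: half_le le1 le2.
Qed.

(** The coefficient functions to which the Rellich estimate is applied. *)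
Definition hf b j k := zext c (fun y=> q y * gam b (e j) (e k) y).

Lemma q_out y: ~ K (chart_inv c y) -> q y = 0.
by move=> nK; rewrite /q rK// expr0n. Qed.

Lemma hf_Ck: exists2 L, 0 < L & forall b j k, asd b -> (forall m, Ck m setT (hf b j k)) /\ supp L (hf b j k).
have [L L0 HL] := zext_Ck cK Kc; exists L=>// b j k hb; apply: HL.
 by apply: sm_M; [exact: sm_q|apply: sm_gam; exact: asd_sm].
by move=> y cy nK; rewrite q_out// mul0r.
Qed.

Lemma sfunX (f: X -> R) n: sfun f -> sfun (fun x=> f x ^+ n).
move=> sf; elim: n=> [|n IH]; first by under eq_fun do rewrite expr0; exact: sfun_cst.
have -> : (fun x=> f x ^+ n.+1) = fun x=> f x * f x ^+ n by apply/funext=> x; rewrite exprS.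
exact: sfunM.
Qed.

Lemma dens_low: exists2 M, 0 <= M & forall y, chart_im c y -> K (chart_inv c y) -> 1 <= M * density g c y.
have d0 y: chart_im c y -> 0 < density g c y := dens_gt0 (c:=c) (y:=y).
have [|M M0 HM] := @sm_bdd (fun y=> (density g c y)^-1).
 by apply: sm_V=> [y cy|]; [rewrite gt_eqF// d0|exact: sm_dens].
exists M=>// y cy Ky; have := HM y cy Ky; have dy := d0 y cy.
rewrite ger0_norm; last by rewrite invr_ge0 ltW.
by rewrite -[leLHS]mul1r ler_pdivrMr.
Qed.

(** By [der_qgam] the derivative is a coefficient of the Lie derivative plus [r ^ 2] times an order
    zero term; the first is controlled in mean by [int_be], the second pointwise. *)
Lemma int_dh i j k: exists2 C, 0 <= C & forall b, asd b ->
 iint (fun y=> 'D_(e i) (hf b j k) y * 'D_(e i) (hf b j k) y) <= C * intg (I2fun b b).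
have [Ce Ce0 He] := int_be i; have [Cd Cd0 Hd] := ordz_dh_err i j k.
have [C2 C20 H2] := nrm_I2; have [Md Md0 HMd] := dens_low.
have [B B0 HB] := sfun_bdd (sfunX 2 sr).
pose C4 := 2 * C2 * (1 + B * Cd ^+ 2) * Md; have C40: 0 <= C4 by rewrite !mulr_ge0// addr_ge0// mulr_ge0 ?sqr_ge0.
exists (C4 * (Ce + B))=> [|b hb]; first by rewrite mulr_ge0// addr_ge0.
have sb := asd_sm hb; have sB := sm_be i hb; have sz := sm_iota i sb.
pose W x := I2fun (be i b) (be i b) x + r x ^+ 2 * I2fun b b x.
have cBB := cI2 sB sB; have cbb := cI2 sb sb.
have cr2 := sf_cont (sfunX 2 sr).
have crb: continuous (fun x=> r x ^+ 2 * I2fun b b x) by exact: contfM cr2 cbb.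
have cW: continuous W by move=> x; exact: (cont_atD (cBB x) (crb x)).
have cCW: continuous (fun x=> C4 * W x) := contfZ (c:=C4) cW.
have W0 x: 0 <= W x by apply: addr_ge0; [exact: I2fun_ge0|apply: mulr_ge0; [exact: sqr_ge0|exact: I2fun_ge0]].
have suppW: sptd K (fun x=> C4 * W x).
 by move=> x nK; rewrite /W /I2fun be_out// I2_zero rK// expr0n mul0r addr0 mulr0.
have [L L0 /(_ b j k hb) [ck sL]] := hf_Ck.
have pt y: 'D_(e i) (hf b j k) y * 'D_(e i) (hf b j k) y <= cintd g c (fun x=> C4 * W x) y.
 have [cy|ncy] := pselect (chart_im c y); last first.
  rewrite cintd0// (zext_der_out _ cK Kc _ ncy) ?mul0r//.
  by move=> z cz nK; rewrite q_out// mul0r.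
 rewrite cintd_in// (zext_der_in _ _ cy) (der_qgam i j k sb (asd_closed hb) cy).
 have d0 := ltW (dens_gt0 cy).
 have [Ky|nK] := pselect (K (chart_inv c y)); last first.
  rewrite rK// expr0n mul0r addr0 l2E be_out// mul0r mulr_ge0// mulr_ge0//.
 have h1 := H2 _ y (l2_alt cy (sB.1 _)) cy Ky; have h2 := H2 _ y (l2_alt cy (sb.1 _)) cy Ky.
 have h3: `|dh_err i j k b y| <= Cd * nrm (l2 b c y) := Hd b hb y cy Ky; have h4 := HMd y cy Ky.
 have h5: `|l2 (be i b) c y (e j) (e k)| <= nrm (l2 (be i b) c y).
  exact: (@le_sum2 (fun a a'=> `|l2 (be i b) c y (e a) (e a')|) j k).
 have h6 := HB (chart_inv c y); rewrite ger0_norm ?sqr_ge0// in h6.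
 rewrite /W !(I2funE)//.
 have i1 := I2_ge0 (hc cy) (l2_alt cy (sB.1 _)); have i2 := I2_ge0 (hc cy) (l2_alt cy (sb.1 _)).
 have n1 := nrm_ge0 (l2 (be i b) c y); have n2 := nrm_ge0 (l2 b c y).
 have r2 := sqr_ge0 (r (chart_inv c y)).
 exact: wtd_sqr_le C20 Cd0 B0 r2 h6 n1 n2 i1 i2 h5 h3 h1 h2 h4.
have cD := Ck_cc_der (e i) (ck 1%N) sL.
have le1 := le_iint (cc_M cD cD) (cintd_cc dens cCW cK Kc suppW) pt.
apply: (le_trans le1); rewrite -/(cint g c (fun x=> C4 * W x)).
have E1 := ivol_chart cptX isT dens cCW cK Kc suppW.
rewrite -E1 (ivZ C4 cW) -mulrA; apply: (ler_wpM2l C40).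
rewrite (ivD cBB crb) mulrDl; apply: lerD; first exact: He.
rewrite -(ivZ B cbb); apply: (intg_le crb (contfZ (c:=B) cbb))=> x.
by apply: ler_wpM2r; [exact: I2fun_ge0|apply: (le_trans (ler_norm _)); exact: HB].
Qed.

(** The exponent 6 is that of [q ^ 2], and the 16 comes from bounding the square of a sum of four
    terms twice. *)
Lemma int_low: exists2 C, 0 <= C & forall b, asd b ->
 intg (fun x=> r x ^+ 6 * I2fun b b x) <= C * \sum_(p: 'I_4 * 'I_4) iint (fun y=> hf b p.1 p.2 y * hf b p.1 p.2 y).
have [C1 C10 H1] := I2_nrm; have [M M0 HM] := sm_bdd (sm_dens c).
have C0: 0 <= C1 * 16 * M by rewrite !mulr_ge0.
exists (C1 * 16 * M)=>// b hb; have sb := asd_sm hb.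
have cbb := cI2 sb sb; have cr6 := sf_cont (sfunX 6 sr).
have crb: continuous (fun x=> r x ^+ 6 * I2fun b b x) by exact: contfM cr6 cbb.
have suppW: sptd K (fun x=> r x ^+ 6 * I2fun b b x) by move=> x nK; rewrite rK// expr0n mul0r.
have [L L0 HL] := hf_Ck.
have ch p: cc (hf b p.1 p.2) by have [ck sL] := HL b p.1 p.2 hb; exact: Ck_cc (ck 0%N) sL.
have chh (p: 'I_4 * 'I_4): cc (fun y=> hf b p.1 p.2 y * hf b p.1 p.2 y) := cc_M (ch p) (ch p).
rewrite (ivol_chart cptX isT dens crb cK Kc suppW).
rewrite -(iint_sum (index_enum _) (P:=xpredT) (fun p _=> chh p)) -iintZ; last exact: cc_sum.
apply: le_iint=> [||y]; first exact: (cintd_cc dens crb cK Kc suppW).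
 by apply: cc_Z; exact: cc_sum.
rewrite -(pair_bigA _ (fun j k=> hf b j k y * hf b j k y)) /=.
have h0: 0 <= \sum_j \sum_k hf b j k y * hf b j k y.
 by apply: sumr_ge0=> j _; apply: sumr_ge0=> k _; rewrite -expr2 sqr_ge0.
have [cy|ncy] := pselect (chart_im c y); last by rewrite cintd0// mulr_ge0.
rewrite cintd_in//; have [Ky|nK] := pselect (K (chart_inv c y)); last first.
 by rewrite rK// expr0n !mul0r mulr_ge0.
have -> : \sum_j \sum_k hf b j k y * hf b j k y = r (chart_inv c y) ^+ 6 * \sum_j \sum_k l2 b c y (e j) (e k) ^+ 2.
 rewrite mulr_sumr; apply: eq_bigr=> j _; rewrite mulr_sumr; apply: eq_bigr=> k _.
 by rewrite /hf zext_in// /q /gam; ring.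
rewrite (I2funE)//; have h1 := H1 (l2 b c y) y cy Ky.
have i0 := I2_ge0 (hc cy) (l2_alt cy (sb.1 _)).
have h2 := le_trans (ler_norm _) (HM y cy Ky); have d0 := ltW (dens_gt0 cy).
have sq (a: 'I_4 -> R): (\sum_j a j) ^+ 2 <= 4 * \sum_j a j ^+ 2.
 rewrite !sum4; move: (a o0) (a o1) (a o2) (a o3)=> x0 x1 x2 x3.
 have := sqr_ge0 (x0 - x1); have := sqr_ge0 (x0 - x2); have := sqr_ge0 (x0 - x3).
 have := sqr_ge0 (x1 - x2); have := sqr_ge0 (x1 - x3); have := sqr_ge0 (x2 - x3); lra.
have h3: nrm (l2 b c y) ^+ 2 <= 16 * \sum_j \sum_k l2 b c y (e j) (e k) ^+ 2.
 apply: (le_trans (sq _)); have -> : (16: R) = 4 * 4 by ring.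
 rewrite -mulrA ler_wpM2l// mulr_sumr; apply: ler_sum=> j _; apply: (le_trans (sq _)).
 by rewrite ler_wpM2l//; apply: ler_sum=> k _; rewrite real_normK// num_real.
have r0: 0 <= r (chart_inv c y) ^+ 6 by rewrite -[6%N]/(2 * 3)%N exprM exprn_ge0// sqr_ge0.
have key (P I D n Q: R): 0 <= P -> 0 <= I -> 0 <= D -> I <= C1 * n -> n <= 16 * Q -> D <= M ->
  P * I * D <= C1 * 16 * M * (P * Q).
 move=> P0 I0 D0 In nQ DM; have IQ: I <= C1 * (16 * Q) by apply: (le_trans In); exact: ler_wpM2l.
 have -> : C1 * 16 * M * (P * Q) = P * (C1 * (16 * Q)) * M by ring.
 by apply: ler_pM=>//; [exact: mulr_ge0|exact: ler_wpM2l].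
exact: key r0 i0 d0 h1 h3 h2.
Qed.

Lemma hf_comb d (a: 'I_d -> R) (b: 'I_d -> X -> ('I_2 -> V) -> R) j k y:
 hf (\sum_i a i *: b i) j k y = \sum_i a i * hf (b i) j k y.
have [cy|ncy] := pselect (chart_im c y); last first.
 by rewrite /hf /zext memNset// big1// => i _; rewrite mulr0.
rewrite /hf zext_in// /gam l2E /f2 form_comb mulr_sumr; apply: eq_bigr=> i _.
by rewrite zext_in// l2E /f2 mulrCA.
Qed.

Lemma chart_fnls (dl: R): 0 < dl -> exists (T: finType) (l: T -> (X -> ('I_2 -> V) -> R) -> R),
 (forall t, lincomb_on asd (l t)) /\
 forall b, asd b -> (forall t, l t b = 0) ->
 intg (fun x=> r x ^+ 6 * I2fun b b x) <= dl * intg (I2fun b b).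
move=> dl0; have [L L0 HL] := hf_Ck; have [C1 C10 H1] := int_low.
have /choice[C2 H2] : forall p: 'I_4 * 'I_4 * 'I_4, exists C, 0 <= C /\ forall b, asd b ->
  iint (fun y=> 'D_(e p.2) (hf b p.1.1 p.1.2) y * 'D_(e p.2) (hf b p.1.1 p.1.2) y) <= C * intg (I2fun b b).
 by move=> p; have [C C0 HC] := int_dh p.2 p.1.1 p.1.2; exists C.
pose M := \sum_(p: 'I_4 * 'I_4) \sum_i C2 (p, i).
have M0: 0 <= M by apply: sumr_ge0=> p _; apply: sumr_ge0=> i _; case: (H2 (p, i)).
have CM: 0 < 1 + C1 * M by rewrite ltr_wpDr// mulr_ge0.
(* Chosen so that [C1 * (ep * M)] is at most [dl]; the 1 keeps the denominator positive. *)
pose ep := dl / (1 + C1 * M); have ep0: 0 < ep by rewrite divr_gt0.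
have [T [w [cw Hw]]] := rellich 4 L0 ep0.
exists (T * ('I_4 * 'I_4))%type, (fun t b=> iint (fun y=> w t.1 y * hf b t.2.1 t.2.2 y)); split.
 move=> [t [j k]] d a b hb /=.
 have ch i: cc (fun y=> w t y * hf (b i) j k y).
  by apply: cc_M=>//; have [ck sL] := HL (b i) j k (hb i); exact: Ck_cc (ck 0%N) sL.
 transitivity (iint (fun y=> \sum_i a i * (w t y * hf (b i) j k y))).
  congr iint; apply/funext=> y; rewrite hf_comb mulr_sumr; apply: eq_bigr=> i _.
  by rewrite mulrCA.
 rewrite iint_sum=> [|i _]; last exact: cc_Z.
 by apply: eq_bigr=> i _; rewrite iintZ.
move=> b hb l0; apply: (le_trans (H1 b hb)).
have le1 (p: 'I_4 * 'I_4): iint (fun y=> hf b p.1 p.2 y * hf b p.1 p.2 y) <=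
  ep * ((\sum_i C2 (p, i)) * intg (I2fun b b)).
 have [ck sL] := HL b p.1 p.2 hb; apply: (le_trans (Hw _ (ck 1%N) sL)).
 have z: \sum_k (iint (fun y=> w k y * hf b p.1 p.2 y)) ^+ 2 = 0.
  by apply: big1=> k _; rewrite (l0 (k, p)) expr0n.
 rewrite z addr0; apply: ler_wpM2l; first exact: ltW.
 by rewrite mulr_suml; apply: ler_sum=> i _; case: (H2 (p, i))=> _ /(_ b hb).
have I0 := intI2_ge0 (asd_sm hb).
have le2: \sum_(p: 'I_4 * 'I_4) iint (fun y=> hf b p.1 p.2 y * hf b p.1 p.2 y) <= ep * (M * intg (I2fun b b)).
 by rewrite /M mulr_suml mulr_sumr; apply: ler_sum=> p _; exact: le1.
apply: (le_trans (ler_wpM2l C10 le2)).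
have key (U: R): 0 <= U -> C1 * (ep * (M * U)) <= dl * U.
 move=> U0; have -> : C1 * (ep * (M * U)) = dl * (C1 * M / (1 + C1 * M)) * U by rewrite /ep; field; rewrite gt_eqF.
 apply: ler_wpM2r=>//; rewrite -[leRHS]mulr1; apply: ler_wpM2l; first exact: ltW.
 by rewrite ler_pdivrMr// mul1r lerDr.
exact: key.
Qed.

End ChartLocal.

(** * Finiteness of the space of closed anti-self-dual forms *)

Section Finite.

(** If all functionals vanish, the chart estimates add up to the statement that the squared norm of
    [b] is at most half of itself. *)
Lemma asd_fnls: exists (T: finType) (l: T -> (X -> ('I_2 -> V) -> R) -> R),
 (forall t, lincomb_on asd (l t)) /\
 forall b, asd b -> (forall t, l t b = 0) -> b = (fun _ _=> 0).
have [m [c [r [sr r0 Hr r1]]]] := sm_part cptX isT (N:=fun=> setT) (fun=> openT) (fun=> I).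
pose P x := \sum_i r i x ^+ 6.
have sX i: sfun (fun x=> r i x ^+ 6) by exact: sfunX.
have sP: sfun P.
 by move=> d; apply: (@sm_sum _ _ _ _ _ _ _ (fun i y=> r i (chart_inv d y) ^+ 6))=> i _; exact: sX.
have P0 x: 0 < P x.
 have := ltr01 (R:=R); rewrite -(r1 x)=> s0; apply: contraPP s0=> /negP; rewrite -leNgt=> Pl /negP; apply.
 rewrite big1 ?ltxx// => i _; have := r0 i x; rewrite le_eqVlt=> /predU1P[//|ri].
 suff: 0 < P x by rewrite ltNge Pl.
 rewrite /P (bigD1 i)//= ltr_pwDl ?exprn_gt0//; apply: sumr_ge0=> k _; exact: exprn_ge0.
have [B B0 HB] := sfun_bdd (smooth_V (fun x=> lt0r_neq0 (P0 x)) sP).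
(* [B] bounds the inverse of the sum of the [r i ^ 6] and there are [m] charts, so a constant
   [(2 * N)^-1] in each chart gives at most one half in total. *)
pose N := B * m%:R + 1; have N0: 0 < N by rewrite ltr_wpDl// mulr_ge0.
(* The finite index type of the functionals varies with the chart, hence the choice of dependent
   pairs. *)
have /choice[T' HT] : forall i, exists Tl: {T: finType & T -> (X -> ('I_2 -> V) -> R) -> R},
  (forall t, lincomb_on asd (projT2 Tl t)) /\
  forall b, asd b -> (forall t, projT2 Tl t b = 0) ->
  intg (fun x=> r i x ^+ 6 * I2fun b b x) <= (2 * N)^-1 * intg (I2fun b b).
 move=> i; have [K [cK _ Kc rK]] := Hr i.
 have dl0: 0 < (2 * N)^-1 by rewrite invr_gt0 mulr_gt0.
 have [T [l [ll Hl]]] := chart_fnls cK Kc (sr i) rK dl0.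
 by exists (existT _ T l).
exists {i: 'I_m & projT1 (T' i)}, (fun t=> projT2 (T' (tag t)) (tagged t)); split=> [[i t]|b hb l0].
 exact: (HT i).1.
have sb: smooth2 b by exact: asd_sm hb.
have cbb := cI2 sb sb.
have cr i: continuous (fun x=> r i x ^+ 6 * I2fun b b x).
 exact: contfM (sf_cont (sX i)) cbb.
have le1 i: intg (fun x=> r i x ^+ 6 * I2fun b b x) <= (2 * N)^-1 * intg (I2fun b b).
 by apply: (HT i).2=>// t; exact: (l0 (existT (fun i=> projT1 (T' i)) i t)).
have I0 := intI2_ge0 sb.
have cS: continuous (fun x=> \sum_i r i x ^+ 6 * I2fun b b x).
 move=> x; apply: cont_sum=> i _; exact: cr.
have le2: intg (I2fun b b) <= intg (fun x=> B * \sum_i r i x ^+ 6 * I2fun b b x).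
 apply: (intg_le cbb (contfZ (c:=B) cS))=> x.
 rewrite -mulr_suml mulrA -[leLHS]mul1r; apply: ler_wpM2r; first exact: I2fun_ge0 _ _ sb.
 have := HB x; rewrite ger0_norm; last by rewrite invr_ge0 ltW.
 by rewrite -[X in _ -> X <= _](mulVf (lt0r_neq0 (P0 x)))=> h; apply: ler_wpM2r=>//; exact: ltW.
rewrite (ivolZ cptX isT dens B cS) (ivol_sum cptX isT dens cr) in le2.
have le3: \sum_i intg (fun x=> r i x ^+ 6 * I2fun b b x) <= m%:R * ((2 * N)^-1 * intg (I2fun b b)).
 have e (A: R): \sum_(i < m) A = m%:R * A by rewrite sumr_const card_ord mulr_natl.
 by apply: (le_trans (ler_sum _ (fun i _=> le1 i))); rewrite e.
have {le2 le3} le4 := le_trans le2 (ler_wpM2l B0 le3).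
have key (I: R): 0 <= I -> I <= B * (m%:R * ((2 * N)^-1 * I)) -> I = 0.
 move=> i0 le; apply: le_anti; rewrite i0 andbT; move: le.
 have -> : B * (m%:R * ((2 * N)^-1 * I)) = (B * m%:R / N) * (2^-1 * I) by field; rewrite gt_eqF.
 have q1: B * m%:R / N <= 1 by rewrite ler_pdivrMr// mul1r lerDl.
 have h0: 0 <= 2^-1 * I by rewrite mulr_ge0.
 by move=> /le_trans/(_ (ler_wpM2r h0 q1)); rewrite mul1r; lra.
exact: (intI2_eq0 sb (key _ I0 le4)).
Qed.

End Finite.

(** * Solutions of the twisted equation on a connected manifold *)

Section Connected.
Implicit Types (x: X) (f u h: X -> R).

Lemma clopen_all (A: set X) x0: A x0 -> closed A -> (forall x, A x -> nbhs x A) -> forall x, A x.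
move=> Ax0 cA oA x; have oA': open A by rewrite openE=> y; exact: oA.
have E := @Mconnected _ _ X A (ex_intro _ x0 Ax0).
have -> : A = [set: X]; last by [].
by apply: E; exists A; rewrite ?setTI.
Qed.

Lemma nbhs_chart x (W: set V): open W -> W (chart x x) -> nbhs x (chart_dom x `&` chart x @^-1` W).
move=> oW Wx; apply: open_nbhs_nbhs; split; first exact: chart_open.
by split; [exact: dom_self|].
Qed.

Lemma closed_zero (f: X -> R) (t: R): continuous f -> closed [set x | f x = t].
by move=> cf; apply: (@closed_comp _ _ f [set t])=>//; exact: closed_eq. Qed.

Lemma segment_der x f: sfun f -> exists2 r, 0 < r & forall y, `|y - chart x x| <= r ->
 chart_im x y /\ exists2 z, `|z - chart x x| <= `|y - chart x x| &
 f (chart_inv x y) - f x = l1 (df f) x z (y - chart x x).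
move=> sf; set p := chart x x; have [r r0 rU] := ballcO (im_open (c:=x)) (im_self x).
exists r=>// y yr; split; first exact: rU.
have [|s s01 E] := @MVT_unit _ _ (fun y=> f (chart_inv x y)) p (y - p).
 move=> s s01; apply: (Ck_dvb (sf x 1%N)); apply: rU=> /=.
 rewrite addrK normrZ (le_trans _ yr)// ler_piMl//.
 by case/andP: s01=> s0 s1; rewrite ger0_norm.
have sr: `|s *: (y - p) + p - p| <= `|y - p|.
 rewrite addrK normrZ ler_piMl//.
 by case/andP: s01=> s0 s1; rewrite ger0_norm.
exists (s *: (y - p) + p)=>//.
rewrite l1_df//; last exact/rU/(le_trans sr).
by rewrite -E subrK cinv_self.
Qed.

Lemma df0_cst u: sfun u -> (forall x v, f1 (df u x) v = 0) -> exists t, u = fun=> t.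
move=> su du; have [x0 _] := nonempty X; exists (u x0); apply/funext.
apply: (@clopen_all [set x | u x = u x0] x0)=>//.
 by apply: closed_zero; exact: sf_cont.
move=> x /= ux; have [r r0 Hr] := segment_der x su.
have oW: open [set y: V | `|y - chart x x| < r] by exact: cubeO.
apply: filterS (nbhs_chart oW _); last by rewrite /= subrr normr0.
move=> x' [cx' /= lt]; have [_ [z zr]] := Hr _ (ltW lt).
rewrite chartK// l1E du=> /eqP; rewrite subr_eq0=> /eqP ->; exact: ux.
Qed.

(** Near a zero of [f] the equation [df = - f alpha] improves any bound for [|f|] to half of it, and
    iteration gives 0. So the zero set is open, besides being closed. *)
Lemma theta_zero (alpha: rform X 1) f x0: smooth1 alpha -> sfun f -> (forall x v, f1 (theta alpha f x) v = 0) ->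
 f x0 = 0 -> forall x, f x = 0.
move=> sa sf th f0; apply: (@clopen_all [set x | f x = 0] x0)=>//.
 by apply: closed_zero; exact: sf_cont.
move=> x /= fx; have [r r0 Hr] := segment_der x sf; set p := chart x x in Hr.
have rU y: `|y - p| <= r -> chart_im x y by case/Hr.
have /choice[M HM] : forall i: 'I_4, exists M, 0 <= M /\ forall y, `|y - p| <= r -> `|l1 alpha x y 'e_i| <= M.
 move=> i; have [|M M0 HM] := @cpt_bd R _ [set y: V | `|y - p| <= r] (fun y=> l1 alpha x y 'e_i) (@cube_cpt R 4 p r).
  by move=> y yr; apply: (Ck_cont (sa.2 x _ 0%N)); exact: rU.
 by exists M; split; [exact: ltW|].
pose N := 1 + \sum_i M i; have N0: 0 < N by rewrite ltr_pwDl// sumr_ge0// => i _; case: (HM i).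
have al y v: `|y - p| <= r -> `|l1 alpha x y v| <= `|v| * N.
 move=> yr; have ll := l1_lin (rU y yr) (sa.1 _).
 rewrite (lin_exp v ll); apply: (le_trans (ler_norm_sum _ _ _)); rewrite mulrDr mulr1 mulr_sumr ler_wpDl//.
 apply: ler_sum=> i _; rewrite normrM; apply: ler_pM=>//; last exact: (HM i).2.
 exact: coord_le.
(* [N] bounds [alpha] on the cube; the radius [d] makes [d * N] at most one half. *)
pose d := Num.min r (2 * N)^-1; have d0: 0 < d by rewrite lt_min r0 invr_gt0 mulr_gt0.
have dr: d <= r by rewrite ge_min lexx.
have dN: d * N <= 2^-1.
 have: d <= (2 * N)^-1 by rewrite ge_min lexx orbT.
 move=> h; apply: (le_trans (ler_wpM2r (ltW N0) h)).
 by rewrite invfM -mulrA mulVf ?mulr1// gt_eqF.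
have [|B B0 HB] := @cpt_bd R _ [set y: V | `|y - p| <= d] (fun y=> f (chart_inv x y)) (@cube_cpt R 4 p d).
 by move=> y yd; apply: (Ck_cont (sf x 0%N)); apply: rU; exact: le_trans yd dr.
have step (b: R): (forall y, `|y - p| <= d -> `|f (chart_inv x y)| <= b) -> forall y, `|y - p| <= d -> `|f (chart_inv x y)| <= b / 2.
 move=> Hb y yd; have [_ [z zy E]] := Hr y (le_trans yd dr); rewrite fx subr0 in E.
 have zd := le_trans zy yd; have zr := le_trans zd dr.
 have {}E: f (chart_inv x y) = - (f (chart_inv x z) * l1 alpha x z (y - p)).
  rewrite E !l1E; have := th (chart_inv x z) (from_chart x z (y - p)).
  by rewrite f1_theta=> /eqP; rewrite addr_eq0=> /eqP.
 rewrite E normrN normrM; apply: ler_pM=>//; first exact: Hb.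
 apply: (le_trans (al z _ zr)); apply: le_trans dN; apply: ler_wpM2r=>//; exact: ltW.
have it n: forall y, `|y - p| <= d -> `|f (chart_inv x y)| <= B / 2 ^+ n.
 elim: n=> [|n IH]; first by rewrite expr0 divr1.
 by move=> y yd; rewrite exprSr invfM mulrA; exact: step.
have oW: open [set y: V | `|y - p| < d] by exact: cubeO.
apply: filterS (nbhs_chart oW _); last by rewrite /= subrr normr0.
move=> x' [cx' /= lt]; apply/eqP; rewrite -normr_le0 leNgt; apply/negP=> t0.
(* For this exponent [n] the bound [B / 2 ^ n] lies below [|f x'|]. *)
have := upper_nthrootP (leqnn (Num.bound (B / `|f x'|))).
have := it (Num.bound (B / `|f x'|)) _ (ltW lt); rewrite chartK//.
rewrite ler_pdivlMr ?exprn_gt0// => h1; rewrite ltr_pdivrMr// mulrC ltNge=> /negP; exact.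
Qed.

(** The function [f * expR h] has differential 0. *)
Lemma theta_cst (h: X -> R) f: sfun h -> sfun f ->
 (forall x v, f1 (theta (df h) f x) v = 0) -> exists t, f = fun x=> t * expR (- h x).
move=> sh sf th; have se := sm_exp sh.
have [|x v|t E] := @df0_cst (fun x=> f x * expR (h x)).
- exact: sfunM.
- rewrite (df_M x v sf se) (df_exp x v sh); have := th x v; rewrite f1_theta.
 have key (a b t ex: R): a + t * b = 0 -> t * (ex * b) + ex * a = 0.
  by move=> E; rewrite mulrCA -mulrDr addrC E mulr0.
 exact: key.
exists t; apply/funext=> x; have := congr1 (fun F=> F x) E=> /= <-.
by rewrite -mulrA -expRD subrr expR0 mulr1.
Qed.

Lemma theta_exp (h: X -> R) x v: sfun h -> f1 (theta (df h) (fun x=> expR (- h x)) x) v = 0.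
move=> sh; have sN := sfunN sh; rewrite f1_theta (df_exp x v sN).
have -> : f1 (df (fun x=> - h x) x) v = - f1 (df h x) v.
 have -> : (fun x=> - h x) = fun x=> -1 * h x by apply/funext=> z; rewrite mulN1r.
 have sc: sfun (fun _: X=> -1: R) by exact: sfun_cst.
 by rewrite (df_M x v sc sh) df_cst mulr0 addr0 mulN1r.
by move: (f1 _ _) (expR _)=> a b; ring.
Qed.

(** A primitive of [alpha] is [- ln |f|], written as [- ln (f * f) / 2] so that smoothness does not
    depend on the sign of [f]. *)
Lemma theta_exact (alpha: rform X 1) f: smooth1 alpha -> sfun f ->
 (forall x v, f1 (theta alpha f x) v = 0) -> (forall x, f x != 0) -> exact_form alpha.
move=> sa sf th f0; have sff := sfunM sf sf.
have p0 x: 0 < f x * f x by rewrite -expr2 exprn_even_gt0// f0.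
pose w x := - 2^-1 * ln (f x * f x).
have sl := sm_ln p0 sff; have sw: sfun w by apply: sfunM=>//; exact: sfun_cst.
exists (form0 w); first by apply/sm_form0.
have sc: sfun (fun _: X=> - 2^-1: R) by exact: sfun_cst.
apply: r1_ext=> x v; rewrite -[ext_d _]/(df w) (df_M x v sc sl) df_cst.
rewrite (df_ln x v p0 sff) (df_M x v sf sf).
have := th x v; rewrite f1_theta; have := f0 x; move: (f1 _ _) (f1 _ _) (f x)=> a b t t0 E.
have -> : b = - (t * a) by apply/eqP; rewrite -addr_eq0 E.
by field.
Qed.

End Connected.

(** * Complexification of real bases *)

Section Complexification.

Lemma cform_comb d (a: 'I_d -> R[i]) (b: 'I_d -> X -> ('I_2 -> V) -> R[i]) x s:
 (\sum_i a i *: b i) x s = \sum_i a i * b i x s.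
by apply: (big_morph (fun F: X -> ('I_2 -> V) -> R[i]=> F x s)). Qed.

Lemma cpx_comb d (z: 'I_d -> R[i]) (b: 'I_d -> form):
 \sum_i z i *: (cpx (b i) (fun _ _=> 0): X -> ('I_2 -> V) -> R[i]) =
 cpx (\sum_i complex.Re (z i) *: b i) (\sum_i complex.Im (z i) *: b i).
apply: funext2=> x s; rewrite cform_comb /cpx !form_comb; apply: C_ext.
 by rewrite Re_sum; apply: eq_bigr=> i _; rewrite ReM /= mulr0 subr0.
by rewrite Im_sum; apply: eq_bigr=> i _; rewrite ImM /= mulr0 add0r.
Qed.

Lemma cpx_inj (p q p' q': form): cpx p q = cpx p' q' -> p = p' /\ q = q'.
by move=> E; split; [rewrite -(re_cpx p q) E re_cpx|rewrite -(im_cpx p q) E im_cpx]. Qed.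

(** Reduces the complex dimension in [h_dbar] to a real dimension. *)
Lemma complexify (W: set form) d (b: 'I_d -> form): is_basis_of W b -> W (fun _ _=> 0) ->
 is_basis_of [set a | exists p q: form, [/\ a = cpx p q, W p & W q]]
  (fun i=> cpx (b i) (fun _ _=> 0): X -> ('I_2 -> V) -> R[i]).
move=> [Wb ib gen] W0; split=> [i|z E i|_ [p [q [-> Wp Wq]]]].
- by exists (b i), (fun _ _=> 0).
- rewrite cpx_comb in E; have [E1 E2] := @cpx_inj _ _ (fun _ _=> 0) (fun _ _=> 0) E.
 by apply: C_ext; [exact: (ib (fun i=> complex.Re (z i)))|exact: (ib (fun i=> complex.Im (z i)))].
have [c1 ->] := gen p Wp; have [c2 ->] := gen q Wq.
by exists (fun i=> Complex (c1 i) (c2 i)); rewrite cpx_comb.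
Qed.

End Complexification.

Lemma f3_wedge1 (a: rform X 1) (b: rform X 2) x: f3 (wedge1 a b x) = wd (f1 (a x)) (f2 (b x)).
apply: funext2=> u v; apply/funext=> w; have [E0 E1 E2] := lift_vs3 u v w.
have H (t: 'rV[R]_4): a x (fun=> t) = f1 (a x) t by rewrite /f1 (vs1E (fun=> t)).
rewrite /f3 /wedge1 !big_ord_recl big_ord0 expr0 mul1r /bump /= expr1 mulN1r addr0 sqrrN expr1n mul1r E0.
have -> : lift ord0 (ord0: 'I_2) = ord31 :> 'I_3 by exact: val_inj.
have -> : lift ord0 (lift ord0 ord0) = ord_max :> 'I_3 by exact: val_inj.
by rewrite E1 E2 !H addrA mulNr.
Qed.

(** * Counting dimensions *)

Section Count.
Local Notation asdP := asd_hP.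

Lemma closed_scal_cst (t: R) (b: rform X 2): smooth2 b -> (t = 0 \/ closed_form b) -> closed_form (scalf (fun=> t) b).
move=> sb tb; have sc: sfun (fun _: X=> t) by exact: sfun_cst.
apply: r3_ext=> x u v w; rewrite (scal_d2 x u v w sc sb) /wd !df_cst !mul0r subrr !add0r.
by case: tb=> [->|->]; rewrite ?mul0r ?mulr0.
Qed.

(** The alternative [t = 0] makes it possible to obtain the zero form from [Om], which is not
    anti-self-dual. *)
Lemma asd_Z t (b: form): smooth2 b -> (t = 0 \/ asd b) -> asd (scalf (fun=> t) b).
move=> sb tb; apply/asdP; have L x: Lfun (scalf (fun=> t) b) x = t * Lfun b x by rewrite /Lfun -Lam_Z.
have I x u v: f2 (scalf (fun=> t) b x) u v = t * f2 (b x) u v by [].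
split.
- by apply: sm_scal2=>//; exact: sfun_cst.
- by move=> x; rewrite L; case: tb=> [->|/asdP[_ -> _ _]]; rewrite ?mul0r ?mulr0.
- by move=> x u v; rewrite !I; case: tb=> [->|/asdP[_ _ -> _]]; rewrite ?mul0r.
by apply: closed_scal_cst=>//; case: tb=> [|/asdP[]]; [left|right].
Qed.

Lemma asd0: asd (fun _ _=> 0).
have := asd_Z sOm (or_introl erefl: 0 = 0 \/ _); congr asd.
by apply: funext2=> x s; rewrite /scalf mul0r.
Qed.

Lemma asd_D (a b: form): asd a -> asd b -> asd (addf a b).
move=> /asdP[sa La Ja ca] /asdP[sb Lb Jb cb]; apply/asdP; split.
- exact: sm_add2.
- move=> x; transitivity (Lfun a x + Lfun b x); last by rewrite La Lb addr0.
 by rewrite /Lfun -Lam_D.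
- move=> x u v; transitivity (f2 (a x) (u *m J x) (v *m J x) + f2 (b x) (u *m J x) (v *m J x)); first by [].
 by rewrite Ja Jb.
by apply: r3_ext=> x u v w; rewrite (add_d2 x u v w sa sb) ca cb addr0.
Qed.

Lemma asd_comb d (c: 'I_d -> R) (b: 'I_d -> form): (forall i, asd (b i)) -> asd (\sum_i c i *: b i).
move=> hb; apply: (big_ind (fun F: form=> asd F)); [exact: asd0|exact: asd_D|move=> i _].
by apply: asd_Z; [exact: (asd_sm (hb i))|right].
Qed.

Lemma asd_basis: exists d (b: 'I_d -> form), is_basis_of asd b.
have [T [l [ll lk]]] := asd_fnls.
by apply: (basis_ex (l:=l))=>// d c b; exact: asd_comb.
Qed.

Variable alpha: rform X 1.
Hypotheses (sa: smooth1 alpha) (da: forall x u v, f2 (ext_d alpha x) u v = 0).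
Hypothesis dOm: forall x, f3 (ext_d Om x) = wd (f1 (alpha x)) (f2 (Om x)).

Definition parallel f := sfun f /\ forall x u, f1 (theta alpha f x) u = 0.

(** By [harm_split], the possible real parts, and likewise imaginary parts, of harmonic (1,1)
    forms. *)
Definition real_harm: set form := [set p | exists f c, [/\ parallel f, asd c & p = addf (scalf f Om) c]].

Lemma parallel0: parallel (fun=> 0).
by split=> [|x u]; [exact: sfun_cst|rewrite f1_theta df_cst mul0r addr0].
Qed.

Lemma real_harm0: real_harm (fun _ _=> 0).
exists (fun=> 0), (fun _ _=> 0); split; [exact: parallel0|exact: asd0|].
by apply: funext2=> x s; rewrite /addf /scalf mul0r addr0.
Qed.

Lemma h_dbarE d (b: 'I_d -> form): is_basis_of real_harm b -> h_dbar J g 1 1 = d.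
move=> bb; have cb := complexify bb real_harm0; apply: (dimensionE (b:=fun i=> cpx (b i) (fun _ _=> 0))).
rewrite (_: @harmonic_dbar R 4 X J g 1 1 = [set a | exists p q: form, [/\ a = cpx p q, real_harm p & real_harm q]])//.
have split := harm_split sa da dOm.
apply/seteqP; split=> a /=.
 rewrite -(cpx_ReIm a)=> /split[f1' [f2' [c1 [c2 [s1 s2 h1 h2 [t1 t2 E1 E2]]]]]].
 by exists (re_form a), (im_form a); split=>//; [exists f1', c1|exists f2', c2].
move=> [p [q [-> [f1' [c1 [[s1 t1] h1 E1]]] [f2' [c2 [[s2 t2] h2 E2]]]]]].
by apply/split; exists f1', f2', c1, c2.
Qed.

Lemma h_dbar_no_parallel: (forall f, parallel f -> f = fun=> 0) -> h_dbar J g 1 1 = b_minus J g.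
move=> P0; have [d [b bb]] := asd_basis; rewrite /b_minus (dimensionE bb).
apply: (h_dbarE (b:=b)); have [Sb ib gen] := bb.
have z c: c = addf (scalf (fun=> 0) Om) c.
 by apply: funext2=> x s; rewrite /addf /scalf mul0r add0r.
split=>// [i|p [f [c [/P0 -> hc ->]]]]; last by rewrite -z; exact: gen.
by exists (fun=> 0), (b i); split; [exact: parallel0|exact: Sb|exact: z].
Qed.

(** A basis consists of [f Om] and a basis of the closed anti-self-dual forms. *)
Lemma h_dbar_parallel f: parallel f -> (forall x, f x != 0) ->
 (forall h, parallel h -> exists t, h = fun x=> t * f x) -> h_dbar J g 1 1 = (b_minus J g + 1)%N.
move=> pf f0 Pf; have [d [b bb]] := asd_basis; rewrite /b_minus (dimensionE bb) addn1.
have [Sb ib gen] := bb.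
pose b' (i: 'I_d.+1): form := if unlift ord0 i is Some j then b j else scalf f Om.
have sum' (c: 'I_d.+1 -> R): \sum_i c i *: b' i = addf (scalf (fun x=> c ord0 * f x) Om) (\sum_j c (lift ord0 j) *: b j).
 rewrite big_ord_recl /b' unlift_none; under eq_bigr do rewrite liftK.
 by apply: funext2=> x s; rewrite /addf /scalf -mulrA.
have asdc (c: 'I_d -> R): asd (\sum_j c j *: b j) by exact: asd_comb.
apply: (h_dbarE (b:=b')); split=> [i|c E|p [h [c [/Pf[t ->] hc ->]]]].
- rewrite /b'; case: unliftP=> [j|] _.
  exists (fun=> 0), (b j); split; [exact: parallel0|exact: Sb|].
  by apply: funext2=> x s; rewrite /addf /scalf mul0r add0r.
 exists f, (fun _ _=> 0); split=>//; first exact: asd0.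
 by apply: funext2=> x s; rewrite /addf addr0.
- rewrite sum' in E.
 (* The contraction kills anti-self-dual forms and takes [f Om] to [2 f], which has no zero. *)
 have c0: c ord0 = 0.
  have [x _] := nonempty X; have := congr1 (fun F: form=> Lfun F x) E.
  have -> : Lfun (fun _ _=> 0) x = 0 by have /asdP[_ -> _ _] := asd0.
  have -> : Lfun (addf (scalf (fun x=> c ord0 * f x) Om) (\sum_j c (lift ord0 j) *: b j)) x =
    c ord0 * f x * Lfun Om x + Lfun (\sum_j c (lift ord0 j) *: b j) x.
   by rewrite /Lfun -Lam_Z -Lam_D.
  have /asdP[_ -> _ _] := asdc (fun j=> c (lift ord0 j)).
  rewrite addr0 /Lfun f2_Om (Lam_omE (hx x))=> /eqP.
  by rewrite !mulf_eq0 (negPf (f0 x)) pnatr_eq0 !orbF=> /eqP.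
 move=> i; case: (unliftP ord0 i)=> [j ->|-> //].
 apply: (ib (fun j=> c (lift ord0 j))); rewrite -[RHS]E c0.
 by apply: funext2=> x s; rewrite /addf /scalf !mul0r add0r.
have [a ->] := gen c hc; exists (fun i=> if unlift ord0 i is Some j then a j else t).
rewrite sum' unlift_none; congr addf; apply: eq_bigr=> j _; by rewrite liftK.
Qed.

End Count.

(** * Globally and strictly locally conformally Kahler metrics *)

Section ConformallyKahler.

Lemma h_dbar_gcK: globally_conformally_Kahler J g -> h_dbar J g 1 1 = (b_minus J g + 1)%N.
move=> [a [/sm_form1 sa [f0 /sm_form0 sf0 E] dO]].
pose h x := f0 x (fun=> 0); have sh: sfun h by exact: sf0.
have {}E: a = df h.
 rewrite E /df; congr ext_d; apply: funext2=> x s; rewrite /form0 /h; congr (f0 x).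
 by apply/funext=> -[].
have da x u v: f2 (ext_d a x) u v = 0 by rewrite E; exact: ddf.
have dOm x: f3 (ext_d Om x) = wd (f1 (a x)) (f2 (Om x)) by rewrite dO; exact: f3_wedge1.
apply: (h_dbar_parallel sa da dOm (f:=fun x=> expR (- h x))).
- split; first exact/sm_exp/sfunN.
 by move=> x u; rewrite E; exact: theta_exp.
- by move=> x; rewrite gt_eqF// expR_gt0.
by move=> k [sk tk]; apply: (theta_cst sh sk)=> x v; rewrite -E.
Qed.

Lemma h_dbar_slcK: strictly_locally_conformally_Kahler J g -> h_dbar J g 1 1 = b_minus J g.
move=> [a [/sm_form1 sa ca na dO]].
have da x u v: f2 (ext_d a x) u v = 0 by rewrite ca.
have dOm x: f3 (ext_d Om x) = wd (f1 (a x)) (f2 (Om x)) by rewrite dO; exact: f3_wedge1.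
apply: (h_dbar_no_parallel sa da dOm)=> f [sf th]; apply/funext=> x.
apply: contrapT=> fx; apply: na; apply: (theta_exact sa sf th)=> y.
by apply/eqP=> fy; apply: fx; exact: (theta_zero sa sf th fy).
Qed.

(** The Lee form is the differential of the zero function. *)
Lemma almost_Kahler_gcK: almost_Kahler J g -> globally_conformally_Kahler J g.
move=> cO; have s0: sfun (fun _: X=> 0: R) by exact: sfun_cst.
have s1 := sm_df s0; exists (df (fun=> 0)); split; first exact/sm_form1.
 by exists (form0 (fun=> 0))=>//; exact/sm_form0.
by rewrite cO; apply: r3_ext=> x u v w; rewrite f3_wedge1 /wd !df_cst !mul0r subrr addr0 //.
Qed.

End ConformallyKahler.

End Hermitian4.

Theorem theorem2 (R : realType) (X : manifold R 4) (J g : X -> 'M[R]_4)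
  (X_compact : compact [set: X])
  (J_almost_complex : almost_complex J)
  (g_hermitian : hermitian_metric J g) :
  [/\ globally_conformally_Kahler J g ->
        h_dbar J g 1 1 = (b_minus J g + 1)%N,
      almost_Kahler J g ->
        h_dbar J g 1 1 = (b_minus J g + 1)%N &
      strictly_locally_conformally_Kahler J g ->
        h_dbar J g 1 1 = b_minus J g].
Proof.
have gc := h_dbar_gcK X_compact J_almost_complex g_hermitian.
split=> [||]; [exact: gc|by move=> /almost_Kahler_gcK|exact: h_dbar_slcK X_compact J_almost_complex g_hermitian].
Qed.
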